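(* For each $n\in\mathbb{N}$, $n\geq 1$, $$\bigcap_{\nu,\Gamma}\operatorname{Ker}\chi^{(n)}_{x_2\nu(x_1),\Gamma}=0,$$ where the intersection runs over all smooth functions $\nu$ on $\mathbb{R}$ and all pseudogroups $\Gamma$ of orientation-preserving local diffeomorphisms of $\mathbb{R}$ whose lifts $(x_1,x_2)\mapsto(\phi(x_1),x_2/\phi'(x_1))$ to $\mathbb{R}\times\mathbb{R}^+$ preserve the connection $$\nabla_{\partial_{x_1}}\partial_{x_1}=x_2\nu(x_1)\partial_{x_2},\quad\nabla_{\partial_{x_1}}\partial_{x_2}=\nabla_{\partial_{x_2}}\partial_{x_1}=\tfrac1{2x_2}\partial_{x_1},\quad\nabla_{\partial_{x_2}}\partial_{x_2}=-\tfrac1{2x_2}\partial_{x_2},$$ and $\chi^{(n)}_{x_2\nu(x_1),\Gamma}$ is the action map of the $n$-fold tensor power over $P$ of $\tilde{\mathcal{H}}_s$ on the groupoid algebra $\mathcal{A}_{x_2\nu(x_1),\Gamma}$.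
   Context: The Hopf algebra $\mathcal{H}_1$ is the universal enveloping algebra of the Lie algebra with basis $X,Y,\delta_n$ ($n\ge1$), $[Y,X]=X$, $[X,\delta_n]=\delta_{n+1}$, $[Y,\delta_n]=n\delta_n$, $[\delta_n,\delta_m]=0$, with coproduct determined by $\Delta Y=Y\otimes1+1\otimes Y$, $\Delta\delta_1=\delta_1\otimes1+1\otimes\delta_1$, $\Delta X=X\otimes1+1\otimes X+\delta_1\otimes Y$. The algebras $\tilde{\mathcal{H}}_1$, $\tilde{\mathcal{H}}_s$. Let $P=\mathbb{C}[Z_0,Z_1,\dots]$, an $\mathcal{H}_1$-module algebra by $Y(Z_j)=(j+2)Z_j$, $X(Z_j)=Z_{j+1}$, $\delta_k(p)=0$ for all $p\in P$. Let $\tilde{\mathcal{H}}_1=P\rtimes\mathcal{H}_1\ltimes P$, equal to $P\otimes\mathcal{H}_1\otimes P$ as a vector space, with product $(p\rtimes h\ltimes q)(p'\rtimes h'\ltimes q')=\sum p\,h_{(1)}(p')\rtimes h_{(2)}h'\ltimes h_{(3)}(q')\,q$; put $\alpha(p)=p\rtimes1\ltimes1$ and $\beta(q)=1\rtimes1\ltimes q$. $\tilde{\mathcal{H}}_s$ is the quotient of $\tilde{\mathcal{H}}_1$ by the two-sided ideal generated by $\tilde\delta_2'=\delta_2-\frac12\delta_1^2-\alpha(Z_0)+\beta(Z_0)$. In the tensor product $\tilde{\mathcal{H}}_s\otimes_P\tilde{\mathcal{H}}_s$ one has $\beta(p)h\otimes h'=h\otimes\alpha(p)h'$. Groupoid algebra.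 Use coordinates $x=x_1$, $y=1/x_2$, in which the lift of $\phi$ is $\tilde\phi(x,y)=(\phi(x),\phi'(x)y)$. $\mathcal{A}_{x_2\nu(x_1),\Gamma}=C_c^\infty(\mathbb{R}\times\mathbb{R}^+)\rtimes\Gamma$ is spanned by $fU_\phi$, $\phi\in\Gamma$, $f$ smooth with compact support in the range of $\tilde\phi$ ($fU_\phi=fU_\psi$ if $\psi$ is a restriction of $\phi$ with $f$ supported in the range of $\tilde\psi$), with product $fU_\phi\,gU_\psi=f\,(g\circ\tilde\phi^{-1})U_{\phi\psi}$. $\mathcal{H}_1$ acts by $X(fU_\phi)=(y\partial_xf)U_\phi$, $Y(fU_\phi)=(y\partial_yf)U_\phi$, $\delta_n(fU_\phi)=(y\partial_x)^{n-1}\big(y\frac{(\phi^{-1})''}{(\phi^{-1})'}\big)fU_\phi$. For $\Gamma$ preserving the connection defined by $x_2\nu(x_1)$, the function $\Omega(x,y)=-y^2\nu(x)$ (a multiplier of the algebra) satisfies $(\delta_2-\frac12\delta_1^2)(a)=[\Omega,a]$. The action maps. Let $\rho$ be the algebra homomorphism from $P$ to smooth functions on $\mathbb{R}\times\mathbb{R}^+$ (multipliers of $\mathcal{A}_{x_2\nu(x_1),\Gamma}$) with $\rho(Z_k)=(y\partial_x)^k\Omega$. Then $\chi_{x_2\nu(x_1),\Gamma}(p\rtimes h\ltimes q)(a)=\rho(p)\,h(a)\,\rho(q)$ descends to an action of $\tilde{\mathcal{H}}_s$, and $$\chi^{(n)}_{x_2\nu(x_1),\Gamma}:\underbrace{\tilde{\mathcal{H}}_s\otimes_P\cdots\otimes_P\tilde{\mathcal{H}}_s}_n\to\mathcal{L}\big(\mathcal{A}_{x_2\nu(x_1),\Gamma}^{\otimes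 n},\mathcal{A}_{x_2\nu(x_1),\Gamma}\big)$$ ($\mathcal{L}$ = linear maps) is given by $\chi^{(n)}(h_1\otimes\cdots\otimes h_n)(a_1,\dots,a_n)=\chi(h_1)(a_1)\cdots\chi(h_n)(a_n)$. *)

(* Defs.v *)
From HB Require Import structures.
From mathcomp Require Import all_boot all_order all_algebra.
From mathcomp Require Import finmap.
From mathcomp.multinomials Require Import monalg.
From mathcomp Require Import complex.
From mathcomp Require Import all_classical all_reals all_analysis.

Set Implicit Arguments.
Unset Strict Implicit.
Unset Printing Implicit Defensive.
Import Order.TTheory GRing.Theory Num.Theory numFieldNormedType.Exports.
Local Open Scope classical_set_scope.
Local Open Scope quotient_scope.
Local Open Scope ring_scope.

Section Submodules.
Context {K : comNzRingType} {V : lmodType K}.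

Record submodule := Submodule {
  in_submodule :> {pred V};
  submoduleP : submod_closed in_submodule }.

HB.instance Definition _ (W : submodule) :=
  GRing.isZmodClosed.Build V (in_submodule W)
    (GRing.submod_closedB (submoduleP W)).

Definition is_submod (W : set V) : Prop :=
  W 0 /\ forall (a : K) u v, W u -> W v -> W (a *: u + v).

(* [m] is the multiplication of [V], not required here to be associative *)
Definition is_ideal (m : V -> V -> V) (W : set V) : Prop :=
  is_submod W /\ forall a u, W u -> W (m a u) /\ W (m u a).

Fact smallest_submod (C : set V -> Prop) (S : set V) :
  (forall W, C W -> is_submod W) ->
  submod_closed [pred v | `[< smallest C S v >]].
Proof.
move=> CW; split=> [|a u v /asboolP Su /asboolP Sv]; apply/asboolP.
  by move=> W [/CW[]].
move=> W [CW' SW].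
by apply: (CW _ CW').2; [apply: Su|apply: Sv].
Qed.

Definition lspan (S : set V) : submodule :=
  Submodule (@smallest_submod is_submod S (fun _ => id)).

Definition ideal_gen (m : V -> V -> V) (S : set V) : submodule :=
  Submodule (@smallest_submod (is_ideal m) S (fun _ => @proj1 _ _)).

Lemma submoduleZ (W : submodule) a v : v \in W -> a *: v \in W.
Proof.
have [W0 WD] := submoduleP W.
by move=> Wv; rewrite -[a *: v]addr0; apply: WD.
Qed.

Lemma lspan_sub S v : S v -> v \in lspan S.
Proof. by move=> Sv; apply/asboolP; exact: sub_gen_smallest. Qed.

Lemma ideal_gen_sub m S v : S v -> v \in ideal_gen m S.
Proof. by move=> Sv; apply/asboolP; exact: sub_gen_smallest. Qed.

Lemma ideal_genM m S a u :
  u \in ideal_gen m S -> (m a u \in ideal_gen m S) && (m u a \in ideal_gen m S).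
Proof.
move=> /asboolP Su; apply/andP; split; apply/asboolP => W [WI SW];
  have := WI.2 a u (Su W (conj WI SW)); by case.
Qed.

End Submodules.
Arguments submodule {K} V.

Section ModuleQuotient.
Context {K : comNzRingType} {V : lmodType K} (W : submodule V).

Definition lquot : Type := {ideal_quot W}.
HB.instance Definition _ := GRing.Zmodule.on lquot.
HB.instance Definition _ := EqQuotient.on lquot.

Definition lquot_class (v : V) : lquot := \pi_lquot v.
Definition lquot_scale (a : K) (x : lquot) : lquot := lquot_class (a *: repr x).

Lemma lquotP u v : reflect (lquot_class u = lquot_class v) (u - v \in W).
Proof. by rewrite Quotient.idealrBE; exact: eqP. Qed.

Lemma lquot_reprK x : lquot_class (repr x) = x.
Proof. exact: reprK. Qed.

Lemma lquot_class_repr v : repr (lquot_class v) - v \in W.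
Proof. by apply/lquotP; rewrite lquot_reprK. Qed.

Lemma lquot_classD : {morph lquot_class : u v / u + v}.
Proof. exact: Quotient.pi_add. Qed.

Lemma lquot_classB : {morph lquot_class : u v / u - v}.
Proof.
by move=> u v; rewrite lquot_classD; congr (_ + _); exact: Quotient.pi_opp.
Qed.

Lemma lquot_classZ a v : lquot_class (a *: v) = lquot_scale a (lquot_class v).
Proof.
by apply/lquotP; rewrite -scalerBr submoduleZ // -opprB rpredN lquot_class_repr.
Qed.

Fact lquot_scaleA a b x : lquot_scale a (lquot_scale b x) = lquot_scale (a * b) x.
Proof. by rewrite -(lquot_reprK x) -!lquot_classZ scalerA. Qed.
Fact lquot_scale1 : left_id 1 lquot_scale.
Proof. by move=> x; rewrite -(lquot_reprK x) -!lquot_classZ scale1r. Qed.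
Fact lquot_scaleDr : right_distributive lquot_scale +%R.
Proof.
move=> a x y; rewrite -(lquot_reprK x) -(lquot_reprK y).
rewrite -[LHS](congr1 _ (lquot_classD _ _)) -[LHS]lquot_classZ.
by rewrite scalerDr lquot_classD !lquot_classZ.
Qed.
Fact lquot_scaleDl x : {morph lquot_scale^~ x : a b / a + b}.
Proof.
move=> a b; rewrite -(lquot_reprK x) -[LHS]lquot_classZ scalerDl.
by rewrite lquot_classD !lquot_classZ.
Qed.

HB.instance Definition _ := GRing.Zmodule_isLmodule.Build K lquot
  lquot_scaleA lquot_scale1 lquot_scaleDr lquot_scaleDl.
HB.instance Definition _ := GRing.isZmodMorphism.Build V lquot lquot_class lquot_classB.
HB.instance Definition _ := GRing.isScalable.Build K V lquot *:%R lquot_class lquot_classZ.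
End ModuleQuotient.

Section LinearExtension.
Context {K : comNzRingType} {G : choiceType} {U : lmodType K}.
Variable F : G -> U.

Definition lext (x : {malg K[G]}) : U := \sum_(g <- msupp x) x@_g *: F g.

Lemma lextEw (d : {fset G}) x : (msupp x `<=` d)%fset ->
  lext x = \sum_(g <- d) x@_g *: F g.
Proof.
move=> le; rewrite /lext (big_fset_incl _ le) //= => g _ /mcoeff_outdom ->.
by rewrite scale0r.
Qed.

Lemma lextU g : lext << g >> = F g.
Proof. by rewrite (lextEw msuppU_le) big_seq_fset1 mcoeffUU scale1r. Qed.

Fact lext_is_linear : linear lext.
Proof.
move=> a x y; pose d := (msupp x `|` msupp y `|` msupp (a *: x + y))%fset.
rewrite !(@lextEw d) /d.
- rewrite scaler_sumr -big_split /=; apply: eq_bigr => g _.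
  by rewrite mcoeffD mcoeffZ scalerDl scalerA.
- by apply/fsubsetP => g; rewrite !inE => ->; rewrite orbT.
- by apply/fsubsetP => g; rewrite !inE => ->.
- by apply/fsubsetP => g; rewrite !inE => ->; rewrite orbT.
Qed.
HB.instance Definition _ :=
  GRing.isLinear.Build K {malg K[G]} U *:%R lext lext_is_linear.
End LinearExtension.

Section QuotientLift.
Context {K : comNzRingType} {V : lmodType K} {W : submodule V} {T : Type}.

(* As with the [lift_] operators of [generic_quotient], [f] is evaluated at a
   representative; this is the map induced by [f] when [f] is constant on the
   classes, which is the case in all the uses below (see [qliftE]). *)
Definition qlift (f : V -> T) (x : lquot W) : T := f (repr x).
End QuotientLift.

Section QuotientLiftTheory.
Context {K : comNzRingType} {V U : lmodType K}.

Lemma linear_kernel_submod (f : {linear V -> U}) : is_submod [set v | f v = 0].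
Proof.
split=> /= [|a u v fu fv]; first exact: linear0.
by rewrite linearP fu fv scaler0 addr0.
Qed.

Lemma linear_lspan0 (f : {linear V -> U}) (S : set V) :
  (forall v, S v -> f v = 0) -> forall v, v \in lspan S -> f v = 0.
Proof.
move=> fS v /asboolP Sv; apply: (Sv [set v | f v = 0]); split=> //.
exact: linear_kernel_submod.
Qed.

Lemma qliftE (W : submodule V) (f : {linear V -> U}) :
  (forall v, v \in W -> f v = 0) ->
  forall v, qlift f (lquot_class W v) = f v.
Proof.
move=> fW v; apply/eqP; rewrite -subr_eq0 -linearB; apply/eqP/fW.
exact: lquot_class_repr.
Qed.

Lemma lquotW (W : submodule V) (P : lquot W -> Prop) :
  (forall v, P (lquot_class W v)) -> forall x, P x.
Proof. by move=> Pc x; rewrite -(lquot_reprK x). Qed.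

Lemma qlift_linear (W : submodule V) (f : {linear V -> U}) :
  (forall v, v \in W -> f v = 0) -> linear (qlift f : lquot W -> U).
Proof.
move=> fW a; elim/lquotW => u; elim/lquotW => v.
by rewrite -linearP !(qliftE fW) linearP.
Qed.
End QuotientLiftTheory.

Section TensorProduct.
Context {K : comNzRingType}.
Implicit Types U V T : lmodType K.

Definition bilinear_relators U V : set {malg K[(U * V)%type]} :=
  [set x | exists a u u' v,
     x = << (a *: u + u', v) >> - a *: << (u, v) >> - << (u', v) >>] `|`
  [set x | exists a u v v',
     x = << (u, a *: v + v') >> - a *: << (u, v) >> - << (u, v') >>].

Definition tens U V : Type := lquot (lspan (@bilinear_relators U V)).
HB.instance Definition _ U V := GRing.Lmodule.on (tens U V).

Definition tpure {U V} (u : U) (v : V) : tens U V := lquot_class _ << (u, v) >>.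

Definition tlift {U V T} (f : U -> V -> T) : tens U V -> T :=
  qlift (lext (fun p : (U * V)%type => f p.1 p.2)).
End TensorProduct.
Notation "u ⊗ v" := (tpure u v) (at level 40, left associativity).

Section TensorTheory.
Context {K : comNzRingType} {U V T : lmodType K}.

Definition bilin (f : U -> V -> T) : Prop :=
  (forall v, linear (f^~ v)) /\ (forall u, linear (f u)).

Lemma tens_linl (v : V) : linear (fun u : U => u ⊗ v).
Proof.
move=> a u u'; apply/eqP; rewrite -subr_eq0 opprD addrA; apply/eqP.
rewrite /tpure -linearZ -!linearB /=.
have -> : 0 = lquot_class (lspan (@bilinear_relators K U V)) 0 by rewrite linear0.
by apply/lquotP; rewrite subr0; apply: lspan_sub; left; exists a, u, u', v.
Qed.

Lemma tens_linr (u : U) : linear (fun v : V => u ⊗ v).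
Proof.
move=> a v v'; apply/eqP; rewrite -subr_eq0 opprD addrA; apply/eqP.
rewrite /tpure -linearZ -!linearB /=.
have -> : 0 = lquot_class (lspan (@bilinear_relators K U V)) 0 by rewrite linear0.
by apply/lquotP; rewrite subr0; apply: lspan_sub; right; exists a, u, v, v'.
Qed.

Fact tlift_kernel (f : U -> V -> T) : bilin f ->
  forall x, x \in lspan (@bilinear_relators K U V) ->
    lext (fun p : (U * V)%type => f p.1 p.2) x = 0.
Proof.
move=> [fl fr]; apply: linear_lspan0 => _ [] [a] [u] [w] [v] ->.
  by rewrite !linearB linearZ /= !lextU /= fl addrAC addrK subrr.
by rewrite !linearB linearZ /= !lextU /= fr addrAC addrK subrr.
Qed.

Lemma tliftE (f : U -> V -> T) : bilin f -> forall u v, tlift f (u ⊗ v) = f u v.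
Proof. by move=> /tlift_kernel fW u v; rewrite /tlift (qliftE fW) /= lextU. Qed.

Lemma tlift_linear (f : U -> V -> T) : bilin f -> linear (tlift f).
Proof. by move=> /tlift_kernel; exact: qlift_linear. Qed.

Lemma tens_ind (P : tens U V -> Prop) :
  P 0 -> (forall a u v t, P t -> P (a *: (u ⊗ v) + t)) -> forall t, P t.
Proof.
move=> P0 PD t; rewrite -(lquot_reprK t) (monalgE (repr t)) raddf_sum /=.
move: (repr t) => x; elim: (enum_fset (msupp x)) => [|[u v] s IHs]; first by rewrite big_nil.
rewrite big_cons (_ : lquot_class _ _ = x@_(u, v) *: (u ⊗ v)); first exact: PD.
by rewrite /tpure -linearZ /=; congr lquot_class; apply/malgP => k;
  rewrite mcoeffZ !mcoeffU mulr_natr.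
Qed.
End TensorTheory.

Section QuotientAlgebra.
Context {K : comNzRingType} {A : lalgType K} (S : set A).

Definition aquot : Type := lquot (ideal_gen *%R S).
HB.instance Definition _ := GRing.Lmodule.on aquot.

Definition aquot_class (a : A) : aquot := lquot_class (ideal_gen *%R S) a.
Fact aquot_class_is_linear : linear aquot_class.
Proof. exact: linearP. Qed.
HB.instance Definition _ :=
  GRing.isLinear.Build K A aquot *:%R aquot_class aquot_class_is_linear.

Definition aquot_one : aquot := aquot_class 1.
Definition aquot_mul (x y : aquot) : aquot := aquot_class (repr x * repr y).

Lemma aquotW (P : aquot -> Prop) : (forall a, P (aquot_class a)) -> forall x, P x.
Proof. exact: lquotW. Qed.

Lemma aquot_classM a b : aquot_class (a * b) = aquot_mul (aquot_class a) (aquot_class b).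
Proof.
apply/esym/lquotP; set a' := repr _; set b' := repr _.
rewrite -(subrK (a * b') (a' * b')) -addrA -mulrBl -mulrBr rpredD //.
  by have [] := andP (@ideal_genM _ _ *%R S b' _ (lquot_class_repr _ a)).
by have [] := andP (@ideal_genM _ _ *%R S a _ (lquot_class_repr _ b)).
Qed.

Fact aquot_mulA : associative aquot_mul.
Proof.
elim/aquotW => a; elim/aquotW => b; elim/aquotW => c.
by rewrite -!aquot_classM mulrA.
Qed.
Fact aquot_mul1r : left_id aquot_one aquot_mul.
Proof. by elim/aquotW => a; rewrite -aquot_classM mul1r. Qed.
Fact aquot_mulr1 : right_id aquot_one aquot_mul.
Proof. by elim/aquotW => a; rewrite -aquot_classM mulr1. Qed.
Fact aquot_mulDl : left_distributive aquot_mul +%R.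
Proof.
elim/aquotW => a; elim/aquotW => b; elim/aquotW => c.
by rewrite -linearD -!aquot_classM mulrDl linearD.
Qed.
Fact aquot_mulDr : right_distributive aquot_mul +%R.
Proof.
elim/aquotW => a; elim/aquotW => b; elim/aquotW => c.
by rewrite -linearD -!aquot_classM mulrDr linearD.
Qed.
HB.instance Definition _ := GRing.Zmodule_isPzRing.Build aquot
  aquot_mulA aquot_mul1r aquot_mulr1 aquot_mulDl aquot_mulDr.

Fact aquot_class_monoid_morphism : monoid_morphism aquot_class.
Proof. by split=> [//|a b]; exact: aquot_classM. Qed.
HB.instance Definition _ :=
  GRing.isMonoidMorphism.Build A aquot aquot_class aquot_class_monoid_morphism.

Lemma aquot_scaleAl (k : K) (x y : aquot) : k *: (x * y) = (k *: x) * y.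
Proof.
move: x y; elim/aquotW => a; elim/aquotW => b.
by rewrite -rmorphM -!linearZ -rmorphM /= scalerAl.
Qed.
End QuotientAlgebra.

Section Counit.
Context {K : comNzRingType} {A : lalgType K} (S : set A) (eps : A -> K).
Hypotheses (epsP : linear_for *%R eps) (eps1 : eps 1 = 1)
  (epsM : {morph eps : x y / x * y}).

Lemma counit0 : eps 0 = 0.
Proof. by have := epsP (-1) 0 0; rewrite scaler0 addr0 mulN1r addNr. Qed.
Lemma counitB x y : eps (x - y) = eps x - eps y.
Proof. by rewrite addrC -scaleN1r epsP mulN1r addrC. Qed.
Lemma counitZ k x : eps x = 0 -> eps (k *: x) = 0.
Proof. by move=> x0; rewrite -[k *: x]addr0 epsP counit0 x0 mulr0 addr0. Qed.
Lemma counit_commutator x y : eps x = 0 -> eps (x * y - y * x) = 0.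
Proof. by move=> x0; rewrite counitB !epsM x0 mul0r mulr0 subr0. Qed.
Lemma counit_relator x y z : eps x = 0 -> eps z = 0 ->
  eps (x * y - y * x - z) = 0.
Proof. by move=> x0 z0; rewrite counitB counit_commutator // z0 subr0. Qed.

Lemma ideal_gen_proper : (forall x, S x -> eps x = 0) -> aquot_class S 1 != 0.
Proof.
move=> epsS; rewrite -(linear0 (aquot_class S)); apply/eqP => /lquotP.
rewrite subr0 => /asboolP h; have := oner_neq0 K; apply/negP/negPn/eqP.
rewrite -eps1; apply: (h [set x | eps x = 0]); split=> //; split.
  split=> [|k u v /= u0 v0]; last by rewrite epsP u0 v0 mulr0 addr0.
  exact: counit0.
by move=> a u /= u0; rewrite !epsM u0 mulr0 mul0r.
Qed.
End Counit.

Section FreeAlgebra.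
Context {K : comNzRingType} {G : choiceType}.

Lemma malg_scaleAr (M : monomType) (k : K) (x y : {malg K[M]}) :
  k *: (x * y) = x * (k *: y).
Proof.
rewrite -!mul_malgC mulrA [RHS]mulrA; congr (_ * y).
rewrite !malgM_def fgmulUg fgmulgU.
by apply: eq_bigr => m _; rewrite mul1m mulm1 mulrC.
Qed.

Definition free_gen (g : G) : {malg K[{fmonom G}]} := << fmu g >>.
End FreeAlgebra.

(* [GenD n] stands for [delta_{n+1}], so that every constructor is a basis
   element of the Lie algebra. *)
Inductive h1_gen := GenX | GenY | GenD of nat.
HB.instance Definition _ := gen_eqMixin h1_gen.
HB.instance Definition _ := gen_choiceMixin h1_gen.

Section HopfAlgebraH1.
Variable K : fieldType.

Definition h1_relators : set {malg K[{fmonom h1_gen}]} :=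
  let X := free_gen GenX in
  let Y := free_gen GenY in
  let d n := free_gen (GenD n) in
  [set x | x = Y * X - X * Y - X] `|`
  [set x | exists n, x = X * d n - d n * X - d n.+1] `|`
  [set x | exists n, x = Y * d n - d n * Y - n.+1%:R *: d n] `|`
  [set x | exists n m, x = d n * d m - d m * d n].

(* The enveloping algebra: the tensor algebra of the Lie algebra, i.e. the free
   algebra on its basis, modulo the two-sided ideal of the relators
   [x y - y x - [x, y]]. *)
Definition H1 : Type := aquot h1_relators.
HB.instance Definition _ := GRing.Lmodule.on H1.
HB.instance Definition _ := GRing.PzRing.on H1.

Definition h1_class (x : {malg K[{fmonom h1_gen}]}) : H1 := aquot_class h1_relators x.
Fact h1_class_is_linear : linear h1_class.
Proof. exact: linearP. Qed.
Fact h1_class_monoid_morphism : monoid_morphism h1_class.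
Proof. by split=> [|a b]; [exact: rmorph1|exact: rmorphM]. Qed.
HB.instance Definition _ := GRing.isLinear.Build K {malg K[{fmonom h1_gen}]} H1
  *:%R h1_class h1_class_is_linear.
HB.instance Definition _ := GRing.isMonoidMorphism.Build {malg K[{fmonom h1_gen}]} H1
  h1_class h1_class_monoid_morphism.

Lemma h1W (P : H1 -> Prop) : (forall a, P (h1_class a)) -> forall x, P x.
Proof. exact: lquotW. Qed.

Fact h1_counit : exists eps : {malg K[{fmonom h1_gen}]} -> K,
  [/\ linear_for *%R eps, eps 1 = 1, {morph eps : x y / x * y} &
      forall g, eps (free_gen g) = 0].
Proof.
have [epsM eps1] := @mcoeff1g_is_multiplicative {fmonom h1_gen} K.
exists (mcoeff mone); split=> // [a u v|g]; first by rewrite mcoeffD mcoeffZ.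
by rewrite mcoeffU1 fm1_eq1.
Qed.

Fact h1_oner_neq0 : 1 != 0 :> H1.
Proof.
have [eps [epsP eps1 epsM epsg]] := h1_counit.
rewrite -(rmorph1 h1_class); apply: (ideal_gen_proper epsP eps1 epsM).
move=> _ [[[->|[n ->]]|[n ->]]|[n [m ->]]].
- by apply: (counit_relator epsP epsM); exact: epsg.
- by apply: (counit_relator epsP epsM); exact: epsg.
- by apply: (counit_relator epsP epsM); [|apply: (counitZ epsP)]; exact: epsg.
- by apply: (counit_commutator epsP epsM); exact: epsg.
Qed.

HB.instance Definition _ := GRing.PzSemiRing_isNonZero.Build H1 h1_oner_neq0.
HB.instance Definition _ :=
  GRing.Lmodule_isLalgebra.Build K H1 (@aquot_scaleAl K _ h1_relators).

Fact h1_scaleAr (k : K) (x y : H1) : k *: (x * y) = x * (k *: y).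
Proof.
move: x y; elim/h1W => a; elim/h1W => b.
by rewrite -rmorphM -!linearZ -rmorphM /= malg_scaleAr.
Qed.
HB.instance Definition _ := GRing.Lalgebra_isAlgebra.Build K H1 h1_scaleAr.

Definition hX : H1 := h1_class (free_gen GenX).
Definition hY : H1 := h1_class (free_gen GenY).
Definition hdelta (n : nat) : H1 := h1_class (free_gen (GenD n.-1)).
End HopfAlgebraH1.

(* The ring laws of the tensor product of two algebras, for any linear model [T]
   of that tensor product. *)
Section TensorAlgebraLaws.
Context {K : comNzRingType} {A B : algType K} {T : lmodType K}.
Variables (p : A -> B -> T) (lift : (A -> B -> T) -> T -> T).
Hypotheses (pl : forall b, linear (p^~ b)) (pr : forall a, linear (p a)).
Hypothesis ind : forall P : T -> Prop,
  P 0 -> (forall k a b t, P t -> P (k *: p a b + t)) -> forall t, P t.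
Hypothesis liftE : forall f, bilin f -> forall a b, lift f (p a b) = f a b.
Hypothesis lift_linear : forall f, bilin f -> linear (lift f).

Let lin0 (U V : lmodType K) (f : U -> V) : linear f -> f 0 = 0.
Proof. by move=> fL; have := fL (-1) 0 0; rewrite scaler0 addr0 scaleN1r addNr. Qed.

Let mul s t := lift (fun a b => lift (fun a' b' => p (a * a') (b * b')) t) s.

Let bilin_r a b : bilin (fun a' b' => p (a * a') (b * b')).
Proof.
split=> [b'|a'] k u v; first by rewrite mulrDr -scalerAr pl.
by rewrite mulrDr -scalerAr pr.
Qed.

Let bilin_l t : bilin (fun a b => lift (fun a' b' => p (a * a') (b * b')) t).
Proof.
have L a b := lift_linear (bilin_r a b).
have E a b := liftE (bilin_r a b).
split=> [b|a] k u v; elim/ind: t => [|c a' b' t IH].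
- by rewrite !(lin0 (L _ _)) scaler0 addr0.
- rewrite !L !E IH mulrDl -scalerAl pl.
  by rewrite !scalerDr !scalerA (mulrC c) addrACA.
- by rewrite !(lin0 (L _ _)) scaler0 addr0.
- rewrite !L !E IH mulrDl -scalerAl pr.
  by rewrite !scalerDr !scalerA (mulrC c) addrACA.
Qed.

Lemma tensor_mulE a a' b b' : mul (p a b) (p a' b') = p (a * a') (b * b').
Proof. by rewrite /mul (liftE (bilin_l _)) (liftE (bilin_r _ _)). Qed.

Lemma tensor_mulPl t : linear (mul^~ t).
Proof. exact: (lift_linear (bilin_l t)). Qed.

Lemma tensor_mulPr s : linear (mul s).
Proof.
move=> k t t'; elim/ind: s => [|c a b s IH].
  by rewrite !(lin0 (tensor_mulPl _)) scaler0 addr0.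
rewrite !tensor_mulPl IH /mul !(liftE (bilin_l _)) (lift_linear (bilin_r _ _)).
by rewrite !scalerDr !scalerA (mulrC c) addrACA.
Qed.

Lemma tensor_mulA : associative mul.
Proof.
have M0l u := lin0 (tensor_mulPl u); have M0r u := lin0 (tensor_mulPr u).
move=> s t u; elim/ind: s => [|c a b s IHs]; first by rewrite !M0l.
rewrite !tensor_mulPl IHs; congr (_ *: _ + _).
move: t {IHs}; elim/ind => [|c' a' b' t IHt]; first by rewrite !(M0l, M0r).
rewrite !(tensor_mulPl, tensor_mulPr) IHt; congr (_ *: _ + _).
move: u {IHt}; elim/ind => [|c'' a'' b'' u IHu]; first by rewrite !M0r.
by rewrite !tensor_mulPr IHu !tensor_mulE !mulrA.
Qed.

Lemma tensor_mul1r : left_id (p 1 1) mul.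
Proof.
elim/ind=> [|c a b t IH]; first exact: (lin0 (tensor_mulPr _)).
by rewrite tensor_mulPr IH tensor_mulE !mul1r.
Qed.

Lemma tensor_mulr1 : right_id (p 1 1) mul.
Proof.
elim/ind=> [|c a b t IH]; first exact: (lin0 (tensor_mulPl _)).
by rewrite tensor_mulPl IH tensor_mulE !mulr1.
Qed.

Lemma tensor_mulDl : left_distributive mul +%R.
Proof. by move=> s t u; have := tensor_mulPl u 1 s t; rewrite !scale1r. Qed.

Lemma tensor_mulDr : right_distributive mul +%R.
Proof. by move=> s t u; have := tensor_mulPr s 1 t u; rewrite !scale1r. Qed.
End TensorAlgebraLaws.

Section TensorAlgebra.
Context {K : comNzRingType} {A B : algType K}.

Definition tens_mul (s t : tens A B) : tens A B :=
  tlift (fun a b => tlift (fun a' b' => (a * a') ⊗ (b * b')) t) s.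

Lemma tens_mulE (a a' : A) (b b' : B) :
  tens_mul (a ⊗ b) (a' ⊗ b') = (a * a') ⊗ (b * b').
Proof.
exact: (tensor_mulE tens_linl tens_linr tens_ind tliftE tlift_linear).
Qed.

Fact tens_mulA : associative tens_mul.
Proof.
exact: (tensor_mulA tens_linl tens_linr tens_ind tliftE tlift_linear).
Qed.
Fact tens_mul1r : left_id (1 ⊗ 1) tens_mul.
Proof.
exact: (tensor_mul1r tens_linl tens_linr tens_ind tliftE tlift_linear).
Qed.
Fact tens_mulr1 : right_id (1 ⊗ 1) tens_mul.
Proof.
exact: (tensor_mulr1 tens_linl tens_linr tens_ind tliftE tlift_linear).
Qed.
Fact tens_mulDl : left_distributive tens_mul +%R.
Proof.
exact: (tensor_mulDl tens_linl tens_linr tens_ind tliftE tlift_linear).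
Qed.
Fact tens_mulDr : right_distributive tens_mul +%R.
Proof.
exact: (tensor_mulDr tens_linl tens_linr tens_ind tliftE tlift_linear).
Qed.

HB.instance Definition _ := GRing.Zmodule_isPzRing.Build (tens A B)
  tens_mulA tens_mul1r tens_mulr1 tens_mulDl tens_mulDr.
End TensorAlgebra.

Section Coproduct.
Variable K : fieldType.
Local Notation H1 := (H1 K).
Local Notation X := (hX K).
Local Notation Y := (hY K).
Local Notation delta := (hdelta K).

Definition coprodX : tens H1 H1 := X ⊗ 1 + 1 ⊗ X + delta 1 ⊗ Y.
Definition coprodY : tens H1 H1 := Y ⊗ 1 + 1 ⊗ Y.
Definition coprod_delta1 : tens H1 H1 := delta 1 ⊗ 1 + 1 ⊗ delta 1.

(* The value on [delta_{n+1}] is forced by [delta_{n+1} = [X, delta_n]]. *)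
Definition coprod_gen (g : h1_gen) : tens H1 H1 :=
  match g with
  | GenX => coprodX
  | GenY => coprodY
  | GenD n => iter n (fun t => coprodX * t - t * coprodX) coprod_delta1
  end.

Definition coprod : H1 -> tens H1 H1 :=
  qlift (lext (fun w : {fmonom h1_gen} => \prod_(g <- w) coprod_gen g)).

Definition coprod3 (h : H1) : tens (tens H1 H1) H1 :=
  tlift (fun h1 h2 => coprod h1 ⊗ h2) (coprod h).
End Coproduct.

Section H1Modules.
Context {K : fieldType} {V : lmodType K}.
Variable op : h1_gen -> V -> V.

Definition word_act : {malg K[{fmonom h1_gen}]} -> V -> V :=
  lext (fun (w : {fmonom h1_gen}) (v : V) => foldr op v w).

Definition h1_act : H1 K -> V -> V := qlift word_act.
End H1Modules.

Section PolynomialAlgebra.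
Variable K : fieldType.

Definition polyP : Type := {malg K[{cmonom nat}]}.
HB.instance Definition _ := GRing.ComNzRing.on polyP.
HB.instance Definition _ := GRing.Algebra.on polyP.

Definition polyZ (j : nat) : polyP := << ucm j >>.

(* the derivation mapping [Z_j] to [d j] *)
Definition derivation (d : nat -> polyP) : polyP -> polyP :=
  lext (fun m : {cmonom nat} =>
    \sum_(j <- finsupp m) (m j)%:R *: ((<< divcm m (ucm j) >> : polyP) * d j)).

Definition polyP_op (g : h1_gen) : polyP -> polyP :=
  match g with
  | GenX => derivation (fun j => polyZ j.+1)
  | GenY => derivation (fun j => (j + 2)%:R *: polyZ j)
  | GenD _ => fun _ => 0
  end.

Definition polyP_act : H1 K -> polyP -> polyP := h1_act polyP_op.
End PolynomialAlgebra.

Section CrossedProduct.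
Variable K : fieldType.
Local Notation H1 := (H1 K).
Local Notation P := (polyP K).

Definition tlift3 {U V W T : lmodType K} (f : U -> V -> W -> T) :
    tens (tens U V) W -> T :=
  tlift (fun uv w => tlift (fun u v => f u v w) uv).

(* the algebra [P ⋊ H1 ⋉ P] *)
Definition Ht1 : Type := tens (tens P H1) P.
HB.instance Definition _ := GRing.Lmodule.on Ht1.

Definition ht1_pure (p : P) (h : H1) (q : P) : Ht1 := p ⊗ h ⊗ q.

(* [(p, h, q) (p', h', q') = p h_(1)(p') ⊗ h_(2) h' ⊗ h_(3)(q') q] *)
Definition ht1_mul (s t : Ht1) : Ht1 :=
  tlift3 (fun p h q =>
    tlift3 (fun p' h' q' =>
      tlift3 (fun h1 h2 h3 =>
        ht1_pure (p * polyP_act h1 p') (h2 * h') (polyP_act h3 q' * q))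
      (coprod3 h)) t) s.

Definition ht1_alpha (p : P) : Ht1 := ht1_pure p 1 1.
Definition ht1_beta (q : P) : Ht1 := ht1_pure 1 1 q.

Definition tdelta2 : Ht1 :=
  ht1_pure 1 (hdelta K 2 - 2^-1 *: hdelta K 1 ^+ 2) 1
    - ht1_alpha (polyZ K 0) + ht1_beta (polyZ K 0).

Definition Hs : Type := lquot (ideal_gen ht1_mul [set tdelta2]).
HB.instance Definition _ := GRing.Lmodule.on Hs.

Definition hs_class (x : Ht1) : Hs := lquot_class (ideal_gen ht1_mul [set tdelta2]) x.

Definition hs_mul (x y : Hs) : Hs := hs_class (ht1_mul (repr x) (repr y)).
Definition hs_alpha (p : P) : Hs := hs_class (ht1_alpha p).
Definition hs_beta (p : P) : Hs := hs_class (ht1_beta p).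

Section TensorPower.
Variable n : nat.

(* The [n]-fold tensor power over [P]: besides multilinearity over the scalars,
   [beta(p) h_i ⊗ h_(i+1) = h_i ⊗ alpha(p) h_(i+1)]. *)
Definition upd (h : 'I_n -> Hs) (i : 'I_n) (u : Hs) : 'I_n -> Hs :=
  fun j => if j == i then u else h j.

Definition tensP_relators : set {malg K['I_n -> Hs]} :=
  [set x | exists (h : 'I_n -> Hs) i a u v,
     x = << upd h i (a *: u + v) >> - a *: << upd h i u >> - << upd h i v >>] `|`
  [set x | exists (h : 'I_n -> Hs) (i j : 'I_n) (p : P), j = i.+1 :> nat /\
     x = << upd h i (hs_mul (hs_beta p) (h i)) >>
         - << upd h j (hs_mul (hs_alpha p) (h j)) >>].

Definition tensP : Type := lquot (lspan tensP_relators).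
HB.instance Definition _ := GRing.Lmodule.on tensP.
End TensorPower.
End CrossedProduct.

Section PartialMaps.
Context {T : pointedType}.
(* Partial maps from [T] to itself, represented by their graphs, so that equal
   partial maps are equal terms; [papp phi x] is [point] off the domain. *)
Implicit Types phi psi : T -> set T.

Definition pdom phi : set T := [set x | phi x !=set0].
Definition pran phi : set T := [set y | exists x, phi x y].
Definition papp phi (x : T) : T := get (phi x).
Definition pinv phi : T -> set T := fun y => [set x | phi x y].
Definition pcomp phi psi : T -> set T :=
  fun x => [set z | exists2 y, psi x y & phi y z].
Definition prestr (U : set T) phi : T -> set T := fun x => [set y | U x /\ phi x y].
Definition psub psi phi : Prop := forall x, psi x `<=` phi x.
End PartialMaps.

Section Smoothness.
Context {R : realType} {V W : normedModType R}.

(* For [U] open and finite-dimensional spaces this is [C^oo] on [U]: all the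
   iterated directional derivatives of [f], [f] included, are Frechet
   differentiable (hence continuous) at every point of [U]. *)
Definition smooth_on (U : set V) (f : V -> W) : Prop :=
  forall (s : seq V) z, U z ->
    differentiable (foldr (fun (v : V) (g : V -> W) => fun x => 'D_v g x) f s) z.
End Smoothness.

Section Pseudogroups.
Context {R : realType}.
Implicit Types (phi psi : R -> set R) (Gamma : set (R -> set R)).

Record local_diffeo phi : Prop := LocalDiffeo {
  ld_fun : forall x, is_subset1 (phi x);
  ld_inj : forall y, is_subset1 (pinv phi y);
  ld_open_dom : open (pdom phi);
  ld_open_ran : open (pran phi);
  ld_smooth : smooth_on (pdom phi) (papp phi);
  ld_smooth_inv : smooth_on (pran phi) (papp (pinv phi)) }.

Definition orientation_preserving phi : Prop :=
  forall x, pdom phi x -> 0 < derive1 (papp phi) x.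

Record pseudogroup Gamma : Prop := Pseudogroup {
  pg_diffeo : forall phi, Gamma phi -> local_diffeo phi /\ orientation_preserving phi;
  pg_id : Gamma (fun x => [set x]);
  pg_comp : forall phi psi, Gamma phi -> Gamma psi -> Gamma (pcomp phi psi);
  pg_inv : forall phi, Gamma phi -> Gamma (pinv phi);
  pg_restr : forall U phi, open U -> Gamma phi -> Gamma (prestr U phi);
  pg_glue : forall phi, local_diffeo phi -> orientation_preserving phi ->
    (forall x, pdom phi x -> exists U, [/\ open U, U x & Gamma (prestr U phi)]) ->
    Gamma phi }.
End Pseudogroups.

Section Connection.
Context {R : realType} (nu : R -> R).
Local Notation M := (R * R)%type.
Implicit Types (V W : M -> M) (z : M).

(* the values of [nabla_(d_i) (d_j)] *)
Definition nabla11 z : M := (0, z.2 * nu z.1).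
Definition nabla12 z : M := ((2 * z.2)^-1, 0).
Definition nabla21 z : M := nabla12 z.
Definition nabla22 z : M := (0, - (2 * z.2)^-1).

Definition nabla V W z : M :=
  'D_(V z) W z
    + ((V z).1 * (W z).1) *: nabla11 z + ((V z).1 * (W z).2) *: nabla12 z
    + ((V z).2 * (W z).1) *: nabla21 z + ((V z).2 * (W z).2) *: nabla22 z.

Definition pushes_forward (U : set M) (F : M -> M) V V' : Prop :=
  forall z, U z -> V' (F z) = 'D_(V z) F z.

(* Meant for [F] a diffeomorphism from [U] onto [U']: [V'] and [W'] are then the
   push-forwards of [V] and [W]. *)
Definition preserves_nabla (U U' : set M) (F : M -> M) : Prop :=
  forall V W V' W',
    smooth_on U V -> smooth_on U W -> smooth_on U' V' -> smooth_on U' W' ->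
    pushes_forward U F V V' -> pushes_forward U F W W' ->
    pushes_forward U F (nabla V W) (nabla V' W').

(* the lift in the coordinates [(x_1, x_2)] *)
Definition frame_lift (phi : R -> set R) (z : M) : M :=
  (papp phi z.1, z.2 / derive1 (papp phi) z.1).

Definition preserves_connection (Gamma : set (R -> set R)) : Prop :=
  forall phi, Gamma phi ->
    preserves_nabla [set z | pdom phi z.1 /\ 0 < z.2]
                    [set z | pran phi z.1 /\ 0 < z.2] (frame_lift phi).
End Connection.

Section ComplexFunctions.
Context {R : realType}.
Local Notation C := R[i].
Implicit Types f : R * R -> C.

Definition csmooth f : Prop :=
  smooth_on setT (fun z => complex.Re (f z)) /\
  smooth_on setT (fun z => complex.Im (f z)).

Definition cderive (v : R * R) f (z : R * R) : C :=
  ('D_v (fun w => complex.Re (f w)) z +i* 'D_v (fun w => complex.Im (f w)) z)%C.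

Definition y_dx f : R * R -> C := fun z => (z.2)%:C%C * cderive (1, 0) f z.
Definition y_dy f : R * R -> C := fun z => (z.2)%:C%C * cderive (0, 1) f z.
End ComplexFunctions.

Section GroupoidAlgebra.
Context {R : realType} (Gamma : set (R -> set R)).
Local Notation C := R[i].

(* the same lift in the coordinates [(x, y) = (x_1, 1 / x_2)] *)
Definition half_lift (phi : R -> set R) : R * R -> set (R * R) :=
  fun z => [set w | [/\ phi z.1 w.1, 0 < z.2 & w.2 = derive1 (papp phi) z.1 * z.2]].

(* the pairs [(f, phi)] such that [f U_phi] is an element of the algebra *)
Definition is_monomial (m : (R * R -> C) * (R -> set R)) : Prop :=
  [/\ Gamma m.2, csmooth m.1, compact (closure [set z | m.1 z != 0]) &
      closure [set z | m.1 z != 0] `<=` pran (half_lift m.2)].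

Definition monomial : Type := {m | `[< is_monomial m >]}.
HB.instance Definition _ := Choice.on monomial.

Definition mono_fun (m : monomial) : R * R -> C := (val m).1.
Definition mono_map (m : monomial) : R -> set R := (val m).2.

Definition groupoid_relators : set {malg C[monomial]} :=
  [set x | exists (a : C) (m m1 m2 : monomial),
     [/\ mono_map m1 = mono_map m, mono_map m2 = mono_map m,
         forall z, mono_fun m z = a * mono_fun m1 z + mono_fun m2 z &
         x = << m >> - a *: << m1 >> - << m2 >>]] `|`
  [set x | exists m m' : monomial,
     [/\ psub (mono_map m') (mono_map m), mono_fun m' = mono_fun m & x = << m >> - << m' >>]].

(* Spanned by the [f U_phi], linear in [f], with [f U_phi = f U_psi] when [psi]
   is a restriction of [phi]. *)
Definition groupoid_alg : Type := lquot (lspan groupoid_relators).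
HB.instance Definition _ := GRing.Lmodule.on groupoid_alg.

Local Notation A := groupoid_alg.

(* [f U_phi]. The value [0] for a pair that is not a monomial is never reached
   below: the operations applied to monomials yield monomials. *)
Definition monoU (f : R * R -> C) (phi : R -> set R) : A :=
  if insub (f, phi) is Some m then lquot_class (lspan groupoid_relators) << m >>
  else 0.

(* the linear map with [f U_phi |-> F f phi] *)
Definition mono_lift {T : lmodType C} (F : (R * R -> C) -> (R -> set R) -> T) : A -> T :=
  qlift (lext (fun m : monomial => F (mono_fun m) (mono_map m))).

(* composition with the inverse of the lift of [phi] *)
Definition transport (phi : R -> set R) (g : R * R -> C) : R * R -> C :=
  fun z => g (papp (pinv (half_lift phi)) z).

Definition gmul (a b : A) : A :=
  mono_lift (fun f phi => mono_lift (fun g psi =>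
    monoU (fun z => f z * transport phi g z) (pcomp phi psi)) b) a.

(* left and right multiplication by a multiplier [g] *)
Definition gmull (g : R * R -> C) : A -> A :=
  mono_lift (fun f phi => monoU (fun z => g z * f z) phi).
Definition gmulr (g : R * R -> C) : A -> A :=
  mono_lift (fun f phi => monoU (fun z => f z * transport phi g z) phi).

(* [y (phi^-1)'' / (phi^-1)'] *)
Definition log_jac (phi : R -> set R) (z : R * R) : C :=
  let psi := papp (pinv phi) in
  (z.2 * (derive1 (derive1 psi) z.1 / derive1 psi z.1))%:C%C.

Definition groupoid_op (g : h1_gen) : A -> A :=
  match g with
  | GenX => mono_lift (fun f phi => monoU (y_dx f) phi)
  | GenY => mono_lift (fun f phi => monoU (y_dy f) phi)
  | GenD n => mono_lift (fun f phi =>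
      monoU (fun z => iter n y_dx (log_jac phi) z * f z) phi)
  end.

Definition groupoid_act : H1 C -> A -> A := h1_act groupoid_op.

Definition gprod n (a : 'I_n -> A) : A :=
  if [seq a i | i <- enum 'I_n] is x :: s then foldl gmul x s else 0.
End GroupoidAlgebra.

Section ActionMaps.
Context {R : realType} (nu : R -> R) (Gamma : set (R -> set R)).
Local Notation C := R[i].
Local Notation A := (groupoid_alg Gamma).

Definition Omega (z : R * R) : C := (- (z.2 ^+ 2 * nu z.1))%:C%C.

(* the algebra morphism mapping [Z_k] to [(y d/dx)^k Omega] *)
Definition rho (p : polyP C) (z : R * R) : C :=
  \sum_(m <- msupp p) p@_m * \prod_(k <- finsupp m) iter k y_dx Omega z ^+ m k.

Definition chi_ht1 : Ht1 C -> A -> A :=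
  tlift3 (fun p h q => fun a => gmulr (rho q) (gmull (rho p) (groupoid_act h a))).

Definition chi : Hs C -> A -> A := qlift chi_ht1.

Definition chi_n n : tensP C n -> ('I_n -> A) -> A :=
  qlift (lext (fun h : 'I_n -> Hs C => fun a : 'I_n -> A =>
    gprod (fun i => chi (h i) (a i)))).

Definition Ker_chi n : set (tensP C n) := [set t | forall a, chi_n t a = 0].
End ActionMaps.

(* Main.v *)
(* One inclusion says that the action maps are well defined and linear; it needs
   the full compatibility of [X], [Y], [delta_1] with products, multipliers and
   the Schwarzian relation that kills
   [delta_2 - (1 / 2) delta_1^2 - alpha(Z_0) + beta(Z_0)].

   For the other one, moving [beta(p)] across the tensor signs shows that the
   tensor power is spanned by tensors with factors
   [Z^m delta_1^c X^a Y^b], the last one followed by [beta(Z^m')].  In the lifted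
   coordinates a local diffeomorphism [phi], with inverse [psi], preserves the
   connection iff [S(psi) = psi'^2 nu(psi) - nu] for the Schwarzian [S].
   Evaluating the product of the [chi(h_i)(f_i U_(phi_i))] at the point [z_0]
   involves [f_i] near [z_i] only, where [z_(i+1)] is the preimage of [z_i] under
   the lift of [phi_i], and turns the basis tensor into a monomial in the jets of
   [Omega] at the [z_i], the numbers [delta_1(phi_i)(z_i)] and the jets of the
   [f_i].  All of these can be prescribed independently: pick polynomials [v_i]
   with [v_i' = 1] and given second derivative and jet of [S(v_i)] at [x_i], let
   [nu = - S(v_i)] near [x_i], and let [phi_i] be [v_i^-1 o v_(i+1)].  A Kronecker
   substitution of powers of a single integer for all variables then shows that
   all coefficients of an element of the common kernel vanish. *)

From HB Require Import structures.
From mathcomp Require Import all_boot all_order all_algebra.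
From mathcomp Require Import finmap.
From mathcomp.multinomials Require Import monalg.
From mathcomp Require Import complex.
From mathcomp Require Import all_classical all_reals all_analysis.
From mathcomp Require Import ring lra zify.
Require Import Defs.

Set Implicit Arguments.
Unset Strict Implicit.
Unset Printing Implicit Defensive.
Import Order.TTheory GRing.Theory Num.Theory numFieldNormedType.Exports.
Local Open Scope classical_set_scope.
Local Open Scope ring_scope.

(** * Relations and modules of H1 *)

(** Of the standard tensors only the spanning property is established beforehand. Their linear
    independence comes out together with faithfulness, because the evaluations separate them. The
    obstacle on the geometric side is that a member of the pseudogroup has to satisfy the Schwarzian
    equation for [nu] exactly on an open set, while only finitely many jets are to be prescribed.
    Fixing [nu] first would mean solving a nonlinear third order differential equation for the maps.
    With the charts chosen first and [nu] read off them, transitions are exact symmetries for formal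
    reasons, and what remains is a recursion on the coefficients of a polynomial. For a given [nu]
    the pseudogroup consists of all solutions of the equation, so that membership of the transitions
    is a pointwise check. The evaluation points are consecutive integers at height [y = 1], and the
    transitions have derivative 1 there, so the lifts link the points and no powers of [y] enter the
    values. There is one point more than there are factors: the last one only carries the trailing
    [beta]. *)

Section LinearMaps.
Context {K : pzRingType} {U V : lmodType K} (f : U -> V).
Hypothesis fL : linear f.

Lemma lin0 : f 0 = 0.
Proof. by have := fL (-1) 0 0; rewrite scaler0 addr0 scaleN1r addNr. Qed.
Lemma linD u v : f (u + v) = f u + f v.
Proof. by have := fL 1 u v; rewrite !scale1r. Qed.
Lemma linZ a u : f (a *: u) = a *: f u.
Proof. by have := fL a u 0; rewrite lin0 !addr0. Qed.
Lemma linN u : f (- u) = - f u.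
Proof. by rewrite -scaleN1r linZ scaleN1r. Qed.
Lemma linB u v : f (u - v) = f u - f v.
Proof. by rewrite linD linN. Qed.

Lemma lin_add3 a b c : f (a + b + c) = f a + f b + f c.
Proof. by rewrite !linD. Qed.
Lemma lin_add4 a b c e : f (a + b + c + e) = f a + f b + f c + f e.
Proof. by rewrite !linD. Qed.
Lemma lin_solve k a b c e : f (a - k *: b - c + e) = 0 -> f a = k *: f b + f c - f e.
Proof.
move=> /eqP; rewrite linD !linB linZ addr_eq0 !subr_eq => /eqP ->.
by rewrite -addrA addrC (addrC (f c)).
Qed.
End LinearMaps.

Lemma linear_comp (K : pzRingType) (U V W : lmodType K) (f : V -> W) (g : U -> V) :
  linear f -> linear g -> linear (fun x => f (g x)).
Proof. by move=> fL gL k u v; rewrite gL fL. Qed.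

Lemma linear_add (K : pzRingType) (U V : lmodType K) (f g : U -> V) :
  linear f -> linear g -> linear (fun x => f x + g x).
Proof. by move=> fL gL k u v; rewrite fL gL scalerDr addrACA. Qed.

Lemma linear_eq (K : pzRingType) (U V : lmodType K) (f g : U -> V) :
  f =1 g -> linear g -> linear f.
Proof. by move=> /funext ->. Qed.

Lemma linear_lcomb (K : comNzRingType) (U V : lmodType K) k (f g : U -> V) :
  linear f -> linear g -> linear (fun x => k *: f x + g x).
Proof.
by move=> fL gL c u v; rewrite fL gL !scalerDr !scalerA (mulrC k) addrACA.
Qed.

Lemma lin_rel0 (K : pzRingType) (U V : lmodType K) (f : U -> V) k u v w : linear f ->
  f u = k *: f v + f w -> f (u - k *: v - w) = 0.
Proof. by move=> L E; rewrite !(linB L) (linZ L) E addrAC addrK subrr. Qed.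

Lemma lin_sub0 (K : pzRingType) (U V : lmodType K) (f : U -> V) u v : linear f -> f u = f v -> f (u - v) = 0.
Proof. by move=> L E; rewrite (linB L) E subrr. Qed.

Lemma malg_ind (K : comNzRingType) (G : choiceType) (P : {malg K[G]} -> Prop) :
  P 0 -> (forall k g x, P x -> P (k *: << g >> + x)) -> forall x, P x.
Proof.
move=> P0 PD x; rewrite (monalgE x).
elim: (enum_fset (msupp x)) => [|g s IHs]; first by rewrite big_nil.
rewrite big_cons (_ : << _ *g g >> = x@_g *: << g >>); first exact: PD.
by apply/malgP => k; rewrite mcoeffZ !mcoeffU mulr_natr.
Qed.

Lemma malg_mulUU (K : comNzRingType) (M : monomType) (m m' : M) :
  << m >> * << m' >> = << mmul m m' >> :> {malg K[M]}.
Proof. by rewrite malgM_def fgmulUU mulr1. Qed.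

Lemma h1_class_mul (K : fieldType) (x y : {malg K[{fmonom h1_gen}]}) :
  h1_class x * h1_class y = h1_class (x * y).
Proof. by rewrite rmorphM. Qed.

Section H1Relations.
Variable K : fieldType.
Local Notation h1_class := (@h1_class K).

Lemma h1_rel x : @h1_relators K x -> h1_class x = 0.
Proof.
move=> Rx; rewrite -(linear0 h1_class).
by apply/lquotP; rewrite subr0; exact: ideal_gen_sub.
Qed.

Lemma h1_YX : hY K * hX K = hX K * hY K + hX K.
Proof.
apply/eqP; rewrite -subr_eq0 opprD addrA /hX /hY !h1_class_mul -!linearB /=.
by apply/eqP/h1_rel; left; left; left.
Qed.

Lemma h1_Xd n : hX K * hdelta K n.+1 = hdelta K n.+1 * hX K + hdelta K n.+2.
Proof.
apply/eqP; rewrite -subr_eq0 opprD addrA /hX /hdelta !h1_class_mul -!linearB /=.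
by apply/eqP/h1_rel; left; left; right; exists n.
Qed.

Lemma h1_Yd n : hY K * hdelta K n.+1 = hdelta K n.+1 * hY K + n.+1%:R *: hdelta K n.+1.
Proof.
apply/eqP; rewrite -subr_eq0 opprD addrA /hY /hdelta !h1_class_mul -linearZ.
by rewrite -!linearB /=; apply/eqP/h1_rel; left; right; exists n.
Qed.

Lemma h1_dd n m : hdelta K n.+1 * hdelta K m.+1 = hdelta K m.+1 * hdelta K n.+1.
Proof.
apply/eqP; rewrite -subr_eq0 /hdelta !h1_class_mul -!linearB /=.
by apply/eqP/h1_rel; right; exists n, m.
Qed.

Definition h1_of (g : h1_gen) : H1 K := h1_class (free_gen g).

Lemma h1_class_fmonom (w : {fmonom h1_gen}) :
  h1_class << w >> = foldr (fun g h => h1_of g * h) 1 w.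
Proof.
case: w => w; elim: w => [|g w IHw] /=.
  by rewrite -(rmorph1 h1_class); congr (h1_class << _ >>); apply/eqP; rewrite fmP fm1.
rewrite -IHw /h1_of h1_class_mul /free_gen malg_mulUU; congr (h1_class << _ >>).
by apply/eqP; rewrite fmP fmM fmU.
Qed.

Lemma h1_gens_ind (P : H1 K -> Prop) :
  P 0 -> P 1 -> (forall k a b, P a -> P b -> P (k *: a + b)) ->
  (forall g h, P h -> P (h1_of g * h)) -> forall h, P h.
Proof.
move=> P0 P1 PL Pg; elim/h1W => x; elim/malg_ind: x => [|k w x Px].
  by rewrite linear0.
rewrite linearP /=; apply: PL => //; rewrite h1_class_fmonom.
by elim: (w : seq _) => [|g s IHs] //=; exact: Pg.
Qed.

(* [delta_(n+1) = [X, delta_n]], so that the [delta_n], [n > 1], are not needed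
   as generators. *)
Lemma h1_ind (P : H1 K -> Prop) :
  P 0 -> P 1 -> (forall k a b, P a -> P b -> P (k *: a + b)) ->
  (forall h, P h -> P (hX K * h)) -> (forall h, P h -> P (hY K * h)) ->
  (forall h, P h -> P (hdelta K 1 * h)) -> forall h, P h.
Proof.
move=> P0 P1 PL PX PY Pd; apply: (h1_gens_ind P0 P1 PL) => g.
have -> : h1_of g = match g with GenX => hX K | GenY => hY K | GenD n => hdelta K n.+1 end.
  by case: g => [||n]; rewrite /h1_of /hdelta.
case: g => [||n]; [exact: PX|exact: PY|].
elim: n => [|n IHn] h Ph; first by apply: Pd.
have -> : hdelta K n.+2 * h = (-1) *: (hdelta K n.+1 * (hX K * h)) +
    hX K * (hdelta K n.+1 * h).
  by rewrite !mulrA h1_Xd mulrDl scaleN1r addKr.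
by apply: PL; [apply/IHn/PX|apply/PX/IHn].
Qed.
End H1Relations.

(** A module over the Lie algebra, in terms of its basis. By the universal property of the
    enveloping algebra the brackets suffice for an action of [H1]; [word_act_ideal] is the
    factorization behind it. *)
Record h1_rep {K : fieldType} {V : lmodType K} (op : h1_gen -> V -> V) : Prop := H1Rep {
  rep_lin : forall g, linear (op g);
  rep_YX : forall v, op GenY (op GenX v) = op GenX (op GenY v) + op GenX v;
  rep_Xd : forall n v,
    op GenX (op (GenD n) v) = op (GenD n) (op GenX v) + op (GenD n.+1) v;
  rep_Yd : forall n v,
    op GenY (op (GenD n) v) = op (GenD n) (op GenY v) + n.+1%:R *: op (GenD n) v;
  rep_dd : forall n m v, op (GenD n) (op (GenD m) v) = op (GenD m) (op (GenD n) v) }.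

Section Representations.
Context {K : fieldType} {V : lmodType K} (op : h1_gen -> V -> V).

Lemma word_act_linl v : linear (fun x => word_act op x v).
Proof. by move=> k x y; rewrite /word_act linearP. Qed.

Lemma word_actU w v : word_act op << w >> v = foldr op v w.
Proof. by rewrite /word_act lextU. Qed.

Lemma word_act_lext (F : {fmonom h1_gen} -> V) v x :
  (forall w, F w = foldr op v w) -> lext F x = word_act op x v.
Proof.
move=> FE; elim/malg_ind: x => [|k w x IHx].
  by rewrite linear0 (lin0 (word_act_linl _)).
by rewrite linearP /= IHx word_act_linl word_actU lextU FE.
Qed.

Hypothesis opR : h1_rep op.

Lemma foldr_rep_lin (w : seq h1_gen) : linear (fun v => foldr op v w).
Proof. by elim: w => [|g w IHw] k u v //=; rewrite IHw (rep_lin opR). Qed.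

Lemma word_act_linr x : linear (word_act op x).
Proof.
move=> k u v; elim/malg_ind: x => [|c w x IHx].
  by rewrite !(lin0 (word_act_linl _)) scaler0 addr0.
rewrite !word_act_linl IHx !word_actU foldr_rep_lin.
by rewrite !scalerDr !scalerA (mulrC k) addrACA.
Qed.

Lemma word_actUM w y v :
  word_act op (<< w >> * y) v = word_act op << w >> (word_act op y v).
Proof.
elim/malg_ind: y => [|c w' y IHy].
  by rewrite mulr0 (lin0 (word_act_linl _)) (lin0 (word_act_linr _)).
rewrite mulrDr -malg_scaleAr !word_act_linl word_act_linr.
congr (_ *: _ + _); last exact: IHy.
by rewrite malg_mulUU !word_actU fmM foldr_cat.
Qed.

Lemma word_actM x y v : word_act op (x * y) v = word_act op x (word_act op y v).
Proof.
elim/malg_ind: x => [|c w x IHx].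
  by rewrite mul0r !(lin0 (word_act_linl _)).
rewrite mulrDl -scalerAl !word_act_linl.
by congr (_ *: _ + _); [exact: word_actUM|exact: IHx].
Qed.

Lemma word_act_gen g v : word_act op (free_gen g) v = op g v.
Proof. by rewrite word_actU fmU. Qed.

(** Products of words act by composition, so the elements acting by zero form a two-sided ideal, and
    the brackets in [opR] put the relators into it. *)
Lemma word_act_ideal x :
  x \in ideal_gen *%R (@h1_relators K) -> forall v, word_act op x v = 0.
Proof.
move=> /asboolP Ix; apply: (Ix [set x | forall v, word_act op x v = 0]); split.
  split; first split=> /= [v|k u v u0 v0 w]; first exact: (lin0 (word_act_linl v)).
    by rewrite word_act_linl u0 v0 scaler0 addr0.
  move=> a u /= u0; split=> v; rewrite word_actM u0 //.
  exact: (lin0 (word_act_linr _)).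
have lB v x1 x2 : word_act op (x1 - x2) v = word_act op x1 v - word_act op x2 v.
  exact: (linB (word_act_linl v)).
have lZ v k x1 : word_act op (k *: x1) v = k *: word_act op x1 v.
  exact: (linZ (word_act_linl v)).
have g2 g g' v : word_act op (free_gen g * free_gen g') v = op g (op g' v).
  by rewrite word_actM !word_act_gen.
have g3 g g' z v : word_act op (free_gen g * free_gen g' - free_gen g' * free_gen g - z) v
    = op g (op g' v) - op g' (op g v) - word_act op z v.
  by rewrite lB lB; congr (_ - _ - _); exact: g2.
move=> _ [[[->|[n ->]]|[n ->]]|[n [m ->]]] v.
- by rewrite g3 word_act_gen (rep_YX opR) addrAC addrK subrr.
- by rewrite g3 word_act_gen (rep_Xd opR) addrAC addrK subrr.
- by rewrite g3 lZ word_act_gen (rep_Yd opR) addrAC addrK subrr.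
- by rewrite -[X in word_act op X v]subr0 g3 (lin0 (word_act_linl v)) (rep_dd opR) subrr subr0.
Qed.

Lemma h1_act_class x v : h1_act op (h1_class x) v = word_act op x v.
Proof.
apply/eqP; rewrite -subr_eq0 /h1_act /qlift -(linB (word_act_linl v)).
by apply/eqP/word_act_ideal; exact: lquot_class_repr.
Qed.

Lemma h1_act_linl v : linear (fun h => h1_act op h v).
Proof.
move=> k; elim/h1W => x; elim/h1W => y.
by rewrite -linearP !h1_act_class word_act_linl.
Qed.

Lemma h1_act_linr h : linear (h1_act op h).
Proof. exact: word_act_linr. Qed.

Lemma h1_actM h h' v : h1_act op (h * h') v = h1_act op h (h1_act op h' v).
Proof.
elim/h1W: h => x; elim/h1W: h' => y.
by rewrite -rmorphM !h1_act_class word_actM.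
Qed.

Lemma h1_act1 v : h1_act op 1 v = v.
Proof.
by rewrite -(rmorph1 (@h1_class K)) h1_act_class word_actU fm1.
Qed.

Lemma h1_act_gen g v : h1_act op (h1_of K g) v = op g v.
Proof. by rewrite h1_act_class word_act_gen. Qed.

Lemma h1_actX v : h1_act op (hX K) v = op GenX v. Proof. exact: h1_act_gen. Qed.
Lemma h1_actY v : h1_act op (hY K) v = op GenY v. Proof. exact: h1_act_gen. Qed.
Lemma h1_actd n v : h1_act op (hdelta K n.+1) v = op (GenD n) v.
Proof. exact: h1_act_gen. Qed.
End Representations.

(** * The coproduct *)

Section Bracket.
Context {A : pzRingType}.
Implicit Types a b c : A.

Definition br a b := a * b - b * a.

Lemma brDl a b c : br (a + b) c = br a c + br b c.
Proof. by rewrite /br mulrDl mulrDr opprD addrACA. Qed.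
Lemma brDr a b c : br c (a + b) = br c a + br c b.
Proof. by rewrite /br mulrDl mulrDr opprD addrACA. Qed.
Lemma brP a b c : br a b = c -> a * b = b * a + c.
Proof. by move=> <-; rewrite addrC subrK. Qed.
Lemma br_comm a b : br a b = 0 -> a * b = b * a.
Proof. by move/brP; rewrite addr0. Qed.
Lemma br_mulr a b c : br a (b * c) = br a b * c + b * br a c.
Proof. by rewrite /br mulrBl mulrBr !mulrA addrA subrK. Qed.

Lemma mul_commP a b c v : a * b = b * a + c -> a * (b * v) = b * (a * v) + c * v.
Proof. by move=> E; rewrite !mulrA -mulrDl E. Qed.
Lemma mul_commMn a b c n v :
  a * b = b * a + c *+ n -> a * (b * v) = b * (a * v) + (c * v) *+ n.
Proof. by move=> /mul_commP E; rewrite E mulrnAl. Qed.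
Lemma mul_comm0 a b v : a * b = b * a -> a * (b * v) = b * (a * v).
Proof. by move=> E; rewrite !mulrA E. Qed.

Lemma br_jacobi a b c : br a (br b c) = br (br a b) c + br b (br a c).
Proof.
rewrite /br !mulrBl !mulrBr !mulrA !opprB; set p := a * b * c.
rewrite [RHS]addrACA subrKA [_ - _ + (_ - _)]addrACA subrKA.
rewrite [RHS]addrACA [in RHS](addrC (- _)) [RHS]addrACA.
by rewrite [LHS]addrACA.
Qed.
End Bracket.

Section CoproductRelations.
Context {A T : pzRingType} (p : A -> A -> T).
Hypotheses (pDl : forall c, {morph p^~ c : a b / a + b})
  (pDr : forall c, {morph p c : a b / a + b})
  (pM : forall a b c e, p a b * p c e = p (a * c) (b * e)).
Variables (X Y : A) (d : nat -> A).
Hypotheses (YX : br Y X = X) (Xd : forall n, br X (d n) = d n.+1)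
  (Yd : forall n, br Y (d n) = d n *+ n.+1) (dd : forall n m, br (d n) (d m) = 0).

Variables (cX cY : T) (cd : nat -> T).
Hypotheses (cXE : cX = p X 1 + p 1 X + p (d 0) Y) (cYE : cY = p Y 1 + p 1 Y)
  (cd0 : cd 0%N = p (d 0) 1 + p 1 (d 0)) (cdS : forall n, cd n.+1 = br cX (cd n)).

Let br1 (a : A) : br a 1 = 0. Proof. by rewrite /br mul1r mulr1 subrr. Qed.
Let brr (a : A) : br a a = 0. Proof. by rewrite /br subrr. Qed.
Let p0l a : p 0 a = 0.
Proof. by apply: (addrI (p 0 a)); rewrite -pDl !addr0. Qed.
Let p0r a : p a 0 = 0.
Proof. by apply: (addrI (p a 0)); rewrite -pDr !addr0. Qed.
Let pBl a b c : p (a - b) c = p a c - p b c.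
Proof. by apply/eqP; rewrite eq_sym subr_eq -pDl subrK. Qed.
Let pBr a b c : p c (a - b) = p c a - p c b.
Proof. by apply/eqP; rewrite eq_sym subr_eq -pDr subrK. Qed.

Let br_l a c e : br (p a 1) (p c e) = p (br a c) e.
Proof. by rewrite /br !pM mul1r mulr1 pBl. Qed.
Let br_r b c e : br (p 1 b) (p c e) = p c (br b e).
Proof. by rewrite /br !pM mul1r mulr1 pBr. Qed.

Lemma coprod_YX : br cY cX = cX.
Proof.
rewrite cYE cXE brDl !brDr !br_l !br_r YX Yd !br1 brr mulr1n.
by rewrite !p0l !p0r !add0r !addr0 addrAC.
Qed.

(** Jacobi turns [[Y, [X, c]]] into [[[Y, X], c] + [X, [Y, c]]]: every bracket with [cX] raises the
    weight by one. *)
Lemma coprod_Yd n : br cY (cd n) = cd n *+ n.+1.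
Proof.
elim: n => [|n IHn].
  by rewrite cd0 cYE brDl !brDr !br_l !br_r Yd !br1 !mulr1n p0l p0r addr0 add0r.
rewrite cdS br_jacobi coprod_YX IHn.
have -> : br cX (cd n *+ n.+1) = br cX (cd n) *+ n.+1.
  by elim: n.+1 => [|m IHm]; rewrite ?mulr0n ?mulrSr ?brDr ?IHm // /br mulr0 mul0r subrr.
by rewrite -mulrS.
Qed.

(** That the [cd n] commute is not formal, since [cX] contains [Y]. They are shown to stay among
    tensors of polynomials in the [d n], which commute with each other and are stable under the
    bracket with [cX]. *)
Inductive dpoly : A -> Prop :=
| dpoly0 : dpoly 0
| dpoly1 : dpoly 1
| dpolyM n a : dpoly a -> dpoly (d n * a)
| dpolyD a b : dpoly a -> dpoly b -> dpoly (a + b).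

Let dpoly_comm1 n a : dpoly a -> d n * a = a * d n.
Proof.
elim=> {a} [||m a _ IH|a b _ IHa _ IHb]; first by rewrite mulr0 mul0r.
- by rewrite mulr1 mul1r.
- by rewrite mulrA (br_comm (dd n m)) -mulrA IH mulrA.
- by rewrite mulrDr mulrDl IHa IHb.
Qed.

Let dpoly_comm a b : dpoly a -> dpoly b -> a * b = b * a.
Proof.
move=> Da Db; elim: Da => {a} [||m a _ IH|a a' _ IHa _ IHb].
- by rewrite mulr0 mul0r.
- by rewrite mulr1 mul1r.
- by rewrite -mulrA IH !mulrA dpoly_comm1.
- by rewrite mulrDr mulrDl IHa IHb.
Qed.

Let br0 (a : A) : br a 0 = 0. Proof. by rewrite /br mul0r mulr0 subrr. Qed.

Let dpoly_brX a : dpoly a -> dpoly (br X a).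
Proof.
elim=> {a} [||m a Da IH|a b _ IHa _ IHb]; rewrite ?br0 ?br1; try exact: dpoly0.
  by rewrite br_mulr Xd; apply: dpolyD; exact: dpolyM.
by rewrite brDr; exact: dpolyD.
Qed.

Let dpoly_brY a : dpoly a -> dpoly (br Y a).
Proof.
elim=> {a} [||m a Da IH|a b _ IHa _ IHb]; rewrite ?br0 ?br1; try exact: dpoly0.
  rewrite br_mulr Yd; apply: dpolyD; last exact: dpolyM.
  rewrite mulrnAl; elim: m.+1 => [|k IHk]; rewrite ?mulr0n ?mulrS; first exact: dpoly0.
  by apply: dpolyD => //; exact: dpolyM.
by rewrite brDr; exact: dpolyD.
Qed.

Inductive dtens : T -> Prop :=
| dtens0 : dtens 0
| dtensL a b t : dpoly a -> dpoly b -> dtens t -> dtens (p a b + t).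

Let dtensD s t : dtens s -> dtens t -> dtens (s + t).
Proof.
elim=> {s} [|a b s Da Db _ IH] Dt; first by rewrite add0r.
by rewrite -addrA; apply: dtensL => //; exact: IH.
Qed.
Let dtensU a b : dpoly a -> dpoly b -> dtens (p a b).
Proof. by move=> Da Db; rewrite -[p _ _]addr0; apply: dtensL => //; exact: dtens0. Qed.

Let dtens_brX s : dtens s -> dtens (br cX s).
Proof.
elim=> {s} [|a b s Da Db _ IH]; first by rewrite /br mul0r mulr0 subrr; exact: dtens0.
rewrite brDr; apply: dtensD IH.
rewrite cXE 2!brDl br_l br_r; apply: dtensD; first apply: dtensD.
- by apply: dtensU => //; exact: dpoly_brX.
- by apply: dtensU => //; exact: dpoly_brX.
(* As [a] commutes with [d 0], the bracket of [d 0 ⊗ Y] with [a ⊗ b] is [d 0 a ⊗ [Y, b]], and no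
   bare [Y] is left. *)
rewrite /br !pM -(dpoly_comm1 0 Da) -pBr.
by apply: dtensU; [exact: dpolyM|exact: dpoly_brY].
Qed.

Let dtens_comm s t : dtens s -> dtens t -> s * t = t * s.
Proof.
move=> Ds Dt; elim: Ds => {s} [|a b s Da Db _ IH]; first by rewrite mul0r mulr0.
rewrite mulrDl mulrDr IH; congr (_ + _).
elim: Dt {IH} => {t} [|a' b' t Da' Db' _ IH]; first by rewrite mul0r mulr0.
by rewrite mulrDl mulrDr IH !pM (dpoly_comm Da Da') (dpoly_comm Db Db').
Qed.

Lemma coprod_dd n m : cd n * cd m = cd m * cd n.
Proof.
have dcd k : dtens (cd k).
  elim: k => [|k IHk]; last by rewrite cdS; exact: dtens_brX.
  have D0 : dpoly (d 0) by rewrite -[d 0]mulr1; apply: dpolyM; exact: dpoly1.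
  by rewrite cd0; apply: dtensD; apply: dtensU => //; exact: dpoly1.
exact: dtens_comm.
Qed.
End CoproductRelations.

Section TensorMul.
Context {K : comNzRingType} {A B : algType K}.
Local Notation T := (tens A B).

Lemma tens_mulPr (s : T) : linear (fun t : T => s * t : T).
Proof. exact: (tensor_mulPr tens_linl tens_linr tens_ind tliftE tlift_linear). Qed.
End TensorMul.

Section CoproductTheory.
Variable K : fieldType.
Local Notation H1 := (H1 K).

Let coprod_op (g : h1_gen) (t : tens H1 H1) : tens H1 H1 := coprod_gen K g * t.

(** Makes [H1 ⊗ H1] a module in which a generator acts as left multiplication by its coproduct. The
    coproduct is then the orbit map of [1], so that its descent to [H1] and the formulas for
    [coprod (g * h)] come from the general facts on representations. *)
Lemma coprod_rep : h1_rep coprod_op.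
Proof.
have brq (a b c : H1) : a * b = b * a + c -> br a b = c.
  by rewrite /br => ->; rewrite addrAC subrr add0r.
have YX := brq _ _ _ (h1_YX K).
have Xd n := brq _ _ _ (h1_Xd K n).
have Yd n : br (hY K) (hdelta K n.+1) = hdelta K n.+1 *+ n.+1.
  by apply: brq; rewrite -scaler_nat; exact: h1_Yd.
have dd n m : br (hdelta K n.+1) (hdelta K m.+1) = 0.
  by apply: brq; rewrite addr0; exact: h1_dd.
pose p (a b : H1) : tens H1 H1 := a ⊗ b.
have pDl c : {morph p^~ c : a b / a + b} by exact: (linD (tens_linl c)).
have pDr c : {morph p c : a b / a + b} by exact: (linD (tens_linr c)).
have pM a b c e : p a b * p c e = p (a * c) (b * e) by exact: tens_mulE.
have cXE : coprod_gen K GenX = p (hX K) 1 + p 1 (hX K) + p (hdelta K 1) (hY K).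
  reflexivity.
have cYE : coprod_gen K GenY = p (hY K) 1 + p 1 (hY K).
  reflexivity.
have cd0 : coprod_gen K (GenD 0) = p (hdelta K 1) 1 + p 1 (hdelta K 1).
  reflexivity.
have cdS n : coprod_gen K (GenD n.+1) = br (coprod_gen K GenX) (coprod_gen K (GenD n)).
  reflexivity.
split=> [g|v|n v|n v|n m v]; first exact: tens_mulPr.
- exact: (mul_commP v (brP (coprod_YX pDl pDr pM YX Yd cXE cYE))).
- exact: (mul_commP v (brP (esym (cdS n)))).
- rewrite scaler_nat.
  exact: (mul_commMn v (brP (coprod_Yd pDl pDr pM YX Yd cXE cYE cd0 cdS n))).
- exact: (mul_comm0 v (coprod_dd pDl pDr pM Xd Yd dd cXE cd0 cdS n m)).
Qed.

Lemma coprodE h : coprod h = h1_act coprod_op h 1.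
Proof.
apply: word_act_lext => w.
by elim: (w : seq _) => [|g s IHs]; rewrite ?big_nil // big_cons IHs.
Qed.

Lemma coprod_linear : linear (@coprod K).
Proof. by move=> k x y; rewrite !coprodE (h1_act_linl coprod_rep). Qed.

Lemma coprod1 : coprod 1 = 1 :> tens H1 H1.
Proof. by rewrite coprodE (h1_act1 coprod_rep). Qed.

Lemma coprodM_X h : coprod (hX K * h) = coprodX K * coprod h.
Proof. by rewrite !coprodE (h1_actM coprod_rep) (h1_actX coprod_rep). Qed.

Lemma coprodM_Y h : coprod (hY K * h) = coprodY K * coprod h.
Proof. by rewrite !coprodE (h1_actM coprod_rep) (h1_actY coprod_rep). Qed.

Lemma coprodM_d h : coprod (hdelta K 1 * h) = coprod_delta1 K * coprod h.
Proof. by rewrite !coprodE (h1_actM coprod_rep) (h1_actd coprod_rep). Qed.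
End CoproductTheory.

Record trilin {K : comNzRingType} {U V W T : lmodType K} (f : U -> V -> W -> T) : Prop :=
  Trilin {
    trilin1 : forall v w, linear (fun u => f u v w);
    trilin2 : forall u w, linear (fun v => f u v w);
    trilin3 : forall u v, linear (f u v) }.

Lemma tens_ext (K : comNzRingType) (U V T : lmodType K) (L1 L2 : tens U V -> T) :
  linear L1 -> linear L2 -> (forall u v, L1 (u ⊗ v) = L2 (u ⊗ v)) -> L1 =1 L2.
Proof.
move=> L1L L2L E; apply: (@tens_ind K) => [|k u v t IH].
  by rewrite (lin0 L1L) (lin0 L2L).
by rewrite L1L L2L E IH.
Qed.

Section TripleTensors.
Context {K : fieldType} {U V W T : lmodType K}.
Implicit Types f g : U -> V -> W -> T.

Lemma tens3_ind (P : tens (tens U V) W -> Prop) :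
  P 0 -> (forall k u v w t, P t -> P (k *: (u ⊗ v ⊗ w) + t)) -> forall t, P t.
Proof.
move=> P0 PD; apply: (@tens_ind K) => // k t w x Px.
elim/(@tens_ind K): t k x Px => [|k' u v t IHt] k x Px.
  by rewrite (lin0 (tens_linl w)) scaler0 add0r.
by rewrite tens_linl scalerDr scalerA -addrA; apply: PD; exact: IHt.
Qed.

Lemma trilin_bilin2 f : trilin f -> forall w, bilin (fun u v => f u v w).
Proof. by move=> fT w; split=> [v|u]; [exact: (trilin1 fT)|exact: (trilin2 fT)]. Qed.

Lemma trilin_bilin f : trilin f ->
  bilin (fun (t : tens U V) w => tlift (fun u v => f u v w) t).
Proof.
move=> fT; split=> [w|t] k; first exact: tlift_linear (trilin_bilin2 fT w) k.
move=> w w'; have L x := tlift_linear (trilin_bilin2 fT x).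
elim/(@tens_ind K): t => [|k' u v t IHt]; first by rewrite !(lin0 (L _)) scaler0 addr0.
rewrite !L !(tliftE (trilin_bilin2 fT _)) IHt (trilin3 fT).
by rewrite !scalerDr !scalerA (mulrC k) addrACA.
Qed.

Lemma tlift3E f : trilin f -> forall u v w, tlift3 f (u ⊗ v ⊗ w) = f u v w.
Proof.
move=> fT u v w.
by rewrite /tlift3 (tliftE (trilin_bilin fT)) (tliftE (trilin_bilin2 fT w)).
Qed.

Lemma tlift3_linear f : trilin f -> linear (tlift3 f).
Proof. by move=> fT; exact: (tlift_linear (trilin_bilin fT)). Qed.

Lemma tlift3Dl f (s t : tens U V) w : trilin f ->
  tlift3 f ((s + t) ⊗ w) = tlift3 f (s ⊗ w) + tlift3 f (t ⊗ w).
Proof. by move=> fT; rewrite (linD (tens_linl w)) (linD (tlift3_linear fT)). Qed.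

Lemma tens3_ext (L1 L2 : tens (tens U V) W -> T) : linear L1 -> linear L2 ->
  (forall u v w, L1 (u ⊗ v ⊗ w) = L2 (u ⊗ v ⊗ w)) -> L1 =1 L2.
Proof.
move=> L1L L2L E; elim/(@tens3_ind) => [|k u v w t IH]; first by rewrite (lin0 L1L) (lin0 L2L).
by rewrite L1L L2L E IH.
Qed.

Lemma trilinD f g : trilin f -> trilin g -> trilin (fun u v w => f u v w + g u v w).
Proof.
by move=> fT gT; split=> [v w|u w|u v] k a b;
  rewrite ?(trilin1 fT) ?(trilin2 fT) ?(trilin3 fT) ?(trilin1 gT) ?(trilin2 gT)
    ?(trilin3 gT) scalerDr addrACA.
Qed.

Lemma trilinZ k f : trilin f -> trilin (fun u v w => k *: f u v w).
Proof.
by move=> fT; split=> [v w|u w|u v] c a b;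
  rewrite ?(trilin1 fT) ?(trilin2 fT) ?(trilin3 fT) scalerDr !scalerA (mulrC k).
Qed.

Lemma tlift3_lcomb f g k x : trilin f -> trilin g ->
  tlift3 (fun u v w => k *: f u v w + g u v w) x = k *: tlift3 f x + tlift3 g x.
Proof.
move=> fT gT; have fgT := trilinD (trilinZ k fT) gT.
elim/(@tens3_ind): x => [|c u v w t IHt].
  rewrite (lin0 (tlift3_linear fgT)) (lin0 (tlift3_linear fT)).
  by rewrite (lin0 (tlift3_linear gT)) scaler0 addr0.
rewrite !tlift3_linear // !tlift3E // IHt !scalerDr !scalerA (mulrC k).
by rewrite addrACA.
Qed.
End TripleTensors.

Section TrilinearComp.
Context {K : fieldType} {U V W T : lmodType K} (F : U -> V -> W -> T).
Hypothesis FT : trilin F.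

Lemma trilin_comp (U' V' W' : lmodType K) (a : U' -> U) (b : V' -> V) (c : W' -> W) :
  linear a -> linear b -> linear c -> trilin (fun u v w => F (a u) (b v) (c w)).
Proof.
move=> aL bL cL; split=> [v w|u w|u v] k x y.
- by rewrite aL (trilin1 FT).
- by rewrite bL (trilin2 FT).
- by rewrite cL (trilin3 FT).
Qed.

Lemma trilin_post (S : lmodType K) (g : T -> S) :
  linear g -> trilin (fun u v w => g (F u v w)).
Proof.
move=> gL; split=> [v w|u w|u v] k x y.
- by rewrite (trilin1 FT) gL.
- by rewrite (trilin2 FT) gL.
- by rewrite (trilin3 FT) gL.
Qed.
End TrilinearComp.

Section IteratedCoproduct.
Context {K : fieldType} {H T : lmodType K} (cop : H -> tens H H).
Hypothesis copL : linear cop.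

Definition cop3 h := tlift (fun h1 h2 : H => cop h1 ⊗ h2) (cop h).

Lemma cop_bilin : bilin (fun h1 h2 : H => cop h1 ⊗ h2).
Proof. by split=> [b|a] k u v; rewrite ?copL ?tens_linl ?tens_linr. Qed.

Lemma cop3_linear : linear cop3.
Proof. by move=> k u v; rewrite /cop3 copL (tlift_linear cop_bilin). Qed.

Variables (lX lY ld : H -> H) (op opd : tens H H -> tens H H).
Hypotheses (XL : linear lX) (YL : linear lY) (dL : linear ld)
  (opL : linear op) (opdL : linear opd)
  (copX : forall h, cop (lX h) = op (cop h)) (copd : forall h, cop (ld h) = opd (cop h))
  (opE : forall a b, op (a ⊗ b) = lX a ⊗ b + a ⊗ lX b + ld a ⊗ lY b)
  (opdE : forall a b, opd (a ⊗ b) = ld a ⊗ b + a ⊗ ld b).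

(** Left multiplication by the iterated coproduct of [X], read on trilinear maps. The terms are
    those of [(Δ ⊗ 1) Δ X]: first [Δ X ⊗ 1], then [1 ⊗ 1 ⊗ X], then [Δ δ_1 ⊗ Y]. *)
Definition tri_op (F : H -> H -> H -> T) : H -> H -> H -> T := fun a b c =>
  F (lX a) b c + F a (lX b) c + F (ld a) (lY b) c + F a b (lX c)
    + (F (ld a) b (lY c) + F a (ld b) (lY c)).

Lemma tri_op_trilin F : trilin F -> trilin (tri_op F).
Proof.
have idL : linear (@idfun H) by [].
move=> FT; have C := trilin_comp FT.
apply: trilinD; first apply: trilinD; first apply: trilinD; first apply: trilinD.
- exact: (C H H H _ _ _ XL idL idL).
- exact: (C H H H _ _ _ idL XL idL).
- exact: (C H H H _ _ _ dL YL idL).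
- exact: (C H H H _ _ _ idL idL XL).
apply: trilinD.
- exact: (C H H H _ _ _ dL idL YL).
- exact: (C H H H _ _ _ idL dL YL).
Qed.

Lemma cop3_op F h : trilin F ->
  tlift3 F (cop3 (lX h)) = tlift3 (tri_op F) (cop3 h).
Proof.
move=> FT; have GT := tri_op_trilin FT.
have cL := tlift_linear cop_bilin; have FL := tlift3_linear FT.
rewrite /cop3 copX; move: (cop h); apply: tens_ext => [||a b].
- exact: (linear_comp FL (linear_comp cL opL)).
- exact: (linear_comp (tlift3_linear GT) cL).
rewrite opE !(linD cL) !(tliftE cop_bilin) copX copd !(linD FL).
move: (cop a); apply: tens_ext => [||x y].
- apply: linear_add; first apply: linear_add.
  + exact: (linear_comp FL (linear_comp (tens_linl _) opL)).
  + exact: (linear_comp FL (tens_linl _)).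
  + exact: (linear_comp FL (linear_comp (tens_linl _) opdL)).
- exact: (linear_comp (tlift3_linear GT) (tens_linl _)).
have E1 : tlift3 F (op (x ⊗ y) ⊗ b) = F (lX x) y b + F x (lX y) b + F (ld x) (lY y) b.
  rewrite opE; apply: etrans (tlift3Dl _ _ _ FT) _; congr (_ + _); last exact: tlift3E.
  by apply: etrans (tlift3Dl _ _ _ FT) _; congr (_ + _); exact: tlift3E.
have E2 : tlift3 F (opd (x ⊗ y) ⊗ lY b) = F (ld x) y (lY b) + F x (ld y) (lY b).
  by rewrite opdE; apply: etrans (tlift3Dl _ _ _ FT) _; congr (_ + _); exact: tlift3E.
apply: etrans (congr2 +%R (congr2 +%R E1 (tlift3E FT x y (lX b))) E2) _.
by apply: etrans (esym (tlift3E GT x y b)).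
Qed.
End IteratedCoproduct.

Section PrimitiveCoproduct.
Context {K : fieldType} {H T : lmodType K} (cop : H -> tens H H).
Hypothesis copL : linear cop.
Variables (l : H -> H) (op : tens H H -> tens H H).
Hypotheses (lL : linear l) (opL : linear op) (copl : forall h, cop (l h) = op (cop h))
  (opE : forall a b, op (a ⊗ b) = l a ⊗ b + a ⊗ l b).

(** The analogue for a primitive element; it is [tri_op] with both twisting maps zero. *)
Definition tri_prim (F : H -> H -> H -> T) : H -> H -> H -> T := fun a b c =>
  F (l a) b c + F a (l b) c + F a b (l c).

Let zeroL (U : lmodType K) : linear (fun _ : U => 0 : U).
Proof. by move=> k u v; rewrite scaler0 addr0. Qed.

Let tri_primE F : trilin F -> tri_prim F = tri_op l (fun _ => 0) (fun _ => 0) F.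
Proof.
move=> FT; apply/funext => a; apply/funext => b; apply/funext => c.
rewrite /tri_prim /tri_op (lin0 (trilin1 FT _ _)) (lin0 (trilin1 FT _ _)).
by rewrite (lin0 (trilin2 FT _ _)) !addr0.
Qed.

Lemma tri_prim_trilin F : trilin F -> trilin (tri_prim F).
Proof. by move=> FT; rewrite (tri_primE FT); exact: tri_op_trilin. Qed.

Lemma cop3_prim F h : trilin F ->
  tlift3 F (cop3 cop (l h)) = tlift3 (tri_prim F) (cop3 cop h).
Proof.
move=> FT; rewrite (tri_primE FT).
have cop0 h' : cop 0 = (fun _ => 0 : tens H H) (cop h') by exact: (lin0 copL).
apply: (@cop3_op K H T cop copL l (fun _ => 0) (fun _ => 0) op (fun _ => 0) lL
  (@zeroL H) (@zeroL H) opL (@zeroL (tens H H)) copl cop0) FT.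
  by move=> a b; rewrite opE (lin0 (tens_linl _)) addr0.
by move=> a b; rewrite (lin0 (tens_linl _)) (lin0 (tens_linr _)) addr0.
Qed.
End PrimitiveCoproduct.

Section AbstractCoproductMul.
Context {A T : pzRingType} (p : A -> A -> T).
Hypothesis pM : forall a b c e, p a b * p c e = p (a * c) (b * e).

Lemma primitive_mul d a b : (p d 1 + p 1 d) * p a b = p (d * a) b + p a (d * b).
Proof. by rewrite mulrDl !pM !mul1r. Qed.

Lemma twisted_mul x d y a b : (p x 1 + p 1 x + p d y) * p a b =
  p (x * a) b + p a (x * b) + p (d * a) (y * b).
Proof. by rewrite mulrDl primitive_mul pM. Qed.
End AbstractCoproductMul.

Section Coproduct3.
Context {K : fieldType} {T : lmodType K}.
Local Notation H1 := (H1 K).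
Local Notation X := (hX K).
Local Notation Y := (hY K).
Local Notation d1 := (hdelta K 1).
Implicit Types F : H1 -> H1 -> H1 -> T.

Lemma h1_mul_linr (a : H1) : linear (fun h : H1 => a * h).
Proof. by move=> k x y; rewrite mulrDr scalerAr. Qed.

Let pM (a b c e : H1) : (a ⊗ b) * (c ⊗ e) = (a * c) ⊗ (b * e). Proof. exact: tens_mulE. Qed.
Let YE (a b : H1) : coprodY K * (a ⊗ b) = (Y * a) ⊗ b + a ⊗ (Y * b).
Proof. exact: (primitive_mul pM). Qed.
Let dE (a b : H1) : coprod_delta1 K * (a ⊗ b) = (d1 * a) ⊗ b + a ⊗ (d1 * b).
Proof. exact: (primitive_mul pM). Qed.
Let XE (a b : H1) : coprodX K * (a ⊗ b) =
  (X * a) ⊗ b + a ⊗ (X * b) + (d1 * a) ⊗ (Y * b).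
Proof. exact: (twisted_mul pM). Qed.

Definition triX F : H1 -> H1 -> H1 -> T := tri_op ( *%R X) ( *%R Y) ( *%R d1) F.
Definition triY F : H1 -> H1 -> H1 -> T := tri_prim ( *%R Y) F.
Definition trid F : H1 -> H1 -> H1 -> T := tri_prim ( *%R d1) F.

Lemma coprod3_linear : linear (@coprod3 K).
Proof. exact: (cop3_linear (@coprod_linear K)). Qed.

Lemma coprod3_X F h : trilin F ->
  tlift3 F (coprod3 (X * h)) = tlift3 (triX F) (coprod3 h).
Proof.
exact: (cop3_op (@coprod_linear K) (h1_mul_linr X) (h1_mul_linr Y) (h1_mul_linr d1)
  (tens_mulPr _) (tens_mulPr _) (@coprodM_X K) (@coprodM_d K) XE dE).
Qed.

Lemma triX_trilin F : trilin F -> trilin (triX F).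
Proof. exact: (tri_op_trilin (h1_mul_linr X) (h1_mul_linr Y) (h1_mul_linr d1)). Qed.

Lemma triY_trilin F : trilin F -> trilin (triY F).
Proof. exact: (tri_prim_trilin (h1_mul_linr Y)). Qed.

Lemma trid_trilin F : trilin F -> trilin (trid F).
Proof. exact: (tri_prim_trilin (h1_mul_linr d1)). Qed.

Lemma coprod3_Y F h : trilin F ->
  tlift3 F (coprod3 (Y * h)) = tlift3 (triY F) (coprod3 h).
Proof.
exact: (cop3_prim (@coprod_linear K) (h1_mul_linr Y) (tens_mulPr _) (@coprodM_Y K) YE).
Qed.

Lemma coprod3_d F h : trilin F ->
  tlift3 F (coprod3 (d1 * h)) = tlift3 (trid F) (coprod3 h).
Proof.
exact: (cop3_prim (@coprod_linear K) (h1_mul_linr d1) (tens_mulPr _) (@coprodM_d K) dE).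
Qed.

Lemma coprod3_1 F : trilin F -> tlift3 F (coprod3 1) = F 1 1 1.
Proof.
move=> FT; have c1 : coprod 1 = (1 : H1) ⊗ (1 : H1) := coprod1 K.
rewrite /coprod3 c1 (tliftE (cop_bilin (@coprod_linear K))) c1.
exact: tlift3E.
Qed.
End Coproduct3.

(** * The module algebra P *)

Lemma cmonomP (m m' : {cmonom nat}) : (forall i, m i = m' i) -> m = m'.
Proof. by move=> E; apply/eqP/cmP. Qed.

Lemma mul_ucm_div (m : {cmonom nat}) i : m i != 0%N ->
  mmul (ucm i) (divcm m (ucm i)) = m.
Proof.
move=> mi; apply: cmonomP => k; rewrite cmM divcmE !ucmE.
by have [<-|_] := eqVneq i k; rewrite ?add0n ?subn0 // add1n subn1 prednK // lt0n.
Qed.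

Lemma cmonom_ind (Q : {cmonom nat} -> Prop) :
  Q mone -> (forall j m, Q m -> Q (mmul (ucm j) m)) -> forall m, Q m.
Proof.
move=> Q1 QM m; move: {2}(mdeg m) (erefl (mdeg m)) => n.
elim: n m => [|n IHn] m dm; first by rewrite (mdeg_eq0I dm).
have [s0|[i si]] := fset_0Vmem (finsupp m).
  by move: dm; rewrite mdegE s0 big_seq_fset0.
have mi : m i != 0%N by rewrite cmE_neq0.
rewrite -(mul_ucm_div mi); apply/QM/IHn.
by apply: succn_inj; rewrite -dm -{2}(mul_ucm_div mi) mdegM mdegU.
Qed.

Section AbstractDerivation.
Context {K : comNzRingType} {A : comAlgType K} (U : {cmonom nat} -> A).
Hypothesis UM : forall m m', U (mmul m m') = U m * U m'.
Variable d : nat -> A.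

Definition mono_der (m : {cmonom nat}) : A :=
  \sum_(i <- finsupp m) (m i)%:R *: (U (divcm m (ucm i)) * d i).

Let derW (D : {fset nat}) (m : {cmonom nat}) : (finsupp m `<=` D)%fset ->
  mono_der m = \sum_(i <- D) (m i)%:R *: (U (divcm m (ucm i)) * d i).
Proof.
move=> sD; rewrite /mono_der (big_fset_incl _ sD) //= => i _.
by rewrite -cmE_eq0 => /eqP ->; rewrite scale0r.
Qed.

Lemma mono_derM j (m : {cmonom nat}) :
  mono_der (mmul (ucm j) m) = d j * U m + U (ucm j) * mono_der m.
Proof.
pose D := (j |` finsupp m)%fset; pose M := mmul (ucm j) m.
have sM : (finsupp M `<=` D)%fset by rewrite mdomD mdomU.
have sm : (finsupp m `<=` D)%fset by apply/fsubsetP => i; rewrite !inE => ->; rewrite orbT.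
rewrite (derW sM) (derW sm).
have -> : d j * U m = \sum_(i <- D) (i == j)%:R *: (d j * U m).
  rewrite (big_fsetD1 j) ?fset1U1 //= eqxx scale1r big1_fset ?addr0 // => i.
  by rewrite !inE => /andP[/negPf -> _] _; rewrite scale0r.
rewrite mulr_sumr -big_split /=; apply: eq_bigr => i _.
have -> : M i = ((i == j) + m i)%N by rewrite cmM ucmE eq_sym.
rewrite natrD scalerDl; congr (_ + _).
  have [->|_] := eqVneq i j; last by rewrite !scale0r.
  have -> : divcm M (ucm j) = m by apply: cmonomP => k; rewrite divcmE cmM ucmE addKn.
  by rewrite mulrC.
have [->|mi] := eqVneq (m i) 0%N; first by rewrite !scale0r mulr0.
rewrite -scalerAr mulrA -UM; congr (_ *: (U _ * _)).
apply: cmonomP => k; rewrite cmM !divcmE cmM addnBA // !ucmE.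
by have [<-|//] := eqVneq i k; rewrite lt0n.
Qed.

Lemma mono_der1 : mono_der mone = 0.
Proof. by rewrite /mono_der mdom1 big_seq_fset0. Qed.
End AbstractDerivation.

Section Derivations.
Variable K : fieldType.
Local Notation P := (polyP K).
Local Notation Z := (polyZ K).

Lemma polyP_ind (Q : P -> Prop) : Q 0 -> Q 1 ->
  (forall k a b, Q a -> Q b -> Q (k *: a + b)) ->
  (forall j p, Q p -> Q (Z j * p)) -> forall p, Q p.
Proof.
move=> Q0 Q1 QL QM; apply: malg_ind => [|k m x Qx]; first exact: Q0.
apply: QL Qx; elim/cmonom_ind: m => [|j m Qm]; first exact: Q1.
by rewrite -malg_mulUU; exact: QM.
Qed.

Variable d : nat -> P.
Local Notation der := (derivation d).

Lemma derivation_linear : linear der.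
Proof. by move=> k u v; rewrite /derivation linearP. Qed.

Let monoU (m : {cmonom nat}) : P := << m >>.
Let monoUM m m' : monoU (mmul m m') = monoU m * monoU m'.
Proof. exact: esym (malg_mulUU _ _ _). Qed.

Let derU m : der << m >> = mono_der monoU d m.
Proof. exact: lextU. Qed.

Let derM_U j (m : {cmonom nat}) :
  der (Z j * (<< m >> : P)) = d j * (<< m >> : P) + Z j * der << m >>.
Proof.
apply: etrans (congr1 der (esym (monoUM _ _))) _.
apply: etrans (derU _) _; apply: etrans (mono_derM monoUM _ _ _) _.
by congr (_ + _ * _); exact: esym (derU _).
Qed.

Lemma derivationM_Z j p : der (Z j * p) = d j * p + Z j * der p.
Proof.
have L1 : linear (fun p => der (Z j * p)).
  by apply: linear_comp derivation_linear _ => k u v; rewrite mulrDr scalerAr.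
have L2 : linear (fun p => d j * p + Z j * der p).
  apply: linear_add; first by move=> k u v; rewrite mulrDr scalerAr.
  by apply: linear_comp derivation_linear => k u v; rewrite mulrDr scalerAr.
elim/malg_ind: p => [|k m x IHx]; first exact: etrans (lin0 L1) (esym (lin0 L2)).
apply: etrans (L1 _ _ _) _; apply: etrans _ (esym (L2 _ _ _)).
exact: (congr2 (fun a b => k *: a + b) (derM_U j m) IHx).
Qed.

Lemma derivation1 : der 1 = 0.
Proof.
exact: etrans (derU _) (mono_der1 _ _).
Qed.
End Derivations.

Section WeightArithmetic.
Context {K : comNzRingType} {A : comAlgType K} (X Y : A -> A).
Hypotheses (XL : linear X) (YL : linear Y).

(** The weight of [z'] exceeds that of [z] by one; this surplus supplies the summand [z' * p] of the
    extra term [X (z * p)]. *)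
Lemma weight_commutator (z z' p : A) j :
  (forall q, X (z * q) = z' * q + z * X q) ->
  (forall q, Y (z * q) = (j + 2)%:R *: z * q + z * Y q) ->
  (forall q, Y (z' * q) = (j.+1 + 2)%:R *: z' * q + z' * Y q) ->
  Y (X p) = X (Y p) + X p -> Y (X (z * p)) = X (Y (z * p)) + X (z * p).
Proof.
move=> Xz Yz Yz' E.
rewrite Xz (linD YL) Yz Yz' Yz E (linD XL) -!scalerAl (linZ XL) !Xz.
rewrite !scaler_nat addSn !mulrSr -!mulrnAl; ring.
Qed.
End WeightArithmetic.

Section PolyModule.
Variable K : fieldType.
Local Notation P := (polyP K).
Local Notation Z := (polyZ K).
Local Notation op := (@polyP_op K).

Lemma polyP_op_linear g : linear (op g).
Proof.
case: g => [||n]; try exact: derivation_linear.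
by move=> k u v; rewrite /= scaler0 addr0.
Qed.

Lemma polyP_ext (T : lmodType K) (L1 L2 : P -> T) : linear L1 -> linear L2 ->
  L1 1 = L2 1 -> (forall j p, L1 p = L2 p -> L1 (Z j * p) = L2 (Z j * p)) -> L1 =1 L2.
Proof.
move=> L1L L2L E1 EZ; apply: polyP_ind => [||k a b Ea Eb|j p E].
- exact: etrans (lin0 L1L) (esym (lin0 L2L)).
- exact: E1.
- exact: etrans (L1L _ _ _) (etrans (congr2 (fun u v => k *: u + v) Ea Eb) (esym (L2L _ _ _))).
- exact: EZ.
Qed.

Lemma polyP_rep : h1_rep op.
Proof.
have XL := polyP_op_linear GenX; have YL := polyP_op_linear GenY.
have X1 : op GenX 1 = 0 by exact: derivation1.
have Y1 : op GenY 1 = 0 by exact: derivation1.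
have XZ j p : op GenX (Z j * p) = Z j.+1 * p + Z j * op GenX p by exact: derivationM_Z.
have YZ j p : op GenY (Z j * p) = (j + 2)%:R *: Z j * p + Z j * op GenY p.
  exact: derivationM_Z.
split=> [|p|n p|n p|n m p]; first exact: polyP_op_linear.
- move: p; apply: polyP_ext => [|||j p E].
  + exact: (linear_comp YL XL).
  + exact: (linear_add (linear_comp XL YL) XL).
  + by rewrite X1 Y1 (lin0 XL) (lin0 YL) addr0.
  + exact: (weight_commutator XL YL (XZ j) (YZ j) (YZ j.+1) E).
- by rewrite (lin0 XL) addr0.
- by rewrite (lin0 YL) scaler0 addr0.
- by [].
Qed.
End PolyModule.

(** * Spanning families *)

Inductive lin_span {K : pzRingType} {V : lmodType K} (S : V -> Prop) : V -> Prop :=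
| lin_span0 : lin_span S 0
| lin_spanL k s v : S s -> lin_span S v -> lin_span S (k *: s + v).

Section LinSpan.
Context {K : pzRingType} {V : lmodType K} (S : V -> Prop).

Lemma lin_spanD u v : lin_span S u -> lin_span S v -> lin_span S (u + v).
Proof.
elim=> {u} [|k s u Ss _ IH] Sv; first by rewrite add0r.
by rewrite -addrA; apply: lin_spanL => //; exact: IH.
Qed.

Lemma lin_spanZ k u : lin_span S u -> lin_span S (k *: u).
Proof.
elim=> {u} [|k' s u Ss _ IH]; first by rewrite scaler0; exact: lin_span0.
by rewrite scalerDr scalerA; exact: lin_spanL.
Qed.

Lemma lin_spanB u v : lin_span S u -> lin_span S v -> lin_span S (u - v).
Proof.
by move=> Su Sv; rewrite -scaleN1r; apply: lin_spanD => //; exact: lin_spanZ.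
Qed.

Lemma lin_span_gen s : S s -> lin_span S s.
Proof.
by move=> Ss; rewrite -[s]addr0 -[s]scale1r; apply: lin_spanL => //; exact: lin_span0.
Qed.

End LinSpan.

Lemma lin_span_map (K : pzRingType) (V W : lmodType K) (f : V -> W)
  (S : V -> Prop) (S' : W -> Prop) : linear f ->
  (forall s, S s -> lin_span S' (f s)) -> forall v, lin_span S v -> lin_span S' (f v).
Proof.
move=> fL fS v; elim=> {v} [|k s v Ss _ IH]; first by rewrite (lin0 fL); exact: lin_span0.
by rewrite fL; exact: (lin_spanD (lin_spanZ k (fS s Ss)) IH).
Qed.

Section NormalOrdering.
Context {A : pzRingType} (X Y d d2 : A).
Hypotheses (YX : Y * X = X * Y + X) (Xd : X * d = d * X + d2) (Yd : Y * d = d * Y + d)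
  (dd2 : d * d2 = d2 * d).

Definition pbw c a b := d ^+ c * X ^+ a * Y ^+ b.

(** Since [d] and [d2] commute, all [c] commutators agree. The factor [d2] is collected in front
    because the defining relation of the quotient is available there; at [c = 0] the truncated
    [c.-1] comes with multiplicity 0. *)
Lemma X_exp_d c : X * d ^+ c = d ^+ c * X + (d2 * d ^+ c.-1) *+ c.
Proof.
elim: c => [|c IHc]; first by rewrite !expr0 mulr1 mul1r mulr0n addr0.
rewrite exprSr mulrA IHc mulrDl -mulrA Xd mulrDr mulrA -addrA; congr (_ + _).
have dd2c : d ^+ c * d2 = d2 * d ^+ c by apply/commr_sym/commrX/commr_sym.
rewrite dd2c mulrS; congr (_ + _).
case: c {IHc dd2c} => [|c]; first by rewrite !mulr0n mul0r.
by rewrite mulrnAl -mulrA -exprSr.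
Qed.

Lemma Y_exp_d c : Y * d ^+ c = d ^+ c * Y + (d ^+ c) *+ c.
Proof.
elim: c => [|c IHc]; first by rewrite !expr0 mulr1 mul1r mulr0n addr0.
by rewrite exprSr mulrA IHc mulrDl -mulrA Yd mulrDr mulrnAl mulrA -exprSr -addrA -mulrS.
Qed.

Lemma Y_exp_X a : Y * X ^+ a = X ^+ a * Y + (X ^+ a) *+ a.
Proof.
elim: a => [|a IHa]; first by rewrite !expr0 mulr1 mul1r mulr0n addr0.
by rewrite exprSr mulrA IHa mulrDl -mulrA YX mulrDr mulrnAl mulrA -exprSr -addrA -mulrS.
Qed.

Lemma pbw_d c a b : d * pbw c a b = pbw c.+1 a b.
Proof. by rewrite /pbw exprS !mulrA. Qed.

Lemma pbw_X c a b : X * pbw c a b = pbw c a.+1 b + (d2 * pbw c.-1 a b) *+ c.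
Proof.
by rewrite /pbw !mulrA X_exp_d !mulrDl !mulrnAl exprS !mulrA.
Qed.

Lemma pbw_Y c a b : Y * pbw c a b = pbw c a b.+1 + pbw c a b *+ (a + c).
Proof.
rewrite /pbw !mulrA Y_exp_d !mulrDl -(mulrA _ Y) Y_exp_X mulrDr mulrDl.
by rewrite exprS !mulrA mulrnAr !mulrnAl mulrnDr addrA.
Qed.
End NormalOrdering.

Section AbstractSpan.
Context {K : fieldType} {P : lmodType K} {H : algType K} {V : lmodType K}.
Variables (X Y d d2 : H).
Hypotheses (YX : Y * X = X * Y + X) (Xd : X * d = d * X + d2) (Yd : Y * d = d * Y + d)
  (dd2 : d * d2 = d2 * d).
Hypothesis H_ind : forall Q : H -> Prop,
  Q 0 -> Q 1 -> (forall k a b, Q a -> Q b -> Q (k *: a + b)) ->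
  (forall h, Q h -> Q (X * h)) -> (forall h, Q h -> Q (Y * h)) ->
  (forall h, Q h -> Q (d * h)) -> forall h, Q h.
Variables (cls : P -> H -> P -> V) (XP YP Zl : P -> P) (LX LY Ld : V -> V).
Hypotheses (clsT : trilin cls) (LXL : linear LX) (LYL : linear LY) (LdL : linear Ld)
  (LXE : forall p h q, LX (cls p h q) =
     cls (XP p) h q + cls p (X * h) q + cls p h (XP q) + cls p (d * h) (YP q))
  (LYE : forall p h q, LY (cls p h q) =
     cls (YP p) h q + cls p (Y * h) q + cls p h (YP q))
  (LdE : forall p h q, Ld (cls p h q) = cls p (d * h) q)
  (d2E : forall p h q, cls p (d2 * h) q =
     2^-1 *: cls p (d * (d * h)) q + cls (Zl p) h q - cls p h (Zl q)).

Let S (v : V) : Prop := exists p c a b q, v = cls p (pbw X Y d c a b) q.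
Let span := lin_span S.

Let span_pbw p c a b q : span (cls p (pbw X Y d c a b) q).
Proof. by apply: lin_span_gen; exists p, c, a, b, q. Qed.

Let span_d p c a b q : span (cls p (d * pbw X Y d c a b) q).
Proof. by rewrite pbw_d; exact: span_pbw. Qed.

Let span_d2 p c a b q : span (cls p (d2 * pbw X Y d c a b) q).
Proof.
rewrite d2E !pbw_d; apply: lin_spanB; last exact: span_pbw.
by apply: lin_spanD; [apply: lin_spanZ|]; exact: span_pbw.
Qed.

Let cls2D p q : {morph (fun h => cls p h q) : h h' / h + h'}.
Proof. exact: (linD (trilin2 clsT p q)). Qed.

Let cls2Mn p q h n : cls p (h *+ n) q = cls p h q *+ n.
Proof. by rewrite -!scaler_nat (linZ (trilin2 clsT p q)). Qed.

Let span_X p c a b q : span (cls p (X * pbw X Y d c a b) q).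
Proof.
rewrite (pbw_X Y Xd dd2) cls2D cls2Mn -scaler_nat; apply: lin_spanD; first exact: span_pbw.
by apply: lin_spanZ; exact: span_d2.
Qed.

Let span_Y p c a b q : span (cls p (Y * pbw X Y d c a b) q).
Proof.
rewrite (pbw_Y YX Yd) cls2D cls2Mn -scaler_nat; apply: lin_spanD; first exact: span_pbw.
by apply: lin_spanZ; exact: span_pbw.
Qed.

Let span_LX v : span v -> span (LX v).
Proof.
apply: lin_span_map => // _ [p [c [a [b [q ->]]]]]; rewrite LXE.
by do !apply: lin_spanD; [exact: span_pbw|exact: span_X|exact: span_pbw|exact: span_d].
Qed.

Let span_LY v : span v -> span (LY v).
Proof.
apply: lin_span_map => // _ [p [c [a [b [q ->]]]]]; rewrite LYE.
by do !apply: lin_spanD; [exact: span_pbw|exact: span_Y|exact: span_pbw].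
Qed.

Let span_Ld v : span v -> span (Ld v).
Proof.
by apply: lin_span_map => // _ [p [c [a [b [q ->]]]]]; rewrite LdE; exact: span_d.
Qed.

(** Left multiplication by [X] in the crossed product also differentiates the outer factors. Hence
    [cls p (X * h) q] is recovered from [LX (cls p h q)] by subtracting terms with the same [h] but
    other [p] and [q], which is why the induction on [h] keeps these two general. *)
Lemma cls_span p h q : span (cls p h q).
Proof.
elim/H_ind: h p q => [||k a b Ha Hb|h Hh|h Hh|h Hh] p q.
- by rewrite (lin0 (trilin2 clsT p q)); exact: lin_span0.
- by have := span_pbw p 0 0 0 q; rewrite /pbw !expr0 !mulr1.
- by rewrite (trilin2 clsT); exact: (lin_spanD (lin_spanZ k (Ha p q)) (Hb p q)).
- have -> : cls p (X * h) q = LX (cls p h q) - cls (XP p) h q - cls p h (XP q)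
      - Ld (cls p h (YP q)).
    apply/eqP; rewrite LXE LdE eq_sym !subr_eq; apply/eqP.
    by rewrite [RHS]addrC !addrA [RHS]addrAC.
  apply: lin_spanB; last exact: span_Ld (Hh _ _).
  exact: (lin_spanB (lin_spanB (span_LX (Hh p q)) (Hh (XP p) q)) (Hh p (XP q))).
- have -> : cls p (Y * h) q = LY (cls p h q) - cls (YP p) h q - cls p h (YP q).
    apply/eqP; rewrite LYE eq_sym !subr_eq; apply/eqP.
    by rewrite [RHS]addrC !addrA.
  exact: (lin_spanB (lin_spanB (span_LY (Hh p q)) (Hh (YP p) q)) (Hh p (YP q))).
- by rewrite -LdE; exact: span_Ld (Hh _ _).
Qed.
End AbstractSpan.

(** * Multiplication in the crossed product and in its quotient *)

Section CrossedProductMul.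
Variable K : fieldType.
Local Notation H1 := (H1 K).
Local Notation P := (polyP K).
Local Notation Ht1 := (Ht1 K).
Local Notation pure := (@ht1_pure K).
Local Notation act := (@polyP_act K).

Lemma tlift3_lin_param (S U V W T : lmodType K) (F : S -> U -> V -> W -> T) x :
  (forall s, trilin (F s)) -> (forall u v w, linear (fun s => F s u v w)) ->
  linear (fun s => tlift3 (F s) x).
Proof.
move=> FT FL k s s'; rewrite -tlift3_lcomb //; congr (tlift3 _ x).
by apply/funext => u; apply/funext => v; apply/funext => w; exact: FL.
Qed.

Lemma pure_trilin : trilin pure.
Proof.
split=> [h q|p q|p h]; rewrite /ht1_pure.
- exact: (linear_comp (tens_linl q) (tens_linl h)).
- exact: (linear_comp (tens_linl q) (tens_linr p)).
- exact: tens_linr.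
Qed.

Lemma act_linl p : linear (fun h => act h p).
Proof. exact: (h1_act_linl (polyP_rep K)). Qed.

Lemma act_linr h : linear (act h).
Proof. exact: (h1_act_linr (polyP_rep K)). Qed.

Let P_mull (p : P) : linear (fun q : P => p * q).
Proof. by move=> k x y; rewrite mulrDr scalerAr. Qed.
Let P_mulr (p : P) : linear (fun q : P => q * p).
Proof. by move=> k x y; rewrite mulrDl scalerAl. Qed.
Let H_mulr (h : H1) : linear (fun h' : H1 => h' * h).
Proof. by move=> k x y; rewrite mulrDl scalerAl. Qed.

Definition ht1_core (p q p' : P) (h' : H1) (q' : P) : H1 -> H1 -> H1 -> Ht1 :=
  fun h1 h2 h3 => pure (p * act h1 p') (h2 * h') (act h3 q' * q).

Lemma ht1_core_trilin p q p' h' q' : trilin (ht1_core p q p' h' q').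
Proof.
exact: (trilin_comp pure_trilin (linear_comp (P_mull p) (act_linl p')) (H_mulr h')
  (linear_comp (P_mulr q) (act_linl q'))).
Qed.

Let core2_trilin p h q :
  trilin (fun p' h' q' => tlift3 (ht1_core p q p' h' q') (coprod3 h)).
Proof.
split=> [h' q'|p' q'|p' h'].
- apply: tlift3_lin_param => [p'|a b c]; first exact: ht1_core_trilin.
  exact: (linear_comp (trilin1 pure_trilin _ _) (linear_comp (P_mull p) (act_linr a))).
- apply: tlift3_lin_param => [h'|a b c]; first exact: ht1_core_trilin.
  exact: (linear_comp (trilin2 pure_trilin _ _) (h1_mul_linr b)).
- apply: tlift3_lin_param => [q'|a b c]; first exact: ht1_core_trilin.
  exact: (linear_comp (trilin3 pure_trilin _ _) (linear_comp (P_mulr q) (act_linr c))).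
Qed.

Let core3_trilin t : trilin (fun p h q =>
  tlift3 (fun p' h' q' => tlift3 (ht1_core p q p' h' q') (coprod3 h)) t).
Proof.
split=> [h q|p q|p h].
- apply: tlift3_lin_param => [p|p' h' q']; first exact: core2_trilin.
  apply: tlift3_lin_param => [p|a b c]; first exact: ht1_core_trilin.
  exact: (linear_comp (trilin1 pure_trilin _ _) (P_mulr _)).
- apply: tlift3_lin_param => [h|p' h' q']; first exact: core2_trilin.
  exact: (linear_comp (tlift3_linear (ht1_core_trilin p q p' h' q')) (@coprod3_linear K)).
- apply: tlift3_lin_param => [q|p' h' q']; first exact: core2_trilin.
  apply: tlift3_lin_param => [q|a b c]; first exact: ht1_core_trilin.
  exact: (linear_comp (trilin3 pure_trilin _ _) (P_mull _)).
Qed.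

Lemma ht1_mul_pure p h q p' h' q' :
  ht1_mul (pure p h q) (pure p' h' q') = tlift3 (ht1_core p q p' h' q') (coprod3 h).
Proof.
exact: (etrans (tlift3E (core3_trilin (pure p' h' q')) p h q) (tlift3E (core2_trilin p h q) p' h' q')).
Qed.

Lemma ht1_mul_linl (t : Ht1) : linear (fun s : Ht1 => ht1_mul s t : Ht1).
Proof. exact: (tlift3_linear (core3_trilin t)). Qed.

Lemma ht1_mul_linr (s : Ht1) : linear (ht1_mul s : Ht1 -> Ht1).
Proof.
exact: (@tlift3_lin_param _ _ _ _ _ (fun t p h q =>
    tlift3 (fun p' h' q' => tlift3 (ht1_core p q p' h' q') (coprod3 h)) t)
  s core3_trilin (fun p h q => tlift3_linear (core2_trilin p h q))).
Qed.

(* components that contain a [delta] act by zero on [P] *)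
Lemma act_d h p : act (hdelta K 1 * h) p = 0.
Proof. exact: (etrans (h1_actM (polyP_rep K) _ _ _) (h1_actd (polyP_rep K) 0 _)). Qed.

Lemma act_Xd h p : act (hX K * (hdelta K 1 * h)) p = 0.
Proof.
exact: etrans (h1_actM (polyP_rep K) _ _ _) (etrans (congr1 _ (act_d h p)) (lin0 (act_linr _))).
Qed.

Lemma act_Yd h p : act (hY K * (hdelta K 1 * h)) p = 0.
Proof.
exact: etrans (h1_actM (polyP_rep K) _ _ _) (etrans (congr1 _ (act_d h p)) (lin0 (act_linr _))).
Qed.

Lemma act_X p : act (hX K) p = polyP_op GenX p. Proof. exact: (h1_actX (polyP_rep K)). Qed.
Lemma act_Y p : act (hY K) p = polyP_op GenY p. Proof. exact: (h1_actY (polyP_rep K)). Qed.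
Lemma act_1 p : act 1 p = p. Proof. exact: (h1_act1 (polyP_rep K)). Qed.
End CrossedProductMul.

(* [F] vanishes when its first or third argument acts trivially, so that only
   the middle commutator survives. *)
Section Delta2.
Context {K : fieldType} {H : algType K} {V : lmodType K} (X Y d : H) (F : H -> H -> H -> V).
Hypotheses (Fl : forall a b c, F (d * a) b c = 0) (FXl : forall a b c, F (X * (d * a)) b c = 0)
  (Fr : forall a b c, F a b (d * c) = 0) (FXr : forall a b c, F a b (X * (d * c)) = 0)
  (FYr : forall a b c, F a b (Y * (d * c)) = 0).
Local Notation tX := (tri_op ( *%R X) ( *%R Y) ( *%R d)).
Local Notation td := (tri_prim ( *%R d)).

Lemma tri_dX : td (tX F) 1 1 1 = F (X * 1) (d * 1) 1 + F 1 (X * (d * 1)) 1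
   + F 1 (d * 1) (X * 1) + F 1 (d * (d * 1)) (Y * 1).
Proof. by rewrite /tri_prim /tri_op !(Fl, FXl, Fr, FXr, FYr) !(add0r, addr0). Qed.

Lemma tri_Xd : tX (td F) 1 1 1 = F (X * 1) (d * 1) 1 + F 1 (d * (X * 1)) 1
   + F 1 (d * 1) (X * 1) + F 1 (d * (d * 1)) (Y * 1).
Proof. by rewrite /tri_prim /tri_op !(Fl, FXl, Fr, FXr, FYr) !(add0r, addr0). Qed.

Lemma tri_dd : td (td F) 1 1 1 = F 1 (d * (d * 1)) 1.
Proof. by rewrite /tri_prim !(Fl, FXl, Fr, FXr, FYr) !(add0r, addr0). Qed.

Lemma tri_X1 : tX F 1 1 1 = F X 1 1 + F 1 X 1 + F 1 1 X + F 1 d Y.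
Proof.
by rewrite /tri_op !Fl !mulr1 addr0 add0r.
Qed.

Lemma tri_p1 Z : tri_prim ( *%R Z) F 1 1 1 = F Z 1 1 + F 1 Z 1 + F 1 1 Z.
Proof. by rewrite /tri_prim !mulr1. Qed.

Lemma tri_d1 : td F 1 1 1 = F 1 d 1.
Proof. by rewrite /tri_prim !Fl !Fr mulr1 addr0 add0r. Qed.

Lemma tri_Xd_dX d2 : trilin F -> X * d = d * X + d2 ->
  td (tX F) 1 1 1 - tX (td F) 1 1 1 = F 1 d2 1.
Proof.
move=> FT E; rewrite tri_dX tri_Xd !mulr1 E (linD (trilin2 FT 1 1)).
set a := F X d 1; set b := F 1 (d * X) 1; set c := F 1 d X; set e := F 1 _ _.
apply/eqP; rewrite subr_eq; apply/eqP.
by rewrite (addrA a) (addrC (a + b)) !addrA.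
Qed.
End Delta2.

Section CrossedProductFormulas.
Variable K : fieldType.
Local Notation H1 := (H1 K).
Local Notation P := (polyP K).
Local Notation Ht1 := (Ht1 K).
Local Notation pure := (@ht1_pure K).
Local Notation act := (@polyP_act K).
Local Notation X := (hX K).
Local Notation Y := (hY K).
Local Notation d1 := (hdelta K 1).
Local Notation d2 := (hdelta K 2).

Variables (p q : P) (h : H1).
Let F : H1 -> H1 -> H1 -> Ht1 := ht1_core 1 1 p h q.
Let FT : trilin F. Proof. exact: ht1_core_trilin. Qed.

Let pure0l h' q' : pure 0 h' q' = 0. Proof. exact: (lin0 (trilin1 (pure_trilin K) h' q')). Qed.
Let pure0r p' h' : pure p' h' 0 = 0. Proof. exact: (lin0 (trilin3 (pure_trilin K) p' h')). Qed.

Let FE a b c : F a b c = pure (act a p) (b * h) (act c q).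
Proof. exact: (congr2 (fun u v => pure u (b * h) v) (mul1r _) (mulr1 _)). Qed.

Let FE' a b c p' h' q' : act a p = p' -> b * h = h' -> act c q = q' ->
  F a b c = pure p' h' q'.
Proof. by move=> <- <- <-; exact: FE. Qed.

Let Fl0 a b c : act a p = 0 -> F a b c = 0.
Proof. move=> a0.
exact (etrans (FE' a0 (erefl (b * h)) (erefl (act c q))) (pure0l (b * h) (act c q))). Qed.
Let Fr0 a b c : act c q = 0 -> F a b c = 0.
Proof. move=> c0.
exact (etrans (FE' (erefl (act a p)) (erefl (b * h)) c0) (pure0r (act a p) (b * h))). Qed.

Let Fl a b c : F (d1 * a) b c = 0. Proof. exact: Fl0 (act_d _ _). Qed.
Let FXl a b c : F (X * (d1 * a)) b c = 0. Proof. exact: Fl0 (act_Xd _ _). Qed.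
Let Fr a b c : F a b (d1 * c) = 0. Proof. exact: Fr0 (act_d _ _). Qed.
Let FXr a b c : F a b (X * (d1 * c)) = 0. Proof. exact: Fr0 (act_Xd _ _). Qed.
Let FYr a b c : F a b (Y * (d1 * c)) = 0. Proof. exact: Fr0 (act_Yd _ _). Qed.

Let mulE h' : ht1_mul (pure 1 h' 1) (pure p h q) = tlift3 F (coprod3 h').
Proof. exact: ht1_mul_pure. Qed.

Let mul1E h' G : (forall F, trilin F -> tlift3 F (coprod3 (h' * 1)) = tlift3 (G F) (coprod3 1)) ->
  (forall F, trilin F -> trilin (G F)) ->
  ht1_mul (pure 1 h' 1) (pure p h q) = G F 1 1 1.
Proof.
move=> GE GT; apply: etrans (mulE h') _.
apply: etrans (congr1 (fun x => tlift3 F (coprod3 x)) (esym (mulr1 h'))) _.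
exact: etrans (GE F FT) (coprod3_1 (GT F FT)).
Qed.

Let a1 := act_1.
Let m1 := mul1r h.

Lemma ht1_mulX : ht1_mul (pure 1 X 1) (pure p h q) =
  pure (polyP_op GenX p) h q + pure p (X * h) q + pure p h (polyP_op GenX q)
    + pure p (d1 * h) (polyP_op GenY q).
Proof.
apply: etrans (mul1E (@coprod3_X K Ht1 ^~ 1) (@triX_trilin K Ht1)) _.
apply: etrans (tri_X1 X Y Fl) _.
exact: (congr2 +%R (congr2 +%R (congr2 +%R (FE' (act_X _) m1 (a1 _))
  (FE' (a1 _) (erefl _) (a1 _))) (FE' (a1 _) m1 (act_X _))) (FE' (a1 _) (erefl _) (act_Y _))).
Qed.

Lemma ht1_mulY : ht1_mul (pure 1 Y 1) (pure p h q) =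
  pure (polyP_op GenY p) h q + pure p (Y * h) q + pure p h (polyP_op GenY q).
Proof.
apply: etrans (mul1E (@coprod3_Y K Ht1 ^~ 1) (@triY_trilin K Ht1)) _.
apply: etrans (tri_p1 F Y) _.
exact: (congr2 +%R (congr2 +%R (FE' (act_Y _) m1 (a1 _))
  (FE' (a1 _) (erefl _) (a1 _))) (FE' (a1 _) m1 (act_Y _))).
Qed.

Lemma ht1_muld : ht1_mul (pure 1 d1 1) (pure p h q) = pure p (d1 * h) q.
Proof.
apply: etrans (mul1E (@coprod3_d K Ht1 ^~ 1) (@trid_trilin K Ht1)) _.
apply: etrans (tri_d1 Fl Fr) _.
exact: (FE' (a1 _) (erefl _) (a1 _)).
Qed.

Lemma ht1_mul_pq p' q' :
  ht1_mul (pure p' 1 q') (pure p h q) = pure (p' * p) h (q * q').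
Proof.
apply: etrans (ht1_mul_pure _ _ _ _ _ _) _.
apply: etrans (coprod3_1 (ht1_core_trilin _ _ _ _ _)) _.
apply: etrans (congr2 (fun u v => pure (p' * u) (1 * h) v) (a1 p) (congr1 ( *%R^~ q') (a1 q))) _.
exact (congr1 (fun x => pure (p' * p) x (q * q')) m1).
Qed.

Let cop := fun h' => tlift3 F (coprod3 h').

Let copB a b : cop (a - b) = cop a - cop b.
Proof.
exact: (linB (linear_comp (tlift3_linear FT) (@coprod3_linear K))).
Qed.

Let copZ k a : cop (k *: a) = k *: cop a.
Proof.
exact: (linZ (linear_comp (tlift3_linear FT) (@coprod3_linear K))).
Qed.

Let two g g' G G' : (forall F h, trilin F -> tlift3 F (coprod3 (g * h)) = tlift3 (G F) (coprod3 h)) ->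
  (forall F h, trilin F -> tlift3 F (coprod3 (g' * h)) = tlift3 (G' F) (coprod3 h)) ->
  (forall F, trilin F -> trilin (G F)) -> (forall F, trilin F -> trilin (G' F)) ->
  cop (g * g') = G' (G F) 1 1 1.
Proof.
move=> GE GE' GT GT'; rewrite /cop; apply: etrans (GE F g' FT) _.
apply: etrans (congr1 (fun x => tlift3 (G F) (coprod3 x)) (esym (mulr1 g'))) _.
exact: etrans (GE' _ _ (GT F FT)) (coprod3_1 (GT' _ (GT F FT))).
Qed.

Let cop_d2 : cop d2 = pure p (d2 * h) q.
Proof.
have E : d2 = X * d1 - d1 * X by rewrite (h1_Xd K 0) addrAC subrr add0r.
rewrite {1}E; apply: etrans (copB _ _) _.
apply: etrans (congr2 (fun u v => u - v)
  (two (@coprod3_X K Ht1) (@coprod3_d K Ht1) (@triX_trilin K Ht1) (@trid_trilin K Ht1))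
  (two (@coprod3_d K Ht1) (@coprod3_X K Ht1) (@trid_trilin K Ht1) (@triX_trilin K Ht1))) _.
apply: etrans (tri_Xd_dX Fl FXl Fr FXr FYr FT (h1_Xd K 0)) _.
exact: (FE' (a1 _) (erefl _) (a1 _)).
Qed.

Let cop_dd : cop (d1 * d1) = pure p (d1 * (d1 * h)) q.
Proof.
apply: etrans
  (two (@coprod3_d K Ht1) (@coprod3_d K Ht1) (@trid_trilin K Ht1) (@trid_trilin K Ht1)) _.
apply: etrans (tri_dd Fl Fr) _.
apply: (FE' (a1 _) _ (a1 _)).
exact (etrans (congr1 (fun x => d1 * x * h) (mulr1 d1)) (esym (mulrA d1 d1 h))).
Qed.

(** The cross terms in the iterated coproducts of [delta_2] and [delta_1^2] have a [delta] in an
    outer slot, where it acts by zero on [P]. So both behave as if they sat in the middle factor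
    alone, and the relator can be read off on any pure tensor. *)
Lemma ht1_mul_tdelta2 : ht1_mul (tdelta2 K) (pure p h q) =
  pure p (d2 * h) q - 2^-1 *: pure p (d1 * (d1 * h)) q
    - pure (polyZ K 0 * p) h q + pure p h (q * polyZ K 0).
Proof.
have D := linD (ht1_mul_linl (pure p h q)); have B := linB (ht1_mul_linl (pure p h q)).
apply: etrans (D _ _) _; apply: congr2.
  apply: etrans (B _ _) _; apply: congr2.
    apply: etrans (mulE _) _; apply: etrans (copB _ _) _.
    apply: congr2; first exact: cop_d2.
    have E2 : cop (d1 ^+ 2) = pure p (d1 * (d1 * h)) q := etrans (congr1 cop (expr2 d1)) cop_dd.
    exact (congr1 -%R (etrans (copZ 2^-1 (d1 ^+ 2)) (congr1 ( *:%R 2^-1) E2))).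
  apply: congr1; apply: etrans (ht1_mul_pq _ _) _.
  exact: (congr1 (pure _ _) (mulr1 _)).
apply: etrans (ht1_mul_pq _ _) _.
exact: (congr1 (fun x => pure x _ _) (mul1r _)).
Qed.
End CrossedProductFormulas.

Section QuotientAlgebraHs.
Variable K : fieldType.
Local Notation H1 := (H1 K).
Local Notation P := (polyP K).
Local Notation Ht1 := (Ht1 K).
Local Notation Hs := (Hs K).
Local Notation pure := (@ht1_pure K).
Local Notation I := (ideal_gen (@ht1_mul K) [set tdelta2 K]).

Lemma hs_class_linear : linear (@hs_class K).
Proof. exact: linearP. Qed.

Lemma hs_classP (x y : Ht1) : x - y \in I -> hs_class x = hs_class y.
Proof. by move=> xy; apply/lquotP. Qed.

Lemma hs_class0 (x : Ht1) : x \in I -> hs_class x = 0.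
Proof.
move=> Ix; rewrite -(lin0 hs_class_linear); apply: hs_classP.
by rewrite subr0.
Qed.

(** A variant of [hs_mul] that keeps the left factor in [Ht1], where the explicit product formulas
    hold. *)
Definition hs_lmul (s : Ht1) (x : Hs) : Hs := hs_class (ht1_mul s (repr x)).

Lemma hs_lmulE s y : hs_lmul s (hs_class y) = hs_class (ht1_mul s y).
Proof.
apply: hs_classP; rewrite -(linB (ht1_mul_linr s)).
exact (proj1 (andP (ideal_genM s (lquot_class_repr I y)))).
Qed.

Lemma hsW (Q : Hs -> Prop) : (forall t, Q (hs_class t)) -> forall x, Q x.
Proof. exact: lquotW. Qed.

Lemma hs_lmul_linear s : linear (hs_lmul s).
Proof.
move=> k; elim/hsW => x; elim/hsW => y.
refine (etrans (congr1 (hs_lmul s) (esym (hs_class_linear k x y))) _).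
refine (etrans (hs_lmulE s _) _).
refine (etrans (congr1 (@hs_class K) (ht1_mul_linr s k x y)) _).
refine (etrans (hs_class_linear k _ _) _).
exact (congr2 (fun a b => k *: a + b) (esym (hs_lmulE s x)) (esym (hs_lmulE s y))).
Qed.

Definition hs_pure p h q : Hs := hs_class (pure p h q).

Lemma hs_pure_trilin : trilin hs_pure.
Proof. exact: (trilin_post (pure_trilin K) hs_class_linear). Qed.

Lemma hs_pure_d2 p h q : hs_pure p (hdelta K 2 * h) q =
  2^-1 *: hs_pure p (hdelta K 1 * (hdelta K 1 * h)) q
    + hs_pure (polyZ K 0 * p) h q - hs_pure p h (polyZ K 0 * q).
Proof.
have I0 : ht1_mul (tdelta2 K) (pure p h q) \in I.
  have Id : tdelta2 K \in I by exact: ideal_gen_sub.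
  exact (proj2 (andP (ideal_genM (pure p h q) Id))).
have E := etrans (esym (congr1 (@hs_class K) (ht1_mul_tdelta2 p q h))) (hs_class0 I0).
refine (etrans (lin_solve hs_class_linear E) _).
exact (congr1 (fun r => 2^-1 *: hs_pure p (hdelta K 1 * (hdelta K 1 * h)) q
    + hs_pure (polyZ K 0 * p) h q - hs_pure p h r) (mulrC q (polyZ K 0))).
Qed.

Let S (v : Hs) : Prop := exists p c a b q,
  v = hs_pure p (pbw (hX K) (hY K) (hdelta K 1) c a b) q.

Lemma hs_span (x : Hs) : lin_span S x.
Proof.
have pspan p h q : lin_span S (hs_pure p h q).
  pose L := fun g => hs_lmul (pure 1 g 1).
  have LX p' h' q' : L (hX K) (hs_pure p' h' q') =
      hs_pure (polyP_op GenX p') h' q' + hs_pure p' (hX K * h') q'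
        + hs_pure p' h' (polyP_op GenX q') + hs_pure p' (hdelta K 1 * h') (polyP_op GenY q').
    refine (etrans (hs_lmulE _ _) _).
    refine (etrans (congr1 (@hs_class K) (ht1_mulX p' q' h')) _).
    exact (lin_add4 hs_class_linear _ _ _ _).
  have LY p' h' q' : L (hY K) (hs_pure p' h' q') =
      hs_pure (polyP_op GenY p') h' q' + hs_pure p' (hY K * h') q'
        + hs_pure p' h' (polyP_op GenY q').
    refine (etrans (hs_lmulE _ _) _).
    refine (etrans (congr1 (@hs_class K) (ht1_mulY p' q' h')) _).
    exact (lin_add3 hs_class_linear _ _ _).
  have Ld p' h' q' : L (hdelta K 1) (hs_pure p' h' q') = hs_pure p' (hdelta K 1 * h') q'.
    refine (etrans (hs_lmulE _ _) _).
    exact (congr1 (@hs_class K) (ht1_muld p' q' h')).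
  have Yd : hY K * hdelta K 1 = hdelta K 1 * hY K + hdelta K 1.
    exact (etrans (h1_Yd K 0) (congr1 (fun x => hdelta K 1 * hY K + x) (scale1r _))).
  exact (cls_span (h1_YX K) (h1_Xd K 0) Yd (h1_dd K 0 1) (@h1_ind K) hs_pure_trilin
    (hs_lmul_linear _) (hs_lmul_linear _) (hs_lmul_linear _) LX LY Ld hs_pure_d2 p h q).
move: x; apply: hsW => t.
elim/(@tens3_ind): t => [|k p h q t IH].
  exact (eq_ind_r (lin_span S) (lin_span0 S) (lin0 hs_class_linear)).
refine (eq_ind_r (lin_span S) _ (hs_class_linear k (pure p h q) t)).
exact (lin_spanD (lin_spanZ k (pspan p h q)) IH).
Qed.
End QuotientAlgebraHs.

Lemma lin_span_trans (K : pzRingType) (V : lmodType K) (S S' : V -> Prop) :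
  (forall s, S s -> lin_span S' s) -> forall v, lin_span S v -> lin_span S' v.
Proof. by move=> SS'; apply: (lin_span_map (f := idfun)). Qed.

(** * Standard tensors spanning the tensor power over [P] *)

Section TensorPowerSpan.
Variable K : fieldType.
Local Notation H1 := (H1 K).
Local Notation P := (polyP K).
Local Notation Ht1 := (Ht1 K).
Local Notation Hs := (Hs K).
Local Notation pure := (@ht1_pure K).
Local Notation I := (ideal_gen (@ht1_mul K) [set tdelta2 K]).
Local Notation mono := ({cmonom nat}).

Definition Zmono (m : mono) : P := << m >>.
Definition h1_pbw (e : nat * nat * nat) : H1 := pbw (hX K) (hY K) (hdelta K 1) e.1.1 e.1.2 e.2.
Definition std (x : mono * (nat * nat * nat)) (q : P) : Hs :=
  hs_pure (Zmono x.1) (h1_pbw x.2) q.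

Lemma hs_mulE (x y : Ht1) : hs_mul (hs_class x) (hs_class y) = hs_class (ht1_mul x y).
Proof.
refine (etrans (hs_lmulE _ y) _); apply: hs_classP.
rewrite -(linB (ht1_mul_linl y)).
exact (proj2 (andP (ideal_genM y (lquot_class_repr I x)))).
Qed.

Lemma hs_beta_pure (p' p q : P) (h : H1) : hs_mul (hs_beta p') (hs_pure p h q) = hs_pure p h (q * p').
Proof.
refine (etrans (hs_mulE _ _) _); refine (etrans (congr1 (@hs_class K) (ht1_mul_pq p q h 1 p')) _).
exact (congr1 (fun x => hs_pure x h (q * p')) (mul1r p)).
Qed.

Lemma lin_span_poly (V : lmodType K) (f : P -> V) (S : V -> Prop) : linear f ->
  (forall m, lin_span S (f (Zmono m))) -> forall p, lin_span S (f p).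
Proof.
move=> fL fS; elim/malg_ind => [|k m p IH].
  exact (eq_ind_r (lin_span S) (lin_span0 S) (lin0 fL)).
refine (eq_ind_r (lin_span S) _ (fL k (Zmono m) p)).
exact (lin_spanD (lin_spanZ k (fS m)) IH).
Qed.

Lemma hs_span_std (x : Hs) : lin_span (fun v => exists y q, v = std y q) x.
Proof.
apply: lin_span_trans (hs_span x) => _ [p [c [a [b [q ->]]]]].
move: p; apply: (lin_span_poly (trilin1 (@hs_pure_trilin K) _ q)) => m.
by apply: lin_span_gen; exists (m, ((c, a), b)), q.
Qed.

Lemma hs_span_std2 (x : Hs) : lin_span (fun v => exists y m, v = std y (Zmono m)) x.
Proof.
apply: lin_span_trans (hs_span_std x) => _ [y [q ->]].
move: q; apply: (lin_span_poly (trilin3 (@hs_pure_trilin K) _ _)) => m.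
by apply: lin_span_gen; exists y, m.
Qed.

Variable n : nat.
Local Notation T := (tensP K n.+1).

(** For each factor a monomial in the [Z_k] and the exponents [(c, a, b)] of [delta_1^c X^a Y^b].
    The last component is the monomial under [beta] in the last factor, which has no neighbour to be
    moved to. *)
Definition tens_index : Type := ({ffun 'I_n.+1 -> mono * (nat * nat * nat)} * mono)%type.
HB.instance Definition _ := Choice.on tens_index.

Definition tclass (h : 'I_n.+1 -> Hs) : T :=
  lquot_class (lspan (@tensP_relators K n.+1)) << h >>.

Definition tens_basis (j : tens_index) (i : 'I_n.+1) : Hs :=
  std (j.1 i) (if i == ord_max then Zmono j.2 else 1).

Lemma tclass_linear h i : linear (fun u => tclass (upd h i u)).
Proof.
move=> a u v; apply/eqP; rewrite -subr_eq0 opprD addrA /tclass.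
rewrite -linearZ -!linearB /=; apply/eqP.
have -> : 0 = lquot_class (lspan (@tensP_relators K n.+1)) 0 by rewrite linear0.
by apply/lquotP; rewrite subr0; apply: lspan_sub; left; exists h, i, a, u, v.
Qed.

Lemma tclass_balanced h (i j : 'I_n.+1) p : j = i.+1 :> nat ->
  tclass (upd h i (hs_mul (hs_beta p) (h i))) = tclass (upd h j (hs_mul (hs_alpha p) (h j))).
Proof.
move=> ij; apply/lquotP; apply: lspan_sub; right.
by exists h, i, j, p.
Qed.

Let S (v : T) : Prop := exists j, v = tclass (tens_basis j).

Lemma upd_id (h : 'I_n.+1 -> Hs) i : upd h i (h i) = h.
Proof. by apply/funext => k; rewrite /upd; case: eqP => [->|]. Qed.

Lemma tclass_span_last g (h : 'I_n.+1 -> Hs) :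
  (forall i : 'I_n.+1, (i < n)%N -> h i = std (g i) 1) -> lin_span S (tclass h).
Proof.
move=> hg; rewrite -(upd_id h ord_max); move: (h ord_max) (hs_span_std2 (h ord_max)).
apply: lin_span_map; first exact: tclass_linear.
move=> _ [y [m ->]]; apply: lin_span_gen.
exists ([ffun i => if i == ord_max then y else g i], m); congr tclass.
apply/funext => i; rewrite /upd /tens_basis /= ffunE.
case: eqP => // /eqP ni; apply: hg.
by rewrite ltn_neqAle -ltnS ltn_ord andbT.
Qed.

(** Sweep from left to right, [r] counting the factors still to be treated. The factor at [k] is
    written as [beta(q)] times a standard element, and [q] is handed to the factor at [k.+1]. That
    factor becomes arbitrary, which is harmless since the hypothesis concerns positions below [k]
    only. *)
Lemma tclass_span r k g (h : 'I_n.+1 -> Hs) : (k + r = n)%N ->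
  (forall i : 'I_n.+1, (i < k)%N -> h i = std (g i) 1) -> lin_span S (tclass h).
Proof.
elim: r k g h => [|r IHr] k g h; first by rewrite addn0 => ->; exact: tclass_span_last.
move=> kr hg; have kn : (k < n)%N by rewrite -kr -addSnnS leq_addr.
pose i := inord k : 'I_n.+1; pose j := inord k.+1 : 'I_n.+1.
have iE : i = k :> nat by rewrite inordK // ltnS ltnW.
have jE : j = k.+1 :> nat by rewrite inordK.
rewrite -(upd_id h i); move: (h i) (hs_span_std (h i)).
apply: lin_span_map; first exact: tclass_linear.
move=> _ [y [q ->]]; pose h' := upd h i (std y 1).
have h'i : h' i = std y 1 by rewrite /h' /upd eqxx.
have -> : upd h i (std y q) = upd h' i (hs_mul (hs_beta q) (h' i)).
  rewrite h'i; apply/funext => l; rewrite /upd /h'; case: eqP => [_|nl].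
    refine (esym (etrans (hs_beta_pure _ _ _ _) _)).
    exact (congr1 (hs_pure _ _) (mul1r q)).
  by rewrite /upd; case: eqP nl.
rewrite (@tclass_balanced h' i j q) ?iE //.
apply: (IHr k.+1 (fun l => if l == i then y else g l)); first by rewrite addSnnS.
move=> l lk.
have nlj : (l == j) = false by apply/eqP => lj; rewrite lj jE ltnn in lk.
refine (etrans (congr1 (fun b : bool => if b then _ else h' l) nlj) _).
rewrite /h' /upd; have [//|nli] := eqVneq l i; apply: hg.
move: lk; rewrite ltnS leq_eqVlt => /orP[/eqP lk|//].
by case/eqP: nli; apply: val_inj; rewrite /= iE.
Qed.

Lemma tensP_span (t : T) : lin_span S t.
Proof.
move: t; apply: lquotW => x; elim/malg_ind: x => [|k h x IH].
  refine (eq_ind_r (lin_span S) (lin_span0 S) (linear0 _)).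
refine (eq_ind_r (lin_span S) _ (linearP (lquot_class (lspan (@tensP_relators K n.+1))) k _ x)).
refine (lin_spanD (lin_spanZ k _) IH).
by apply: (@tclass_span n 0 (fun=> (mone, (0, 0, 0)))).
Qed.
End TensorPowerSpan.

(** * Bimodule actions *)

Section TermSums.
Context {V : zmodType}.
Implicit Types t a : V.

Lemma six_terms t1 t2 t3 t4 t5 t6 a1 a2 a4 a6 :
  t1 = a1 -> t2 = a2 -> t3 = 0 -> t4 = a4 -> t5 = 0 -> t6 = a6 ->
  a4 + (a1 + a2) + a6 = t1 + t2 + t3 + t4 + (t5 + t6).
Proof. by move=> -> -> -> -> -> ->; rewrite add0r addr0 (addrC a4). Qed.

Lemma three_terms t1 t2 t3 a1 a2 a3 : t1 = a1 -> t2 = a2 -> t3 = a3 ->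
  a3 + (a1 + a2) = t1 + t2 + t3.
Proof. by move=> -> -> ->; rewrite addrC. Qed.

Lemma middle_term t1 t2 t3 : t1 = 0 -> t3 = 0 -> t2 = t1 + t2 + t3.
Proof. by move=> -> ->; rewrite add0r addr0. Qed.
End TermSums.

Section BimoduleAction.
Context {K : fieldType} {A : lmodType K}.
Local Notation H1 := (H1 K).
Local Notation P := (polyP K).
Local Notation Ht1 := (Ht1 K).
Local Notation Hs := (Hs K).
Local Notation pure := (@ht1_pure K).
Local Notation act := (@polyP_act K).
Local Notation X := (hX K).
Local Notation Y := (hY K).
Local Notation d1 := (hdelta K 1).

Variables (op : h1_gen -> A -> A) (ml mr : P -> A -> A).
Local Notation hact := (h1_act op).
Local Notation PX := (@polyP_op K GenX).
Local Notation PY := (@polyP_op K GenY).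
Hypothesis opR : h1_rep op.
Hypotheses (mlL : forall p, linear (ml p)) (mrL : forall p, linear (mr p))
  (mlP : forall a, linear (fun p => ml p a)) (mrP : forall a, linear (fun p => mr p a))
  (mlM : forall p q a, ml (p * q) a = ml p (ml q a))
  (mrM : forall p q a, mr (p * q) a = mr p (mr q a))
  (ml1 : forall a, ml 1 a = a) (mr1 : forall a, mr 1 a = a)
  (mlr : forall p q a, ml p (mr q a) = mr q (ml p a)).
(** On the left the [delta_1 ⊗ Y] in the coproduct of [X] leaves no trace because [delta_1] kills
    [P]. On the right it survives as the third term of [Xmr], with [delta_1] acting on [a] and [Y]
    on [p]. *)
Hypotheses
  (Xml : forall p a, op GenX (ml p a) = ml (PX p) a + ml p (op GenX a))
  (Yml : forall p a, op GenY (ml p a) = ml (PY p) a + ml p (op GenY a))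
  (dml : forall p a, op (GenD 0) (ml p a) = ml p (op (GenD 0) a))
  (Xmr : forall p a, op GenX (mr p a) =
    mr (PX p) a + mr p (op GenX a) + mr (PY p) (op (GenD 0) a))
  (Ymr : forall p a, op GenY (mr p a) = mr (PY p) a + mr p (op GenY a))
  (dmr : forall p a, op (GenD 0) (mr p a) = mr p (op (GenD 0) a)).
Hypothesis d2E : forall a, op (GenD 1) a - 2^-1 *: op (GenD 0) (op (GenD 0) a) =
  ml (polyZ K 0) a - mr (polyZ K 0) a.

Definition bim_core (p : P) (h : H1) (q : P) : A -> A :=
  fun a => mr q (ml p (hact h a)).
Definition bim_act : Ht1 -> A -> A := tlift3 bim_core.

Lemma bim_core_trilin : trilin bim_core.
Proof.
split=> [h q|p q|p h] k u v; apply/funext => a; rewrite /bim_core /=.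
- exact (linear_comp (mrL q) (mlP (hact h a)) k u v).
- exact (linear_comp (mrL q) (linear_comp (mlL p) (h1_act_linl opR a)) k u v).
- exact (mrP (ml p (hact h a)) k u v).
Qed.

Lemma bim_act_linear : linear bim_act.
Proof. exact: (tlift3_linear bim_core_trilin). Qed.

Lemma bim_act_pure p h q a : bim_act (pure p h q) a = mr q (ml p (hact h a)).
Proof. exact (congr1 (fun f => f a) (tlift3E bim_core_trilin p h q)). Qed.

Section Twisted.
Variables (p q : P) (a : A).

Definition twist (h1 h2 h3 : H1) : A := mr (act h3 q) (ml (act h1 p) (hact h2 a)).

Lemma twist_trilin : trilin twist.
Proof.
split=> [h2 h3|h1 h3|h1 h2].
- exact (linear_comp (mrL _) (linear_comp (mlP _) (act_linl p))).
- exact (linear_comp (mrL _) (linear_comp (mlL _) (h1_act_linl opR a))).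
- exact (linear_comp (mrP _) (act_linl q)).
Qed.

Let act_M g h p' : act (g * h) p' = act g (act h p'). Proof. exact: (h1_actM (polyP_rep K)). Qed.
Let hact_M g h a' : hact (g * h) a' = hact g (hact h a'). Proof. exact: (h1_actM opR). Qed.
Let hX a' : hact X a' = op GenX a'. Proof. exact: (h1_actX opR). Qed.
Let hY a' : hact Y a' = op GenY a'. Proof. exact: (h1_actY opR). Qed.
Let hd a' : hact d1 a' = op (GenD 0) a'. Proof. exact: (h1_actd opR). Qed.
Let ml0 a' : ml 0 a' = 0. Proof. exact: (lin0 (mlP a')). Qed.
Let mr0 a' : mr 0 a' = 0. Proof. exact: (lin0 (mrP a')). Qed.
Let mr_0 p' : mr p' 0 = 0. Proof. exact: (lin0 (mrL p')). Qed.

Let twistE h1 h2 h3 p' q' a' : act h1 p = p' -> act h3 q = q' -> hact h2 a = a' ->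
  twist h1 h2 h3 = mr q' (ml p' a').
Proof. by move=> <- <- <-. Qed.
Let aX h p' : act (X * h) p' = PX (act h p'). Proof. exact (etrans (act_M _ _ _) (act_X _)). Qed.
Let aY h p' : act (Y * h) p' = PY (act h p'). Proof. exact (etrans (act_M _ _ _) (act_Y _)). Qed.
Let bX h a' : hact (X * h) a' = op GenX (hact h a'). Proof. exact (etrans (hact_M _ _ _) (hX _)). Qed.
Let bY h a' : hact (Y * h) a' = op GenY (hact h a'). Proof. exact (etrans (hact_M _ _ _) (hY _)). Qed.
Let bd h a' : hact (d1 * h) a' = op (GenD 0) (hact h a'). Proof. exact (etrans (hact_M _ _ _) (hd _)). Qed.

Let twist_dl h1 h2 h3 : twist (d1 * h1) h2 h3 = 0.
Proof.
exact (etrans (twistE (act_d h1 p) (erefl _) (erefl _)) (etrans (congr1 (mr _) (ml0 _)) (mr_0 _))).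
Qed.
Let twist_dr h1 h2 h3 : twist h1 h2 (d1 * h3) = 0.
Proof. exact (etrans (twistE (erefl _) (act_d h3 q) (erefl _)) (mr0 _)). Qed.

Let mrD q' : {morph mr q' : x y / x + y}. Proof. exact: (linD (mrL q')). Qed.

Let Xtwist h1 h2 h3 : op GenX (twist h1 h2 h3) = triX twist h1 h2 h3.
Proof.
set p' := act h1 p; set q' := act h3 q; set a' := hact h2 a.
have E1 := twistE (aX h1 p) (erefl q') (erefl a').
have E2 := twistE (erefl p') (erefl q') (bX h2 a).
have E3 := twistE (erefl p') (aX h3 q) (erefl a').
have E4 := twistE (erefl p') (aY h3 q) (bd h2 a).
have EX : op GenX (mr q' (ml p' a')) =
    mr (PX q') (ml p' a') + (mr q' (ml (PX p') a') + mr q' (ml p' (op GenX a')))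
      + mr (PY q') (ml p' (op (GenD 0) a')).
  refine (etrans (Xmr q' (ml p' a')) _).
  refine (congr2 (fun x y => mr (PX q') (ml p' a') + x + mr (PY q') y) _ (dml p' a')).
  exact (etrans (congr1 (mr q') (Xml p' a')) (mrD _ _ _)).
refine (etrans EX _).
exact (six_terms E1 E2 (twist_dl h1 (Y * h2) h3) E3 (twist_dl h1 h2 (Y * h3)) E4).
Qed.

Let Ytwist h1 h2 h3 : op GenY (twist h1 h2 h3) = triY twist h1 h2 h3.
Proof.
set p' := act h1 p; set q' := act h3 q; set a' := hact h2 a.
have E1 := twistE (aY h1 p) (erefl q') (erefl a').
have E2 := twistE (erefl p') (erefl q') (bY h2 a).
have E3 := twistE (erefl p') (aY h3 q) (erefl a').
refine (etrans (Ymr q' (ml p' a')) _).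
refine (etrans (congr1 (fun x => mr (PY q') (ml p' a') + x) (etrans (congr1 (mr q') (Yml p' a')) (mrD _ _ _))) _).
exact (three_terms E1 E2 E3).
Qed.

Let dtwist h1 h2 h3 : op (GenD 0) (twist h1 h2 h3) = trid twist h1 h2 h3.
Proof.
set p' := act h1 p; set q' := act h3 q; set a' := hact h2 a.
have E2 := twistE (erefl p') (erefl q') (bd h2 a).
refine (etrans (dmr q' (ml p' a')) (etrans (congr1 (mr q') (dml p' a')) _)).
exact (etrans (esym E2) (middle_term _ (twist_dl h1 h2 h3) (twist_dr h1 h2 h3))).
Qed.

(** Both sides respond in the same way when [h] is multiplied on the left by [X], [Y] or [delta_1],
    so [h1_ind] reduces this Leibniz rule of a two-sided module algebra to [Xtwist], [Ytwist] and
    [dtwist]. *)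
Lemma hact_twist h : hact h (mr q (ml p a)) = tlift3 twist (coprod3 h).
Proof.
have TL := tlift3_linear twist_trilin.
have step g (G : (H1 -> H1 -> H1 -> A) -> H1 -> H1 -> H1 -> A) x :
    (forall h' F, trilin F -> tlift3 F (coprod3 (x * h')) = tlift3 (G F) (coprod3 h')) ->
    (forall F, trilin F -> trilin (G F)) ->
    (forall h1 h2 h3, op g (twist h1 h2 h3) = G twist h1 h2 h3) ->
    (forall a', hact x a' = op g a') -> forall h',
    hact h' (mr q (ml p a)) = tlift3 twist (coprod3 h') ->
    hact (x * h') (mr q (ml p a)) = tlift3 twist (coprod3 (x * h')).
  move=> GE GT gE xE h' IH; refine (etrans (hact_M _ _ _) (etrans (xE _) _)).
  refine (etrans (congr1 (op g) IH) (etrans _ (esym (GE h' _ twist_trilin)))).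
  refine (tens3_ext (linear_comp (rep_lin opR g) TL) (tlift3_linear (GT _ twist_trilin)) _ (coprod3 h')) => h1 h2 h3.
  refine (etrans (congr1 (op g) (tlift3E twist_trilin h1 h2 h3)) _).
  exact (etrans (gE h1 h2 h3) (esym (tlift3E (GT _ twist_trilin) h1 h2 h3))).
have CL := linear_comp TL (@coprod3_linear K).
elim/h1_ind: h => [||k h h' IH IH'|h IH|h IH|h IH].
- exact (etrans (lin0 (h1_act_linl opR _)) (esym (lin0 CL))).
- refine (etrans (h1_act1 opR _) (esym (etrans (coprod3_1 twist_trilin) _))).
  exact (twistE (act_1 p) (act_1 q) (h1_act1 opR a)).
- refine (etrans (h1_act_linl opR _ k h h') (esym (etrans (CL k h h') _))).
  exact (esym (congr2 (fun x y => k *: x + y) IH IH')).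
- exact (step GenX _ X (fun h' F => coprod3_X h') (@triX_trilin K A) Xtwist hX h IH).
- exact (step GenY _ Y (fun h' F => coprod3_Y h') (@triY_trilin K A) Ytwist hY h IH).
- exact (step (GenD 0) _ d1 (fun h' F => coprod3_d h') (@trid_trilin K A) dtwist hd h IH).
Qed.
End Twisted.

Lemma ht1_ext (L1 L2 : Ht1 -> A) : linear L1 -> linear L2 ->
  (forall p h q, L1 (pure p h q) = L2 (pure p h q)) -> L1 =1 L2.
Proof. exact: tens3_ext. Qed.

Lemma bim_act_linear_at a : linear (fun s => bim_act s a).
Proof. by move=> k u v; exact (congr1 (fun f => f a) (bim_act_linear k u v)). Qed.

Lemma bim_core_linear p h q : linear (bim_core p h q).
Proof. exact (linear_comp (mrL q) (linear_comp (mlL p) (h1_act_linr opR h))). Qed.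

Lemma bim_act_linr s : linear (bim_act s).
Proof.
move=> k x y; move: s.
refine (ht1_ext (bim_act_linear_at (k *: x + y))
  (linear_lcomb k (bim_act_linear_at x) (bim_act_linear_at y)) _) => p h q.
refine (etrans (bim_act_pure p h q _) (etrans (bim_core_linear p h q k x y) _)).
exact (esym (congr2 (fun a b => k *: a + b) (bim_act_pure p h q x) (bim_act_pure p h q y))).
Qed.

Lemma tlift3_post (U V W T T' : lmodType K) (f : U -> V -> W -> T) (g : T -> T') x :
  trilin f -> linear g -> g (tlift3 f x) = tlift3 (fun u v w => g (f u v w)) x.
Proof.
move=> fT gL; move: x; refine (tens3_ext (linear_comp gL (tlift3_linear fT))
  (tlift3_linear (trilin_post fT gL)) _) => u v w.
by rewrite (tlift3E fT) (tlift3E (trilin_post fT gL)).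
Qed.

(** On pure tensors this is [hact_twist] followed by the outer multiplications. The product
    [act h3 q' * q] lists its factors in the order opposite to the one in which [mr] applies them,
    and commutativity of [P] reconciles the two. *)
Lemma bim_act_mul s t a : bim_act (ht1_mul s t) a = bim_act s (bim_act t a).
Proof.
move: s; refine (ht1_ext (linear_comp (bim_act_linear_at a) (ht1_mul_linl t))
  (bim_act_linear_at (bim_act t a)) _) => p h q.
move: t; refine (ht1_ext (linear_comp (bim_act_linear_at a) (ht1_mul_linr (pure p h q)))
  (linear_comp (bim_act_linr (pure p h q)) (bim_act_linear_at a)) _).
move=> p' h' q'; pose G x := mr q (ml p x).
have GL : linear G by exact (linear_comp (mrL q) (mlL p)).
refine (etrans (congr1 (bim_act^~ a) (ht1_mul_pure p h q p' h' q')) _).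
refine (etrans (tlift3_post _ (ht1_core_trilin p q p' h' q') (bim_act_linear_at a)) _).
have TT := twist_trilin p' q' (hact h' a).
refine (etrans _ (esym (etrans (congr1 (bim_act (pure p h q)) (bim_act_pure p' h' q' a))
  (etrans (bim_act_pure p h q _) (etrans (congr1 G (hact_twist p' q' (hact h' a) h))
  (tlift3_post (coprod3 h) TT GL)))))).
congr (tlift3 _ (coprod3 h)).
apply/funext => h1; apply/funext => h2; apply/funext => h3.
refine (etrans (bim_act_pure _ _ _ a) _); rewrite /G /twist.
rewrite (mulrC (act h3 q') q) mrM mlM mlr; congr (mr q (mr _ (ml p (ml _ _)))).
exact (h1_actM opR h2 h' a).
Qed.

Lemma bim_act_alpha p a : bim_act (ht1_alpha p) a = ml p a.
Proof.
refine (etrans (bim_act_pure p 1 1 a) (etrans (mr1 _) _)).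
exact (congr1 (ml p) (h1_act1 opR a)).
Qed.

Lemma bim_act_beta p a : bim_act (ht1_beta p) a = mr p a.
Proof.
refine (etrans (bim_act_pure 1 1 p a) (congr1 (mr p) (etrans (ml1 _) _))).
exact (h1_act1 opR a).
Qed.

Lemma bim_act_tdelta2 a : bim_act (tdelta2 K) a = 0.
Proof.
have D := linD (bim_act_linear_at a); have B := linB (bim_act_linear_at a).
have hL := h1_act_linl opR a.
have E : bim_act (pure 1 (hdelta K 2 - 2^-1 *: hdelta K 1 ^+ 2) 1) a =
    ml (polyZ K 0) a - mr (polyZ K 0) a.
  refine (etrans (bim_act_pure _ _ _ _) (etrans (mr1 _) (etrans (ml1 _) _))).
  refine (etrans (linB hL _ _) (etrans _ (d2E a))).
  refine (congr2 (fun x y => x - y) (h1_actd opR 1 a) (etrans (linZ hL _ _) _)).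
  refine (congr1 ( *:%R 2^-1) (etrans (congr1 (hact^~ a) (expr2 d1)) _)).
  refine (etrans (h1_actM opR _ _ _) (etrans (h1_actd opR 0 _) _)).
  exact (congr1 (op (GenD 0)) (h1_actd opR 0 a)).
refine (etrans (D _ _) (etrans (congr2 +%R (B _ _) (bim_act_beta (polyZ K 0) a)) _)).
refine (etrans (congr2 (fun x y => x - y + mr (polyZ K 0) a) E (bim_act_alpha (polyZ K 0) a)) _).
by rewrite addrAC subrK subrr.
Qed.

Local Notation I := (ideal_gen (@ht1_mul K) [set tdelta2 K]).

Lemma bim_act_ideal u : u \in I -> forall a, bim_act u a = 0.
Proof.
move=> /asboolP Iu; apply: (Iu [set u | forall a, bim_act u a = 0]).
split; last by move=> _ -> a; exact: bim_act_tdelta2.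
split; first split=> [a|k x y x0 y0 a].
- exact (lin0 (bim_act_linear_at a)).
- refine (etrans (bim_act_linear_at a k x y) _).
  by rewrite x0 y0 scaler0 addr0.
move=> s t t0; split=> a; refine (etrans (bim_act_mul _ _ _) _).
- exact (etrans (congr1 (bim_act s) (t0 a)) (lin0 (bim_act_linr s))).
- exact (t0 _).
Qed.

Definition hs_act : Hs -> A -> A := qlift bim_act.

Lemma hs_act_class t a : hs_act (hs_class t) a = bim_act t a.
Proof.
apply/eqP; rewrite -subr_eq0; apply/eqP.
refine (etrans (esym (linB (bim_act_linear_at a) _ _)) _).
exact (bim_act_ideal (lquot_class_repr I t) a).
Qed.

Lemma hs_act_linear a : linear (fun x => hs_act x a).
Proof.
move=> k; elim/hsW => s; elim/hsW => t.
refine (etrans (congr1 (hs_act^~ a) (esym (hs_class_linear k s t))) _).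
refine (etrans (hs_act_class _ _) (etrans (bim_act_linear_at a k s t) _)).
exact (esym (congr2 (fun x y => k *: x + y) (hs_act_class s a) (hs_act_class t a))).
Qed.

Lemma hs_act_mul x y a : hs_act (hs_mul x y) a = hs_act x (hs_act y a).
Proof.
move: x y; elim/hsW => s; elim/hsW => t.
refine (etrans (congr1 (hs_act^~ a) (hs_mulE s t)) _).
refine (etrans (hs_act_class _ _) (etrans (bim_act_mul s t a) _)).
exact (esym (etrans (hs_act_class s _) (congr1 (bim_act s) (hs_act_class t a)))).
Qed.

Lemma hs_act_pure p h q a : hs_act (hs_pure p h q) a = mr q (ml p (hact h a)).
Proof. exact (etrans (hs_act_class _ _) (bim_act_pure p h q a)). Qed.

Lemma hs_act_alpha p x a : hs_act (hs_mul (hs_alpha p) x) a = ml p (hs_act x a).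
Proof.
refine (etrans (hs_act_mul _ _ _) (etrans (hs_act_class _ _) _)).
exact (bim_act_alpha p _).
Qed.

Lemma hs_act_beta p x a : hs_act (hs_mul (hs_beta p) x) a = mr p (hs_act x a).
Proof.
refine (etrans (hs_act_mul _ _ _) (etrans (hs_act_class _ _) _)).
exact (bim_act_beta p _).
Qed.

Variable gm : A -> A -> A.
Hypotheses (gml : forall b, linear (gm^~ b)) (gmr : forall a, linear (gm a))
  (gm_mr : forall a p b, gm a (mr p b) = mr p (gm a b))
  (gm_bal : forall p a b, gm (mr p a) b = gm a (ml p b)).

Definition seq_prod (s : seq A) : A := if s is x :: s' then foldl gm x s' else 0.

Lemma foldl_linear s : linear (fun x => foldl gm x s).
Proof. by elim: s => [//|b s IHs] k u v /=; rewrite gml IHs. Qed.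

Lemma seq_prod_linear s1 s2 : linear (fun x => seq_prod (s1 ++ x :: s2)).
Proof.
case: s1 => [|y s1] /=; first exact: foldl_linear.
move=> k u v; rewrite !foldl_cat /= gmr; exact: foldl_linear.
Qed.

(** Products associate to the left, so with a non-empty prefix [mr p] has to come out of the
    accumulated product by [gm_mr] before [gm_bal] lets it cross to the next factor. *)
Lemma seq_prod_bal s1 s2 p a b :
  seq_prod (s1 ++ mr p a :: b :: s2) = seq_prod (s1 ++ a :: ml p b :: s2).
Proof.
case: s1 => [|y s1] /=; first by rewrite gm_bal.
by rewrite !foldl_cat /= gm_mr gm_bal.
Qed.

Variable n : nat.
Implicit Types (h : 'I_n -> Hs) (a : 'I_n -> A).

Definition tens_prod h a : A := seq_prod [seq hs_act (h i) (a i) | i <- enum 'I_n].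

Definition tens_act : tensP K n -> ('I_n -> A) -> A := qlift (lext tens_prod).

Lemma enum_split (i : 'I_n) : exists s1 s2 : seq 'I_n,
  [/\ enum 'I_n = s1 ++ i :: s2, i \notin s1, i \notin s2 &
      forall j : 'I_n, j = i.+1 :> nat ->
      exists s3, [/\ s2 = j :: s3, j \notin s1 & j \notin s3]].
Proof.
have iE : i \in enum 'I_n by rewrite mem_enum.
have ind : index i (enum 'I_n) = i by rewrite index_enum_ord.
have drE k : (k < n)%N -> drop k (enum 'I_n) = nth i (enum 'I_n) k :: drop k.+1 (enum 'I_n).
  by move=> kn; rewrite (drop_nth i) // size_enum_ord.
have U := enum_uniq 'I_n.
have E : enum 'I_n = take i (enum 'I_n) ++ i :: drop i.+1 (enum 'I_n).
  by rewrite -{1}(cat_take_drop i (enum 'I_n)) (drE i) // nth_ord_enum.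
move: U; rewrite E cat_uniq /= has_sym /= => /and3P[U1 /norP[i1 d12] /andP[i2 U2]].
exists (take i (enum 'I_n)), (drop i.+1 (enum 'I_n)); split=> // j ji.
have sE : drop i.+1 (enum 'I_n) = j :: drop i.+2 (enum 'I_n).
  by rewrite drE -?ji // nth_ord_enum.
exists (drop i.+2 (enum 'I_n)); split=> //.
  by move: d12; rewrite has_sym sE /= => /norP[].
by move: U2; rewrite sE /= => /andP[].
Qed.

Lemma upd_same h i u : upd h i u i = u.
Proof. by rewrite /upd eqxx. Qed.

Lemma upd_other h i u j : j != i -> upd h i u j = h j.
Proof. by rewrite /upd => /negbTE ->. Qed.

Let map_upd h a i u (s : seq 'I_n) : i \notin s ->
  [seq hs_act (upd h i u j) (a j) | j <- s] = [seq hs_act (h j) (a j) | j <- s].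
Proof.
move=> si; apply/eq_in_map => j js; apply: (congr1 (hs_act^~ (a j))).
by apply: upd_other; apply: contraNneq si => <-.
Qed.

Lemma tens_prod_upd h a i : exists s1 s2,
  forall u, tens_prod (upd h i u) a = seq_prod (s1 ++ hs_act u (a i) :: s2).
Proof.
have [s1 [s2 [E i1 i2 _]]] := enum_split i.
exists [seq hs_act (h j) (a j) | j <- s1], [seq hs_act (h j) (a j) | j <- s2] => u.
rewrite /tens_prod E map_cat map_cons (map_upd h a u i1) (map_upd h a u i2).
by rewrite upd_same.
Qed.

Lemma tens_prod_linear h a i : linear (fun u => tens_prod (upd h i u) a).
Proof.
have [s1 [s2 E]] := tens_prod_upd h a i.
apply: (linear_eq E).
exact (linear_comp (seq_prod_linear s1 s2) (hs_act_linear (a i))).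
Qed.

Lemma tens_prod_bal h a (i j : 'I_n) p : j = i.+1 :> nat ->
  tens_prod (upd h i (hs_mul (hs_beta p) (h i))) a =
  tens_prod (upd h j (hs_mul (hs_alpha p) (h j))) a.
Proof.
move=> ji; have [s1 [s2 [E i1 i2 /(_ j ji)[s3 [E2 j1 j3]]]]] := enum_split i.
have nij : j != i by apply/eqP => /(congr1 val) /=; rewrite ji => /esym/n_Sn.
have i3 : i \notin s3 by move: i2; rewrite E2 inE => /norP[].
have nji : i != j by rewrite eq_sym.
pose m (s : seq 'I_n) := [seq hs_act (h k) (a k) | k <- s].
have EL u : tens_prod (upd h i u) a =
    seq_prod (m s1 ++ hs_act u (a i) :: hs_act (h j) (a j) :: m s3).
  rewrite /tens_prod E E2 map_cat !map_cons (map_upd h a u i1) (map_upd h a u i3).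
  by rewrite upd_same (upd_other h u nij).
have ER u : tens_prod (upd h j u) a =
    seq_prod (m s1 ++ hs_act (h i) (a i) :: hs_act u (a j) :: m s3).
  rewrite /tens_prod E E2 map_cat !map_cons (map_upd h a u j1) (map_upd h a u j3).
  by rewrite upd_same (upd_other h u nji).
refine (etrans (EL _) (etrans _ (esym (ER _)))).
refine (etrans (congr1 (fun x => seq_prod (m s1 ++ x :: _)) (hs_act_beta p (h i) (a i))) _).
refine (etrans _ (esym (congr1 (fun x => seq_prod (m s1 ++ _ :: x :: _)) (hs_act_alpha p (h j) (a j))))).
exact (seq_prod_bal (m s1) (m s3) p _ _).
Qed.

Lemma tens_prod_lext_linear a : linear (fun x => lext tens_prod x a).
Proof.
by move=> k u v; exact (congr1 (fun f => f a) (lext_is_linear tens_prod k u v)).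
Qed.

Lemma tens_prod_relators x : x \in lspan (@tensP_relators K n) ->
  forall a, lext tens_prod x a = 0.
Proof.
move=> /asboolP Rx a; have L := tens_prod_lext_linear a.
have E h : lext tens_prod << h >> a = tens_prod h a.
  exact (congr1 (fun f => f a) (lextU tens_prod h)).
apply: (Rx [set x | lext tens_prod x a = 0]); split.
  split=> [|k u v u0 v0]; first exact (lin0 L).
  refine (etrans (L k u v) _).
  by rewrite u0 v0 scaler0 addr0.
move=> _ [[h [i [k [u [v ->]]]]]|[h [i [j [p [ji ->]]]]]].
  refine (lin_rel0 L (etrans (E _) (etrans (tens_prod_linear h a i k u v) _))).
  exact (esym (congr2 (fun x y => k *: x + y) (E _) (E _))).
exact (lin_sub0 L (etrans (E _) (etrans (tens_prod_bal h a p ji) (esym (E _))))).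
Qed.

Lemma tens_act_class x a : tens_act (lquot_class _ x) a = lext tens_prod x a.
Proof.
apply/eqP; rewrite -subr_eq0; apply/eqP.
refine (etrans (esym (linB (tens_prod_lext_linear a) _ _)) _).
exact (tens_prod_relators (lquot_class_repr _ x) a).
Qed.

Lemma tens_act_linear a : linear (fun t => tens_act t a).
Proof.
have W (Q : tensP K n -> Prop) : (forall x, Q (lquot_class _ x)) -> forall t, Q t.
  exact: lquotW.
move=> k; elim/W => x; elim/W => y.
refine (etrans (congr1 (tens_act^~ a) (esym (linearP (lquot_class _) k x y))) _).
refine (etrans (tens_act_class _ _) (etrans (tens_prod_lext_linear a k x y) _)).
exact (esym (congr2 (fun x y => k *: x + y) (tens_act_class x a) (tens_act_class y a))).
Qed.

Lemma tens_act_pure h a : tens_act (lquot_class _ << h >>) a = tens_prod h a.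
Proof.
exact (etrans (tens_act_class _ _) (congr1 (fun f => f a) (lextU tens_prod h))).
Qed.
End BimoduleAction.

(** * Smooth functions *)

Section NearDifferentiable.
Context {R : realType} {V W : normedModType R}.

Lemma near_eq_differentiable (f g : V -> W) x :
  (\near x, f x = g x) -> differentiable f x -> differentiable g x.
Proof.
move=> fg df; have dfE := diff_locally df.
have E : g \o shift x = cst (g x) + 'd f x +o_ 0 id.
  apply/eqaddoP => _/posnumP[e].
  have /eqaddoP/(_ e%:num)/(_ [gt0 of e%:num]) := dfE.
  have fgs : \forall y \near 0, f (y + x) = g (y + x).
    by have := fg; rewrite (near_shift 0) subr0; apply: filterS.
  apply: filterS2 fgs => y fgy.
  by rewrite /= -![(_ + _ : _ -> _) _]/(_ + _) -![(- _ : _ -> _) _]/(- _) /cst /=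
    -fgy (nbhs_singleton fg).
have dE : 'd g x = 'd f x :> (V -> W).
  by apply: diff_unique E; exact: diff_continuous.
apply/diff_locallyP; rewrite dE; split; [exact: diff_continuous|exact: E].
Qed.
End NearDifferentiable.

Lemma open_dist {R : realType} (c r : R) : open [set x : R | `|x - c| < r].
Proof.
have -> : [set x : R | `|x - c| < r] = [set x | c - r < x] `&` [set x | x < c + r].
  rewrite eqEsubset; split=> x; rewrite /= ltr_norml.
    by move=> /andP[x1 x2]; split; lra.
  by move=> [x1 x2]; apply/andP; split; lra.
by apply: openI; [exact: open_gt|exact: open_lt].
Qed.

Section SmoothK.
Context {R : realType}.
Implicit Types V W : normedModType R.

(* The first [k] levels of [smooth_on]; unlike [smooth_on] it lends itself to
   induction on the order of differentiation. *)
Fixpoint smk {V W} (k : nat) (U : set V) (f : V -> W) : Prop :=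
  if k is k'.+1 then (forall z, U z -> differentiable f z) /\ forall v, smk k' U ('D_v f)
  else True.

(** The directions are peeled off at the end of the list, which is the derivative taken first. *)
Lemma smooth_onP V W (U : set V) (f : V -> W) :
  smooth_on U f <-> forall k, smk k U f.
Proof.
split=> [fs k|fs s].
  elim: k f fs => [//|k IHk] f fs; split=> [z Uz|v]; first exact: (fs [::] z Uz).
  by apply: IHk => s z Uz; have := fs (rcons s v) z Uz; rewrite foldr_rcons.
elim/last_ind: s f fs => [|s v IHs] f fs z Uz; first by have [+ _] := fs 1%N; exact.
rewrite foldr_rcons; apply: IHs => // k; have [_] := fs k.+1; exact.
Qed.

Lemma smk_sub V W k (U U' : set V) (f : V -> W) : U' `<=` U -> smk k U f -> smk k U' f.
Proof.
move=> UU'; elim: k f => [//|k IHk] f [df Df]; split=> [z /UU'|v]; first exact: df.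
by apply: IHk; exact: Df.
Qed.

Lemma smk_eq V W k (U : set V) (f g : V -> W) : open U -> (forall z, U z -> f z = g z) ->
  smk k U f -> smk k U g.
Proof.
move=> oU; elim: k f g => [//|k IHk] f g fg [df Df].
have nfg z : U z -> \forall y \near z, f y = g y.
  by move=> Uz; apply: filterS (open_nbhs_nbhs (conj oU Uz)) => y; exact: fg.
split=> [z Uz|v]; first exact: near_eq_differentiable (nfg z Uz) (df z Uz).
by apply: IHk (Df v) => z Uz; exact: near_eq_derive (nfg z Uz).
Qed.

Lemma smkS V W k (U : set V) (f : V -> W) : smk k.+1 U f -> smk k U f.
Proof.
elim: k f => [//|k IHk] f [df Df]; split=> // v; apply: IHk; exact: Df.
Qed.

Lemma smk_cst V W k (U : set V) (a : W) : smk k U (cst a).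
Proof.
elim: k a => [//|k IHk] a; split=> [z _|v]; first exact: differentiable_cst.
have -> : 'D_v (cst a : V -> W) = cst 0 by apply/funext => z; exact: derive_cst.
exact: IHk.
Qed.

Lemma smkD V W k (U : set V) (f g : V -> W) : open U -> smk k U f -> smk k U g ->
  smk k U (fun z => f z + g z).
Proof.
move=> oU; elim: k f g => [//|k IHk] f g [df Df] [dg Dg].
split=> [z Uz|v]; first exact: differentiableD (df z Uz) (dg z Uz).
apply: smk_eq (IHk _ _ (Df v) (Dg v)) => // z Uz.
by rewrite deriveD //; apply: diff_derivable; [exact: df|exact: dg].
Qed.

Lemma smkN V W k (U : set V) (f : V -> W) : open U -> smk k U f ->
  smk k U (fun z => - f z).
Proof.
move=> oU; elim: k f => [//|k IHk] f [df Df].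
split=> [z Uz|v]; first exact: differentiableN (df z Uz).
apply: smk_eq (IHk _ (Df v)) => // z Uz.
by rewrite deriveN //; apply: diff_derivable; exact: df.
Qed.

Lemma smk_sum V W k (U : set V) (I : Type) (r : seq I) (f : I -> V -> W) : open U ->
  (forall i, smk k U (f i)) -> smk k U (fun z => \sum_(i <- r) f i z).
Proof.
move=> oU fs; elim: r => [|i r IHr].
  by apply: smk_eq (smk_cst k U 0) => // z _; rewrite big_nil.
by apply: smk_eq (smkD oU (fs i) IHr) => // z _; rewrite big_cons.
Qed.

Lemma smkM V k (U : set V) (f g : V -> R) : open U -> smk k U f -> smk k U g ->
  smk k U (fun z => f z * g z).
Proof.
move=> oU; elim: k f g => [//|k IHk] f g fs gs; have [df Df] := fs; have [dg Dg] := gs.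
split=> [z Uz|v]; first exact: differentiableM (df z Uz) (dg z Uz).
apply: smk_eq (smkD oU (IHk _ _ (smkS fs) (Dg v)) (IHk _ _ (smkS gs) (Df v))) => // z Uz.
by rewrite deriveM //; apply: diff_derivable; [exact: df|exact: dg].
Qed.

Lemma smkV V k (U : set V) (f : V -> R) : open U -> (forall z, U z -> f z != 0) ->
  smk k U f -> smk k U (fun z => (f z)^-1).
Proof.
move=> oU f0; elim: k => [//|k IHk] fs; have [df Df] := fs.
split=> [z Uz|v]; first exact: differentiableV (df z Uz) (f0 z Uz).
have Vs := IHk (smkS fs).
apply: smk_eq (smkN oU (smkM oU (smkM oU Vs Vs) (Df v))) => // z Uz.
rewrite deriveV ?f0 //; last by apply: diff_derivable; exact: df.
by rewrite expr2 invfM scaleNr.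
Qed.

Lemma smk_pair V W W' k (U : set V) (f : V -> W) (g : V -> W') : open U ->
  smk k U f -> smk k U g -> smk k U (fun z => (f z, g z)).
Proof.
move=> oU; elim: k f g => [//|k IHk] f g [df Df] [dg Dg].
split=> [z Uz|v]; first exact: differentiable_pair (df z Uz) (dg z Uz).
apply: smk_eq (IHk _ _ (Df v) (Dg v)) => // z Uz.
have [dfz dgz] := (df z Uz, dg z Uz).
by rewrite [RHS](deriveE _ (differentiable_pair dfz dgz)) diff_pair // !deriveE.
Qed.

Lemma smk_linear V W k (U : set V) (f : {linear V -> W}) : continuous f -> smk k U f.
Proof.
move=> fc; case: k => [//|k]; split=> [z _|v]; first exact: linear_differentiable.
have -> : 'D_v f = cst (f v).
  by apply/funext => z; rewrite deriveE ?diff_lin //; exact: linear_differentiable.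
exact: smk_cst.
Qed.

Lemma derive_comp1 V (h : R -> R) (f : V -> R) v z :
  differentiable f z -> differentiable h (f z) ->
  'D_v (fun z => h (f z)) z = 'D_1 h (f z) * 'D_v f z.
Proof.
move=> df dh; rewrite [LHS](deriveE _ (differentiable_comp df dh)) diff_comp //=.
rewrite !deriveE // -[X in 'd h _ X]mulr1 [LHS]linearZ /= mulrC //.
Qed.

Lemma derive_comp2 V (g : R * R -> R) (F : V -> R * R) v z :
  differentiable F z -> differentiable g (F z) ->
  'D_v (fun z => g (F z)) z = 'D_(1, 0) g (F z) * ('D_v F z).1 + 'D_(0, 1) g (F z) * ('D_v F z).2.
Proof.
move=> dF dg; rewrite [LHS](deriveE _ (differentiable_comp dF dg)) diff_comp //=.
rewrite !deriveE //; case: ('d F z v) => a b /=.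
have -> : (a, b) = a *: (1, 0) + b *: (0, 1) :> R * R.
  have -> : a *: (1, 0) + b *: (0, 1) = (a * 1 + b * 0, a * 0 + b * 1) :> R * R by [].
  by rewrite !mulr1 !mulr0 addr0 add0r.
by rewrite linearD !linearZ; congr (_ + _); exact: mulrC.
Qed.

Lemma derive_pair V W W' (f : V -> W) (g : V -> W') v z :
  differentiable f z -> differentiable g z ->
  'D_v (fun z => (f z, g z)) z = ('D_v f z, 'D_v g z).
Proof.
by move=> df dg; rewrite [LHS](deriveE _ (differentiable_pair df dg)) diff_pair // !deriveE.
Qed.

Let fst_linear : linear (@fst R R). Proof. by []. Qed.
Let snd_linear : linear (@snd R R). Proof. by []. Qed.
Let fstL : {linear (R^o * R^o)%type -> R^o} :=
  HB.pack (@fst R R) (GRing.isLinear.Build _ _ _ _ _ fst_linear).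
Let sndL : {linear (R^o * R^o)%type -> R^o} :=
  HB.pack (@snd R R) (GRing.isLinear.Build _ _ _ _ _ snd_linear).

Lemma smk_fst k (U : set (R * R)) : smk k U (@fst R R).
Proof. by apply: (@smk_linear _ _ _ _ fstL) => z; exact: cvg_fst. Qed.

Lemma smk_snd k (U : set (R * R)) : smk k U (@snd R R).
Proof. by apply: (@smk_linear _ _ _ _ sndL) => z; exact: cvg_snd. Qed.

Lemma smk_id k (U : set R) : smk k U (@idfun R).
Proof. by apply: (@smk_linear _ _ _ _ (@idfun R)) => z. Qed.

Lemma derive_fst v (z : R * R) : 'D_v (@fst R R) z = v.1.
Proof.
have fc : continuous (fstL : R * R -> R) by move=> x; exact: cvg_fst.
rewrite [LHS]deriveE ?(diff_lin _ fc) //.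
by apply: (@linear_differentiable _ _ _ fstL).
Qed.

Lemma derive_snd v (z : R * R) : 'D_v (@snd R R) z = v.2.
Proof.
have fc : continuous (sndL : R * R -> R) by move=> x; exact: cvg_snd.
rewrite [LHS]deriveE ?(diff_lin _ fc) //.
by apply: (@linear_differentiable _ _ _ sndL).
Qed.

Lemma smk_comp1 V k (U : set V) (U' : set R) (h : R -> R) (f : V -> R) :
  open U -> open U' -> (forall z, U z -> U' (f z)) ->
  smk k U' h -> smk k U f -> smk k U (fun z => h (f z)).
Proof.
move=> oU oU' Uf; elim: k h f Uf => [//|k IHk] h f Uf [dh Dh] fs.
have [df Df] := fs; split=> [z Uz|v].
  by apply: differentiable_comp; [exact: df|exact/dh/Uf].
apply: smk_eq (smkM oU (IHk _ _ Uf (Dh 1) (smkS fs)) (Df v)) => // z Uz.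
by rewrite (derive_comp1 v (df z Uz) (dh _ (Uf z Uz))).
Qed.

Lemma smk_comp2 V k (U : set V) (U' : set (R * R)) (g : R * R -> R) (f1 f2 : V -> R) :
  open U -> open U' -> (forall z, U z -> U' (f1 z, f2 z)) ->
  smk k U' g -> smk k U f1 -> smk k U f2 -> smk k U (fun z => g (f1 z, f2 z)).
Proof.
move=> oU oU' Uf; elim: k g => [//|k IHk] g [dg Dg] fs1 fs2.
have [df1 Df1] := fs1; have [df2 Df2] := fs2.
have dF z : U z -> differentiable (fun z => (f1 z, f2 z)) z.
  by move=> Uz; apply: differentiable_pair; [exact: df1|exact: df2].
split=> [z Uz|v].
  by apply: (differentiable_comp (dF z Uz)); exact/dg/Uf.
have S1 := smkM oU (IHk _ (Dg (1, 0)) (smkS fs1) (smkS fs2)) (Df1 v).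
have S2 := smkM oU (IHk _ (Dg (0, 1)) (smkS fs1) (smkS fs2)) (Df2 v).
apply: smk_eq (smkD oU S1 S2) => // z Uz.
rewrite (derive_comp2 v (dF z Uz)); last exact/dg/Uf.
by rewrite (derive_pair v (df1 z Uz) (df2 z Uz)).
Qed.

Lemma derive_dir (f : R -> R) v x : differentiable f x -> 'D_v f x = v * 'D_1 f x.
Proof. by move=> df; rewrite !deriveE // -[X in 'd f x X]mulr1 [LHS]linearZ. Qed.
End SmoothK.

(** * Symmetry of second derivatives *)

Section MixedDerivatives.
Context {R : realType}.
Implicit Types f : R * R -> R.

Lemma MVT_differentiable (g : R -> R) (a b : R) : a < b -> (forall x, differentiable g x) ->
  exists2 c, a < c < b & g b - g a = 'D_1 g c * (b - a).
Proof.
move=> ab dg; have [||c cab E] := @MVT R g (fun x => 'D_1 g x) a b ab.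
- by move=> x _; apply: derivableP; exact: diff_derivable.
- apply: continuous_subspaceT => x; exact: differentiable_continuous.
by exists c.
Qed.

Lemma derive_line1 f (c s : R) : differentiable f (s, c) ->
  differentiable (fun s => f (s, c)) s /\ 'D_1 (fun s => f (s, c)) s = 'D_(1, 0) f (s, c).
Proof.
move=> df; have dF : differentiable (fun s : R => (s, c)) s by exact: differentiable_pair.
split; first exact: (differentiable_comp dF).
rewrite (derive_comp2 _ dF) // derive_pair // derive_id derive_cst /=.
by rewrite mulr1 mulr0 addr0.
Qed.

Lemma derive_line2 f (c s : R) : differentiable f (c, s) ->
  differentiable (fun s => f (c, s)) s /\ 'D_1 (fun s => f (c, s)) s = 'D_(0, 1) f (c, s).
Proof.
move=> df; have dF : differentiable (fun s : R => (c, s)) s by exact: differentiable_pair.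
split; first exact: (differentiable_comp dF).
rewrite (derive_comp2 _ dF) // derive_pair // derive_id derive_cst /=.
by rewrite mulr1 mulr0 add0r.
Qed.

Let sub_sub_swap (a b c d : R) : a - b - (c - d) = a - c - (b - d).
Proof. by ring. Qed.

Let dist_lt_shift (x s h r : R) : h <= r -> x < s < x + h -> `|x - s| < r.
Proof. by move=> hr /andP[xs sx]; rewrite distrC gtr0_norm ?subr_gt0 //; lra. Qed.

Let second_difference f (x y h : R) : smk 2 setT f -> 0 < h ->
  exists p : R * R, [/\ x < p.1 < x + h, y < p.2 < y + h &
    f (x + h, y + h) - f (x + h, y) - (f (x, y + h) - f (x, y)) =
      'D_(0, 1) ('D_(1, 0) f) p * h * h].
Proof.
move=> [df Df] h0; pose g s := f (s, y + h) - f (s, y).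
have dg s : differentiable g s.
  by apply: differentiableB; apply: (derive_line1 _).1; exact: df.
have Dg s : 'D_1 g s = 'D_(1, 0) f (s, y + h) - 'D_(1, 0) f (s, y).
  have l1 c := derive_line1 (df (s, c) I).
  by rewrite deriveB ?(l1 _).2 //; apply: diff_derivable; exact: (l1 _).1.
have xh : x < x + h by rewrite ltrDl.
have yh : y < y + h by rewrite ltrDl.
have [c1 c1x E1] := MVT_differentiable xh dg.
have [dD _] := Df (1, 0).
have [c2 c2y E2] := MVT_differentiable yh (fun s => (derive_line2 (dD (c1, s) I)).1).
exists (c1, c2); split => //=.
rewrite -/(g (x + h)) -/(g x) E1 Dg E2 (derive_line2 (dD _ I)).2.
by rewrite !(addrC _ h) !addrK.
Qed.

Let second_difference' f (x y h : R) : smk 2 setT f -> 0 < h ->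
  exists p : R * R, [/\ x < p.1 < x + h, y < p.2 < y + h &
    f (x + h, y + h) - f (x, y + h) - (f (x + h, y) - f (x, y)) =
      'D_(1, 0) ('D_(0, 1) f) p * h * h].
Proof.
move=> [df Df] h0; pose g s := f (x + h, s) - f (x, s).
have dg s : differentiable g s.
  by apply: differentiableB; apply: (derive_line2 _).1; exact: df.
have Dg s : 'D_1 g s = 'D_(0, 1) f (x + h, s) - 'D_(0, 1) f (x, s).
  have l1 c := derive_line2 (df (c, s) I).
  by rewrite deriveB ?(l1 _).2 //; apply: diff_derivable; exact: (l1 _).1.
have xh : x < x + h by rewrite ltrDl.
have yh : y < y + h by rewrite ltrDl.
have [c2 c2y E1] := MVT_differentiable yh dg.
have [dD _] := Df (0, 1).
have [c1 c1x E2] := MVT_differentiable xh (fun s => (derive_line1 (dD (s, c2) I)).1).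
exists (c1, c2); split => //=.
rewrite -/(g (y + h)) -/(g y) E1 Dg E2 (derive_line1 (dD _ I)).2.
by rewrite !(addrC _ h) !addrK.
Qed.

(** The second difference over a small square is, by two applications of the mean value theorem in
    either order, [h^2] times either mixed derivative at some point of the square; continuity of
    both derivatives concludes. The relation [[Y, X] = X] on functions rests on this. *)
Lemma derive_mixed f z : smk 3 setT f ->
  'D_(1, 0) ('D_(0, 1) f) z = 'D_(0, 1) ('D_(1, 0) f) z.
Proof.
move=> fs; case: z => x y.
set A : R * R -> R := 'D_(1, 0) ('D_(0, 1) f).
set B : R * R -> R := 'D_(0, 1) ('D_(1, 0) f).
have cA : {for (x, y), continuous A}.
  apply: differentiable_continuous; have [_ /(_ (0, 1))[_ /(_ (1, 0))[+ _]]] := fs.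
  by move/(_ (x, y) I).
have cB : {for (x, y), continuous B}.
  apply: differentiable_continuous; have [_ /(_ (1, 0))[_ /(_ (0, 1))[+ _]]] := fs.
  by move/(_ (x, y) I).
apply/eqP; rewrite -subr_eq0 -normr_le0; apply/ler_addgt0Pl => e e0; rewrite addr0.
have e20 : 0 < e / 2 by rewrite divr_gt0.
have /nbhs_ballP[r1 /= r10 rA] : \forall t \near (x, y), `|A (x, y) - A t| < e / 2.
  by move/cvgrPdist_lt: cA; apply.
have /nbhs_ballP[r2 /= r20 rB] : \forall t \near (x, y), `|B (x, y) - B t| < e / 2.
  by move/cvgrPdist_lt: cB; apply.
have [h [h0 h1 h2]] : exists h, [/\ 0 < h, h <= r1 & h <= r2].
  by exists (Num.min r1 r2); rewrite lt_min r10 r20 !ge_min !lexx orbT.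
have fs2 := smkS fs.
have [p [px py Ep]] := second_difference x y fs2 h0.
have [q [qx qy Eq]] := second_difference' x y fs2 h0.
(* The two second differences group the same four values of [f] differently, so they agree, and
   [h * h] cancels. *)
have AB : A q = B p.
  apply: (mulIf (lt0r_neq0 h0)); apply: (mulIf (lt0r_neq0 h0)).
  exact (etrans (esym Eq) (etrans (sub_sub_swap _ _ _ _) Ep)).
have Aq := rA q (conj (dist_lt_shift h1 qx) (dist_lt_shift h1 qy)).
have Bp := rB p (conj (dist_lt_shift h2 px) (dist_lt_shift h2 py)).
rewrite (splitr e); apply: le_trans (ler_distD (A q) _ _) (ltW (ltrD Aq _)).
by rewrite AB distrC.
Qed.
End MixedDerivatives.

(** * Smooth complex-valued functions through their real and imaginary parts *)

Section ComplexSmooth.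
Context {R : realType}.
Local Notation C := R[i].
Implicit Types (f g : R * R -> C) (U : set (R * R)) (z v : R * R).

Definition csm k U f : Prop :=
  smk k U (fun z => complex.Re (f z)) /\ smk k U (fun z => complex.Im (f z)).

Definition cdiff f z : Prop :=
  differentiable (fun z => complex.Re (f z)) z /\ differentiable (fun z => complex.Im (f z)) z.

Lemma csmoothP f : csmooth f <-> forall k, csm k setT f.
Proof.
split=> [[/smooth_onP fr /smooth_onP fi] k|fs]; first by split.
by split; apply/smooth_onP => k; have [] := fs k.
Qed.

Lemma csm_cdiff U f z : csm 1 U f -> U z -> cdiff f z.
Proof. by move=> [[df _] [dg _]] Uz; split; [exact: df|exact: dg]. Qed.

Lemma csmS k U f : csm k.+1 U f -> csm k U f.
Proof. by move=> [fr fi]; split; exact: smkS. Qed.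

Lemma csm_leq m k U f : (m <= k)%N -> csm k U f -> csm m U f.
Proof.
by move=> /subnK <-; elim: (k - m)%N => [//|l IHl] fs; apply/IHl/csmS.
Qed.

Lemma csm_eq k U f g : open U -> (forall z, U z -> f z = g z) -> csm k U f -> csm k U g.
Proof.
move=> oU fg [fr fi].
by split; [apply: smk_eq fr|apply: smk_eq fi] => // z Uz; rewrite fg.
Qed.

Lemma csm_sub k U U' f : U' `<=` U -> csm k U f -> csm k U' f.
Proof. by move=> UU' [fr fi]; split; apply: (smk_sub UU'). Qed.

Lemma smkU {V W : normedModType R} k (A B : set V) (f : V -> W) :
  smk k A f -> smk k B f -> smk k (A `|` B) f.
Proof.
elim: k f => [//|k IHk] f [fA FA] [fB FB]; split=> [z [Az|Bz]|v].
- exact: fA.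
- exact: fB.
- by apply: IHk; [exact: FA|exact: FB].
Qed.

Lemma csmU k U U' f : csm k U f -> csm k U' f -> csm k (U `|` U') f.
Proof. by move=> [fr fi] [gr gi]; split; exact: smkU. Qed.

Lemma csm_real k U (g : R * R -> R) : smk k U g -> csm k U (fun z => (g z)%:C%C).
Proof. by move=> gs; split=> //; exact: smk_cst. Qed.

Lemma csm_cst k U (a : C) : csm k U (fun=> a).
Proof. by split; exact: smk_cst. Qed.

Let ReD (x y : C) : complex.Re (x + y) = complex.Re x + complex.Re y. Proof. by case: x; case: y. Qed.
Let ImD (x y : C) : complex.Im (x + y) = complex.Im x + complex.Im y. Proof. by case: x; case: y. Qed.
Let ReM (x y : C) : complex.Re (x * y) =
  complex.Re x * complex.Re y - complex.Im x * complex.Im y. Proof. by case: x; case: y. Qed.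
Let ImM (x y : C) : complex.Im (x * y) =
  complex.Re x * complex.Im y + complex.Im x * complex.Re y. Proof. by case: x; case: y. Qed.

Lemma complexP (x y : C) : complex.Re x = complex.Re y -> complex.Im x = complex.Im y -> x = y.
Proof. by case: x y => [a b] [c d] /= -> ->. Qed.

Lemma csmD k U f g : open U -> csm k U f -> csm k U g -> csm k U (fun z => f z + g z).
Proof.
move=> oU [fr fi] [gr gi].
by split; [apply: smk_eq (smkD oU fr gr)|apply: smk_eq (smkD oU fi gi)] => // z _;
  rewrite (ReD, ImD).
Qed.

Lemma csmM k U f g : open U -> csm k U f -> csm k U g -> csm k U (fun z => f z * g z).
Proof.
move=> oU [fr fi] [gr gi].
split; [apply: smk_eq (smkD oU (smkM oU fr gr) (smkN oU (smkM oU fi gi)))|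
  apply: smk_eq (smkD oU (smkM oU fr gi) (smkM oU fi gr))] => // z _;
  by rewrite (ReM, ImM).
Qed.

Lemma csm_cderive k U v f : csm k.+1 U f -> csm k U (cderive v f).
Proof. by move=> [[_ fr] [_ fi]]; split; [exact: fr|exact: fi]. Qed.

Lemma csm_comp k U U' f (f1 f2 : R * R -> R) : open U -> open U' ->
  (forall z, U z -> U' (f1 z, f2 z)) -> csm k U' f -> smk k U f1 -> smk k U f2 ->
  csm k U (fun z => f (f1 z, f2 z)).
Proof.
move=> oU oU' UU' [fr fi] f1s f2s; split.
  exact: (smk_comp2 oU oU' UU' fr f1s f2s).
exact: (smk_comp2 oU oU' UU' fi f1s f2s).
Qed.

Let ReDf f g : (fun w => complex.Re (f w + g w)) =
  (fun w => complex.Re (f w)) + (fun w => complex.Re (g w)).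
Proof. by apply/funext => w; rewrite ReD. Qed.
Let ImDf f g : (fun w => complex.Im (f w + g w)) =
  (fun w => complex.Im (f w)) + (fun w => complex.Im (g w)).
Proof. by apply/funext => w; rewrite ImD. Qed.
Let ReMf f g : (fun w => complex.Re (f w * g w)) =
  (fun w => complex.Re (f w)) * (fun w => complex.Re (g w)) -
  (fun w => complex.Im (f w)) * (fun w => complex.Im (g w)).
Proof. by apply/funext => w; rewrite ReM. Qed.
Let ImMf f g : (fun w => complex.Im (f w * g w)) =
  (fun w => complex.Re (f w)) * (fun w => complex.Im (g w)) +
  (fun w => complex.Im (f w)) * (fun w => complex.Re (g w)).
Proof. by apply/funext => w; rewrite ImM. Qed.

Lemma cderiveD v f g z : cdiff f z -> cdiff g z ->
  cderive v (fun z => f z + g z) z = cderive v f z + cderive v g z.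
Proof.
move=> [fr fi] [gr gi]; apply: complexP.
  rewrite ReD /cderive [LHS]/= ReDf deriveD //; exact: diff_derivable.
rewrite ImD /cderive [LHS]/= ImDf deriveD //; exact: diff_derivable.
Qed.

Let derM v (p q : R * R -> R) z : differentiable p z -> differentiable q z ->
  'D_v (p * q) z = p z * 'D_v q z + q z * 'D_v p z.
Proof. by move=> dp dq; rewrite deriveM //; exact: diff_derivable. Qed.

Let derMB v (p q p' q' : R * R -> R) z : differentiable p z -> differentiable q z ->
  differentiable p' z -> differentiable q' z ->
  'D_v (p * q - p' * q') z = p z * 'D_v q z + q z * 'D_v p z
    - (p' z * 'D_v q' z + q' z * 'D_v p' z).
Proof.
move=> dp dq dp' dq'.
have dpq : derivable (p * q) z v := diff_derivable (differentiableM dp dq).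
have dpq' : derivable (p' * q') z v := diff_derivable (differentiableM dp' dq').
by rewrite (deriveB dpq dpq') !derM.
Qed.

Let derMD v (p q p' q' : R * R -> R) z : differentiable p z -> differentiable q z ->
  differentiable p' z -> differentiable q' z ->
  'D_v (p * q + p' * q') z = p z * 'D_v q z + q z * 'D_v p z
    + (p' z * 'D_v q' z + q' z * 'D_v p' z).
Proof.
move=> dp dq dp' dq'.
have dpq : derivable (p * q) z v := diff_derivable (differentiableM dp dq).
have dpq' : derivable (p' * q') z v := diff_derivable (differentiableM dp' dq').
by rewrite (deriveD dpq dpq') !derM.
Qed.

Let leibniz_arith (a b c d a' b' c' d' : R) :
  Complex (a * c' + c * a' - (b * d' + d * b')) (a * d' + d * a' + (b * c' + c * b')) =
  Complex a' b' * Complex c d + Complex a b * Complex c' d'.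
Proof. by apply: complexP => /=; ring. Qed.

Let cfE (x : C) : x = Complex (complex.Re x) (complex.Im x).
Proof. by case: x. Qed.

Lemma cderiveM v f g z : cdiff f z -> cdiff g z ->
  cderive v (fun z => f z * g z) z = cderive v f z * g z + f z * cderive v g z.
Proof.
move=> [fr fi] [gr gi].
have Er := etrans (congr1 (fun h => 'D_v h z) (ReMf f g)) (derMB v fr gr fi gi).
have Ei := etrans (congr1 (fun h => 'D_v h z) (ImMf f g)) (derMD v fr gi fi gr).
refine (etrans (congr2 (@Complex R) Er Ei) _).
refine (etrans (leibniz_arith _ _ _ _ _ _ _ _) _).
exact (congr2 (fun a b => cderive v f z * b + a * cderive v g z) (esym (cfE (f z))) (esym (cfE (g z)))).
Qed.

Lemma cdiff_cst (a : C) z : cdiff (fun=> a) z.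
Proof. by split; exact: differentiable_cst. Qed.

Lemma cdiffM f g z : cdiff f z -> cdiff g z -> cdiff (fun z => f z * g z) z.
Proof.
move=> [fr fi] [gr gi]; split.
  exact (eq_ind_r (fun h => differentiable h z)
    (differentiableB (differentiableM fr gr) (differentiableM fi gi)) (ReMf f g)).
exact (eq_ind_r (fun h => differentiable h z)
  (differentiableD (differentiableM fr gi) (differentiableM fi gr)) (ImMf f g)).
Qed.

Lemma cderive_eq v f g z : (\near z, f z = g z) -> cderive v f z = cderive v g z.
Proof.
move=> fg; rewrite /cderive; congr Complex; apply: near_eq_derive;
  by apply: filterS fg => w ->.
Qed.

Lemma cderive_cst v (a : C) z : cderive v (fun=> a) z = 0.
Proof. by apply: complexP; exact: derive_cst. Qed.

Lemma cderiveZ v (a : C) f z : cdiff f z ->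
  cderive v (fun z => a * f z) z = a * cderive v f z.
Proof.
move=> df; have da : cdiff (fun=> a) z by split; exact: differentiable_cst.
refine (etrans (cderiveM v da df) _).
by rewrite cderive_cst mul0r add0r.
Qed.

Lemma cderive_real v (g : R * R -> R) z :
  cderive v (fun z => (g z)%:C%C) z = ('D_v g z)%:C%C.
Proof. by apply: complexP => //=; exact: derive_cst. Qed.

Let chain_arith (a b c d p q : R) :
  Complex (a * p + c * q) (b * p + d * q) = Complex a b * p%:C%C + Complex c d * q%:C%C.
Proof. by apply: complexP => /=; ring. Qed.

Lemma cderive_comp v f (f1 f2 : R * R -> R) z : differentiable f1 z -> differentiable f2 z ->
  cdiff f (f1 z, f2 z) ->
  cderive v (fun z => f (f1 z, f2 z)) z =
    cderive (1, 0) f (f1 z, f2 z) * ('D_v f1 z)%:C%C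
      + cderive (0, 1) f (f1 z, f2 z) * ('D_v f2 z)%:C%C.
Proof.
move=> df1 df2 [fr fi].
have dF := differentiable_pair df1 df2.
have DF := derive_pair v df1 df2.
have Er := etrans (derive_comp2 v dF fr) (congr2 (fun p q => _ * p + _ * q) (congr1 fst DF) (congr1 snd DF)).
have Ei := etrans (derive_comp2 v dF fi) (congr2 (fun p q => _ * p + _ * q) (congr1 fst DF) (congr1 snd DF)).
refine (etrans (congr2 (@Complex R) Er Ei) _).
exact: chain_arith.
Qed.

Lemma cderive_mixed f z : csm 3 setT f ->
  cderive (1, 0) (cderive (0, 1) f) z = cderive (0, 1) (cderive (1, 0) f) z.
Proof.
move=> [fr fi].
exact (congr2 (@Complex R) (derive_mixed z fr) (derive_mixed z fi)).
Qed.
End ComplexSmooth.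

(** * Local diffeomorphisms and their lifts *)

Section PartialMapFacts.
Context {T : pointedType}.
Implicit Types phi psi : T -> set T.

Lemma papp_eq phi x y : is_subset1 (phi x) -> phi x y -> papp phi x = y.
Proof. by move=> s1 xy; apply: s1 => //; exact: (getPex (ex_intro _ y xy)). Qed.

Lemma papp_dom phi x : pdom phi x -> phi x (papp phi x).
Proof. exact: getPex. Qed.
End PartialMapFacts.

Section LocalDiffeo.
Context {R : realType}.
Implicit Types (phi psi : R -> set R).

Definition pinvf phi : R -> R := papp (pinv phi).

Lemma smooth_smk {V W : normedModType R} (U : set V) (f : V -> W) k :
  smooth_on U f -> smk k U f.
Proof. by move=> /smooth_onP; exact. Qed.

Lemma local_diffeo_inv phi : local_diffeo phi -> local_diffeo (pinv phi).
Proof.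
by case=> f1 f2 o1 o2 s1 s2; split.
Qed.

Section Facts.
Variable phi : R -> set R.
Hypothesis phiD : local_diffeo phi.

Lemma papp_graph x y : phi x y -> papp phi x = y.
Proof. by move=> xy; apply: papp_eq xy; exact: ld_fun. Qed.

Lemma pinvf_graph x y : phi x y -> pinvf phi y = x.
Proof. by move=> xy; apply: (@papp_eq _ (pinv phi) y x) xy; exact: ld_inj. Qed.

Lemma papp_ran x : pdom phi x -> pran phi (papp phi x).
Proof. by move=> xd; exists x; exact: papp_dom. Qed.

Lemma pinvf_dom y : pran phi y -> pdom phi (pinvf phi y).
Proof. by move=> [x xy]; rewrite (pinvf_graph xy); exists y. Qed.

Lemma pinvfK y : pran phi y -> papp phi (pinvf phi y) = y.
Proof. by move=> [x xy]; rewrite (pinvf_graph xy) (papp_graph xy). Qed.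

Lemma pappK x : pdom phi x -> pinvf phi (papp phi x) = x.
Proof. by move=> [y xy]; rewrite (papp_graph xy) (pinvf_graph xy). Qed.

Lemma graph_pinvf y : pran phi y -> phi (pinvf phi y) y.
Proof. by move=> [x xy]; rewrite (pinvf_graph xy). Qed.

Lemma papp_smk k : smk k (pdom phi) (papp phi).
Proof. exact: smooth_smk (ld_smooth phiD). Qed.

Lemma pinvf_smk k : smk k (pran phi) (pinvf phi).
Proof. exact: smooth_smk (ld_smooth_inv phiD). Qed.

Lemma derive_papp_pinvf y : pran phi y ->
  'D_1 (papp phi) (pinvf phi y) * 'D_1 (pinvf phi) y = 1.
Proof.
move=> yr; have [/(_ y yr) dp _] := pinvf_smk 1.
have [/(_ _ (pinvf_dom yr)) df _] := papp_smk 1.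
rewrite -derive_comp1 // -[RHS](derive_id y 1); apply: near_eq_derive.
apply: filterS (open_nbhs_nbhs (conj (ld_open_ran phiD) yr)) => z.
exact: pinvfK.
Qed.

Hypothesis phiO : orientation_preserving phi.

Lemma derive_papp_gt0 x : pdom phi x -> 0 < 'D_1 (papp phi) x.
Proof. by move=> xd; rewrite -derive1E; exact: phiO. Qed.

Lemma derive_pinvf_gt0 y : pran phi y -> 0 < 'D_1 (pinvf phi) y.
Proof.
move=> yr; rewrite -(pmulr_rgt0 _ (derive_papp_gt0 (pinvf_dom yr))).
by rewrite derive_papp_pinvf.
Qed.

Lemma orientation_inv : orientation_preserving (pinv phi).
Proof. by move=> y yr; rewrite derive1E; exact: derive_pinvf_gt0. Qed.

Definition hran : set (R * R) := [set z | pran phi z.1 /\ 0 < z.2].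

(** As [phi' > 0], multiplication by it maps the positive half-line onto itself, so the range of the
    lift is the full product over the range of [phi]. *)
Lemma half_lift_pran : pran (half_lift phi) = hran.
Proof.
rewrite eqEsubset; split=> [z [w [wz w2 zE]]|z [zr z2]].
  have wd : pdom phi w.1 by exists z.1.
  split; first by exists w.1.
  by rewrite zE mulr_gt0 // derive1E derive_papp_gt0.
exists (pinvf phi z.1, 'D_1 (pinvf phi) z.1 * z.2); split => /=.
- exact: graph_pinvf.
- by rewrite mulr_gt0 // derive_pinvf_gt0.
- by rewrite mulrA derive1E derive_papp_pinvf ?mul1r.
Qed.

Lemma half_lift_inv z : hran z ->
  papp (pinv (half_lift phi)) z = (pinvf phi z.1, 'D_1 (pinvf phi) z.1 * z.2).
Proof.
move=> [zr z2]; apply: papp_eq.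
  move=> [w1 w2] [w1' w2'] [/= a0 _ a1] [/= b0 _ b1].
  have e1 : w1 = w1' by rewrite -(pinvf_graph a0) -(pinvf_graph b0).
  rewrite e1; congr (_, _); move: a1; rewrite b1 e1 derive1E => /mulfI -> //.
  by apply: lt0r_neq0; apply: derive_papp_gt0; exists z.1.
split => /=.
- exact: graph_pinvf.
- by rewrite mulr_gt0 // derive_pinvf_gt0.
- by rewrite mulrA derive1E derive_papp_pinvf ?mul1r.
Qed.

Lemma hran_open : open hran.
Proof.
have -> : hran = fst @^-1` pran phi `&` snd @^-1` [set y : R | 0 < y].
  by rewrite eqEsubset; split.
apply: openI.
  by apply: open_comp (ld_open_ran phiD) => z _; exact: cvg_fst.
have og : open [set y : R | 0 < y] by exact: open_gt.
by apply: open_comp og => z _; exact: cvg_snd.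
Qed.

Lemma smk_fst_comp k (g : R -> R) : smk k (pran phi) g -> smk k hran (fun z => g z.1).
Proof.
move=> gs; apply: (smk_comp1 hran_open (ld_open_ran phiD) _ gs (smk_fst _ _)).
by move=> z [].
Qed.
End Facts.
End LocalDiffeo.

(** * The groupoid algebra *)

Section GroupoidElements.
Context {R : realType} (Gamma : set (R -> set R)).
Local Notation C := R[i].
Local Notation A := (groupoid_alg Gamma).
Local Notation mono := (is_monomial Gamma).
Local Notation fn := (R * R -> C).
Implicit Types (f g : fn) (phi psi : R -> set R).

Definition mono_class (m : monomial Gamma) : A := lquot_class _ << m >>.

Definition mk_mono f phi (H : mono (f, phi)) : monomial Gamma :=
  exist (fun m => `[< mono m >]) (f, phi) (introT (asboolP _) H).

Lemma monoUE f phi (H : mono (f, phi)) : monoU Gamma f phi = mono_class (mk_mono H).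
Proof.
rewrite /monoU; case: insubP => [m _ mE|/asboolP //].
by congr mono_class; apply: val_inj.
Qed.

Lemma monoP (m : monomial Gamma) : mono (mono_fun m, mono_map m).
Proof. by have /asboolP := valP m; rewrite /mono_fun /mono_map -surjective_pairing. Qed.

Lemma mono_classE m : mono_class m = monoU Gamma (mono_fun m) (mono_map m).
Proof.
rewrite (monoUE (monoP m)); congr mono_class; apply: val_inj.
by rewrite /= /mono_fun /mono_map -surjective_pairing.
Qed.

Lemma galg_ind (Q : A -> Prop) : Q 0 ->
  (forall k f phi x, mono (f, phi) -> Q x -> Q (k *: monoU Gamma f phi + x)) ->
  forall x, Q x.
Proof.
move=> Q0 QD; apply: lquotW => x; elim/malg_ind: x => [|k m x IH].
  exact (eq_ind_r Q Q0 (linear0 (lquot_class _))).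
refine (eq_ind_r Q _ (linearP (lquot_class _) k << m >> x)).
have := QD k _ _ _ (monoP m) IH.
exact (eq_ind_r (fun y => Q (k *: y + lquot_class _ x) -> _) id (esym (mono_classE m))).
Qed.

Lemma galg_ext (T : lmodType C) (L1 L2 : A -> T) : linear L1 -> linear L2 ->
  (forall f phi, mono (f, phi) -> L1 (monoU Gamma f phi) = L2 (monoU Gamma f phi)) ->
  L1 =1 L2.
Proof.
move=> L1L L2L E; apply: galg_ind => [|k f phi x H IH].
  exact (etrans (lin0 L1L) (esym (lin0 L2L))).
refine (etrans (L1L _ _ _) (etrans _ (esym (L2L _ _ _)))).
exact (congr2 (fun a b => k *: a + b) (E f phi H) IH).
Qed.

Section MonoLift.
Context {T : lmodType C} (F : fn -> (R -> set R) -> T).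
Hypotheses
  (F_lin : forall a f f1 f2 phi, mono (f, phi) -> mono (f1, phi) -> mono (f2, phi) ->
    (forall z, f z = a * f1 z + f2 z) -> F f phi = a *: F f1 phi + F f2 phi)
  (F_restr : forall f phi phi', mono (f, phi) -> mono (f, phi') -> psub phi' phi ->
    F f phi = F f phi').

Let G := lext (fun m : monomial Gamma => F (mono_fun m) (mono_map m)).

Let GU m : G << m >> = F (mono_fun m) (mono_map m). Proof. exact: lextU. Qed.
Let GL : linear G. Proof. exact: lext_is_linear. Qed.

Let G_rel x : x \in lspan (@groupoid_relators R Gamma) -> G x = 0.
Proof.
move=> /asboolP Rx; apply: (Rx [set x | G x = 0]); split.
  split=> [|k u v u0 v0]; first exact (lin0 GL).
  refine (etrans (GL k u v) _); rewrite u0 v0 scaler0 addr0 //.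
move=> _ [[a [m [m1 [m2 [e1 e2 E ->]]]]]|[m [m' [sub e ->]]]].
  refine (lin_rel0 GL (etrans (GU m) (etrans _ (esym (congr2 (fun x y => a *: x + y) (GU m1) (GU m2)))))).
  have M1 := monoP m1; have M2 := monoP m2.
  rewrite e1 in M1 *; rewrite e2 in M2 *.
  exact: (F_lin (monoP m) M1 M2 E).
refine (lin_sub0 GL (etrans (GU m) (etrans _ (esym (GU m'))))).
have M' := monoP m'; rewrite e in M' *.
exact: (F_restr (monoP m) M' sub).
Qed.

Lemma mono_lift_class x : mono_lift F (lquot_class _ x) = G x.
Proof.
apply/eqP; rewrite -subr_eq0; apply/eqP.
refine (etrans (esym (linB GL _ _)) _).
exact (G_rel (lquot_class_repr _ x)).
Qed.

Lemma mono_lift_linear : linear (mono_lift F : A -> T).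
Proof.
have W (Q : A -> Prop) : (forall x, Q (lquot_class _ x)) -> forall t, Q t by exact: lquotW.
move=> k; elim/W => x; elim/W => y.
refine (etrans (congr1 (mono_lift F) (esym (linearP (lquot_class _) k x y))) _).
refine (etrans (mono_lift_class _) (etrans (GL k x y) _)).
exact (esym (congr2 (fun x y => k *: x + y) (mono_lift_class x) (mono_lift_class y))).
Qed.

Lemma mono_liftE f phi : mono (f, phi) -> mono_lift F (monoU Gamma f phi) = F f phi.
Proof.
move=> H; refine (etrans (congr1 (mono_lift F) (monoUE H)) _).
exact (etrans (mono_lift_class _) (GU _)).
Qed.
End MonoLift.

Lemma monoU_lin a f f1 f2 phi : mono (f, phi) -> mono (f1, phi) -> mono (f2, phi) ->
  (forall z, f z = a * f1 z + f2 z) ->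
  monoU Gamma f phi = a *: monoU Gamma f1 phi + monoU Gamma f2 phi.
Proof.
move=> M M1 M2 E; rewrite (monoUE M) (monoUE M1) (monoUE M2).
apply/eqP; rewrite -subr_eq0 opprD addrA; apply/eqP.
set m := mk_mono M; set m1 := mk_mono M1; set m2 := mk_mono M2.
have L : linear (lquot_class (lspan (@groupoid_relators R Gamma))) by exact: linearP.
have r : << m >> - a *: << m1 >> - << m2 >> \in lspan (@groupoid_relators R Gamma).
  apply: lspan_sub; left; by exists a, m, m1, m2; split.
have r0 : lquot_class (lspan (@groupoid_relators R Gamma)) (<< m >> - a *: << m1 >> - << m2 >>) = 0.
  refine (etrans _ (lin0 L)); apply/lquotP.
  exact (eq_ind_r (fun x => x \in lspan (@groupoid_relators R Gamma)) r (subr0 _)).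
refine (etrans (esym _) r0).
refine (etrans (linB L _ _) (congr1 (fun x => x - _) (etrans (linB L _ _) _))).
exact (congr1 (fun x => _ - x) (linZ L a _)).
Qed.

Lemma monoU_restr f phi phi' : mono (f, phi) -> mono (f, phi') -> psub phi' phi ->
  monoU Gamma f phi = monoU Gamma f phi'.
Proof.
move=> M M' sub; rewrite (monoUE M) (monoUE M').
apply/lquotP; apply: lspan_sub; right.
by exists (mk_mono M), (mk_mono M').
Qed.

Lemma monoU_eq f f' phi : (forall z, f z = f' z) -> monoU Gamma f phi = monoU Gamma f' phi.
Proof. by move=> /funext ->. Qed.

(** An operator on the coefficient [f] depending on [phi]. The three conditions make it descend to
    the quotient by [groupoid_relators]; identities between such operators can then be checked
    pointwise on monomials. *)
Record local_op (L : (R -> set R) -> fn -> fn) : Prop := LocalOp {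
  lop_mono : forall f phi, mono (f, phi) -> mono (L phi f, phi);
  lop_lin : forall a f f1 f2 phi, mono (f, phi) -> mono (f1, phi) -> mono (f2, phi) ->
    (forall z, f z = a * f1 z + f2 z) -> forall z, L phi f z = a * L phi f1 z + L phi f2 z;
  lop_restr : forall f phi phi', mono (f, phi) -> mono (f, phi') -> psub phi' phi ->
    forall z, L phi f z = L phi' f z }.

Section LocalOp.
Variable L : (R -> set R) -> fn -> fn.
Hypothesis LP : local_op L.
Let F f phi := monoU Gamma (L phi f) phi.

Let F_lin a f f1 f2 phi : mono (f, phi) -> mono (f1, phi) -> mono (f2, phi) ->
  (forall z, f z = a * f1 z + f2 z) -> F f phi = a *: F f1 phi + F f2 phi.
Proof.
by move=> M M1 M2 E; apply: monoU_lin (lop_lin LP M M1 M2 E); exact: lop_mono.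
Qed.

Let F_restr f phi phi' : mono (f, phi) -> mono (f, phi') -> psub phi' phi ->
  F f phi = F f phi'.
Proof.
move=> M M' sub; have E := funext (lop_restr LP M M' sub).
rewrite /F E; apply: monoU_restr sub; last exact: lop_mono.
by rewrite -E; exact: lop_mono.
Qed.

Lemma local_op_linear : linear (mono_lift (fun f phi => monoU Gamma (L phi f) phi) : A -> A).
Proof. exact: (mono_lift_linear F_lin F_restr). Qed.

Lemma local_opE f phi : mono (f, phi) ->
  mono_lift (fun f phi => monoU Gamma (L phi f) phi) (monoU Gamma f phi)
    = monoU Gamma (L phi f) phi.
Proof. exact: (mono_liftE F_lin F_restr). Qed.
End LocalOp.

Lemma local_op_comp L L' : local_op L -> local_op L' ->
  local_op (fun phi f => L phi (L' phi f)).
Proof.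
move=> LP LP'; split=> [f phi M|a f f1 f2 phi M M1 M2 E|f phi phi' M M' sub].
- by apply: (lop_mono LP); exact: lop_mono.
- by apply: (lop_lin LP) (lop_lin LP' M M1 M2 E); exact: lop_mono.
- move=> z; have E := funext (lop_restr LP' M M' sub); rewrite E.
  by apply: (lop_restr LP) sub z; [rewrite -E|]; exact: lop_mono.
Qed.

(** Adds up the coefficient functions at [z], whatever their partial maps. Both kinds of relators
    respect this, which gives a linear functional able to see the value of a product at one
    point. *)
Definition ev (z : R * R) : A -> C^o := mono_lift (fun f _ => f z : C^o).

Lemma ev_linear z : linear (ev z).
Proof. by apply: mono_lift_linear => // a f f1 f2 phi _ _ _ ->. Qed.

Lemma evE z f phi : mono (f, phi) -> ev z (monoU Gamma f phi) = f z.
Proof. by move=> M; apply: (mono_liftE (F := fun f _ => f z : C^o)) M => // a g f1 f2 psi _ _ _ ->. Qed.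
End GroupoidElements.

(** * The vector fields [y d/dx] and [y d/dy] *)

Section ScaledDerivatives.
Context {R : realType}.
Local Notation C := R[i].
Implicit Types (f g : R * R -> C) (U : set (R * R)) (z : R * R).

Lemma csm_snd k U : csm k U (fun z => (z.2)%:C%C).
Proof. by apply: csm_real; exact: smk_snd. Qed.

Lemma csm_ydx k U f : open U -> csm k.+1 U f -> csm k U (y_dx f).
Proof. by move=> oU fs; apply: csmM => //; [exact: csm_snd|exact: csm_cderive]. Qed.

Lemma csm_ydy k U f : open U -> csm k.+1 U f -> csm k U (y_dy f).
Proof. by move=> oU fs; apply: csmM => //; [exact: csm_snd|exact: csm_cderive]. Qed.

Lemma y_dx_eq f g z : (\near z, f z = g z) -> y_dx f z = y_dx g z.
Proof. by move=> fg; rewrite /y_dx (cderive_eq _ fg). Qed.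

Lemma y_dy_eq f g z : (\near z, f z = g z) -> y_dy f z = y_dy g z.
Proof. by move=> fg; rewrite /y_dy (cderive_eq _ fg). Qed.

Lemma y_dxM f g z : cdiff f z -> cdiff g z ->
  y_dx (fun z => f z * g z) z = y_dx f z * g z + f z * y_dx g z.
Proof. by move=> df dg; rewrite /y_dx cderiveM // mulrDr mulrA mulrCA. Qed.

Lemma y_dyM f g z : cdiff f z -> cdiff g z ->
  y_dy (fun z => f z * g z) z = y_dy f z * g z + f z * y_dy g z.
Proof. by move=> df dg; rewrite /y_dy cderiveM // mulrDr mulrA mulrCA. Qed.

Lemma y_dx_lin a f g z : cdiff f z -> cdiff g z ->
  y_dx (fun z => a * f z + g z) z = a * y_dx f z + y_dx g z.
Proof.
move=> df dg; have daf := cdiffM (cdiff_cst a z) df.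
by rewrite /y_dx (cderiveD _ daf dg) (cderiveZ _ _ df) mulrDr mulrCA.
Qed.

Lemma y_dy_lin a f g z : cdiff f z -> cdiff g z ->
  y_dy (fun z => a * f z + g z) z = a * y_dy f z + y_dy g z.
Proof.
move=> df dg; have daf := cdiffM (cdiff_cst a z) df.
by rewrite /y_dy (cderiveD _ daf dg) (cderiveZ _ _ df) mulrDr mulrCA.
Qed.

Lemma y_dx_snd z : y_dx (fun z => (z.2)%:C%C : C) z = 0.
Proof.
by rewrite /y_dx cderive_real derive_snd /= (rmorph0 (real_complex R)) mulr0.
Qed.

Lemma y_dy_snd z : y_dy (fun z => (z.2)%:C%C : C) z = (z.2)%:C%C.
Proof.
by rewrite /y_dy cderive_real derive_snd /= (rmorph1 (real_complex R)) mulr1.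
Qed.

Let ydydx_arith (a b c d s p q p' q' : C) :
  a = p * c + s * p' -> b = q * d + s * q' -> p = s -> q = 0 -> p' = q' -> a = b + s * c.
Proof. by move=> -> -> -> -> ->; rewrite mul0r add0r addrC. Qed.

Lemma y_dydx f z : csm 3 setT f ->
  y_dy (y_dx f) z = y_dx (y_dy f) z + y_dx f z.
Proof.
move=> fs.
have dsnd : cdiff (fun z => (z.2)%:C%C : C) z by apply: (@csm_cdiff _ setT) => //; exact: csm_snd.
have dd v : cdiff (cderive v f) z.
  by apply: (@csm_cdiff _ setT) => //; apply: csm_cderive; apply: csm_leq fs.
have Ex := y_dyM dsnd (dd (1, 0)); have Ey := y_dxM dsnd (dd (0, 1)).
have Em : y_dy (cderive (1, 0) f) z = y_dx (cderive (0, 1) f) z.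
  by rewrite /y_dy /y_dx (cderive_mixed _ fs).
exact (@ydydx_arith _ _ _ _ _ _ _ _ _ Ex Ey (y_dy_snd z) (y_dx_snd z) Em).
Qed.

Section Homogeneous.
Variables (V : set R) (g : R -> R).
Hypotheses (Vo : open V) (gs : forall k, smk k V g).

Lemma open_fst : open [set z : R * R | V z.1].
Proof. by apply: open_comp => // z _; exact: cvg_fst. Qed.

Lemma near_fst z : V z.1 -> \near z, V z.1.
Proof. by move=> Vz; exact: open_nbhs_nbhs (conj open_fst Vz). Qed.

(** For functions [y^m g(x)] the operator [y d/dx] replaces [(m, g)] by [(m + 1, g')], and [y d/dy]
    multiplies by [m]. The jets of [Omega] and the multipliers [delta n phi] are of this form, and
    so are the test functions near their base point. *)
Lemma smk_homog k m : smk k [set z : R * R | V z.1] (fun z => z.2 ^+ m * g z.1).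
Proof.
apply: smkM; first exact: open_fst.
  elim: m => [|m IH]; first exact: smk_cst.
  have -> : (fun z : R * R => z.2 ^+ m.+1) = (fun z => z.2 * z.2 ^+ m).
    by apply/funext => z; rewrite exprS.
  by apply: smkM => //; [exact: open_fst|exact: smk_snd].
by apply: (smk_comp1 open_fst Vo) => //; exact: smk_fst.
Qed.

Lemma csm_homog k m : csm k [set z : R * R | V z.1] (fun z => (z.2 ^+ m * g z.1)%:C%C).
Proof. by apply: csm_real; exact: smk_homog. Qed.

Lemma derive_smk k : smk k V ('D_1 g).
Proof. by have [_] := gs k.+1; exact. Qed.

Lemma derive_homog v m z : V z.1 ->
  'D_v (fun z : R * R => z.2 ^+ m * g z.1) z =
    m%:R * z.2 ^+ m.-1 * v.2 * g z.1 + z.2 ^+ m * ('D_1 g z.1 * v.1).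
Proof.
move=> Vz; have dg : differentiable g z.1 by have [dg _] := gs 1; exact: dg.
have dfst : differentiable (@fst R R) z by have [d _] := @smk_fst R 1 setT; exact: d.
have dsnd : differentiable (@snd R R) z by have [d _] := @smk_snd R 1 setT; exact: d.
have dX : differentiable (fun t : R => t ^+ m) z.2 by exact/derivable1_diffP/exprn_derivable.
have dp : differentiable (fun z : R * R => z.2 ^+ m) z by exact: differentiable_comp dsnd dX.
have dq : differentiable (fun z : R * R => g z.1) z by exact: differentiable_comp dfst dg.
have Eq : 'D_v (fun z : R * R => g z.1) z = 'D_1 g z.1 * v.1.
  by rewrite (derive_comp1 _ dfst dg) derive_fst.
have Ep : 'D_v (fun z : R * R => z.2 ^+ m) z = m%:R * z.2 ^+ m.-1 * v.2.
  rewrite (derive_comp1 _ dsnd dX) derive_snd; by rewrite exp_derive /GRing.scale /= mulr1.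
have := @deriveM _ _ (fun z : R * R => z.2 ^+ m) (fun z : R * R => g z.1) z v
  (diff_derivable dp) (diff_derivable dq).
rewrite Ep Eq => E; refine (etrans E _); rewrite addrC; congr (_ + _).
by rewrite [LHS]mulrC.
Qed.

Lemma y_dx_homog m z : V z.1 ->
  y_dx (fun z => (z.2 ^+ m * g z.1)%:C%C : C) z = (z.2 ^+ m.+1 * 'D_1 g z.1)%:C%C.
Proof.
move=> Vz; rewrite /y_dx cderive_real derive_homog //=.
by rewrite !mulr0 mul0r add0r mulr1 -rmorphM mulrA -exprS.
Qed.

Lemma y_dy_homog m z : V z.1 ->
  y_dy (fun z => (z.2 ^+ m * g z.1)%:C%C : C) z = m%:R * (z.2 ^+ m * g z.1)%:C%C.
Proof.
move=> Vz; rewrite /y_dy cderive_real derive_homog //= mulr0 mulr0 addr0 mulr1.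
rewrite -rmorphM -(rmorph_nat (real_complex R)) -rmorphM; congr (_ %:C)%C.
by case: m => [|m]; [rewrite !mul0r mulr0|rewrite exprS; ring].
Qed.
End Homogeneous.

Lemma iter_smk (V : set R) (g : R -> R) n : (forall k, smk k V g) ->
  forall k, smk k V (iter n (fun h : R -> R => 'D_1 h : R -> R) g).
Proof. by move=> gs; elim: n => [//|n IH] k; exact: derive_smk. Qed.

Lemma iter_ydx (V : set R) (g : R -> R) m n z : open V -> (forall k, smk k V g) -> V z.1 ->
  iter n y_dx (fun z => (z.2 ^+ m * g z.1)%:C%C : C) z =
    (z.2 ^+ (n + m) * iter n (fun h : R -> R => 'D_1 h : R -> R) g z.1)%:C%C.
Proof.
move=> Vo gs; elim: n z => [//|n IH] z Vz; rewrite iterS.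
have E : \near z, iter n y_dx (fun z => (z.2 ^+ m * g z.1)%:C%C : C) z =
    (z.2 ^+ (n + m) * iter n (fun h : R -> R => 'D_1 h : R -> R) g z.1)%:C%C.
  by apply: filterS (near_fst Vo Vz) => w; exact: IH.
refine (etrans (y_dx_eq E) _).
exact (y_dx_homog (iter_smk n gs) (n + m) Vz).
Qed.

End ScaledDerivatives.

(** * Supports, and operations that preserve monomials *)

Section MonomialClosure.
Context {R : realType} (Gamma : set (R -> set R)).
Local Notation C := R[i].
Local Notation mono := (is_monomial Gamma).
Local Notation fn := (R * R -> C).
Hypothesis GammaP : pseudogroup Gamma.
Implicit Types (f g : fn) (phi psi : R -> set R).

Definition supp f : set (R * R) := closure [set z | f z != 0].

Lemma supp_neq0 f z : f z != 0 -> supp f z.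
Proof. by move=> fz; exact: (@subset_closure _ [set z | f z != 0] z fz). Qed.

Lemma near_supp0 f z : ~ supp f z -> \near z, f z = 0.
Proof.
move=> nz; have : open_nbhs z (~` supp f) by split=> //; exact/closed_openC/closed_closure.
move=> /open_nbhs_nbhs; apply: filterS => w nw; apply/eqP; apply: contrapT => /negP.
by move=> /supp_neq0.
Qed.

Lemma mono_diffeo f phi : mono (f, phi) -> local_diffeo phi.
Proof. by move=> [G _ _ _]; have [] := pg_diffeo GammaP G. Qed.

Lemma mono_orient f phi : mono (f, phi) -> orientation_preserving phi.
Proof. by move=> [G _ _ _]; have [] := pg_diffeo GammaP G. Qed.

Lemma mono_csm f phi : mono (f, phi) -> forall k, csm k setT f.
Proof. by move=> [_ /csmoothP]. Qed.

Lemma mono_compact f phi : mono (f, phi) -> compact (supp f).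
Proof. by move=> [_ _]. Qed.

Lemma mono_supp f phi : mono (f, phi) -> supp f `<=` hran phi.
Proof.
move=> H; have [_ _ _] := H.
by rewrite /= (half_lift_pran (mono_diffeo H) (mono_orient H)).
Qed.

(** [U] and the complement of [K] form an open cover, and [g] is smooth on the first and zero on the
    second. So [g] is smooth everywhere, even if its formula is meaningful on [U] only. *)
Lemma mono_intro g phi (K U : set (R * R)) : Gamma phi -> compact K ->
  K `<=` hran phi -> open U -> K `<=` U -> (forall k, csm k U g) ->
  (forall z, g z != 0 -> K z) -> mono (g, phi).
Proof.
move=> Gphi cK Kr oU KU gs gK.
have clK : closed K by apply: compact_closed cK; exact: norm_hausdorff.
have sK : supp g `<=` K by rewrite /supp closureE => z; apply; split.
have [pd po] := pg_diffeo GammaP Gphi.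
split=> //=.
- apply/csmoothP => k; apply: (@csm_sub _ _ (U `|` ~` K)).
    by move=> z _; case: (pselect (K z)) => [/KU|]; [left|right].
  apply: csmU => //; apply: (csm_eq (f := fun=> 0)); [exact: closed_openC| |exact: csm_cst].
  by move=> z nK; apply/esym/eqP; apply: contrapT => /negP /gK.
- exact (subclosed_compact (@closed_closure _ [set z | g z != 0]) cK sK).
- by rewrite half_lift_pran // => z /sK /Kr.
Qed.

Lemma mono_supp_intro f g phi : mono (f, phi) -> (forall k, csm k (hran phi) g) ->
  (forall z, g z != 0 -> supp f z) -> mono (g, phi).
Proof.
move=> H gs gf; have [G _ _ _] := H.
have s := mono_supp H.
apply: (mono_intro G (mono_compact H) s _ s gs gf).
exact: hran_open (mono_diffeo H).
Qed.

(** A multiplier such as [delta n phi] is controlled on the range of the lift only, which suffices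
    because the support of [f] lies there. *)
Lemma local_op_mul (h : (R -> set R) -> fn) :
  (forall phi, Gamma phi -> forall k, csm k (hran phi) (h phi)) ->
  (forall phi phi', Gamma phi -> Gamma phi' -> psub phi' phi ->
    forall z, hran phi' z -> h phi z = h phi' z) ->
  local_op Gamma (fun phi f z => h phi z * f z).
Proof.
move=> hs hr; split.
- move=> f phi H; have [G _ _ _] := H; apply: (mono_supp_intro H).
    move=> k; apply: csmM; first exact: hran_open (mono_diffeo H).
      exact: hs.
    by apply: csm_sub (mono_csm H k).
  by move=> z; rewrite mulf_eq0 negb_or => /andP[_ /supp_neq0].
- by move=> a f f1 f2 phi _ _ _ E z; rewrite E mulrDr mulrCA.
- move=> f phi phi' H H' sub z; have [G _ _ _] := H; have [G' _ _ _] := H'.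
  case: (eqVneq (f z) 0) => [->|/supp_neq0 fz]; first by rewrite !mulr0.
  by rewrite (hr _ _ G G' sub) //; exact: (mono_supp H').
Qed.

Lemma local_op_mulr (h : (R -> set R) -> fn) :
  (forall phi, Gamma phi -> forall k, csm k (hran phi) (h phi)) ->
  (forall phi phi', Gamma phi -> Gamma phi' -> psub phi' phi ->
    forall z, hran phi' z -> h phi z = h phi' z) ->
  local_op Gamma (fun phi f z => f z * h phi z).
Proof.
move=> hs hr; have [m l r] := local_op_mul hs hr; split.
- move=> f phi H.
  have E : (fun z => h phi z * f z) = (fun z => f z * h phi z).
    by apply/funext => z; rewrite mulrC.
  exact (eq_ind _ (fun g => mono (g, phi)) (m f phi H) _ E).
- move=> a f f1 f2 phi H H1 H2 E z; rewrite !(mulrC _ (h phi z)).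
  exact: (l a f f1 f2).
- by move=> f phi phi' H H' s z; rewrite !(mulrC (f z)); exact: (r f).
Qed.

Lemma y_dx_supp f z : y_dx f z != 0 -> supp f z.
Proof.
apply: contraPP => /near_supp0 E; apply/negP; rewrite negbK.
by rewrite (@y_dx_eq _ f (fun=> 0) z E) /y_dx cderive_cst mulr0.
Qed.

Lemma y_dy_supp f z : y_dy f z != 0 -> supp f z.
Proof.
apply: contraPP => /near_supp0 E; apply/negP; rewrite negbK.
by rewrite (@y_dy_eq _ f (fun=> 0) z E) /y_dy cderive_cst mulr0.
Qed.

Lemma local_op_ydx : local_op Gamma (fun _ f => y_dx f).
Proof.
split=> //.
- move=> f phi H.
  have fs k : csm k (hran phi) (y_dx f).
    by apply: (csm_sub (@subsetT _ _)); apply: csm_ydx; [exact: openT|exact: mono_csm H k.+1].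
  exact (mono_supp_intro H fs (@y_dx_supp f)).
- move=> a f f1 f2 phi H H1 H2 /funext -> z.
  by apply: y_dx_lin; apply: (@csm_cdiff _ setT) => //; [exact: mono_csm H1 _|exact: mono_csm H2 _].
Qed.

Lemma local_op_ydy : local_op Gamma (fun _ f => y_dy f).
Proof.
split=> //.
- move=> f phi H.
  have fs k : csm k (hran phi) (y_dy f).
    by apply: (csm_sub (@subsetT _ _)); apply: csm_ydy; [exact: openT|exact: mono_csm H k.+1].
  exact (mono_supp_intro H fs (@y_dy_supp f)).
- move=> a f f1 f2 phi H H1 H2 /funext -> z.
  by apply: y_dy_lin; apply: (@csm_cdiff _ setT) => //; [exact: mono_csm H1 _|exact: mono_csm H2 _].
Qed.
End MonomialClosure.

(** * Composition with the inverse of the lift *)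

Section Transport.
Context {R : realType}.
Local Notation C := R[i].
Local Notation fn := (R * R -> C).
Implicit Types (f g : fn) (phi psi : R -> set R) (z : R * R).

Definition lift_inv phi z : R * R := (pinvf phi z.1, 'D_1 (pinvf phi) z.1 * z.2).

Definition lj phi (x : R) : R := 'D_1 ('D_1 (pinvf phi)) x / 'D_1 (pinvf phi) x.

(** The multiplier of [delta_(n+1)], with the same index shift as in [GenD]. *)
Definition delta n phi : fn := iter n y_dx (log_jac phi).

Lemma log_jacE phi : log_jac phi = (fun z => (z.2 ^+ 1 * lj phi z.1)%:C%C).
Proof.
have dE (h : R -> R) : derive1 h = 'D_1 h by apply/funext => x; rewrite derive1E.
by apply/funext => z; rewrite /log_jac /lj expr1 !dE.
Qed.

Section OneMap.
Variable phi : R -> set R.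
Hypotheses (phiD : local_diffeo phi) (phiO : orientation_preserving phi).

Lemma transportE g z : hran phi z -> transport phi g z = g (lift_inv phi z).
Proof. by move=> zr; rewrite /transport (half_lift_inv phiD phiO zr). Qed.

Lemma near_hran z : hran phi z -> \near z, hran phi z.
Proof. by move=> zr; exact: open_nbhs_nbhs (conj (hran_open phiD) zr). Qed.

Lemma near_transport g z : hran phi z -> \near z, transport phi g z = g (lift_inv phi z).
Proof. by move=> /near_hran; apply: filterS => w; exact: transportE. Qed.

Lemma smk_lift_inv1 k : smk k (hran phi) (fun z => (lift_inv phi z).1).
Proof. by apply: (smk_fst_comp phiD); exact: pinvf_smk. Qed.

Lemma smk_dpinvf k : smk k (pran phi) ('D_1 (pinvf phi)).
Proof. exact: derive_smk (pinvf_smk phiD) k. Qed.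

Lemma smk_lift_inv2 k : smk k (hran phi) (fun z => (lift_inv phi z).2).
Proof.
apply: smkM; [exact: hran_open|exact: (smk_fst_comp phiD) (smk_dpinvf k)|].
exact: smk_snd.
Qed.

Lemma csm_transport k (U U' : set (R * R)) g : open U -> open U' -> U `<=` hran phi ->
  (forall z, U z -> U' (lift_inv phi z)) -> csm k U' g -> csm k U (transport phi g).
Proof.
move=> oU oU' Ur UU' gs.
have s1 := smk_sub Ur (smk_lift_inv1 k); have s2 := smk_sub Ur (smk_lift_inv2 k).
apply: (csm_eq oU) (csm_comp oU oU' UU' gs s1 s2) => z /Ur /transportE ->.
by [].
Qed.

Let d1 z : hran phi z -> differentiable (fun z => (lift_inv phi z).1) z.
Proof. by move=> zr; have [d _] := smk_lift_inv1 1; exact: d. Qed.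

Let d2 z : hran phi z -> differentiable (fun z => (lift_inv phi z).2) z.
Proof. by move=> zr; have [d _] := smk_lift_inv2 1; exact: d. Qed.

Let D1 v z : hran phi z ->
  'D_v (fun z => (lift_inv phi z).1) z = 'D_1 (pinvf phi) z.1 * v.1.
Proof.
move=> [zr _]; have [dp _] := pinvf_smk phiD 1.
have dfst : differentiable (@fst R R) z by have [d _] := @smk_fst R 1 setT; exact: d.
by rewrite (derive_comp1 _ dfst (dp _ zr)) derive_fst.
Qed.

Let D2 v z : hran phi z -> 'D_v (fun z => (lift_inv phi z).2) z =
  v.2 * 'D_1 (pinvf phi) z.1 + z.2 * ('D_1 ('D_1 (pinvf phi)) z.1 * v.1).
Proof.
move=> [zr _].
have E : (fun z => (lift_inv phi z).2) = (fun z => z.2 ^+ 1 * 'D_1 (pinvf phi) z.1).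
  by apply/funext => w; rewrite expr1 mulrC.
refine (etrans (congr1 (fun h : R * R -> R => 'D_v h z) E) _).
refine (etrans (derive_homog smk_dpinvf v 1 zr) _).
by rewrite mulr1n expr0 expr1 !mul1r.
Qed.

Let ydx_arith (y p1 p2 : R) (a b : C) : p1 != 0 ->
  y%:C%C * (a * (p1 * 1)%:C%C + b * (0 * p1 + y * (p2 * 1))%:C%C) =
  (p1 * y)%:C%C * a + (y ^+ 1 * (p2 / p1))%:C%C * ((p1 * y)%:C%C * b).
Proof.
move=> p0; rewrite !mulr1 mul0r add0r expr1 mulrDr !mulrA -!rmorphM; congr (_ + _).
  by rewrite mulrAC -rmorphM mulrC (mulrC y) mulrC.
rewrite mulrAC -rmorphM; congr (_%:C%C * _); field.
by [].
Qed.

(** By the chain rule the second coordinate [psi'(x) y] of the inverse lift contributes its own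
    [x]-derivative, which is [psi'' / psi'] times that coordinate. This term is the origin of
    [δ_1 ⊗ Y] in the coproduct of [X]. *)
Lemma y_dx_transport g z : hran phi z -> cdiff g (lift_inv phi z) ->
  y_dx (transport phi g) z =
    transport phi (y_dx g) z + log_jac phi z * transport phi (y_dy g) z.
Proof.
move=> zr dg; have [zr1 z2] := zr.
have p0 : 'D_1 (pinvf phi) z.1 != 0.
  by apply: lt0r_neq0; exact: derive_pinvf_gt0.
refine (etrans (y_dx_eq (near_transport g zr)) _).
refine (etrans _ (esym (congr2 (fun a b => a + log_jac phi z * b)
  (transportE (y_dx g) zr) (transportE (y_dy g) zr)))).
have E := cderive_comp (1, 0) (d1 zr) (d2 zr) dg.
rewrite (D1 _ zr) (D2 _ zr) in E.
refine (etrans (congr1 (fun a => (z.2)%:C%C * a) E) _).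
rewrite log_jacE; exact (ydx_arith z.2 _ _ _ p0).
Qed.

Let ydy_arith (y p1 p2 : R) (a b : C) :
  y%:C%C * (a * (p1 * 0)%:C%C + b * (1 * p1 + y * (p2 * 0))%:C%C) = (p1 * y)%:C%C * b.
Proof.
rewrite !mulr0 addr0 mul1r add0r mulrCA mulrC -rmorphM.
by rewrite (mulrC y).
Qed.

Lemma y_dy_transport g z : hran phi z -> cdiff g (lift_inv phi z) ->
  y_dy (transport phi g) z = transport phi (y_dy g) z.
Proof.
move=> zr dg.
refine (etrans (y_dy_eq (near_transport g zr)) _).
refine (etrans _ (esym (transportE (y_dy g) zr))).
have E := cderive_comp (0, 1) (d1 zr) (d2 zr) dg.
rewrite (D1 _ zr) (D2 _ zr) in E.
refine (etrans (congr1 (fun a => (z.2)%:C%C * a) E) _).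
exact (ydy_arith z.2 _ _ _ _).
Qed.

Lemma lj_smk k : smk k (pran phi) (lj phi).
Proof.
apply: smkM; first exact: ld_open_ran.
  exact: derive_smk smk_dpinvf k.
apply: smkV; [exact: ld_open_ran| |exact: smk_dpinvf].
by move=> x xr; apply: lt0r_neq0; exact: derive_pinvf_gt0.
Qed.

Lemma deltaE n z : hran phi z ->
  delta n phi z = (z.2 ^+ (n + 1) * iter n (fun h : R -> R => 'D_1 h : R -> R) (lj phi) z.1)%:C%C.
Proof.
by move=> [zr _]; rewrite /delta log_jacE (iter_ydx _ _ (ld_open_ran phiD) lj_smk zr).
Qed.

Lemma delta_csm n k : csm k (hran phi) (delta n phi).
Proof.
have s : forall z, hran phi z -> [set z : R * R | pran phi z.1] z by move=> z [].
apply: (csm_eq (hran_open phiD)) (csm_sub s (csm_homog (ld_open_ran phiD) (iter_smk n lj_smk) k (n + 1))).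
by move=> z zr; rewrite deltaE.
Qed.

Lemma y_dy_delta n z : hran phi z -> y_dy (delta n phi) z = n.+1%:R * delta n phi z.
Proof.
move=> zr; have [zr1 _] := zr.
have E : \near z, delta n phi z = (z.2 ^+ (n + 1) * iter n (fun h : R -> R => 'D_1 h : R -> R) (lj phi) z.1)%:C%C.
  by apply: filterS (near_hran zr) => w; exact: deltaE.
refine (etrans (y_dy_eq E) _).
by rewrite (y_dy_homog (iter_smk n lj_smk) (n + 1) zr1) deltaE // addn1.
Qed.
End OneMap.
End Transport.

Section TransportMaps.
Context {R : realType}.
Local Notation C := R[i].
Local Notation fn := (R * R -> C).
Implicit Types (f g : fn) (phi psi : R -> set R) (z : R * R).

Section Restriction.
Variables phi phi' : R -> set R.
Hypotheses (phiD : local_diffeo phi) (phiD' : local_diffeo phi')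
  (phiO : orientation_preserving phi) (phiO' : orientation_preserving phi')
  (sub : psub phi' phi).

Lemma pran_sub x : pran phi' x -> pran phi x.
Proof. by move=> [y yx]; exists y; exact: sub. Qed.

Lemma hran_sub z : hran phi' z -> hran phi z.
Proof. by move=> [/pran_sub zr z2]. Qed.

Lemma pinvf_sub x : pran phi' x -> pinvf phi x = pinvf phi' x.
Proof. by move=> /(graph_pinvf phiD') /sub /(pinvf_graph phiD). Qed.

Lemma near_pinvf_sub x : pran phi' x -> \near x, pinvf phi x = pinvf phi' x.
Proof.
move=> xr; apply: filterS (open_nbhs_nbhs (conj (ld_open_ran phiD') xr)) => y.
exact: pinvf_sub.
Qed.

Lemma dpinvf_sub x : pran phi' x -> 'D_1 (pinvf phi) x = 'D_1 (pinvf phi') x.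
Proof. by move=> /near_pinvf_sub; exact: near_eq_derive. Qed.

Lemma lift_inv_sub z : hran phi' z -> lift_inv phi z = lift_inv phi' z.
Proof. move=> [zr _]; exact (congr2 (fun a b => (a, b * z.2)) (pinvf_sub zr) (dpinvf_sub zr)). Qed.

Lemma transport_sub g z : hran phi' z -> transport phi g z = transport phi' g z.
Proof.
move=> zr; refine (etrans (transportE phiD phiO g (hran_sub zr)) _).
refine (etrans _ (esym (transportE phiD' phiO' g zr))).
exact (congr1 g (lift_inv_sub zr)).
Qed.

Lemma lj_sub x : pran phi' x -> lj phi x = lj phi' x.
Proof.
move=> xr; refine (congr2 (fun a b => a / b) _ (dpinvf_sub xr)).
exact (near_eq_derive _ (filterS dpinvf_sub (open_nbhs_nbhs (conj (ld_open_ran phiD') xr)))).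
Qed.

Lemma iter_derive_eq (V : set R) (h h' : R -> R) n : open V ->
  (forall x, V x -> h x = h' x) -> forall x, V x ->
  iter n (fun h : R -> R => 'D_1 h : R -> R) h x =
    iter n (fun h : R -> R => 'D_1 h : R -> R) h' x.
Proof.
move=> oV E; elim: n => [|n IH] x Vx; first exact (E x Vx).
exact (near_eq_derive _ (filterS IH (open_nbhs_nbhs (conj oV Vx)))).
Qed.

Lemma delta_sub n z : hran phi' z -> delta n phi z = delta n phi' z.
Proof.
move=> zr; refine (etrans (deltaE phiD phiO n (hran_sub zr)) _).
refine (etrans _ (esym (deltaE phiD' phiO' n zr))); have [zr1 _] := zr.
exact (congr1 (fun a => (z.2 ^+ (n + 1) * a)%:C%C)
  (iter_derive_eq n (ld_open_ran phiD') lj_sub zr1)).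
Qed.
End Restriction.

Section Composition.
Variables phi psi : R -> set R.
Hypotheses (phiD : local_diffeo phi) (psiD : local_diffeo psi)
  (compD : local_diffeo (pcomp phi psi))
  (phiO : orientation_preserving phi) (psiO : orientation_preserving psi)
  (compO : orientation_preserving (pcomp phi psi)).
Local Notation comp := (pcomp phi psi).

Lemma pran_pcomp x : pran comp x <-> pran phi x /\ pran psi (pinvf phi x).
Proof.
split=> [[w [y wy yx]]|[xr [w wy]]].
  by split; [exists y|rewrite (pinvf_graph phiD yx); exists w].
by exists w; exists (pinvf phi x) => //; exact: graph_pinvf.
Qed.

Lemma pinvf_pcomp x : pran comp x -> pinvf comp x = pinvf psi (pinvf phi x).
Proof.
move=> [w wx]; rewrite (pinvf_graph compD wx); have [y wy yx] := wx.
by rewrite (pinvf_graph phiD yx) (pinvf_graph psiD wy).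
Qed.

Lemma hran_pcomp z : hran comp z <-> hran phi z /\ hran psi (lift_inv phi z).
Proof.
split=> [[/pran_pcomp[zr1 zr2] z2]|[[zr1 z2] [zr2 _]]].
  by do 2?[split=> //]; rewrite /= mulr_gt0 // derive_pinvf_gt0.
by split=> //; apply/pran_pcomp.
Qed.

Lemma dpinvf_pcomp x : pran comp x -> 'D_1 (pinvf comp) x =
  'D_1 (pinvf psi) (pinvf phi x) * 'D_1 (pinvf phi) x.
Proof.
move=> xr; have [xr1 xr2] := (pran_pcomp x).1 xr.
have [d1 _] := pinvf_smk phiD 1; have [d2 _] := pinvf_smk psiD 1.
rewrite -(derive_comp1 _ (d1 _ xr1) (d2 _ xr2)); apply: near_eq_derive.
apply: filterS (open_nbhs_nbhs (conj (ld_open_ran compD) xr)) => y.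
exact: pinvf_pcomp.
Qed.

Lemma lift_inv_pcomp z : hran comp z -> lift_inv comp z = lift_inv psi (lift_inv phi z).
Proof.
move=> [zr _]; refine (etrans (congr2 (fun a b => (a, b * z.2)) (pinvf_pcomp zr) (dpinvf_pcomp zr)) _).
by rewrite -mulrA.
Qed.

Lemma transport_pcomp g z : hran comp z ->
  transport phi (transport psi g) z = transport comp g z.
Proof.
move=> zr; have [zr1 zr2] := (hran_pcomp z).1 zr.
refine (etrans (transportE phiD phiO _ zr1) (etrans (transportE psiD psiO _ zr2) _)).
refine (etrans _ (esym (transportE compD compO g zr))).
exact (congr1 g (esym (lift_inv_pcomp zr))).
Qed.

Let lj_arith (a b p q : R) : p != 0 -> q != 0 ->
  (p * a + q * (b * q)) / (p * q) = a / q + b / p * q.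
Proof. by move=> p0 q0; field; rewrite p0 q0. Qed.

(** Logarithmic differentiation of the chain rule in [dpinvf_pcomp]. *)
Lemma lj_pcomp x : pran comp x ->
  lj comp x = lj phi x + lj psi (pinvf phi x) * 'D_1 (pinvf phi) x.
Proof.
move=> xr; have [xr1 xr2] := (pran_pcomp x).1 xr.
have [d1 _] := pinvf_smk phiD 1.
have [d1' _] := smk_dpinvf phiD 1; have [d2' _] := smk_dpinvf psiD 1.
have dc : differentiable (fun y => 'D_1 (pinvf psi) (pinvf phi y)) x.
  exact (differentiable_comp (d1 _ xr1) (d2' _ xr2)).
have E : 'D_1 ('D_1 (pinvf comp)) x = 'D_1 (pinvf psi) (pinvf phi x) * 'D_1 ('D_1 (pinvf phi)) x
    + 'D_1 (pinvf phi) x * ('D_1 ('D_1 (pinvf psi)) (pinvf phi x) * 'D_1 (pinvf phi) x).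
  have -> : 'D_1 ('D_1 (pinvf comp)) x =
      'D_1 ((fun y => 'D_1 (pinvf psi) (pinvf phi y)) * 'D_1 (pinvf phi)) x.
    apply: near_eq_derive.
    apply: filterS (open_nbhs_nbhs (conj (ld_open_ran compD) xr)) => y.
    exact: dpinvf_pcomp.
  refine (etrans (deriveM (diff_derivable dc) (diff_derivable (d1' _ xr1))) _).
  exact (congr1 (fun a => 'D_1 (pinvf psi) (pinvf phi x) * 'D_1 ('D_1 (pinvf phi)) x
    + 'D_1 (pinvf phi) x * a) (derive_comp1 _ (d1 _ xr1) (d2' _ xr2))).
refine (etrans (congr2 (fun a b => a / b) E (dpinvf_pcomp xr)) _).
exact (lj_arith _ _ (lt0r_neq0 (derive_pinvf_gt0 psiD psiO xr2))
  (lt0r_neq0 (derive_pinvf_gt0 phiD phiO xr1))).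
Qed.

End Composition.
End TransportMaps.

Lemma scale1_sum (K : pzRingType) (V : lmodType K) (u u' v : V) : u' = u ->
  1 *: u + v = u' + v.
Proof. by move=> ->; rewrite scale1r. Qed.

Lemma scale_sum_comm (K : pzRingType) (V : lmodType K) k (u v v' : V) : v' = v ->
  k *: u + v = v' + k *: u.
Proof. by move=> ->; rewrite addrC. Qed.

(** * The generators as operators on the groupoid algebra *)

Section GroupoidOperators.
Context {R : realType} (Gamma : set (R -> set R)).
Local Notation C := R[i].
Local Notation A := (groupoid_alg Gamma).
Local Notation mono := (is_monomial Gamma).
Local Notation fn := (R * R -> C).
Hypothesis GammaP : pseudogroup Gamma.
Implicit Types (f g h : fn) (phi psi : R -> set R) (a b : A).

Definition lop (L : (R -> set R) -> fn -> fn) : A -> A :=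
  mono_lift (fun f phi => monoU Gamma (L phi f) phi).

Lemma lop_rel k L1 L2 L3 : local_op Gamma L1 -> local_op Gamma L2 -> local_op Gamma L3 ->
  (forall f phi, mono (f, phi) -> forall z, L1 phi f z = k * L2 phi f z + L3 phi f z) ->
  forall a, lop L1 a = k *: lop L2 a + lop L3 a.
Proof.
move=> H1 H2 H3 E; apply: galg_ext.
- exact: local_op_linear.
- exact (linear_lcomb k (local_op_linear H2) (local_op_linear H3)).
- move=> f phi H; refine (etrans (local_opE H1 H) (esym _)).
  refine (etrans (congr2 (fun a b => k *: a + b) (local_opE H2 H) (local_opE H3 H)) _).
  by apply/esym/monoU_lin; [exact: (lop_mono H1 H)|exact: (lop_mono H2 H)|
    exact: (lop_mono H3 H)|exact: E].
Qed.

Lemma lop_eq L1 L2 : local_op Gamma L1 -> local_op Gamma L2 ->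
  (forall f phi, mono (f, phi) -> forall z, L1 phi f z = L2 phi f z) ->
  forall a, lop L1 a = lop L2 a.
Proof.
move=> H1 H2 E; apply: galg_ext; [exact: local_op_linear|exact: local_op_linear|].
move=> f phi H; refine (etrans (local_opE H1 H) (etrans _ (esym (local_opE H2 H)))).
exact (monoU_eq _ _ (E f phi H)).
Qed.

Lemma lop_comp L L' : local_op Gamma L -> local_op Gamma L' ->
  forall a, lop L (lop L' a) = lop (fun phi f => L phi (L' phi f)) a.
Proof.
move=> H H'; apply: galg_ext.
- exact (linear_comp (local_op_linear H) (local_op_linear H')).
- exact (local_op_linear (local_op_comp H H')).
- move=> f phi Hf; refine (etrans (congr1 (lop L) (local_opE H' Hf)) _).
  exact (etrans (local_opE H (lop_mono H' Hf)) (esym (local_opE (local_op_comp H H') Hf))).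
Qed.

Section MonomialLeibniz.
Variables (h f : fn) (phi : R -> set R).
Hypotheses (fM : mono (f, phi)) (hs : csm 1 (hran phi) h).

(** [h] is differentiable on [hran phi] only. On the support of [f], which lies there, the usual
    rule applies; off the support [f] vanishes in a neighbourhood and both sides are zero. *)
Let leibniz (D : fn -> fn) :
  (forall f g z, (\near z, f z = g z) -> D f z = D g z) -> (forall z, D (fun=> 0) z = 0) ->
  (forall f g z, cdiff f z -> cdiff g z ->
    D (fun z => f z * g z) z = D f z * g z + f z * D g z) ->
  forall z, D (fun z => h z * f z) z = D h z * f z + h z * D f z.
Proof.
move=> Deq D0 DM z; case: (pselect (supp f z)) => [fz|nz].
  apply: DM; first exact: csm_cdiff hs (mono_supp GammaP fM fz).
  exact: csm_cdiff (mono_csm fM 1) I.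
have E := near_supp0 nz.
have -> : f z = 0 by exact (nbhs_singleton E).
rewrite (Deq f (fun=> 0) z E) D0 !mulr0 addr0 -(D0 z); apply: Deq.
by apply: filterS E => w ->; rewrite mulr0.
Qed.

Lemma mono_ydxM z : y_dx (fun z => h z * f z) z = y_dx h z * f z + h z * y_dx f z.
Proof.
apply: (leibniz (@y_dx_eq R)) => [w|]; last exact: y_dxM.
by rewrite /y_dx cderive_cst mulr0.
Qed.

Lemma mono_ydyM z : y_dy (fun z => h z * f z) z = y_dy h z * f z + h z * y_dy f z.
Proof.
apply: (leibniz (@y_dy_eq R)) => [w|]; last exact: y_dyM.
by rewrite /y_dy cderive_cst mulr0.
Qed.
End MonomialLeibniz.

Lemma local_op_delta n : local_op Gamma (fun phi f z => delta n phi z * f z).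
Proof.
apply: (local_op_mul GammaP) => [phi G|phi phi' G G' s].
  by have [D O] := pg_diffeo GammaP G; exact: delta_csm.
have [D O] := pg_diffeo GammaP G; have [D' O'] := pg_diffeo GammaP G'.
exact: delta_sub.
Qed.

Let LX := local_op_ydx GammaP.
Let LY := local_op_ydy GammaP.
Let LD := local_op_delta.

Let mono_delta n f phi : mono (f, phi) -> csm 1 (hran phi) (delta n phi).
Proof. by move=> H; exact (delta_csm (mono_diffeo GammaP H) (mono_orient GammaP H) n 1). Qed.

Lemma groupoid_rep : h1_rep (@groupoid_op R Gamma).
Proof.
split.
- move=> [||n]; [exact (local_op_linear LX)|exact (local_op_linear LY)|exact (local_op_linear (LD n))].
- move=> v; refine (etrans (lop_comp LY LX v) _).
  refine (etrans (lop_rel (k := 1) (local_op_comp LY LX) (local_op_comp LX LY) LX _ v) _).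
    by move=> f phi H z; rewrite mul1r; exact: y_dydx (mono_csm H 3).
  exact (scale1_sum _ (lop_comp LX LY v)).
- move=> n v; refine (etrans (lop_comp LX (LD n) v) _).
  refine (etrans (lop_rel (k := 1) (local_op_comp LX (LD n)) (local_op_comp (LD n) LX) (LD n.+1) _ v) _).
    move=> f phi H z; rewrite mul1r addrC.
    exact (mono_ydxM H (mono_delta n H) z).
  exact (scale1_sum _ (lop_comp (LD n) LX v)).
- move=> n v; refine (etrans (lop_comp LY (LD n) v) _).
  refine (etrans (lop_rel (k := n.+1%:R) (local_op_comp LY (LD n)) (LD n) (local_op_comp (LD n) LY) _ v) _).
    move=> f phi H z; refine (etrans (mono_ydyM H (mono_delta n H) z) _).
    congr (_ + _); case: (eqVneq (f z) 0) => [->|/supp_neq0 fz]; first by rewrite !mulr0.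
    by rewrite mulrA (y_dy_delta (mono_diffeo GammaP H) (mono_orient GammaP H)) //;
      exact: (mono_supp GammaP H).
  exact (scale_sum_comm _ _ (lop_comp (LD n) LY v)).
- move=> n m v; refine (etrans (lop_comp (LD n) (LD m) v) _).
  refine (etrans _ (esym (lop_comp (LD m) (LD n) v))).
  refine (lop_eq (local_op_comp (LD n) (LD m)) (local_op_comp (LD m) (LD n)) _ v).
  by move=> f phi H z; rewrite mulrCA.
Qed.
End GroupoidOperators.

(** * Left and right multiplication by smooth functions *)

Section Multipliers.
Context {R : realType} (Gamma : set (R -> set R)).
Local Notation C := R[i].
Local Notation A := (groupoid_alg Gamma).
Local Notation mono := (is_monomial Gamma).
Local Notation fn := (R * R -> C).
Local Notation LMul g := (fun (_ : R -> set R) (f : fn) z => g z * f z).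
Local Notation RMul g := (fun (phi : R -> set R) (f : fn) z => f z * transport phi g z).
Hypothesis GammaP : pseudogroup Gamma.
Implicit Types (f g h : fn) (phi psi : R -> set R) (a b : A).

Definition smooth_fun g : Prop := forall k, csm k setT g.

Lemma transport_csm g phi : Gamma phi -> smooth_fun g -> forall k, csm k (hran phi) (transport phi g).
Proof.
move=> G gs k; have [D O] := pg_diffeo GammaP G.
exact (csm_transport D O (hran_open D) openT (@subset_refl _ _) (fun _ _ => I) (gs k)).
Qed.

Lemma local_op_gmull g : smooth_fun g -> local_op Gamma (LMul g).
Proof.
move=> gs; apply: (local_op_mul GammaP) => // phi G k.
exact: csm_sub (@subsetT _ _) (gs k).
Qed.

Lemma local_op_gmulr g : smooth_fun g -> local_op Gamma (RMul g).
Proof.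
move=> gs; apply: (local_op_mulr GammaP) => [phi G|phi phi' G G' s].
  exact: transport_csm.
have [D O] := pg_diffeo GammaP G; have [D' O'] := pg_diffeo GammaP G'.
exact: transport_sub.
Qed.

Lemma gmull_linear g : smooth_fun g -> linear (gmull g : A -> A).
Proof. move=> gs; exact (local_op_linear (local_op_gmull gs)). Qed.

Lemma gmulr_linear g : smooth_fun g -> linear (gmulr g : A -> A).
Proof. move=> gs; exact (local_op_linear (local_op_gmulr gs)). Qed.

Lemma gmull_lin k g g1 g2 a : smooth_fun g -> smooth_fun g1 -> smooth_fun g2 ->
  (forall z, g z = k * g1 z + g2 z) -> gmull g a = k *: gmull g1 a + gmull g2 a.
Proof.
move=> gs g1s g2s E.
refine (lop_rel (local_op_gmull gs) (local_op_gmull g1s) (local_op_gmull g2s) _ a).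
by move=> f phi _ z; rewrite E mulrDl mulrA.
Qed.

Lemma gmulr_lin k g g1 g2 a : smooth_fun g -> smooth_fun g1 -> smooth_fun g2 ->
  (forall z, g z = k * g1 z + g2 z) -> gmulr g a = k *: gmulr g1 a + gmulr g2 a.
Proof.
move=> gs g1s g2s E.
refine (lop_rel (local_op_gmulr gs) (local_op_gmulr g1s) (local_op_gmulr g2s) _ a).
by move=> f phi _ z; rewrite /transport E mulrDr mulrCA.
Qed.

Lemma gmullM g g1 g2 a : smooth_fun g -> smooth_fun g1 -> smooth_fun g2 ->
  (forall z, g z = g1 z * g2 z) -> gmull g a = gmull g1 (gmull g2 a).
Proof.
move=> gs g1s g2s E; have L1 := local_op_gmull g1s; have L2 := local_op_gmull g2s.
refine (etrans _ (esym (lop_comp L1 L2 a))).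
refine (lop_eq (local_op_gmull gs) (local_op_comp L1 L2) _ a).
by move=> f phi _ z; rewrite E mulrA.
Qed.

Lemma gmulrM g g1 g2 a : smooth_fun g -> smooth_fun g1 -> smooth_fun g2 ->
  (forall z, g z = g1 z * g2 z) -> gmulr g a = gmulr g1 (gmulr g2 a).
Proof.
move=> gs g1s g2s E; have L1 := local_op_gmulr g1s; have L2 := local_op_gmulr g2s.
refine (etrans _ (esym (lop_comp L1 L2 a))).
refine (lop_eq (local_op_gmulr gs) (local_op_comp L1 L2) _ a).
by move=> f phi _ z; rewrite /transport E mulrAC mulrA.
Qed.

Lemma gmull_gmulr g h a : smooth_fun g -> smooth_fun h ->
  gmull g (gmulr h a) = gmulr h (gmull g a).
Proof.
move=> gs hs; have L1 := local_op_gmull gs; have L2 := local_op_gmulr hs.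
refine (etrans (lop_comp L1 L2 a) (etrans _ (esym (lop_comp L2 L1 a)))).
refine (lop_eq (local_op_comp L1 L2) (local_op_comp L2 L1) _ a).
by move=> f phi _ z; rewrite mulrA.
Qed.

Lemma lop_id (L : (R -> set R) -> fn -> fn) a : local_op Gamma L ->
  (forall f phi, mono (f, phi) -> forall z, L phi f z = f z) -> lop L a = a.
Proof.
move=> LP E; refine (galg_ext (local_op_linear LP) (fun k u v => erefl) _ a).
move=> f phi H; refine (etrans (local_opE LP H) _); exact (monoU_eq _ _ (E f phi H)).
Qed.

Lemma gmull1 g a : smooth_fun g -> (forall z, g z = 1) -> gmull g a = a.
Proof.
move=> gs E; apply: (lop_id _ (local_op_gmull gs)) => f phi _ z.
by rewrite E mul1r.
Qed.

Lemma gmulr1 g a : smooth_fun g -> (forall z, g z = 1) -> gmulr g a = a.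
Proof.
move=> gs E; apply: (lop_id _ (local_op_gmulr gs)) => f phi _ z.
by rewrite /transport E mulr1.
Qed.

Let LX := local_op_ydx GammaP.
Let LY := local_op_ydy GammaP.
Let LD := local_op_delta GammaP.

Lemma lop_rel1 L1 L2 L3 a : local_op Gamma L1 -> local_op Gamma L2 -> local_op Gamma L3 ->
  (forall f phi, mono (f, phi) -> forall z, L1 phi f z = L2 phi f z + L3 phi f z) ->
  lop L1 a = lop L2 a + lop L3 a.
Proof.
move=> H1 H2 H3 E; refine (etrans (lop_rel (k := 1) H1 H2 H3 _ a) (scale1_sum _ erefl)).
by move=> f phi H z; rewrite mul1r; exact: E.
Qed.

Lemma X_gmull g h a : smooth_fun g -> smooth_fun h -> (forall z, y_dx g z = h z) ->
  groupoid_op GenX (gmull g a) = gmull h a + gmull g (groupoid_op GenX a).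
Proof.
move=> gs hs E; have L := local_op_gmull gs; have L' := local_op_gmull hs.
refine (etrans (lop_comp LX L a) _).
refine (etrans (lop_rel1 a (local_op_comp LX L) L' (local_op_comp L LX) _) _).
  move=> f phi H z; rewrite -E.
  exact (mono_ydxM GammaP H (csm_sub (@subsetT _ _) (gs 1)) z).
exact (congr1 (fun b => gmull h a + b) (esym (lop_comp L LX a))).
Qed.

Lemma Y_gmull g h a : smooth_fun g -> smooth_fun h -> (forall z, y_dy g z = h z) ->
  groupoid_op GenY (gmull g a) = gmull h a + gmull g (groupoid_op GenY a).
Proof.
move=> gs hs E; have L := local_op_gmull gs; have L' := local_op_gmull hs.
refine (etrans (lop_comp LY L a) _).
refine (etrans (lop_rel1 a (local_op_comp LY L) L' (local_op_comp L LY) _) _).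
  move=> f phi H z; rewrite -E.
  exact (mono_ydyM GammaP H (csm_sub (@subsetT _ _) (gs 1)) z).
exact (congr1 (fun b => gmull h a + b) (esym (lop_comp L LY a))).
Qed.

Lemma D_gmull g a n : smooth_fun g ->
  groupoid_op (GenD n) (gmull g a) = gmull g (groupoid_op (GenD n) a).
Proof.
move=> gs; have L := local_op_gmull gs.
refine (etrans (lop_comp (LD n) L a) (etrans _ (esym (lop_comp L (LD n) a)))).
refine (lop_eq (local_op_comp (LD n) L) (local_op_comp L (LD n)) _ a).
by move=> f phi _ z; rewrite mulrCA.
Qed.

Lemma D_gmulr g a n : smooth_fun g ->
  groupoid_op (GenD n) (gmulr g a) = gmulr g (groupoid_op (GenD n) a).
Proof.
move=> gs; have L := local_op_gmulr gs.
refine (etrans (lop_comp (LD n) L a) (etrans _ (esym (lop_comp L (LD n) a)))).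
refine (lop_eq (local_op_comp (LD n) L) (local_op_comp L (LD n)) _ a).
by move=> f phi _ z; rewrite mulrA.
Qed.

Let leib_arith (f t f' t' : C) : t' * f + t * f' = f * t' + f' * t.
Proof. by rewrite (mulrC t') (mulrC t). Qed.

Lemma Y_gmulr g h a : smooth_fun g -> smooth_fun h -> (forall z, y_dy g z = h z) ->
  groupoid_op GenY (gmulr g a) = gmulr h a + gmulr g (groupoid_op GenY a).
Proof.
move=> gs hs E; have L := local_op_gmulr gs; have L' := local_op_gmulr hs.
refine (etrans (lop_comp LY L a) _).
refine (etrans (lop_rel1 a (local_op_comp LY L) L' (local_op_comp L LY) _) _).
  move=> f phi H z; have [G _ _ _] := H; have [D O] := pg_diffeo GammaP G.
  have Ec : (fun z => f z * transport phi g z) = (fun z => transport phi g z * f z).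
    by apply/funext => w; rewrite mulrC.
  refine (etrans (congr1 (fun F : fn => y_dy F z) Ec) _).
  refine (etrans (mono_ydyM GammaP H (transport_csm G gs 1) z) _).
  refine (etrans (leib_arith _ _ _ _) _); congr (_ + _).
  case: (eqVneq (f z) 0) => [->|/supp_neq0 /(mono_supp GammaP H) zr]; first by rewrite !mul0r.
  congr (_ * _); refine (etrans (y_dy_transport D O zr (csm_cdiff (gs 1) I)) _).
  exact (E _).
exact (congr1 (fun b => gmulr h a + b) (esym (lop_comp L LY a))).
Qed.

Let leib3_arith (f t f' t' u d : C) : t' = u + d -> t' * f + t * f' = 1 * (f * u) + (f' * t + f * d).
Proof.
by move=> ->; rewrite mul1r mulrDl -addrA (mulrC u) (mulrC t) (addrC (d * f)) (mulrC d).
Qed.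

Let sum_arith (c x x1 x2 y y1 y2 : C) : x = c * x1 + x2 -> y = c * y1 + y2 ->
  x + y = c * (x1 + y1) + (x2 + y2).
Proof. by move=> -> ->; rewrite mulrDr addrACA. Qed.

Lemma X_gmulr g h h' a : smooth_fun g -> smooth_fun h -> smooth_fun h' ->
  (forall z, y_dx g z = h z) -> (forall z, y_dy g z = h' z) ->
  groupoid_op GenX (gmulr g a) =
    gmulr h a + gmulr g (groupoid_op GenX a) + gmulr h' (groupoid_op (GenD 0) a).
Proof.
move=> gs hs hs' E E'; have L := local_op_gmulr gs; have L1 := local_op_gmulr hs.
have L2 := local_op_gmulr hs'.
(* [lop_rel] splits off one summand at a time, so the sum of the two remaining terms has to be a
   local operator in its own right. *)
have L3 : local_op Gamma (fun phi f z => y_dx f z * transport phi g z +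
    (delta 0 phi z * f z) * transport phi h' z).
  have [m l r] := local_op_comp L LX; have [m' l' r'] := local_op_comp L2 (LD 0).
  split.
  - move=> f phi H; apply: (mono_supp_intro GammaP H) => [k|z].
      have [G _ _ _] := H; have [D O] := pg_diffeo GammaP G.
      apply: csmD; [exact: hran_open|exact: csm_sub (@subsetT _ _) (mono_csm (m f phi H) k)|].
      exact: csm_sub (@subsetT _ _) (mono_csm (m' f phi H) k).
    apply: contraPP => nz; apply/negP; rewrite negbK.
    have /negP := contra_not (@y_dx_supp _ f z) nz; rewrite negbK => /eqP ->.
    have /negP := contra_not (@supp_neq0 _ f z) nz; rewrite negbK => /eqP ->.
    by rewrite mulr0 !mul0r addr0.
  - move=> c f f1 f2 phi H H1 H2 Ef z.
    exact (sum_arith (l c f f1 f2 phi H H1 H2 Ef z) (l' c f f1 f2 phi H H1 H2 Ef z)).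
  - move=> f phi phi' H H' s z.
    exact (congr2 (fun x y => x + y) (r f phi phi' H H' s z) (r' f phi phi' H H' s z)).
refine (etrans (lop_comp LX L a) _).
refine (etrans (lop_rel (k := 1) (local_op_comp LX L) L1 L3 _ a) _).
  move=> f phi H z; have [G _ _ _] := H; have [D O] := pg_diffeo GammaP G.
  have Ec : (fun z => f z * transport phi g z) = (fun z => transport phi g z * f z).
    by apply/funext => w; rewrite mulrC.
  refine (etrans (congr1 (fun F : fn => y_dx F z) Ec) _).
  refine (etrans (mono_ydxM GammaP H (transport_csm G gs 1) z) _).
  case: (eqVneq (f z) 0) => [->|/supp_neq0 /(mono_supp GammaP H) zr].
    by rewrite !(mulr0, mul0r) add0r addr0 add0r mulrC.
  refine (etrans (leib3_arith _ _ _ _) _); first exact (y_dx_transport D O zr (csm_cdiff (gs 1) I)).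
  refine (congr2 (fun x y => 1 * (f z * x) + (y_dx f z * transport phi g z + y)) (E _) _).
  by rewrite -[transport phi (y_dy g) z]/(y_dy g _) E' mulrA (mulrC (f z)).
refine (etrans (scale1_sum _ erefl) _); rewrite -addrA; congr (_ + _).
refine (etrans (lop_rel1 a L3 (local_op_comp L LX) (local_op_comp L2 (LD 0)) _) _).
  by [].
exact (congr2 (fun x y => x + y) (esym (lop_comp L LX a)) (esym (lop_comp L2 (LD 0) a))).
Qed.
End Multipliers.

(** * The product of the groupoid algebra *)

Section Convolution.
Context {R : realType} (Gamma : set (R -> set R)).
Local Notation C := R[i].
Local Notation A := (groupoid_alg Gamma).
Local Notation mono := (is_monomial Gamma).
Local Notation fn := (R * R -> C).
Hypothesis GammaP : pseudogroup Gamma.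
Implicit Types (f g h : fn) (phi psi : R -> set R) (a b : A).

Lemma lift_inv_continuous phi z : Gamma phi -> hran phi z -> {for z, continuous (lift_inv phi)}.
Proof.
move=> G zr; have [D O] := pg_diffeo GammaP G.
have [d1 _] := smk_lift_inv1 D 1; have [d2 _] := smk_lift_inv2 D 1.
exact (cvg_pair (differentiable_continuous (d1 _ zr)) (differentiable_continuous (d2 _ zr))).
Qed.

Definition conv f phi g : fn := fun z => f z * transport phi g z.

Lemma conv_supp f phi g z : conv f phi g z != 0 -> f z != 0 /\ transport phi g z != 0.
Proof. by rewrite /conv mulf_eq0 negb_or => /andP. Qed.

(** The support is contained in the part of [supp f] that the inverse lift sends into [supp g]. That
    set is closed because the inverse lift is continuous at every point of [supp f], hence compact,
    and it lies in the range of the composed lift. *)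
Lemma conv_mono f phi g psi : mono (f, phi) -> mono (g, psi) ->
  mono (conv f phi g, pcomp phi psi).
Proof.
move=> H H'; have [G _ _ _] := H; have [G' _ _ _] := H'.
have [D O] := pg_diffeo GammaP G; have [D' O'] := pg_diffeo GammaP G'.
have Gc := pg_comp GammaP G G'; have [Dc Oc] := pg_diffeo GammaP Gc.
pose K := [set z | supp f z /\ supp g (lift_inv phi z)].
have Kr : K `<=` hran (pcomp phi psi).
  move=> z [/(mono_supp GammaP H) z1 /(mono_supp GammaP H') z2].
  exact: (hran_pcomp psi D O z).2 (conj z1 z2).
have clK : closed K.
  move=> z zK; have zf : supp f z.
    apply: (@closed_closure _ [set z | f z != 0]).
    by move=> B /zK[w [[wf _] wB]]; exists w.
  split=> //; apply: (@closed_closure _ [set z | g z != 0]) => B zB.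
  have /zK[w [[_ wg] wB]] := lift_inv_continuous G (mono_supp GammaP H zf) zB.
  by exists (lift_inv phi w).
have cK : compact K.
  by apply: subclosed_compact clK (mono_compact H) _ => z [].
apply: (mono_intro GammaP Gc cK Kr (hran_open Dc) Kr).
  move=> k; apply: csmM; first exact: hran_open.
    exact: csm_sub (@subsetT _ _) (mono_csm H k).
  apply: csm_sub (transport_csm GammaP G (mono_csm H') k) => z.
  by move=> /(hran_pcomp psi D O z)[].
move=> z /conv_supp[/supp_neq0 fz gz]; split=> //.
apply: supp_neq0; move: gz.
by rewrite (transportE D O) //; exact: (mono_supp GammaP H).
Qed.

Let inner f phi : A -> A :=
  mono_lift (fun g psi => monoU Gamma (conv f phi g) (pcomp phi psi)).

Let pcomp_subr phi psi psi' : psub psi' psi -> psub (pcomp phi psi') (pcomp phi psi).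
Proof. by move=> s x z [y /s xy yz]; exists y. Qed.

Let pcomp_subl phi phi' psi : psub phi' phi -> psub (pcomp phi' psi) (pcomp phi psi).
Proof. by move=> s x z [y xy /s yz]; exists y. Qed.

Let inner_lin f phi : mono (f, phi) -> forall k g g1 g2 psi,
  mono (g, psi) -> mono (g1, psi) -> mono (g2, psi) ->
  (forall z, g z = k * g1 z + g2 z) ->
  monoU Gamma (conv f phi g) (pcomp phi psi) =
    k *: monoU Gamma (conv f phi g1) (pcomp phi psi) + monoU Gamma (conv f phi g2) (pcomp phi psi).
Proof.
move=> H k g g1 g2 psi Hg H1 H2 E.
apply: (monoU_lin (conv_mono H Hg) (conv_mono H H1) (conv_mono H H2)) => z.
by rewrite /conv /transport E mulrDr mulrCA.
Qed.

Let inner_restr f phi : mono (f, phi) -> forall g psi psi',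
  mono (g, psi) -> mono (g, psi') -> psub psi' psi ->
  monoU Gamma (conv f phi g) (pcomp phi psi) = monoU Gamma (conv f phi g) (pcomp phi psi').
Proof.
move=> H g psi psi' Hg Hg' s.
exact (monoU_restr (conv_mono H Hg) (conv_mono H Hg') (@pcomp_subr phi psi psi' s)).
Qed.

Let inner_linear f phi : mono (f, phi) -> linear (inner f phi).
Proof. by move=> H; exact (mono_lift_linear (inner_lin H) (inner_restr H)). Qed.

Let innerE f phi g psi : mono (f, phi) -> mono (g, psi) ->
  inner f phi (monoU Gamma g psi) = monoU Gamma (conv f phi g) (pcomp phi psi).
Proof. by move=> H Hg; exact (mono_liftE (inner_lin H) (inner_restr H) Hg). Qed.

Let outer_lin b k f f1 f2 phi : mono (f, phi) -> mono (f1, phi) -> mono (f2, phi) ->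
  (forall z, f z = k * f1 z + f2 z) -> inner f phi b = k *: inner f1 phi b + inner f2 phi b.
Proof.
move=> H H1 H2 E; move: b; apply: galg_ext; first exact: inner_linear.
  exact (linear_lcomb k (inner_linear H1) (inner_linear H2)).
move=> g psi Hg; refine (etrans (innerE H Hg) (esym _)).
refine (etrans (congr2 (fun a b => k *: a + b) (innerE H1 Hg) (innerE H2 Hg)) (esym _)).
apply: (monoU_lin (conv_mono H Hg) (conv_mono H1 Hg) (conv_mono H2 Hg)) => z.
by rewrite /conv E mulrDl mulrA.
Qed.

Let outer_restr b f phi phi' : mono (f, phi) -> mono (f, phi') -> psub phi' phi ->
  inner f phi b = inner f phi' b.
Proof.
move=> H H' s; move: b; apply: galg_ext; [exact: inner_linear|exact: inner_linear|].
move=> g psi Hg; refine (etrans (innerE H Hg) (etrans _ (esym (innerE H' Hg)))).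
have E z : conv f phi g z = conv f phi' g z.
  rewrite /conv; case: (eqVneq (f z) 0) => [->|/supp_neq0 fz]; first by rewrite !mul0r.
  congr (_ * _); have [G _ _ _] := H; have [G' _ _ _] := H'.
  have [D O] := pg_diffeo GammaP G; have [D' O'] := pg_diffeo GammaP G'.
  exact (transport_sub D D' O O' s g (mono_supp GammaP H' fz)).
have M := conv_mono H' Hg.
refine (etrans (monoU_eq Gamma (pcomp phi psi) E) _).
apply: monoU_restr M (@pcomp_subl phi phi' psi s).
by move: (conv_mono H Hg); rewrite (funext E).
Qed.

Lemma gmul_linl b : linear (fun a : A => gmul a b).
Proof. exact (mono_lift_linear (outer_lin b) (@outer_restr b)). Qed.

Lemma gmulUl f phi b : mono (f, phi) -> gmul (monoU Gamma f phi) b = inner f phi b.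
Proof. by move=> H; exact (mono_liftE (outer_lin b) (@outer_restr b) H). Qed.

Lemma gmulUU f phi g psi : mono (f, phi) -> mono (g, psi) ->
  gmul (monoU Gamma f phi) (monoU Gamma g psi) = monoU Gamma (conv f phi g) (pcomp phi psi).
Proof. by move=> H Hg; exact (etrans (gmulUl _ H) (innerE H Hg)). Qed.

Lemma gmul_linr a : linear (gmul a : A -> A).
Proof.
move=> k u v; move: a; apply: galg_ext; first exact: gmul_linl.
  exact (linear_lcomb k (gmul_linl u) (gmul_linl v)).
move=> f phi H; refine (etrans (gmulUl _ H) (esym _)).
refine (etrans (congr2 (fun a b => k *: a + b) (gmulUl _ H) (gmulUl _ H)) (esym _)).
exact (inner_linear H k u v).
Qed.

Lemma gmul_ext (T : lmodType C) (B1 B2 : A -> A -> T) :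
  (forall b, linear (fun a => B1 a b)) -> (forall b, linear (fun a => B2 a b)) ->
  (forall a, linear (B1 a)) -> (forall a, linear (B2 a)) ->
  (forall f phi g psi, mono (f, phi) -> mono (g, psi) ->
    B1 (monoU Gamma f phi) (monoU Gamma g psi) = B2 (monoU Gamma f phi) (monoU Gamma g psi)) ->
  forall a b, B1 a b = B2 a b.
Proof.
move=> l1 l2 r1 r2 E a b; move: a; apply: (galg_ext (l1 b) (l2 b)) => f phi H.
by move: b; apply: (galg_ext (r1 _) (r2 _)) => g psi Hg; exact: E.
Qed.

Lemma gmul_gmulr h a b : smooth_fun h -> gmul a (gmulr h b) = gmulr h (gmul a b).
Proof.
move=> hs; have L := local_op_gmulr GammaP hs; have lin := gmulr_linear GammaP hs.
apply: (gmul_ext (B1 := fun a b => gmul a (gmulr h b)) (B2 := fun a b => gmulr h (gmul a b))).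
- by move=> c; exact: gmul_linl.
- by move=> c; exact (linear_comp lin (gmul_linl c)).
- by move=> c; exact (linear_comp (gmul_linr c) lin).
- by move=> c; exact (linear_comp lin (gmul_linr c)).
move=> f phi g psi H Hg; have Hc := conv_mono H Hg.
refine (etrans (congr1 (gmul _) (local_opE L Hg)) _).
refine (etrans (gmulUU H (lop_mono L Hg)) _).
refine (etrans _ (esym (congr1 (gmulr h) (gmulUU H Hg)))).
refine (etrans _ (esym (local_opE L Hc))).
apply: monoU_eq => z; rewrite /conv [transport phi _ z]/transport.
case: (eqVneq (conv f phi g z) 0) => [E|nz].
  have E' : f z * g (papp (pinv (half_lift phi)) z) = 0 by exact E.
  by rewrite mulrA E' !mul0r.
rewrite mulrA; congr (_ * _).
have [G _ _ _] := H; have [G' _ _ _] := Hg; have [Gc _ _ _] := Hc.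
have [D O] := pg_diffeo GammaP G; have [D' O'] := pg_diffeo GammaP G'.
have [Dc Oc] := pg_diffeo GammaP Gc.
exact (transport_pcomp D D' Dc O O' Oc h (mono_supp GammaP Hc (supp_neq0 nz))).
Qed.

Lemma gmul_balanced h a b : smooth_fun h -> gmul (gmulr h a) b = gmul a (gmull h b).
Proof.
move=> hs; have L := local_op_gmulr GammaP hs; have lin := gmulr_linear GammaP hs.
have L' := local_op_gmull GammaP hs; have lin' := gmull_linear GammaP hs.
apply: (gmul_ext (B1 := fun a b => gmul (gmulr h a) b) (B2 := fun a b => gmul a (gmull h b))).
- by move=> c; exact (linear_comp (gmul_linl c) lin).
- by move=> c; exact: gmul_linl.
- by move=> c; exact: gmul_linr.
- by move=> c; exact (linear_comp (gmul_linr c) lin').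
move=> f phi g psi H Hg.
refine (etrans (congr1 (fun x => gmul x _) (local_opE L H)) _).
refine (etrans (gmulUU (lop_mono L H) Hg) _).
refine (etrans _ (esym (congr1 (gmul _) (local_opE L' Hg)))).
refine (etrans _ (esym (gmulUU H (lop_mono L' Hg)))).
by apply: monoU_eq => z; rewrite /conv -mulrA.
Qed.
End Convolution.

(** * The representation of [P] by functions *)

Section MonomialValue.
Context {K : comNzRingType} (o : nat -> K).

Definition mval (m : {cmonom nat}) : K := \prod_(k <- finsupp m) o k ^+ m k.

Let mvalW (D : {fset nat}) (m : {cmonom nat}) : (finsupp m `<=` D)%fset ->
  mval m = \prod_(k <- D) o k ^+ m k.
Proof.
move=> sD; rewrite /mval (big_fset_incl _ sD) //= => i _.
by rewrite -cmE_eq0 => /eqP ->; rewrite expr0.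
Qed.

Lemma mvalM m m' : mval (mmul m m') = mval m * mval m'.
Proof.
pose D := (finsupp m `|` finsupp m' `|` finsupp (mmul m m'))%fset.
rewrite !(@mvalW D) /D; first last.
- by apply/fsubsetP => i; rewrite !inE => ->; rewrite ?orbT.
- by apply/fsubsetP => i; rewrite !inE => ->; rewrite ?orbT.
- by apply/fsubsetP => i; rewrite !inE => ->; rewrite ?orbT.
by rewrite -big_split /=; apply: eq_bigr => i _; rewrite cmM exprD.
Qed.

Lemma mval1 : mval mone = 1.
Proof.
rewrite (@mvalW fset0) ?big_seq_fset0 //; apply/fsubsetP => i; by rewrite -(cmE_neq0 mone i) cm1.
Qed.

Lemma mval_ucm j : mval (ucm j) = o j.
Proof.
rewrite (@mvalW [fset j]%fset) ?big_seq_fset1 ?ucmE ?eqxx //.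
by apply/fsubsetP => i; rewrite -(cmE_neq0 (ucm j) i) ucmE !inE (eq_sym j); case: (i == j).
Qed.
End MonomialValue.

Section Rho.
Context {R : realType} (nu : R -> R).
Local Notation C := R[i].
Local Notation P := (polyP C).
Local Notation Z := (polyZ C).
Local Notation om k := (iter k y_dx (Omega nu)).
Hypothesis nus : smooth_on setT nu.
Implicit Types (p q : P) (z : R * R).

Let nuN (x : R) : R := - nu x.

Lemma nuN_smk k : smk k setT nuN.
Proof. by apply: smkN; [exact: openT|exact: smooth_smk]. Qed.

Lemma OmegaE : Omega nu = (fun z => (z.2 ^+ 2 * nuN z.1)%:C%C).
Proof. by apply/funext => z; rewrite /Omega mulrN. Qed.

Lemma omE k z : om k z =
  (z.2 ^+ (k + 2) * iter k (fun h : R -> R => 'D_1 h : R -> R) nuN z.1)%:C%C.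
Proof. by rewrite OmegaE; exact (iter_ydx 2 k openT nuN_smk I). Qed.

Lemma om_smooth k : smooth_fun (om k).
Proof.
move=> n; rewrite (funext (omE k)).
exact (csm_homog openT (iter_smk k nuN_smk) n (k + 2)).
Qed.

Lemma y_dy_om k z : y_dy (om k) z = (k + 2)%:R * om k z.
Proof.
refine (etrans (congr1 (fun F : R * R -> C => y_dy F z) (funext (omE k))) _).
refine (etrans (@y_dy_homog _ setT _ (iter_smk k nuN_smk) (k + 2) z I) _).
exact (congr1 (fun a => (k + 2)%:R * a) (esym (omE k z))).
Qed.

Lemma rho_linear z : linear (fun p => rho nu p z : C^o).
Proof. move=> k u v; exact (lext_is_linear _ k u v). Qed.

Lemma rhoU m z : rho nu << m >> z = mval (fun k => om k z) m.
Proof. exact (@lextU C {cmonom nat} C^o (fun m => mval (fun k => om k z) m) m). Qed.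

Lemma rho1 z : rho nu 1 z = 1.
Proof. by refine (etrans (rhoU mone z) _); exact: mval1. Qed.

Lemma rhoM p q z : rho nu (p * q) z = rho nu p z * rho nu q z.
Proof.
have l1 (x : P) : linear (fun y : P => rho nu (x * y) z : C^o).
  by apply: linear_comp (rho_linear z) _ => k u v; rewrite mulrDr scalerAr.
have l2 (x : P) : linear (fun y : P => rho nu (y * x) z : C^o).
  by apply: linear_comp (rho_linear z) _ => k u v; rewrite mulrDl scalerAl.
have l3 (c : C) : linear (fun y : P => c * rho nu y z : C^o).
  move=> k u v; refine (etrans (congr1 (fun a => c * a) (rho_linear z k u v)) _).
  by rewrite mulrDr /GRing.scale /= mulrCA.
have l4 (c : C) : linear (fun y : P => rho nu y z * c : C^o).
  move=> k u v; refine (etrans (congr1 (fun a => a * c) (rho_linear z k u v)) _).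
  by rewrite mulrDl /GRing.scale /= mulrA.
have base (m m' : {cmonom nat}) :
    rho nu ((<< m >> : P) * << m' >>) z = rho nu << m >> z * rho nu << m' >> z.
  rewrite malg_mulUU.
  refine (etrans (rhoU _ z) (etrans (mvalM _ m m') _)).
  exact (congr2 (fun a b => a * b) (esym (rhoU m z)) (esym (rhoU m' z))).
elim/malg_ind: p => [|k m x IH].
  exact (etrans (lin0 (l2 q)) (esym (lin0 (l4 (rho nu q z))))).
refine (etrans (l2 q _ _ _) (etrans _ (esym (l4 (rho nu q z) _ _ _)))).
refine (congr2 (fun a b => k *: (a : C^o) + b) _ IH).
elim/malg_ind: q {IH} => [|k' m' y IH'].
  exact (etrans (lin0 (l1 _)) (esym (lin0 (l3 (rho nu << m >> z))))).
refine (etrans (l1 _ _ _ _) (etrans _ (esym (l3 (rho nu << m >> z) _ _ _)))).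
exact (congr2 (fun a b => k' *: (a : C^o) + b) (base m m') IH').
Qed.

Lemma rhoZ j z : rho nu (Z j) z = om j z.
Proof. by refine (etrans (rhoU (ucm j) z) _); exact: mval_ucm. Qed.

Lemma rho_lcomb k p q z : rho nu (k *: p + q) z = k * rho nu p z + rho nu q z.
Proof. exact: rho_linear. Qed.

Lemma rhoZM j p : rho nu (Z j * p) = (fun z => om j z * rho nu p z).
Proof. by apply/funext => z; rewrite rhoM rhoZ. Qed.

Lemma rho0 z : rho nu 0 z = 0.
Proof. exact (lin0 (rho_linear z)). Qed.

Lemma rho_smooth p : smooth_fun (rho nu p).
Proof.
elim/polyP_ind: p => [||k p q ps qs|j p ps] n.
- rewrite (funext rho0); exact: csm_cst.
- rewrite (funext rho1); exact: csm_cst.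
- rewrite (funext (rho_lcomb k p q)).
  apply: csmD; [exact: openT| |exact: qs].
  by apply: csmM; [exact: openT|exact: csm_cst|exact: ps].
- by rewrite rhoZM; apply: csmM; [exact: openT|exact: om_smooth|exact: ps].
Qed.

Let rho_cdiff p z : cdiff (rho nu p) z.
Proof. exact (csm_cdiff (rho_smooth p 1) I). Qed.

Let om_cdiff k z : cdiff (om k) z.
Proof. exact (csm_cdiff (om_smooth k 1) I). Qed.

Let rho_der (D : (R * R -> C) -> R * R -> C) (d : nat -> P) :
  (forall f a z, (forall w, f w = a) -> D f z = 0) ->
  (forall a f g z, cdiff f z -> cdiff g z -> D (fun z => a * f z + g z) z = a * D f z + D g z) ->
  (forall f g z, cdiff f z -> cdiff g z ->
    D (fun z => f z * g z) z = D f z * g z + f z * D g z) ->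
  (forall j z, D (om j) z = rho nu (d j) z) ->
  forall p z, D (rho nu p) z = rho nu (derivation d p) z.
Proof.
move=> Dc DL DM DZ p z; elim/polyP_ind: p => [||k p q ps qs|j p ps].
- by rewrite (Dc _ 0 z rho0) (lin0 (@derivation_linear _ d)) rho0.
- by rewrite (Dc _ 1 z rho1) derivation1 rho0.
- rewrite (funext (rho_lcomb k p q)).
  refine (etrans (DL k _ _ z (rho_cdiff p z) (rho_cdiff q z)) _).
  refine (etrans (congr2 (fun a b => k * a + b) ps qs) _).
  refine (etrans (esym (rho_lcomb k _ _ z)) _).
  exact (congr1 (fun x => rho nu x z) (esym (@derivation_linear _ d k p q))).
- refine (etrans (congr1 (fun F : R * R -> C => D F z) (rhoZM j p)) _).
  refine (etrans (DM _ _ z (om_cdiff j z) (rho_cdiff p z)) _).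
  refine (esym (etrans (congr1 (fun x => rho nu x z) (derivationM_Z d j p)) _)).
  refine (etrans (linD (rho_linear z) _ _) _).
  refine (etrans (congr2 (fun a b => a + b) (rhoM _ _ z) (rhoM _ _ z)) _).
  refine (etrans (congr1 (fun a => rho nu (d j) z * rho nu p z + a * rho nu (derivation d p) z) (rhoZ j z)) _).
  exact (congr2 (fun a b => a * rho nu p z + om j z * b) (esym (DZ j z)) (esym ps)).
Qed.

Lemma y_dx_rho p z : y_dx (rho nu p) z = rho nu (polyP_op GenX p) z.
Proof.
apply: (rho_der (D := y_dx)) => [f a w fa| | |j w]; first last.
- exact (esym (rhoZ j.+1 w)).
- exact (@y_dxM R).
- exact (@y_dx_lin R).
- by rewrite /y_dx (funext fa) cderive_cst mulr0.
Qed.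

Lemma y_dy_rho p z : y_dy (rho nu p) z = rho nu (polyP_op GenY p) z.
Proof.
apply: (rho_der (D := y_dy)) => [f a w fa| | |j w]; first last.
- rewrite y_dy_om; refine (esym (etrans (linZ (rho_linear w) _ _) _)).
  exact (congr1 (fun a => (j + 2)%:R * a) (rhoZ j w)).
- exact (@y_dyM R).
- exact (@y_dy_lin R).
- by rewrite /y_dy (funext fa) cderive_cst mulr0.
Qed.
End Rho.

(** * The Schwarzian and the connection *)

Section RealDerivatives.
Context {R : realType}.
Implicit Types (h k : R -> R) (x : R).

Lemma der1M h k x : differentiable h x -> differentiable k x ->
  'D_1 (fun y => h y * k y) x = 'D_1 h x * k x + h x * 'D_1 k x.
Proof.
move=> dh dk; refine (etrans (deriveM (diff_derivable dh) (diff_derivable dk)) _).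
by rewrite addrC [X in X + _]mulrC.
Qed.

Lemma der1V h x : h x != 0 -> differentiable h x ->
  'D_1 (fun y => (h y)^-1) x = - ('D_1 h x / h x ^+ 2).
Proof.
move=> h0 dh; refine (etrans (deriveV h0 (diff_derivable dh)) _).
by rewrite scaleNr mulrC.
Qed.

Lemma der1sq h x : differentiable h x ->
  'D_1 (fun y => h y ^+ 2) x = 2 * h x * 'D_1 h x.
Proof.
move=> dh.
have -> : (fun y => h y ^+ 2) = (fun y => h y * h y) by apply/funext => y; rewrite expr2.
rewrite der1M //; ring.
Qed.

Let div_arith (a b p q : R) : p != 0 -> a * p^-1 + b * - (q / p ^+ 2) = (a * p - b * q) / p ^+ 2.
Proof. by move=> p0; field. Qed.

Lemma der1div h k x : k x != 0 -> differentiable h x -> differentiable k x ->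
  'D_1 (fun y => h y / k y) x = ('D_1 h x * k x - h x * 'D_1 k x) / k x ^+ 2.
Proof.
move=> k0 dh dk; refine (etrans (der1M dh (differentiableV dk k0)) _).
rewrite der1V //; exact: div_arith.
Qed.
End RealDerivatives.

Section Schwarzian.
Context {R : realType}.
Local Notation M := (R * R)%type.
Implicit Types (phi psi : R -> set R) (nu : R -> R) (z w : M).

(** With [psi = pinvf phi] one has [lj phi = psi'' / psi'], so this is the Schwarzian derivative of
    the inverse map [psi], not of [phi]. *)
Definition schw phi (y : R) : R := 'D_1 (lj phi) y - 2^-1 * lj phi y ^+ 2.

Definition schwarz nu phi : Prop := forall y, pran phi y ->
  schw phi y = 'D_1 (pinvf phi) y ^+ 2 * nu (pinvf phi y) - nu y.

Lemma derive_fst_snd v (f : R * R -> R * R) z : differentiable f z ->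
  'D_v f z = ('D_v (fun z => (f z).1) z, 'D_v (fun z => (f z).2) z).
Proof.
move=> df; have d1 : differentiable (fun z => (f z).1) z.
  have [d _] := @smk_fst R 1 setT; exact (differentiable_comp df (d _ I)).
have d2 : differentiable (fun z => (f z).2) z.
  have [d _] := @smk_snd R 1 setT; exact (differentiable_comp df (d _ I)).
refine (etrans (congr1 (fun h : M -> M => 'D_v h z) (_ : f = fun z => ((f z).1, (f z).2)))
  (derive_pair v d1 d2)).
by apply/funext => w; case: (f w).
Qed.

Section OneMap.
Variables (phi : R -> set R).
Hypotheses (phiD : local_diffeo phi) (phiO : orientation_preserving phi).
Local Notation psi := (pinvf phi).
Local Notation f := (papp phi).

Let dom : set M := [set z | pdom phi z.1 /\ 0 < z.2].
Let ran : set M := [set z | pran phi z.1 /\ 0 < z.2].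

Definition invjac (x : R) : R := ('D_1 f x)^-1.

Lemma dpapp_smk k : smk k (pdom phi) ('D_1 f).
Proof. exact: derive_smk (papp_smk phiD) k. Qed.

Lemma invjac_smk k : smk k (pdom phi) invjac.
Proof.
apply: smkV; [exact: ld_open_dom|move=> x xd|exact: dpapp_smk].
by apply: lt0r_neq0; exact: derive_papp_gt0.
Qed.

Lemma frame_liftE z : frame_lift phi z = (f z.1, z.2 ^+ 1 * invjac z.1).
Proof. by rewrite /frame_lift derive1E expr1. Qed.

Lemma dom_open : open dom.
Proof.
have -> : dom = hran (pinv phi) by [].
exact: hran_open (local_diffeo_inv phiD).
Qed.

Lemma frame_lift_ran z : dom z -> ran (frame_lift phi z).
Proof.
move=> [zd z2]; split => /=; first exact: papp_ran.
by rewrite derive1E divr_gt0 // derive_papp_gt0.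
Qed.

Lemma smk_frame_lift1 k : smk k dom (fun z => f z.1).
Proof. exact: (smk_fst_comp (local_diffeo_inv phiD) (papp_smk phiD k)). Qed.

Lemma smk_frame_lift2 k : smk k dom (fun z => z.2 ^+ 1 * invjac z.1).
Proof.
have s : dom `<=` [set z : M | pdom phi z.1] by move=> z [].
exact (smk_sub s (smk_homog (ld_open_dom phiD) invjac_smk k 1)).
Qed.

Lemma frame_lift_differentiable z : dom z -> differentiable (frame_lift phi) z.
Proof.
move=> zd; rewrite (funext frame_liftE).
have [+ _] := smk_pair dom_open (smk_frame_lift1 1) (smk_frame_lift2 1).
by move=> d; exact: d zd.
Qed.

Lemma derive_frame_lift v z : dom z -> 'D_v (frame_lift phi) z =
  ('D_1 f z.1 * v.1, v.2 * invjac z.1 + z.2 * ('D_1 invjac z.1 * v.1)).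
Proof.
move=> zd; have [zd1 _] := zd; rewrite (funext frame_liftE).
have [d1 _] := smk_frame_lift1 1; have [d2 _] := smk_frame_lift2 1.
refine (etrans (derive_pair v (d1 _ zd) (d2 _ zd)) _).
have [df _] := papp_smk phiD 1; have [dfst _] := @smk_fst R 1 setT.
have E1 : 'D_v (fun z => f z.1) z = 'D_1 f z.1 * v.1.
  by rewrite (derive_comp1 v (dfst z I) (df _ zd1)) derive_fst.
refine (congr2 pair E1 (etrans (derive_homog invjac_smk v 1 zd1) _)).
by rewrite mulr1n expr0 expr1 !mul1r.
Qed.

Lemma dpinvf_papp x : pdom phi x -> 'D_1 psi (f x) = invjac x.
Proof.
move=> xd; have := derive_papp_pinvf phiD (papp_ran xd); rewrite (pappK phiD xd) => E.
have n0 := lt0r_neq0 (derive_papp_gt0 phiO xd).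
by apply: (mulfI n0); rewrite E /invjac divff.
Qed.

Lemma dinvjac x : pdom phi x -> 'D_1 invjac x = 'D_1 ('D_1 psi) (f x) * 'D_1 f x.
Proof.
move=> xd; have [df _] := papp_smk phiD 1; have [dp _] := smk_dpinvf phiD 1.
rewrite -(derive_comp1 _ (df _ xd) (dp _ (papp_ran xd))); apply: near_eq_derive.
apply: filterS (open_nbhs_nbhs (conj (ld_open_dom phiD) xd)) => y yd.
by rewrite dpinvf_papp.
Qed.

Let fwd_arith (p q r n n' e : R) : p != 0 ->
  1 ^+ 1 * (q / p ^+ 2) * (q / p ^+ 2) + 1 * ((r * p - 2 * q ^+ 2) / p ^+ 3 / p)
    + p^-1 / p * (1 * n) + p^-1 * (1 ^+ 1 * (q / p ^+ 2)) * 0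
    + 1 ^+ 1 * (q / p ^+ 2) / p * 0
    + 1 ^+ 1 * (q / p ^+ 2) * (1 ^+ 1 * (q / p ^+ 2)) * - (2 * 1)^-1 =
    p^-1 * n' * p + p^-1 * (e * 0) ->
  (r * p - q * q) / p ^+ 2 - 2^-1 * (q / p) ^+ 2 = p ^+ 2 * n' - n.
Proof.
move=> p0; have -> : p^-1 * n' * p + p^-1 * (e * 0) = n' by field.
by move=> <-; field.
Qed.

(* [(D phi~)(d_1)], as a vector field on the range *)
Definition push1 (w : M) : M :=
  (('D_1 psi w.1)^-1, w.2 ^+ 1 * ('D_1 ('D_1 psi) w.1 / 'D_1 psi w.1 ^+ 2)).

Let dpsi0 y : pran phi y -> 'D_1 psi y != 0.
Proof. by move=> yr; apply: lt0r_neq0; exact: derive_pinvf_gt0. Qed.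

Let ran_open : open ran. Proof. exact: (hran_open phiD). Qed.

Lemma dpinvf_sq_smk k : smk k (pran phi) (fun y => 'D_1 psi y ^+ 2).
Proof.
have -> : (fun y => 'D_1 psi y ^+ 2) = (fun y => 'D_1 psi y * 'D_1 psi y).
  by apply/funext => y; rewrite expr2.
by apply: smkM; [exact: ld_open_ran|exact: smk_dpinvf|exact: smk_dpinvf].
Qed.

Let q2 (y : R) : R := 'D_1 ('D_1 psi) y / 'D_1 psi y ^+ 2.

Let q2_smk k : smk k (pran phi) q2.
Proof.
apply: smkM; [exact: ld_open_ran|exact: (derive_smk (smk_dpinvf phiD) k)|].
apply: smkV; [exact: ld_open_ran| |exact: dpinvf_sq_smk].
by move=> y yr; rewrite expf_neq0 // dpsi0.
Qed.

Let p1 (y : R) : R := ('D_1 psi y)^-1.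

Let p1_smk k : smk k (pran phi) p1.
Proof. by apply: smkV; [exact: ld_open_ran|exact: dpsi0|exact: smk_dpinvf]. Qed.

Let push1_smk1 k : smk k ran (fun w => p1 w.1).
Proof. exact: (smk_fst_comp phiD (p1_smk k)). Qed.

Let push1_smk2 k : smk k ran (fun w => w.2 ^+ 1 * q2 w.1).
Proof.
have s : ran `<=` [set z : M | pran phi z.1] by move=> z [].
exact (smk_sub s (smk_homog (ld_open_ran phiD) q2_smk k 1)).
Qed.

Lemma push1_smooth : smooth_on ran push1.
Proof.
apply/smooth_onP => k; exact (smk_pair ran_open (push1_smk1 k) (push1_smk2 k)).
Qed.

Let dq2_arith (p q r : R) : p != 0 ->
  (r * p ^+ 2 - q * (2 * p * q)) / (p ^+ 2) ^+ 2 = (r * p - 2 * q ^+ 2) / p ^+ 3.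
Proof. by move=> p0; field. Qed.

Let dq2 y : pran phi y -> 'D_1 q2 y =
  ('D_1 ('D_1 ('D_1 psi)) y * 'D_1 psi y - 2 * 'D_1 ('D_1 psi) y ^+ 2) / 'D_1 psi y ^+ 3.
Proof.
move=> yr; have [dp _] := smk_dpinvf phiD 1; have [dr _] := derive_smk (smk_dpinvf phiD) 1.
have [dsq _] := dpinvf_sq_smk 1; have n0 := dpsi0 yr.
refine (etrans (@der1div _ ('D_1 ('D_1 psi)) (fun y => 'D_1 psi y ^+ 2) y (expf_neq0 2 n0) (dr _ yr) (dsq _ yr)) _).
refine (etrans (congr1 (fun a => ('D_1 ('D_1 ('D_1 psi)) y * 'D_1 psi y ^+ 2
    - 'D_1 ('D_1 psi) y * a) / ('D_1 psi y ^+ 2) ^+ 2)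
  (@der1sq _ ('D_1 psi) y (dp _ yr))) _).
exact (dq2_arith _ _ n0).
Qed.

Lemma push1_forward : pushes_forward dom (frame_lift phi) (fun=> (1, 0)) push1.
Proof.
move=> z zd; have [zd1 _] := zd; rewrite (derive_frame_lift (1, 0) zd) /push1 frame_liftE /=.
have xr := papp_ran zd1.
rewrite dpinvf_papp // dinvjac // !mulr1 mul0r add0r expr1 /invjac invrK.
have n0 := lt0r_neq0 (derive_papp_gt0 phiO zd1).
by congr (_, _); field.
Qed.

Lemma derive_push1 v w : ran w ->
  'D_v push1 w = ('D_1 p1 w.1 * v.1, v.2 * q2 w.1 + w.2 * ('D_1 q2 w.1 * v.1)).
Proof.
move=> wr; have [wr1 _] := wr.
have [d1 _] := push1_smk1 1; have [d2 _] := push1_smk2 1.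
refine (etrans (derive_pair v (d1 _ wr) (d2 _ wr)) _).
have [dp _] := p1_smk 1; have [dfst _] := @smk_fst R 1 setT.
have E1 : 'D_v (fun w => p1 w.1) w = 'D_1 p1 w.1 * v.1.
  by rewrite (derive_comp1 v (dfst w I) (dp _ wr1)) derive_fst.
refine (congr2 pair E1 (etrans (derive_homog q2_smk v 1 wr1) _)).
by rewrite mulr1n expr0 expr1 !mul1r.
Qed.

(* The coefficient of [d_2] in the invariance of [nabla_(d_1) d_1]. *)
Lemma preserves_schwarz nu : preserves_nabla nu dom ran (frame_lift phi) -> schwarz nu phi.
Proof.
(* The height of [z] is chosen so that its image under the lift is [(y, 1)], which keeps powers of
   [x_2] at the image out of the identity. *)
move=> H y yr; pose z : M := (psi y, ('D_1 psi y)^-1).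
have zd : dom z.
  by split; [exact: pinvf_dom|rewrite invr_gt0; exact: derive_pinvf_gt0].
have cs : smooth_on dom (fun=> (1, 0) : M).
  by apply/smooth_onP => k; exact: smk_cst.
have E := congr1 snd (H _ _ _ _ cs cs push1_smooth push1_smooth push1_forward push1_forward z zd).
have n0 := dpsi0 yr; have zd1 : pdom phi (psi y) := zd.1.
have jE : invjac (psi y) = 'D_1 psi y by rewrite -dpinvf_papp // pinvfK.
have wE : frame_lift phi z = (y, 1).
  by rewrite frame_liftE /z /= expr1 jE mulVf // pinvfK.
have wr : ran (y, 1) by split.
have EN : nabla nu (fun=> (1, 0)) (fun=> (1, 0)) z = (0, z.2 * nu (psi y)).
  rewrite /nabla derive_cst /=.
  by congr (_, _) => /=; rewrite /nabla11 /nabla21 /nabla12 /nabla22 /GRing.scale /=; ring.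
move: E; rewrite wE EN (derive_frame_lift _ zd) /nabla (derive_push1 _ wr) /=.
rewrite /z /= jE (dq2 yr) => E.
have [dr _] := derive_smk (smk_dpinvf phiD) 1; have [dp _] := smk_dpinvf phiD 1.
refine (etrans (congr1 (fun a => a - _) (@der1div _ ('D_1 ('D_1 psi)) ('D_1 psi) y n0 (dr _ yr) (dp _ yr))) _).
exact (fwd_arith n0 E).
Qed.
End OneMap.
End Schwarzian.

Section SchwarzianConverse.
Context {R : realType}.
Local Notation M := (R * R)%type.

Lemma derive_comp_diff {U V W : normedModType R} (F : U -> V) (G : V -> W) v z :
  differentiable F z -> differentiable G (F z) ->
  'D_v (fun z => G (F z)) z = 'D_('D_v F z) G (F z).
Proof.
move=> dF dG; have dGF : differentiable (G \o F) z by exact: differentiable_comp.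
by rewrite (deriveE _ dGF) (deriveE _ dG) (deriveE _ dF) diff_comp.
Qed.

Lemma derMr (p q : M -> R) v z : differentiable p z -> differentiable q z ->
  'D_v (fun z => p z * q z) z = 'D_v p z * q z + p z * 'D_v q z.
Proof.
move=> dp dq; refine (etrans (deriveM (diff_derivable dp) (diff_derivable dq)) _).
by rewrite addrC [X in X + _]mulrC.
Qed.

Lemma derDr (p q : M -> R) v z : differentiable p z -> differentiable q z ->
  'D_v (fun z => p z + q z) z = 'D_v p z + 'D_v q z.
Proof.
by move=> dp dq; exact (deriveD (diff_derivable dp) (diff_derivable dq)).
Qed.

Lemma differentiable_fst_comp (g : R -> R) (z : M) : differentiable g z.1 ->
  differentiable (fun z : M => g z.1) z.
Proof.
have [d _] := @smk_fst R 1 setT; move=> dg; exact (differentiable_comp (d z I) dg).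
Qed.

Lemma derive_fst_comp (g : R -> R) (z : M) v : differentiable g z.1 ->
  'D_v (fun z : M => g z.1) z = 'D_1 g z.1 * v.1.
Proof.
have [d _] := @smk_fst R 1 setT; move=> dg.
by rewrite (derive_comp1 v (d z I) dg) derive_fst.
Qed.

Variables (nu : R -> R) (phi : R -> set R).
Hypotheses (phiD : local_diffeo phi) (phiO : orientation_preserving phi).
(** Stated for [pinv phi], so that the equation is one for [f = papp phi] and its derivatives at
    points of the domain, where the vector fields live. *)
Hypothesis phiS : schwarz nu (pinv phi).
Local Notation f := (papp phi).
Local Notation j := (invjac phi).

Let dom : set M := [set z | pdom phi z.1 /\ 0 < z.2].
Let ran : set M := [set z | pran phi z.1 /\ 0 < z.2].

Let schwarz_arith (u u' u'' : R) (n n' : R) : u != 0 ->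
  (u'' * u - u' * u') / u ^+ 2 - 2^-1 * (u' / u) ^+ 2 = u ^+ 2 * n' - n ->
  n' = (n + (u'' * u - u' * u') / u ^+ 2 - 2^-1 * (u' / u) ^+ 2) / u ^+ 2.
Proof. by move=> u0 E; rewrite -addrA E; field. Qed.

Let tensor1_arith (V1 V2 W1 W2 e1 x u u' u'' : R) : u != 0 -> x != 0 ->
  (u' * V1 * W1 + u * e1)
   + (u * V1 * (u * W1)) * 0
   + (u * V1 * (W2 * u^-1 + x * (- (u' / u ^+ 2) * W1))) * (2 * (x * u^-1))^-1
   + ((V2 * u^-1 + x * (- (u' / u ^+ 2) * V1)) * (u * W1)) * (2 * (x * u^-1))^-1
   + ((V2 * u^-1 + x * (- (u' / u ^+ 2) * V1)) * (W2 * u^-1 + x * (- (u' / u ^+ 2) * W1))) * 0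
  = u * (e1 + V1 * W1 * 0 + V1 * W2 * (2 * x)^-1 + V2 * W1 * (2 * x)^-1 + V2 * W2 * 0).
Proof. by move=> u0 x0; field; rewrite u0 x0. Qed.

Let tensor2_arith (V1 V2 W1 W2 e1 e2 x u u' u'' n n' : R) : u != 0 -> x != 0 ->
  n' = (n + (u'' * u - u' * u') / u ^+ 2 - 2^-1 * (u' / u) ^+ 2) / u ^+ 2 ->
  (e2 * u^-1 + W2 * (- (u' / u ^+ 2) * V1)
    + (V2 * (- (u' / u ^+ 2) * W1)
       + x * (- ((u'' * u ^+ 2 - u' * (2 * u * u')) / (u ^+ 2) ^+ 2) * V1 * W1 + - (u' / u ^+ 2) * e1)))
   + (u * V1 * (u * W1)) * (x * u^-1 * n')
   + (u * V1 * (W2 * u^-1 + x * (- (u' / u ^+ 2) * W1))) * 0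
   + ((V2 * u^-1 + x * (- (u' / u ^+ 2) * V1)) * (u * W1)) * 0
   + ((V2 * u^-1 + x * (- (u' / u ^+ 2) * V1)) * (W2 * u^-1 + x * (- (u' / u ^+ 2) * W1)))
       * - (2 * (x * u^-1))^-1
  = (e2 + V1 * W1 * (x * n) + V1 * W2 * 0 + V2 * W1 * 0 + V2 * W2 * - (2 * x)^-1) * u^-1
    + x * (- (u' / u ^+ 2) *
       (e1 + V1 * W1 * 0 + V1 * W2 * (2 * x)^-1 + V2 * W1 * (2 * x)^-1 + V2 * W2 * 0)).
Proof. by move=> u0 x0 ->; field; rewrite u0 x0. Qed.

Let du x : pdom phi x -> differentiable ('D_1 f) x.
Proof. by move=> xd; have [d _] := dpapp_smk phiD 1; exact: d. Qed.

Let du' x : pdom phi x -> differentiable ('D_1 ('D_1 f)) x.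
Proof. by move=> xd; have [d _] := derive_smk (dpapp_smk phiD) 1; exact: d. Qed.

Let u0 x : pdom phi x -> 'D_1 f x != 0.
Proof. by move=> xd; apply: lt0r_neq0; exact: derive_papp_gt0. Qed.

Let dj x : pdom phi x -> 'D_1 j x = - ('D_1 ('D_1 f) x / 'D_1 f x ^+ 2).
Proof. by move=> xd; exact (@der1V _ ('D_1 f) x (u0 xd) (du xd)). Qed.

Let djs x : pdom phi x -> differentiable ('D_1 j) x.
Proof. by move=> xd; have [d _] := derive_smk (invjac_smk phiD phiO) 1; exact: d. Qed.

Let djj x : pdom phi x -> differentiable j x.
Proof. by move=> xd; have [d _] := invjac_smk phiD phiO 1; exact: d. Qed.

Let dsq x : pdom phi x -> differentiable (fun y => 'D_1 f y ^+ 2) x.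
Proof.
move=> xd; have -> : (fun y => 'D_1 f y ^+ 2) = (fun y => 'D_1 f y * 'D_1 f y).
  by apply/funext => y; rewrite expr2.
exact (differentiableM (du xd) (du xd)).
Qed.

Let ddj x : pdom phi x -> 'D_1 ('D_1 j) x = - (('D_1 ('D_1 ('D_1 f)) x * 'D_1 f x ^+ 2
  - 'D_1 ('D_1 f) x * (2 * 'D_1 f x * 'D_1 ('D_1 f) x)) / ('D_1 f x ^+ 2) ^+ 2).
Proof.
move=> xd.
have E : 'D_1 ('D_1 j) x = 'D_1 (fun y => - ('D_1 ('D_1 f) y / 'D_1 f y ^+ 2)) x.
  by apply: near_eq_derive; apply: filterS dj (open_nbhs_nbhs (conj (ld_open_dom phiD) xd)).
have dq := differentiableM (du' xd) (differentiableV (dsq xd) (expf_neq0 2 (u0 xd))).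
refine (etrans E (etrans (deriveN (diff_derivable dq)) _)).
refine (congr1 -%R (etrans (@der1div _ ('D_1 ('D_1 f)) (fun y => 'D_1 f y ^+ 2) x
  (expf_neq0 2 (u0 xd)) (du' xd) (dsq xd)) _)).
exact (congr1 (fun a => (_ - _ * a) / _) (@der1sq _ ('D_1 f) x (du xd))).
Qed.

Let phiS' x : pdom phi x -> nu (f x) = (nu x +
  ('D_1 ('D_1 ('D_1 f)) x * 'D_1 f x - 'D_1 ('D_1 f) x * 'D_1 ('D_1 f) x) / 'D_1 f x ^+ 2
  - 2^-1 * ('D_1 ('D_1 f) x / 'D_1 f x) ^+ 2) / 'D_1 f x ^+ 2.
Proof.
move=> xd; refine (schwarz_arith (u0 xd) (etrans _ (phiS xd))).
exact (congr1 (fun a => a - 2^-1 * _ ^+ 2) (esym (@der1div _ ('D_1 ('D_1 f)) ('D_1 f) x (u0 xd) (du' xd) (du xd)))).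
Qed.

(* [nabla] is tensorial up to the second derivative of the lift, so both sides are
   compared componentwise at a point; the only non-formal term is the Schwarzian. *)
Lemma schwarz_preserves : preserves_nabla nu dom ran (frame_lift phi).
Proof.
move=> V W V' W' Vs Ws Vs' Ws' VV' WW' z zd.
have [zd1 z2] := zd; have oD := dom_open phiD; have zr := frame_lift_ran phiO zd.
have dF := frame_lift_differentiable phiD phiO zd.
have dW' : differentiable W' (frame_lift phi z) by exact: (Ws' [::]).
have dW : differentiable W z by exact: (Ws [::]).
have [dfst _] := @smk_fst R 1 setT; have [dsnd _] := @smk_snd R 1 setT.
have dW1 : differentiable (fun z => (W z).1) z by exact (differentiable_comp dW (dfst _ I)).
have dW2 : differentiable (fun z => (W z).2) z by exact (differentiable_comp dW (dsnd _ I)).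
set v := V z; set e1 := 'D_v (fun z => (W z).1) z; set e2 := 'D_v (fun z => (W z).2) z.
have DW : 'D_v W z = (e1, e2) by exact: derive_fst_snd.
have EV : V' (frame_lift phi z) =
    ('D_1 f z.1 * v.1, v.2 * j z.1 + z.2 * ('D_1 j z.1 * v.1)).
  by rewrite (VV' z zd) derive_frame_lift.
have EW w : dom w -> W' (frame_lift phi w) =
    ('D_1 f w.1 * (W w).1, (W w).2 * j w.1 + w.2 * ('D_1 j w.1 * (W w).1)).
  by move=> wd; rewrite (WW' w wd) derive_frame_lift.
pose p1 (w : M) : R := 'D_1 f w.1; pose p2 (w : M) : R := j w.1; pose p3 (w : M) : R := 'D_1 j w.1.
have d1 : differentiable p1 z by exact (differentiable_fst_comp (du zd1)).
have d2 : differentiable p2 z by exact (differentiable_fst_comp (djj zd1)).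
have d3 : differentiable p3 z by exact (differentiable_fst_comp (djs zd1)).
have D1 : 'D_v p1 z = 'D_1 ('D_1 f) z.1 * v.1 by exact (derive_fst_comp v (du zd1)).
have D2 : 'D_v p2 z = 'D_1 j z.1 * v.1 by exact (derive_fst_comp v (djj zd1)).
have D3 : 'D_v p3 z = 'D_1 ('D_1 j) z.1 * v.1 by exact (derive_fst_comp v (djs zd1)).
have ds : differentiable (@snd R R) z by exact (dsnd z I).
pose q1 (w : M) : R := (W w).1; pose q2 (w : M) : R := (W w).2.
have dd1 : differentiable (fun w : M => p1 w * q1 w) z by exact (differentiableM d1 dW1).
have dd2 : differentiable (fun w : M => q2 w * p2 w) z by exact (differentiableM dW2 d2).
have dd3 : differentiable (fun w : M => p3 w * q1 w) z by exact (differentiableM d3 dW1).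
have dd4 : differentiable (fun w : M => w.2 * (p3 w * q1 w)) z by exact (differentiableM ds dd3).
have dd5 : differentiable (fun w : M => q2 w * p2 w + w.2 * (p3 w * q1 w)) z.
  by exact (differentiableD dd2 dd4).
(* [W'] is known along the lift only, so its derivative in the direction [V'] is computed as the
   derivative of [W'] composed with the lift, in the direction [V]. *)
have EDW : 'D_(V' (frame_lift phi z)) W' (frame_lift phi z) =
  ('D_1 ('D_1 f) z.1 * v.1 * (W z).1 + 'D_1 f z.1 * e1,
   e2 * j z.1 + (W z).2 * ('D_1 j z.1 * v.1) +
   (v.2 * ('D_1 j z.1 * (W z).1) + z.2 * ('D_1 ('D_1 j) z.1 * v.1 * (W z).1 + 'D_1 j z.1 * e1))).
  rewrite (VV' z zd) -(derive_comp_diff v dF dW').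
  have E : 'D_v (fun w => W' (frame_lift phi w)) z =
      'D_v (fun w : M => (p1 w * q1 w, q2 w * p2 w + w.2 * (p3 w * q1 w))) z.
    by apply: near_eq_derive; apply: filterS EW (open_nbhs_nbhs (conj oD zd)).
  refine (etrans E (etrans (derive_pair v dd1 dd5) _)).
  have E1 := derMr v d1 dW1; have E2 := derMr v dW2 d2; have E3 := derMr v d3 dW1.
  have E4 := derMr v ds dd3; have E5 := derDr v dd2 dd4.
  rewrite D1 in E1; rewrite D2 in E2; rewrite D3 in E3.
  rewrite derive_snd E3 in E4; rewrite E2 E4 in E5.
  exact (congr2 pair E1 E5).
rewrite (derive_frame_lift phiD phiO _ zd).
rewrite /nabla EDW EV (EW z zd) DW frame_liftE.
rewrite (dj zd1) (ddj zd1) /=.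
have z0 : z.2 != 0 by exact: lt0r_neq0.
have n0 := u0 zd1.
have a1 := tensor1_arith v.1 v.2 (W z).1 (W z).2 e1 ('D_1 ('D_1 f) z.1) ('D_1 ('D_1 f) z.1) n0 z0.
have a2 := tensor2_arith v.1 v.2 (W z).1 (W z).2 e1 e2 n0 z0 (phiS' zd1).
rewrite expr1.
exact (congr2 pair a1 a2).
Qed.
End SchwarzianConverse.

(** * The pseudogroup of all solutions of the Schwarzian equation *)

Section SchwarzPseudogroup.
Context {R : realType}.
Implicit Types (phi psi : R -> set R) (nu : R -> R).

Lemma open_preimage (U V : set R) (f : R -> R) : open U -> open V ->
  (forall x, V x -> differentiable f x) -> open [set x | V x /\ U (f x)].
Proof.
move=> oU oV df; rewrite openE => x [Vx Ux].
apply: filterI; first exact: open_nbhs_nbhs (conj oV Vx).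
have c := differentiable_continuous (df x Vx).
exact (c U (open_nbhs_nbhs (conj oU Ux))).
Qed.

Lemma pinv_psub phi phi' : psub phi' phi -> psub (pinv phi') (pinv phi).
Proof. by move=> s y x /s. Qed.

Lemma papp_sub phi phi' x : local_diffeo phi -> psub phi' phi -> pdom phi' x ->
  papp phi x = papp phi' x.
Proof.
by move=> D s xd; apply: (papp_graph D); exact (s _ _ (papp_dom xd)).
Qed.

Lemma local_diffeo_sub phi phi' : local_diffeo phi -> psub phi' phi ->
  open (pdom phi') -> open (pran phi') -> local_diffeo phi'.
Proof.
move=> D s od or; have sd : pdom phi' `<=` pdom phi by move=> x [y /s xy]; exists y.
have sr : pran phi' `<=` pran phi by move=> y [x /s xy]; exists x.
split=> //.
- by move=> x y y' /s xy /s xy'; exact: ld_fun xy xy'.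
- by move=> y x x' /s xy /s xy'; exact: ld_inj xy xy'.
- apply/smooth_onP => k; apply: smk_eq od _ (smk_sub sd (papp_smk D k)) => x.
  exact: papp_sub.
- apply/smooth_onP => k; apply: smk_eq or _ (smk_sub sr (pinvf_smk D k)) => y yr.
  exact: (papp_sub (local_diffeo_inv D) (pinv_psub s) yr).
Qed.

Lemma prestr_psub U phi : psub (prestr U phi) phi.
Proof. by move=> x y []. Qed.

Lemma local_diffeo_restr U phi : open U -> local_diffeo phi -> local_diffeo (prestr U phi).
Proof.
move=> oU D; apply: (local_diffeo_sub D (@prestr_psub U phi)).
- have -> : pdom (prestr U phi) = U `&` pdom phi.
    by rewrite eqEsubset; split=> [x [y [Ux xy]]|x [Ux [y xy]]]; [split=> //; exists y|exists y].
  by apply: openI => //; exact: ld_open_dom.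
- have -> : pran (prestr U phi) = [set y | pran phi y /\ U (pinvf phi y)].
    rewrite eqEsubset; split=> [y [x [Ux xy]]|y [yr Uy]].
      by rewrite /= (pinvf_graph D xy); split=> //; exists x.
    by exists (pinvf phi y); split=> //; exact: graph_pinvf.
  apply: (open_preimage oU (ld_open_ran D)) => y yr.
  by have [d _] := pinvf_smk D 1; exact: d.
Qed.

Lemma orientation_sub phi phi' : local_diffeo phi -> psub phi' phi -> open (pdom phi') ->
  orientation_preserving phi -> orientation_preserving phi'.
Proof.
move=> D s od O x xd; have xd' : pdom phi x by have [y /s xy] := xd; exists y.
rewrite derive1E -(near_eq_derive (f := papp phi)) ?derive_papp_gt0 //.
by apply: filterS (open_nbhs_nbhs (conj od xd)) => y; exact: papp_sub.
Qed.

Lemma pinv_pcomp phi psi : pinv (pcomp phi psi) = pcomp (pinv psi) (pinv phi).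
Proof.
by apply/funext => y; rewrite eqEsubset; split=> x [w a b]; exists w.
Qed.

Section Composition.
Variables phi psi : R -> set R.
Hypotheses (phiD : local_diffeo phi) (psiD : local_diffeo psi).

Lemma pdom_pcomp x : pdom (pcomp phi psi) x <-> pdom psi x /\ pdom phi (papp psi x).
Proof.
split=> [[z [y xy yz]]|[xd [z yz]]].
  by split; [exists y|rewrite (papp_graph psiD xy); exists z].
by exists z; exists (papp psi x) => //; exact: papp_dom.
Qed.

Lemma open_pdom_pcomp : open (pdom (pcomp phi psi)).
Proof.
have -> : pdom (pcomp phi psi) = [set x | pdom psi x /\ pdom phi (papp psi x)].
  by rewrite eqEsubset; split=> x /pdom_pcomp.
apply: (open_preimage (ld_open_dom phiD) (ld_open_dom psiD)) => x xd.
by have [d _] := papp_smk psiD 1; exact: d.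
Qed.

Lemma pcomp_fun x : is_subset1 (pcomp phi psi x).
Proof.
move=> z z' [y xy yz] [y' xy' yz'].
by rewrite -(ld_fun psiD xy xy') in yz'; exact: ld_fun yz yz'.
Qed.

Lemma papp_pcomp x : pdom (pcomp phi psi) x ->
  papp (pcomp phi psi) x = papp phi (papp psi x).
Proof.
move=> /pdom_pcomp[xd yd]; apply: papp_eq; first exact: pcomp_fun.
by exists (papp psi x); exact: papp_dom.
Qed.

Lemma smk_papp_pcomp k : smk k (pdom (pcomp phi psi)) (papp (pcomp phi psi)).
Proof.
have s : pdom (pcomp phi psi) `<=` pdom psi by move=> x /pdom_pcomp[].
have t x : pdom (pcomp phi psi) x -> pdom phi (papp psi x) by move=> /pdom_pcomp[].
apply: smk_eq open_pdom_pcomp _ (smk_comp1 open_pdom_pcomp (ld_open_dom phiD) t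
  (papp_smk phiD k) (smk_sub s (papp_smk psiD k))) => x xd.
by rewrite papp_pcomp.
Qed.
End Composition.

Lemma local_diffeo_comp phi psi : local_diffeo phi -> local_diffeo psi ->
  local_diffeo (pcomp phi psi).
Proof.
move=> D D'; have Di := local_diffeo_inv D; have Di' := local_diffeo_inv D'.
have E : pran (pcomp phi psi) = pdom (pcomp (pinv psi) (pinv phi)) by rewrite -pinv_pcomp.
split.
- exact: pcomp_fun.
- by rewrite pinv_pcomp; exact: pcomp_fun.
- exact: open_pdom_pcomp.
- by rewrite E; exact: open_pdom_pcomp.
- by apply/smooth_onP => k; exact: smk_papp_pcomp.
- by apply/smooth_onP => k; rewrite E pinv_pcomp; exact: smk_papp_pcomp.
Qed.

Lemma orientation_comp phi psi : local_diffeo phi -> local_diffeo psi ->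
  orientation_preserving phi -> orientation_preserving psi ->
  orientation_preserving (pcomp phi psi).
Proof.
move=> D D' O O' x xd; have [xd1 xd2] := (pdom_pcomp phi D' x).1 xd.
have [d _] := papp_smk D 1; have [d' _] := papp_smk D' 1.
have E : 'D_1 (papp (pcomp phi psi)) x = 'D_1 (papp phi) (papp psi x) * 'D_1 (papp psi) x.
  rewrite -(derive_comp1 _ (d' _ xd1) (d _ xd2)); apply: near_eq_derive.
  apply: filterS (open_nbhs_nbhs (conj (open_pdom_pcomp D D') xd)) => y.
  exact: papp_pcomp.
by rewrite derive1E E mulr_gt0 // derive_papp_gt0.
Qed.

Section Cocycle.
Variables phi psi : R -> set R.
Hypotheses (phiD : local_diffeo phi) (psiD : local_diffeo psi)
  (phiO : orientation_preserving phi) (psiO : orientation_preserving psi).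
Local Notation comp := (pcomp phi psi).
Let compD : local_diffeo comp := local_diffeo_comp phiD psiD.

Let cocycle_arith (a a' b b' k' k'' : R) : a = k'' / k' -> k' != 0 ->
  a' + (b' * k' * k' + b * k'') - 2^-1 * (a + b * k') ^+ 2 =
    (a' - 2^-1 * a ^+ 2) + k' ^+ 2 * (b' - 2^-1 * b ^+ 2).
Proof. by move=> -> k0; field. Qed.

(** The cocycle law [S(b o a) = S(a) + a'^2 S(b) o a] of the Schwarzian, for the inverse maps.
    Differentiating [lj_pcomp] produces a term with [a''] that cancels against the cross term of the
    square, because [lj phi = a'' / a']. *)
Lemma schw_pcomp y : pran comp y ->
  schw comp y = schw phi y + 'D_1 (pinvf phi) y ^+ 2 * schw psi (pinvf phi y).
Proof.
move=> yr; have [yr1 yr2] := (pran_pcomp psi phiD y).1 yr.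
have [dk _] := pinvf_smk phiD 1; have [dk' _] := smk_dpinvf phiD 1.
have [da _] := lj_smk phiD phiO 1; have [db _] := lj_smk psiD psiO 1.
have dbk : differentiable (fun x => lj psi (pinvf phi x)) y.
  exact (differentiable_comp (dk _ yr1) (db _ yr2)).
have dm : differentiable (fun x => lj psi (pinvf phi x) * 'D_1 (pinvf phi) x) y.
  exact (differentiableM dbk (dk' _ yr1)).
have E1 : 'D_1 (fun x => lj psi (pinvf phi x)) y =
    'D_1 (lj psi) (pinvf phi y) * 'D_1 (pinvf phi) y.
  by exact (derive_comp1 _ (dk _ yr1) (db _ yr2)).
have da1 : derivable (lj phi) y 1 by exact (diff_derivable (da _ yr1)).
have dm1 : derivable (fun x => lj psi (pinvf phi x) * 'D_1 (pinvf phi) x) y 1.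
  by exact (diff_derivable dm).
have E2 := @der1M _ (fun x => lj psi (pinvf phi x)) ('D_1 (pinvf phi)) y dbk (dk' _ yr1).
have E3 := deriveD da1 dm1.
have E : 'D_1 (lj comp) y = 'D_1 (lj phi) y +
  ('D_1 (lj psi) (pinvf phi y) * 'D_1 (pinvf phi) y * 'D_1 (pinvf phi) y
    + lj psi (pinvf phi y) * 'D_1 ('D_1 (pinvf phi)) y).
  refine (etrans _ (etrans E3 (congr1 (fun a => 'D_1 (lj phi) y + a) (etrans E2 _)))).
    apply: near_eq_derive.
    apply: filterS (open_nbhs_nbhs (conj (ld_open_ran compD) yr)) => x.
    exact: lj_pcomp.
  exact (congr1 (fun a => a * _ + _) E1).
rewrite /schw E lj_pcomp //.
have n0 := lt0r_neq0 (derive_pinvf_gt0 phiD phiO yr1).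
exact (cocycle_arith _ _ _ erefl n0).
Qed.

Let schwarz_arith (k h n n1 n2 : R) :
  k ^+ 2 * n1 - n + k ^+ 2 * (h ^+ 2 * n2 - n1) = (h * k) ^+ 2 * n2 - n.
Proof. ring. Qed.

Lemma schwarz_comp nu : schwarz nu phi -> schwarz nu psi -> schwarz nu comp.
Proof.
move=> S S' y yr; have [yr1 yr2] := (pran_pcomp psi phiD y).1 yr.
rewrite schw_pcomp // S // S' // (dpinvf_pcomp phiD psiD compD yr).
rewrite (pinvf_pcomp phiD psiD compD yr); exact: schwarz_arith.
Qed.
End Cocycle.

Lemma schw_sub phi phi' y : local_diffeo phi -> local_diffeo phi' -> psub phi' phi ->
  pran phi' y -> schw phi y = schw phi' y.
Proof.
move=> D D' s yr; refine (congr2 (fun a b => a - 2^-1 * b ^+ 2) _ (lj_sub D D' s yr)).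
apply: near_eq_derive.
apply: filterS (open_nbhs_nbhs (conj (ld_open_ran D') yr)) => x; exact: lj_sub.
Qed.

(** An equivalence at a single point: one direction serves restriction, the other one gluing. *)
Lemma schwarz_sub nu phi phi' y : local_diffeo phi -> local_diffeo phi' -> psub phi' phi ->
  pran phi' y ->
  (schw phi y = 'D_1 (pinvf phi) y ^+ 2 * nu (pinvf phi y) - nu y <->
   schw phi' y = 'D_1 (pinvf phi') y ^+ 2 * nu (pinvf phi' y) - nu y).
Proof.
move=> D D' s yr.
by rewrite (schw_sub D D' s yr) (dpinvf_sub D D' s yr) (pinvf_sub D D' s yr).
Qed.

(** Asking the equation of [pinv phi] as well makes closure under inverses immediate, and it is the
    form that [schwarz_preserves] takes. Composition follows from the cocycle law, and gluing from
    the pointwise nature of the equation. *)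
Definition schwarz_pg nu : set (R -> set R) := [set phi |
  [/\ local_diffeo phi, orientation_preserving phi, schwarz nu phi & schwarz nu (pinv phi)]].

Lemma local_diffeo_id : local_diffeo (fun x : R => [set x]).
Proof.
have E : papp (fun x : R => [set x]) = id.
  by apply/funext => x; apply: papp_eq => // a b -> ->.
have E' : papp (pinv (fun x : R => [set x])) = id.
  by apply/funext => x; apply: papp_eq => // a b; rewrite /pinv /= => <- <-.
have sm : smooth_on setT (@idfun R) by apply/smooth_onP => k; exact: smk_id.
have dT : pdom (fun x : R => [set x]) = setT.
  by rewrite eqEsubset; split=> // x _; exists x.
have rT : pran (fun x : R => [set x]) = setT.
  by rewrite eqEsubset; split=> // x _; exists x.
split.
- by move=> x a b -> ->.
- by move=> x a b; rewrite /pinv /= => <- <-.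
- by rewrite dT; exact: openT.
- by rewrite rT; exact: openT.
- by rewrite dT E.
- by rewrite rT E'.
Qed.

Lemma schwarz_id nu phi : (forall y, pinvf phi y = y) -> schwarz nu phi.
Proof.
move=> E y _; have D1 x : 'D_1 (pinvf phi) x = 1 by rewrite (funext E) derive_id.
have L : lj phi = cst 0.
  apply/funext => x; rewrite /lj D1 (_ : 'D_1 _ x = 0) ?mul0r //.
  by rewrite (funext D1) derive_cst.
by rewrite /schw L derive_cst D1 E /cst expr0n /= mulr0 subr0 expr1n mul1r subrr.
Qed.

Lemma schwarz_pg_pseudogroup nu : pseudogroup (schwarz_pg nu).
Proof.
split.
- by move=> phi [].
- split; first exact: local_diffeo_id.
  + move=> x _; rewrite derive1E (_ : papp _ = id) ?derive_id ?ltr01 //.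
    by apply/funext => y; apply: papp_eq => // a b -> ->.
  + by apply: schwarz_id => y; apply: papp_eq => // a b; rewrite /pinv /= => <- <-.
  + by apply: schwarz_id => y; apply: papp_eq => // a b -> ->.
- move=> phi psi [D O S S'] [D' O' T T']; split.
  + exact: local_diffeo_comp.
  + exact: orientation_comp.
  + exact: schwarz_comp.
  + rewrite pinv_pcomp; apply: schwarz_comp => //; try exact: local_diffeo_inv.
      exact: orientation_inv.
    exact: orientation_inv.
- move=> phi [D O S S']; split=> //; [exact: local_diffeo_inv|exact: orientation_inv].
- move=> U phi oU [D O S S']; have Dr := local_diffeo_restr oU D.
  have s := @prestr_psub U phi; split=> //.
  + exact (orientation_sub D s (ld_open_dom Dr) O).
  + move=> y yr; apply/(schwarz_sub nu D Dr s yr); apply: S.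
    by have [x /s xy] := yr; exists x.
  + have Di := local_diffeo_inv D; have Dri := local_diffeo_inv Dr; have si := pinv_psub s.
    move=> y yr; apply/(schwarz_sub nu Di Dri si yr); apply: S'.
    by have [x /si xy] := yr; exists x.
- move=> phi D O loc; split=> //.
  + move=> y yr; have [U [oU Uy [Dr _ S _]]] := loc _ (pinvf_dom D yr).
    have yr' : pran (prestr U phi) y.
      by exists (pinvf phi y); split=> //; exact: graph_pinvf.
    by apply/(schwarz_sub nu D Dr (@prestr_psub U phi) yr'); exact: S.
  + move=> x xr; have [U [oU Ux [Dr _ _ S]]] := loc x xr.
    have xr' : pran (pinv (prestr U phi)) x.
      by exists (papp phi x); split=> //; exact: papp_dom.
    apply/(schwarz_sub nu (local_diffeo_inv D) (local_diffeo_inv Dr) (pinv_psub (@prestr_psub U phi)) xr').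
    exact: S.
Qed.

Lemma schwarz_pg_preserves nu : preserves_connection nu (schwarz_pg nu).
Proof. by move=> phi [D O _ S]; exact: schwarz_preserves. Qed.
End SchwarzPseudogroup.

Lemma linear_subZ (K : comNzRingType) (U V : lmodType K) k (f g : U -> V) :
  linear f -> linear g -> linear (fun u => f u - k *: g u).
Proof.
move=> fl gl a u v; rewrite fl gl scalerDr opprD addrACA scalerBr.
by rewrite !scalerA (mulrC k).
Qed.

Lemma sub_eq_lcomb (K : comNzRingType) (V : lmodType K) k (u v w x h : V) :
  u = k *: v + h -> w = 1 *: x + h -> u - k *: v = w - 1 *: x.
Proof. by move=> -> ->; rewrite !(addrC _ h) !addrK. Qed.

(** * The action maps as an instance of the bimodule action *)

Section ActionMapFacts.
Context {R : realType} (nu : R -> R) (Gamma : set (R -> set R)).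
Local Notation C := R[i].
Local Notation A := (groupoid_alg Gamma).
Local Notation P := (polyP C).
Hypotheses (nus : smooth_on setT nu) (GammaP : pseudogroup Gamma)
  (GammaC : preserves_connection nu Gamma).

Definition mulPl (p : P) : A -> A := gmull (rho nu p).
Definition mulPr (p : P) : A -> A := gmulr (rho nu p).
Let op := @groupoid_op R Gamma.
Let rs (p : P) : smooth_fun (rho nu p) := rho_smooth nus p.

Let mlL p : linear (mulPl p). Proof. exact (gmull_linear GammaP (rs p)). Qed.
Let mrL p : linear (mulPr p). Proof. exact (gmulr_linear GammaP (rs p)). Qed.
Let mlP a : linear (fun p => mulPl p a).
Proof.
move=> k p q; exact (gmull_lin GammaP a (rs _) (rs p) (rs q) (rho_lcomb nu k p q)).
Qed.
Let mrP a : linear (fun p => mulPr p a).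
Proof.
move=> k p q; exact (gmulr_lin GammaP a (rs _) (rs p) (rs q) (rho_lcomb nu k p q)).
Qed.
Let mlM (p q : P) a : mulPl (p * q) a = mulPl p (mulPl q a).
Proof. exact (gmullM GammaP a (rs _) (rs p) (rs q) (rhoM nu p q)). Qed.
Let mrM (p q : P) a : mulPr (p * q) a = mulPr p (mulPr q a).
Proof. exact (gmulrM GammaP a (rs _) (rs p) (rs q) (rhoM nu p q)). Qed.
Let ml1 a : mulPl 1 a = a. Proof. exact (gmull1 GammaP a (rs 1) (rho1 nu)). Qed.
Let mr1 a : mulPr 1 a = a. Proof. exact (gmulr1 GammaP a (rs 1) (rho1 nu)). Qed.
Let mlr p q a : mulPl p (mulPr q a) = mulPr q (mulPl p a).
Proof. exact (gmull_gmulr GammaP a (rs p) (rs q)). Qed.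
Let Xml p a : op GenX (mulPl p a) = mulPl (polyP_op GenX p) a + mulPl p (op GenX a).
Proof. exact (X_gmull GammaP a (rs p) (rs _) (y_dx_rho nus p)). Qed.
Let Yml p a : op GenY (mulPl p a) = mulPl (polyP_op GenY p) a + mulPl p (op GenY a).
Proof. exact (Y_gmull GammaP a (rs p) (rs _) (y_dy_rho nus p)). Qed.
Let dml p a : op (GenD 0) (mulPl p a) = mulPl p (op (GenD 0) a).
Proof. exact (D_gmull GammaP a 0 (rs p)). Qed.
Let Xmr p a : op GenX (mulPr p a) = mulPr (polyP_op GenX p) a + mulPr p (op GenX a)
  + mulPr (polyP_op GenY p) (op (GenD 0) a).
Proof. exact (X_gmulr GammaP a (rs p) (rs _) (rs _) (y_dx_rho nus p) (y_dy_rho nus p)). Qed.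
Let Ymr p a : op GenY (mulPr p a) = mulPr (polyP_op GenY p) a + mulPr p (op GenY a).
Proof. exact (Y_gmulr GammaP a (rs p) (rs _) (y_dy_rho nus p)). Qed.
Let dmr p a : op (GenD 0) (mulPr p a) = mulPr p (op (GenD 0) a).
Proof. exact (D_gmulr GammaP a 0 (rs p)). Qed.

Let schwarz_arith (y l l' k n n1 : R) : l' - 2^-1 * l ^+ 2 = k ^+ 2 * n1 - n ->
  (y ^+ 2 * l')%:C%C - 2^-1 * ((y ^+ 1 * l)%:C%C * (y ^+ 1 * l)%:C%C) =
    (- (y ^+ 2 * n))%:C%C - (- ((k * y) ^+ 2 * n1))%:C%C :> C.
Proof.
move=> E; have -> : 2^-1 = (2^-1)%:C%C :> C by rewrite fmorphV rmorph_nat.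
rewrite -!rmorphM -!rmorphB; congr (_%:C)%C.
have -> : l' = k ^+ 2 * n1 - n + 2^-1 * l ^+ 2 by rewrite -E subrK.
ring.
Qed.

(** On [f U_phi] the operator [delta_2 - delta_1^2 / 2] multiplies by [y^2 S(psi)], and
    [preserves_schwarz] turns this into [Omega] minus its value at the preimage. The latter is right
    multiplication by [Omega]. *)
Lemma delta2_Omega phi z : Gamma phi -> hran phi z ->
  delta 1 phi z - 2^-1 * (delta 0 phi z * delta 0 phi z) =
    Omega nu z - transport phi (Omega nu) z.
Proof.
move=> G zr; have [D O] := pg_diffeo GammaP G; have [zr1 _] := zr.
have E := preserves_schwarz D O (GammaC G) zr1.
refine (etrans _ (esym (congr1 (fun a => Omega nu z - a) (transportE D O (Omega nu) zr)))).
refine (etrans (congr2 (fun a b => a - 2^-1 * (b * b)) (deltaE D O 1 zr) (deltaE D O 0 zr)) _).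
exact (schwarz_arith z.2 E).
Qed.

Let dd_arith (u v f w x : C) : u - 2^-1 * (v * v) = w - x ->
  u * f - 2^-1 * (v * (v * f)) = w * f - f * x.
Proof.
by move=> E; rewrite (mulrA v) mulrA -mulrBl E mulrBl (mulrC f).
Qed.

Let rho_Z0 : rho nu (polyZ C 0) = Omega nu.
Proof. by apply/funext => z; rewrite rhoZ. Qed.

Let d2E a : op (GenD 1) a - 2^-1 *: op (GenD 0) (op (GenD 0) a) =
  mulPl (polyZ C 0) a - mulPr (polyZ C 0) a.
Proof.
have Ls := local_op_delta GammaP 1; have L0 := local_op_delta GammaP 0.
have L00 := local_op_comp L0 L0.
have om : smooth_fun (Omega nu) by rewrite -rho_Z0; exact: rs.
have Ll := local_op_gmull GammaP om; have Lr := local_op_gmulr GammaP om.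
rewrite /mulPl /mulPr rho_Z0.
refine (etrans (galg_ext (L1 := fun a => op (GenD 1) a - 2^-1 *: op (GenD 0) (op (GenD 0) a))
  (L2 := fun a => gmull (Omega nu) a - 1 *: gmulr (Omega nu) a)
  (linear_subZ 2^-1 (local_op_linear Ls) (linear_comp (local_op_linear L0) (local_op_linear L0)))
  (linear_subZ 1 (local_op_linear Ll) (local_op_linear Lr)) _ a) (congr1 (fun b => _ - b) (scale1r _))).
move=> f phi H; have [G _ _ _] := H; have [D O] := pg_diffeo GammaP G.
(* Both differences equal [h U_phi]. Linearity in [f] is available for combinations [a f_1 + f_2]
   over one [phi], hence the common remainder [h]. *)
pose h : R * R -> C := fun z => Omega nu z * f z - f z * transport phi (Omega nu) z.
have Hl := lop_mono Ll H; have Hr := lop_mono Lr H; have H00 := lop_mono L00 H.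
have Hs := lop_mono Ls H.
have Hh : is_monomial Gamma (h, phi).
  apply: (mono_supp_intro GammaP H) => [k|z].
    have E : h = (fun z => Omega nu z * f z + (-1) * (f z * transport phi (Omega nu) z)).
      by apply/funext => z; rewrite mulN1r.
    rewrite E; apply: csmD; first exact: hran_open.
      exact (csm_sub (@subsetT _ _) (mono_csm Hl k)).
    apply: csmM; [exact: hran_open|exact: csm_cst|].
    exact (csm_sub (@subsetT _ _) (mono_csm Hr k)).
  move=> hz; apply: supp_neq0; apply: contra_neq hz => fz.
  by rewrite /h fz mulr0 mul0r subrr.
have E1 : monoU Gamma (fun z => delta 1 phi z * f z) phi =
    2^-1 *: monoU Gamma (fun z => delta 0 phi z * (delta 0 phi z * f z)) phi + monoU Gamma h phi.
  apply: (monoU_lin Hs H00 Hh) => z; rewrite /h.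
  case: (eqVneq (f z) 0) => [->|/supp_neq0 /(mono_supp GammaP H) zr].
    by rewrite !mulr0 mul0r subrr addr0.
  by rewrite -(dd_arith (f z) (delta2_Omega G zr)) addrC subrK.
have E2 : monoU Gamma (fun z => Omega nu z * f z) phi =
    1 *: monoU Gamma (fun z => f z * transport phi (Omega nu) z) phi + monoU Gamma h phi.
  by apply: (monoU_lin Hl Hr Hh) => z; rewrite /h mul1r addrC subrK.
have F1 : op (GenD 1) (monoU Gamma f phi) = monoU Gamma (fun z => delta 1 phi z * f z) phi.
  exact (local_opE Ls H).
have F2 : op (GenD 0) (op (GenD 0) (monoU Gamma f phi)) =
    monoU Gamma (fun z => delta 0 phi z * (delta 0 phi z * f z)) phi.
  exact (etrans (congr1 _ (local_opE L0 H)) (local_opE L0 (lop_mono L0 H))).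
refine (etrans (congr2 (fun a b => a - 2^-1 *: b) F1 F2) (etrans (sub_eq_lcomb E1 E2) _)).
exact (esym (congr2 (fun a b => a - 1 *: b) (local_opE Ll H) (local_opE Lr H))).
Qed.

Let gm_mr a p b : gmul a (mulPr p b) = mulPr p (gmul a b).
Proof. exact (gmul_gmulr GammaP a b (rs p)). Qed.
Let gm_bal p a b : gmul (mulPr p a) b = gmul a (mulPl p b).
Proof. exact (gmul_balanced GammaP a b (rs p)). Qed.

Lemma chi_pure p h q a :
  chi nu (hs_pure p h q) a = mulPr q (mulPl p (groupoid_act h a)).
Proof.
exact (hs_act_pure (groupoid_rep GammaP) mlL mrL mlP mrP mlM mrM ml1 mr1 mlr Xml Yml dml
  Xmr Ymr dmr d2E p h q a).
Qed.

Lemma chi_n_linear n (a : 'I_n -> A) : linear (fun t : tensP C n => chi_n nu t a).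
Proof.
exact (tens_act_linear (groupoid_rep GammaP) mlL mrL mlP mrP mlM mrM ml1 mr1 mlr Xml Yml dml
  Xmr Ymr dmr d2E (gmul_linl GammaP) (gmul_linr GammaP) gm_mr gm_bal a).
Qed.

Lemma chi_n_pure n (h : 'I_n -> Hs C) (a : 'I_n -> A) :
  chi_n nu (lquot_class (lspan (@tensP_relators C n)) << h >>) a =
    gprod (fun i => chi nu (h i) (a i)).
Proof.
exact (tens_act_pure (groupoid_rep GammaP) mlL mrL mlP mrP mlM mrM ml1 mr1 mlr Xml Yml dml
  Xmr Ymr dmr d2E (gmul_linl GammaP) (gmul_linr GammaP) gm_mr gm_bal h a).
Qed.

End ActionMapFacts.

(** * Charts with prescribed jets *)

Section PolynomialFunctions.
Context {R : realType}.
Implicit Types (p : {poly R}) (c x : R).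
Local Notation Dn n := (iter n (fun h : R -> R => 'D_1 h : R -> R)).

Lemma derive_horner p : 'D_1 (horner p) = horner p^`().
Proof. by rewrite derivE; apply/funext => x; rewrite derive1E. Qed.

Lemma derive_shift_horner p c : 'D_1 (fun x : R => p.[x - c]) = (fun x => p^`().[x - c]).
Proof.
have E q : (fun x : R => q.[x - c]) = horner (q \Po ('X - c%:P)).
  by apply/funext => x; rewrite horner_comp !hornerE.
rewrite E derive_horner deriv_comp E; apply/funext => x.
by rewrite derivB derivX derivC subr0 mulr1.
Qed.

Lemma differentiable_shift_horner p c x : differentiable (fun x : R => p.[x - c]) x.
Proof.
have -> : (fun x : R => p.[x - c]) = horner (p \Po ('X - c%:P)).
  by apply/funext => y; rewrite horner_comp !hornerE.
exact/derivable1_diffP/derivable_horner.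
Qed.

Lemma smk_horner k (U : set R) p c : smk k U (fun x => p.[x - c]).
Proof.
elim: k p => [//|k IH] p; split=> [x _|v]; first exact: differentiable_shift_horner.
have -> : 'D_v (fun x : R => p.[x - c]) = (fun x => (v *: p^`()).[x - c]); last exact: IH.
apply/funext => x; rewrite hornerZ; have d := differentiable_shift_horner p c x.
exact (etrans (derive_dir v d) (congr1 (fun h : R -> R => v * h x) (derive_shift_horner p c))).
Qed.

Lemma iter_derive_horner n p c : Dn n (fun x : R => p.[x - c]) = (fun x => p^`(n).[x - c]).
Proof.
by elim: n => [|n IH]; [rewrite derivn0|rewrite iterS IH derive_shift_horner derivnS].
Qed.

Lemma derivn_horner0 n p : p^`(n).[0] = p`_n *+ n`!.
Proof.
by rewrite horner_coef0 coef_derivn addn0 ffactnn.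
Qed.

(** Only the surviving power of [x - c] matters, so [h] stays unspecified: for [n < N] the
    derivative vanishes at [c], and an error term divisible by [(x - c)^N] does not show in the jet
    of order below [N]. *)
Lemma iter_derive_Xn (V : set R) c n (g : R -> R) : open V -> (forall k, smk k V g) ->
  forall N, (n <= N)%N -> exists2 h : R -> R, (forall k, smk k V h) &
    forall x, V x -> Dn n (fun x => (x - c) ^+ N * g x) x = (x - c) ^+ (N - n) * h x.
Proof.
move=> oV gs; elim: n => [|n IH] N nN; first by exists g => // x _; rewrite subn0.
have [h hs E] := IH N (ltnW nN).
have Xs k m : smk k V (fun x : R => (x - c) ^+ m).
  have -> : (fun x : R => (x - c) ^+ m) = (fun x => ('X^m : {poly R}).[x - c]).
    by apply/funext => x; rewrite hornerXn.
  exact: smk_horner.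
have dX m x : 'D_1 (fun x : R => (x - c) ^+ m) x = m%:R * (x - c) ^+ m.-1.
  have -> : (fun x : R => (x - c) ^+ m) = (fun x => ('X^m : {poly R}).[x - c]).
    by apply/funext => y; rewrite hornerXn.
  refine (etrans (congr1 (fun h : R -> R => h x) (derive_shift_horner _ c)) _).
  by rewrite derivXn hornerMn hornerXn mulr_natl.
exists (fun x => (N - n)%:R * h x + (x - c) ^+ 1 * 'D_1 h x) => [k|x Vx].
  apply: smkD => //; first by apply: smkM => //; exact: smk_cst.
  by apply: smkM => //; exact: derive_smk hs k.
have [dh _] := hs 1; have [dXn _] := Xs 1 (N - n)%N.
have E' : Dn n.+1 (fun x => (x - c) ^+ N * g x) x =
    'D_1 (fun x => (x - c) ^+ (N - n) * h x) x.
  by apply: near_eq_derive; apply: filterS E (open_nbhs_nbhs (conj oV Vx)).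
rewrite E' der1M ?dX; [|exact: dXn|exact: dh].
have -> : (N - n)%N = (N - n.+1).+1 by rewrite subnSK.
by rewrite /= exprSr expr1; ring.
Qed.

(* Raising the precision from [N] to [N + 1] is a linear equation for the
   coefficient [a] of [X^(N + 2)], since [q''] alone contributes to order [N]. *)
Let step (p T : {poly R}) a N :
  let q := p + a *: 'X^(N + 2) in
  q^`()^`() * q - (3 / 2) *: q^`() ^+ 2 - T * q ^+ 2 =
    (p^`()^`() * p - (3 / 2) *: p^`() ^+ 2 - T * p ^+ 2)
      + (a * ((N + 2) * (N + 1))%:R) *: ('X^N * p)
      + 'X^(N.+1) * ((a *: 'X) * p^`()^`() + (a ^+ 2 * ((N + 2) * (N + 1))%:R) *: 'X^(N + 1)
         - (3 / 2) *: (((2 * a) * (N + 2)%:R) *: p^`() + ((a * (N + 2)%:R) ^+ 2) *: 'X^(N + 1))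
         - T * ((2 * a) *: ('X * p) + (a ^+ 2) *: 'X^(N + 3))).
Proof.
move=> q; have q1 : q^`() = p^`() + (a * (N + 2)%:R) *: 'X^(N + 1).
  by rewrite derivD derivZ derivXn addn2 addn1 /= -[_ *+ N.+2]scaler_nat scalerA.
have q2 : q^`()^`() = p^`()^`() + (a * ((N + 2) * (N + 1))%:R) *: 'X^N.
  by rewrite q1 derivD derivZ derivXn addn1 /= -[_ *+ N.+1]scaler_nat scalerA -mulrA natrM.
rewrite q2 q1 /q -!mul_polyC !natrM !(polyCM, polyC_exp, polyC_natr).
have -> : 'X^(N + 2) = 'X^N * 'X * 'X :> {poly R} by rewrite -!exprSr addn2.
have -> : 'X^(N + 1) = 'X^N * 'X :> {poly R} by rewrite -exprSr addn1.
have -> : 'X^(N + 3) = 'X^N * 'X * 'X * 'X :> {poly R} by rewrite -!exprSr addn3.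
have -> : 'X^(N.+1) = 'X^N * 'X :> {poly R} by rewrite -exprSr.
have h2 : 2 * 2^-1%:P = 1 :> {poly R} by rewrite -polyC_natr -polyCM divff ?pnatr_eq0.
ring: h2.
Qed.

(* [S(v) = v''' / v' - (3 / 2) (v'' / v')^2], so that the equation below, with [p = v'],
   says that [S(v)] and [T] have the same jet of order [N - 1]. *)
Lemma schwarz_jet (T : {poly R}) s N : exists p r : {poly R},
  [/\ p.[0] = 1, p^`().[0] = s &
    p^`()^`() * p - (3 / 2) *: p^`() ^+ 2 - T * p ^+ 2 = 'X^N * r].
Proof.
elim: N => [|N [p [r [p0 p1 E]]]].
  exists (1 + s *: 'X), (let p := 1 + s *: 'X in p^`()^`() * p - (3 / 2) *: p^`() ^+ 2 - T * p ^+ 2).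
  by split; rewrite ?expr0 ?mul1r // ?derivD ?derivC ?derivZ ?derivX !hornerE //= ?mulr0 ?addr0.
(* As [p.[0] = 1], the new term [a (N + 2) (N + 1) X^N p] then cancels the lowest coefficient of the
   error [X^N r]. *)
pose a := - r.[0] / ((N + 2) * (N + 1))%:R.
have k0 : ((N + 2) * (N + 1))%:R != 0 :> R by rewrite pnatr_eq0 addn2 addn1.
have [r' rE] : exists r', r - (r.[0])%:P * p = 'X * r'.
  have /factor_theorem[r' rE] : root (r - (r.[0])%:P * p) 0.
    by rewrite rootE !hornerE p0 mulr1 subrr.
  by exists r'; rewrite rE subr0 mulrC.
exists (p + a *: 'X^(N + 2)); eexists; split.
- by rewrite !hornerE p0 expr0n addn2 /= mulr0 addr0.
- by rewrite derivD derivZ derivXn !hornerE p1 addn2 /= hornerMn hornerXn expr0n /= mul0rn mulr0 addr0.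
rewrite (step _ _ a N) E.
have -> : 'X^N * r + (a * ((N + 2) * (N + 1))%:R) *: ('X^N * p) = 'X^(N.+1) * r'.
  rewrite /a mulrAC -mulrA divff // mulr1 -mul_polyC polyCN mulNr mulrCA -mulrBr rE.
  by rewrite mulrA -exprSr.
by rewrite -mulrDr.
Qed.
End PolynomialFunctions.

(** * Increasing smooth functions as local diffeomorphisms *)

Section InverseFunction.
Context {R : realType}.
Variables (v : R -> R) (c e : R).
Hypotheses (vs : forall k, smk k setT v)
  (vpos : forall x, `|x - c| < e -> 0 < 'D_1 v x).

Definition graph_on : R -> set R := fun x => [set y | `|x - c| < e /\ y = v x].

Let I : set R := [set x | `|x - c| < e].

Let I_open : open I. Proof. exact: open_dist. Qed.

Lemma pdom_graph_on : pdom graph_on = [set x | `|x - c| < e].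
Proof. by rewrite eqEsubset; split=> [x [y []]|x xI] //; exists (v x). Qed.

Let v_diff x : differentiable v x.
Proof. by have [d _] := vs 1; exact: d. Qed.

Let I_convex x y t : I x -> I y -> x < t < y -> I t.
Proof.
rewrite /I /= !ltr_norml => /andP[x1 x2] /andP[y1 y2] /andP[t1 t2].
by apply/andP; split; lra.
Qed.

Let v_incr x y : I x -> I y -> x < y -> v x < v y.
Proof.
move=> Ix Iy xy; have [t txy E] := MVT_differentiable xy v_diff.
by rewrite -subr_gt0 E mulr_gt0 ?subr_gt0 // vpos //; exact: I_convex txy.
Qed.

Let v_inj x y : I x -> I y -> v x = v y -> x = y.
Proof.
move=> Ix Iy E; have [xy|yx|//] := ltgtP x y.
  by have := v_incr Ix Iy xy; rewrite E ltxx.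
by have := v_incr Iy Ix yx; rewrite E ltxx.
Qed.

Let inj y : is_subset1 (pinv graph_on y).
Proof. by move=> x x' [Ix ->] [Ix']; exact: v_inj. Qed.

Let vK x : I x -> papp (pinv graph_on) (v x) = x.
Proof. by move=> Ix; apply: papp_eq; [exact: inj|split]. Qed.

Let pappE x : I x -> papp graph_on x = v x.
Proof. by move=> Ix; apply: papp_eq => // a b [_ ->] [_ ->]. Qed.

Let ran_open : open (pran graph_on).
Proof.
rewrite openE => _ [x [Ix ->]].
(* Half the distance from [x] to the nearer end of the interval, so that the closed segment of
   radius [d] stays inside and the values of [v] at its ends enclose a neighbourhood of [v x]. *)
pose d := (e - `|x - c|) / 2; have d0 : 0 < d by rewrite divr_gt0 // subr_gt0.
have Ib b : `|b - x| <= d -> I b.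
  move=> bd; rewrite /I /= -(subrK x b) -addrA; apply: le_lt_trans (ler_normD _ _) _.
  by have : d < e - `|x - c|; [rewrite /d; have : 0 < e - `|x - c| by rewrite subr_gt0|]; lra.
have Ia : I (x - d) by apply: Ib; rewrite addrC addKr normrN gtr0_norm.
have Ib' : I (x + d) by apply: Ib; rewrite addrC addKr gtr0_norm.
have va : v (x - d) < v x by apply: v_incr => //; rewrite ltrBlDr ltrDl.
have vb : v x < v (x + d) by apply: v_incr => //; rewrite ltrDl.
have n1 : nbhs (v x) [set y | v (x - d) < y] by exact: open_nbhs_nbhs (conj (@open_gt _ (v (x - d))) va).
have n2 : nbhs (v x) [set y | y < v (x + d)] by exact: open_nbhs_nbhs (conj (@open_lt _ (v (x + d))) vb).
apply: filterS2 n1 n2 => y ya yb.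
have ab : x - d <= x + d by lra.
have vc : {within `[x - d, x + d], continuous v}.
  by apply: continuous_subspaceT => t; exact: differentiable_continuous.
have [|t] := @IVT R v (x - d) (x + d) y ab vc.
  by rewrite ge_min le_max (ltW ya) (ltW yb) orbT.
rewrite in_itv /= => /andP[t1 t2] <-; exists t; split=> //.
by apply: Ib; rewrite ler_norml; apply/andP; split; lra.
Qed.

Let u := papp (pinv graph_on).

Let u_derive y : pran graph_on y -> is_derive y 1 u ('D_1 v (u y))^-1.
Proof.
move=> [x [Ix ->]]; rewrite /u vK //; apply: is_derive_inverse.
- by apply: filterS (open_nbhs_nbhs (conj I_open Ix)) => t; exact: vK.
- by apply: (@filterE _ (nbhs x)) => t; exact: differentiable_continuous.
- by apply: DeriveDef => //; exact: diff_derivable.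
- by apply: lt0r_neq0; exact: vpos.
Qed.

(** Bootstrapping: the derivative of [u] is [1 / v'(u)], which is as smooth as [u] is already known
    to be, so every step gains one order. *)
Let u_smk k : smk k (pran graph_on) u.
Proof.
elim: k => [//|k IH]; split=> [y /u_derive d|a].
  by apply/derivable1_diffP; exact: ex_derive.
have uI y : pran graph_on y -> I (u y) by move=> [x [Ix ->]]; rewrite /u vK.
have vD : smk k I ('D_1 v) by apply: smk_sub (@subsetT _ _) (derive_smk vs k).
have s : smk k (pran graph_on) (fun y => a * ('D_1 v (u y))^-1).
  apply: smkM => //; first exact: smk_cst.
  apply: smkV => // [y /uI Iy|]; first by apply: lt0r_neq0; exact: vpos.
  exact: (smk_comp1 ran_open I_open uI vD IH).
apply: smk_eq ran_open _ s => y yr; have d := u_derive yr.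
have du : differentiable u y by apply/derivable1_diffP; exact: ex_derive.
by rewrite (derive_dir a du); congr (_ * _); rewrite derive_val.
Qed.

Lemma graph_on_diffeo : local_diffeo graph_on.
Proof.
split=> //.
- by move=> x y y' [_ ->] [_ ->].
- by rewrite pdom_graph_on.
- apply/smooth_onP => k; rewrite pdom_graph_on.
  apply: smk_eq I_open _ (smk_sub (@subsetT _ _) (vs k)) => x Ix.
  by rewrite pappE.
- by apply/smooth_onP => k; exact: u_smk.
Qed.

Lemma near_papp_graph_on x : `|x - c| < e -> \near x, papp graph_on x = v x.
Proof. by move=> Ix; apply: filterS pappE (open_nbhs_nbhs (conj I_open Ix)). Qed.

Lemma graph_on_orientation : orientation_preserving graph_on.
Proof.
move=> x; rewrite pdom_graph_on => Ix; rewrite derive1E.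
by rewrite (near_eq_derive _ (near_papp_graph_on Ix)) vpos.
Qed.
End InverseFunction.

(** * Smooth cutoff functions *)

Section SmoothCutoff.
Context {R : realType}.

(* The factor [x^-n] makes the family stable under differentiation. *)
Definition flat (n : nat) (x : R) : R := if 0 < x then x^-1 ^+ n * expR (- x^-1) else 0.

(** From [exp y >= y^(n+1) / (n+1)!] at [y = 1 / x]; one power more than [x^-n] leaves the factor
    [x] that gives continuity at 0. *)
Lemma flat_bound n x : `|flat n x| <= n.+1`!%:R * `|x|.
Proof.
rewrite /flat; case: ifPn => [x0|_]; last by rewrite normr0 mulr_ge0.
rewrite ger0_norm ?mulr_ge0 ?exprn_ge0 ?invr_ge0 ?(ltW x0) ?expR_ge0 // (gtr0_norm x0).
have y0 : 0 <= x^-1 by rewrite invr_ge0 ltW.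
have := expR_ge1Dxn n y0; set f := n.+1`!%:R => H.
have f0 : 0 < f by rewrite /f ltr0n fact_gt0.
rewrite expRN -[leLHS]/(_ / _) ler_pdivrMr ?expR_gt0 //.
have H' : x^-1 ^+ n.+1 / f <= expR x^-1 by apply: le_trans H; rewrite lerDr.
apply: le_trans (_ : f * x * (x^-1 ^+ n.+1 / f) <= _); last first.
  by rewrite ler_wpM2l // mulr_ge0 // ltW.
rewrite exprS; set y := x^-1 ^+ n.
have -> : f * x * (x^-1 * y / f) = y by field; rewrite (gt_eqF f0) (gt_eqF x0).
by [].
Qed.

Lemma flat_continuous0 n : {for 0, continuous (flat n)}.
Proof.
have f0 : flat n 0 = 0 by rewrite /flat ltxx.
rewrite /prop_for /continuous_at f0; apply/cvgrPdist_lt => eps eps0.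
pose K : R := n.+1`!%:R; have K0 : 0 < K by rewrite ltr0n fact_gt0.
have dl : 0 < eps / K by rewrite divr_gt0.
near=> t.
rewrite sub0r normrN; apply: le_lt_trans (flat_bound n t) _.
rewrite mulrC -ltr_pdivlMr //.
Unshelve. all: by end_near. Qed.

Let flat_mul n (x : R) : flat n x = flat n.+1 x * x.
Proof.
rewrite /flat; case: ifPn => [x0|_]; last by rewrite mul0r.
rewrite exprS; set y := x^-1 ^+ n; set e := expR _; field; by rewrite gt_eqF.
Qed.

Let flat_arith n (x e : R) :
  n%:R * x^-1 ^+ n.-1 * - (x ^+ 2)^-1 * e + x^-1 ^+ n * (e * (x ^+ 2)^-1) =
    x^-1 ^+ n.+2 * e - n%:R * (x^-1 ^+ n.+1 * e).
Proof.
by rewrite -exprVn expr2; case: n => [|m]; rewrite /= !exprS ?expr0; ring.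
Qed.

Lemma flat_derive n (x : R) : is_derive x 1 (flat n) (flat n.+2 x - n%:R * flat n.+1 x).
Proof.
have [x0|x0|->] := ltgtP x 0.
- have E : \near x, (cst 0 : R -> R) x = flat n x.
    have : \near x, x < 0 by exact: open_nbhs_nbhs (conj (@open_lt _ 0) x0).
    by apply: filterS => t t0; rewrite /flat ltNge ltW.
  have -> : flat n.+2 x - n%:R * flat n.+1 x = 0.
    by rewrite /flat ltNge ltW //= mulr0 subrr.
  apply: DeriveDef; last by rewrite -(near_eq_derive _ E) derive_cst.
  apply/derivable1_diffP; apply: near_eq_differentiable E _.
  exact: differentiable_cst.
- pose h (x : R) : R := x^-1 ^+ n * expR (- x^-1).
  have E : \near x, h x = flat n x.
    have : \near x, 0 < x by exact: open_nbhs_nbhs (conj (@open_gt _ 0) x0).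
    by apply: filterS => t t0; rewrite /flat t0.
  have n0 : x != 0 by rewrite gt_eqF.
  have did : differentiable (@idfun R) x by have [d _] := @smk_id R 1 setT; exact: d.
  have di : differentiable (fun x : R => x^-1) x by exact (differentiableV did n0).
  have Di : 'D_1 (fun x : R => x^-1) x = - (x ^+ 2)^-1.
    refine (etrans (@der1V R idfun x n0 did) _).
    by rewrite derive_id mul1r.
  have dN : differentiable (fun x : R => - x^-1) x by exact (differentiableN di).
  have DN : 'D_1 (fun x : R => - x^-1) x = (x ^+ 2)^-1.
    by refine (etrans (deriveN (diff_derivable di)) _); rewrite Di opprK.
  have dX (y : R) : differentiable (fun y : R => y ^+ n) y.
    exact/derivable1_diffP/exprn_derivable.
  have dE (y : R) : differentiable (@expR R) y by exact/derivable1_diffP/derivable_expR.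
  have dp : differentiable (fun x : R => x^-1 ^+ n) x by exact (differentiable_comp di (dX _)).
  have dq : differentiable (fun x : R => expR (- x^-1)) x by exact (differentiable_comp dN (dE _)).
  have Dp : 'D_1 (fun x : R => x^-1 ^+ n) x = n%:R * x^-1 ^+ n.-1 * - (x ^+ 2)^-1.
    refine (etrans (derive_comp1 _ di (dX _)) _); rewrite Di exp_derive.
    by rewrite /GRing.scale /= mulr1.
  have Dq : 'D_1 (fun x : R => expR (- x^-1)) x = expR (- x^-1) * (x ^+ 2)^-1.
    refine (etrans (derive_comp1 _ dN (dE _)) _); rewrite DN.
    exact (congr1 (fun h : R -> R => h (- x^-1) * (x ^+ 2)^-1) (derive_expR R)).
  have Dh : 'D_1 h x = flat n.+2 x - n%:R * flat n.+1 x.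
    refine (etrans (der1M dp dq) _); rewrite Dp Dq /flat x0; set e := expR _.
    exact: flat_arith.
  have dh : differentiable h x by exact (differentiableM dp dq).
  apply: DeriveDef; last by rewrite -(near_eq_derive _ E).
  by apply/derivable1_diffP; exact: near_eq_differentiable E dh.
- have -> : flat n.+2 0 - n%:R * flat n.+1 0 = 0 by rewrite /flat ltxx mulr0 subrr.
  (* At 0 the slope function is [flat n.+1] itself, by [flat n x = flat n.+1 x * x]. *)
  apply/is_derive1_caratheodory; exists (flat n.+1); split.
  + by move=> z; rewrite subr0 -flat_mul [X in _ - X]/flat ltxx subr0.
  + exact: flat_continuous0.
  + by rewrite /flat ltxx.
Qed.

Lemma smk_flat k (U : set R) n : smk k U (flat n).
Proof.
apply: (@smk_sub _ _ _ k setT U _ (@subsetT _ _)).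
elim: k n => [//|k IH] n; split=> [x _|a].
  by have d := flat_derive n x; apply/derivable1_diffP; exact: ex_derive.
have s : smk k setT (fun x => a * (flat n.+2 x - n%:R * flat n.+1 x)).
  apply: smkM; [exact: openT|exact: smk_cst|].
  apply: smkD; [exact: openT|exact: IH|].
  by apply: smkN; [exact: openT|apply: smkM; [exact: openT|exact: smk_cst|exact: IH]].
apply: smk_eq openT _ s => x _; have d := flat_derive n x.
have df : differentiable (flat n) x by apply/derivable1_diffP; exact: ex_derive.
by rewrite (derive_dir a df); congr (_ * _); rewrite derive_val.
Qed.

Lemma flat_gt0 (x : R) : 0 < x -> 0 < flat 0 x.
Proof. by move=> x0; rewrite /flat x0 expr0 mul1r expR_gt0. Qed.

Lemma flat_ge0 (x : R) : 0 <= flat 0 x.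
Proof. by rewrite /flat; case: ifP => // _; rewrite expr0 mul1r expR_ge0. Qed.

Lemma flat_eq0 (x : R) : x <= 0 -> flat 0 x = 0.
Proof. by rewrite /flat ltNge => ->. Qed.

(** The quotient [a / (a + b)], with [a] positive for [q < 2] and [b] positive for [q > 1], so that
    the denominator never vanishes. The squared distance [q] stands in for the absolute value, which
    is not smooth; at distance [2 r] it is already 4. *)
Lemma cutoff (c r : R) : 0 < r -> exists B : R -> R, [/\ forall k U, smk k U B,
  forall x, `|x - c| < r -> B x = 1 & forall x, 2 * r <= `|x - c| -> B x = 0].
Proof.
move=> r0; pose q (x : R) : R := ((x - c) / r) ^+ 2.
have qs k : smk k setT q.
  have lin : smk k setT (fun x : R => (x - c) / r).
    apply: smkM; [exact: openT| |exact: smk_cst].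
    by apply: smkD; [exact: openT|exact: smk_id|exact: smk_cst].
  have -> : q = (fun x => (x - c) / r * ((x - c) / r)) by apply/funext => x; rewrite /q expr2.
  by apply: smkM; [exact: openT|exact: lin|exact: lin].
pose a (x : R) := flat 0 (2 - q x); pose b (x : R) := flat 0 (q x - 1).
have as_ k : smk k setT a.
  apply: (smk_comp1 openT openT (fun _ _ => I) (smk_flat k setT 0)).
  by apply: smkD; [exact: openT|exact: smk_cst|apply: smkN; [exact: openT|exact: qs]].
have bs k : smk k setT b.
  apply: (smk_comp1 openT openT (fun _ _ => I) (smk_flat k setT 0)).
  by apply: smkD; [exact: openT|exact: qs|exact: smk_cst].
have ab x : a x + b x != 0.
  apply: lt0r_neq0; have [h|h] := ltP (q x) 2.
    by apply: ltr_wpDr; [exact: flat_ge0|apply: flat_gt0; lra].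
  by apply: ltr_wpDl; [exact: flat_ge0|apply: flat_gt0; lra].
exists (fun x => a x * (a x + b x)^-1); split=> [k U|x xr|x xr].
- apply: (@smk_sub _ _ _ k setT U _ (@subsetT _ _)).
  apply: smkM; [exact: openT|exact: as_|].
  by apply: smkV; [exact: openT|move=> z _; exact: ab|
    apply: smkD; [exact: openT|exact: as_|exact: bs]].
- have b0 : b x = 0.
    apply: flat_eq0; rewrite subr_le0 /q -real_normK ?num_real // normrM normfV (gtr0_norm r0).
    by rewrite exprn_ile1 ?divr_ge0 ?(ltW r0) // ler_pdivrMr // mul1r ltW.
  by rewrite b0 addr0 divff //; have := ab x; rewrite b0 addr0.
- have -> : a x = 0; last by rewrite mul0r.
  apply: flat_eq0; rewrite subr_le0 /q -real_normK ?num_real // normrM normfV (gtr0_norm r0).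
  have : 2 <= `|x - c| / r by rewrite ler_pdivlMr.
  by move=> h; rewrite expr2; nra.
Qed.
End SmoothCutoff.

Section LocalChart.
Context {R : realType}.
Local Notation Dn n := (iter n (fun h : R -> R => 'D_1 h : R -> R)).

Lemma iter_deriveD (V : set R) (f g : R -> R) n : open V ->
  (forall k, smk k V f) -> (forall k, smk k V g) ->
  forall x, V x -> Dn n (fun x => f x + g x) x = Dn n f x + Dn n g x.
Proof.
move=> oV fs gs; elim: n => [//|n IH] x Vx.
have [df _] := iter_smk n fs 1; have [dg _] := iter_smk n gs 1.
refine (etrans (near_eq_derive _ (filterS IH (open_nbhs_nbhs (conj oV Vx)))) _).
exact (deriveD (diff_derivable (df _ Vx)) (diff_derivable (dg _ Vx))).
Qed.

Lemma iter_deriveN (V : set R) (f : R -> R) n : open V -> (forall k, smk k V f) ->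
  forall x, V x -> Dn n (fun x => - f x) x = - Dn n f x.
Proof.
move=> oV fs; elim: n => [//|n IH] x Vx; have [df _] := iter_smk n fs 1.
refine (etrans (near_eq_derive _ (filterS IH (open_nbhs_nbhs (conj oV Vx)))) _).
exact (deriveN (diff_derivable (df _ Vx))).
Qed.

Lemma smk_schw (phi : R -> set R) k : local_diffeo phi -> orientation_preserving phi ->
  smk k (pran phi) (schw phi).
Proof.
move=> D O; have oV := ld_open_ran D.
have Ls : forall k, smk k (pran phi) (lj phi) by move=> j; exact: lj_smk.
apply: smkD => //; first exact: derive_smk Ls k.
apply: smkN => //; apply: smkM => //; first exact: smk_cst.
have -> : (fun y => lj phi y ^+ 2) = (fun y => lj phi y * lj phi y).
  by apply/funext => y; rewrite expr2.
by apply: smkM.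
Qed.

Definition antideriv (p : {poly R}) : {poly R} :=
  \poly_(i < (size p).+1) (if i is j.+1 then p`_j / j.+1%:R else 0).

Lemma deriv_antideriv p : (antideriv p)^`() = p.
Proof.
apply/poly.polyP => i; rewrite coef_deriv coef_poly ltnS.
case: ltnP => [_|h]; first by rewrite -[LHS]mulr_natr mulfVK // pnatr_eq0.
by rewrite mul0rn nth_default.
Qed.

Lemma antideriv0 p : (antideriv p).[0] = 0.
Proof. by rewrite horner_coef0 coef_poly. Qed.

Let chart_arith (t x r p0 p1 p2 : R) : p0 != 0 ->
  p2 * p0 - (3 / 2) * p1 ^+ 2 - t * p0 ^+ 2 = x * r ->
  (p2 * p0 - p1 * p1) / p0 ^+ 2 - 2^-1 * (p1 / p0) ^+ 2 = t + x * (r / p0 ^+ 2).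
Proof.
move=> n0 E; have -> : x * (r / p0 ^+ 2) = x * r / p0 ^+ 2 by rewrite mulrA.
by rewrite -E; field.
Qed.

(** Dividing the equation of [schwarz_jet] by [p^2] gives [S(v) = T + (x - c)^N g] with [g] smooth
    near [c], where [v' = p] is positive because [p.[0] = 1]. As [schw] refers to the inverse of its
    argument, [S(v)] appears as [schw (pinv w)]. *)
Lemma local_chart (c s : R) (T : {poly R}) N : exists (w : R -> set R) (e : R),
  [/\ 0 < e, local_diffeo w, orientation_preserving w & pdom w = [set x | `|x - c| < e]] /\
  [/\ w c 0, 'D_1 (papp w) c = 1, lj (pinv w) c = s &
    forall k, (k < N)%N -> Dn k (schw (pinv w)) c = T^`(k).[0]].
Proof.
have [p [r [p0 p1 E]]] := schwarz_jet T s N.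
pose v (x : R) : R := (antideriv p).[x - c].
have Dv : 'D_1 v = (fun x => p.[x - c]) by rewrite derive_shift_horner deriv_antideriv.
have Dvx x : 'D_1 v x = p.[x - c] by exact (congr1 (fun h : R -> R => h x) Dv).
have vs k : smk k setT v by exact: smk_horner.
have [e e0 pe] : exists2 e, 0 < e & forall x, `|x - c| < e -> 0 < p.[x - c].
  have cont := differentiable_continuous (differentiable_shift_horner p c c).
  have pc : 0 < p.[c - c] by rewrite subrr p0 ltr01.
  have := cont _ (open_nbhs_nbhs (conj (@open_gt R 0) pc)).
  move=> /nbhs_ballP[e e0 H]; exists e => // x xe.
  by apply: H; rewrite /ball /= distrC.
have vpos x : `|x - c| < e -> 0 < 'D_1 v x by rewrite Dvx; exact: pe.
have cc : `|c - c| < e by rewrite subrr normr0.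
pose w := graph_on v c e.
have wD := graph_on_diffeo vs vpos; have wO := graph_on_orientation vpos.
have dom := pdom_graph_on v c e.
pose V : set R := [set x | `|x - c| < e].
have oV : open V by rewrite /V -dom; exact: ld_open_dom wD.
have d1 x : V x -> 'D_1 (papp w) x = p.[x - c].
  move=> Vx; refine (etrans (near_eq_derive _ (@near_papp_graph_on R v c e x Vx)) _).
  exact: Dvx.
have d2 x : V x -> 'D_1 ('D_1 (papp w)) x = p^`().[x - c].
  move=> Vx; refine (etrans (near_eq_derive _ (filterS d1 (open_nbhs_nbhs (conj oV Vx)))) _).
  exact (congr1 (fun h : R -> R => h x) (derive_shift_horner p c)).
have ljE x : V x -> lj (pinv w) x = p^`().[x - c] / p.[x - c].
  by move=> Vx; exact (congr2 (fun a b => a / b) (d2 x Vx) (d1 x Vx)).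
have schwE x : V x -> schw (pinv w) x =
    T.[x - c] + (x - c) ^+ N * (r.[x - c] / p.[x - c] ^+ 2).
  move=> Vx; have n0 : p.[x - c] != 0 by exact/lt0r_neq0/pe.
  have D1 : 'D_1 (lj (pinv w)) x =
      (p^`()^`().[x - c] * p.[x - c] - p^`().[x - c] * p^`().[x - c]) / p.[x - c] ^+ 2.
    refine (etrans (near_eq_derive _ (filterS ljE (open_nbhs_nbhs (conj oV Vx)))) _).
    refine (etrans (@der1div R (fun x => p^`().[x - c]) (fun x => p.[x - c]) x n0
      (differentiable_shift_horner _ _ _) (differentiable_shift_horner _ _ _)) _).
    exact (congr2 (fun f g : R -> R => (f x * p.[x - c] - p^`().[x - c] * g x) / p.[x - c] ^+ 2)
      (derive_shift_horner _ c) (derive_shift_horner _ c)).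
  rewrite /schw D1 (ljE x Vx); apply: chart_arith => //.
  have := congr1 (fun q : {poly R} => q.[x - c]) E.
  by rewrite !(hornerD, hornerN, hornerM, hornerZ, horner_exp, hornerX).
exists w, e; split; split=> //.
- by split=> //; rewrite /v subrr antideriv0.
- by rewrite d1 // subrr.
- by rewrite ljE // subrr p0 p1 divr1.
move=> k kN.
have g_s j : smk j V (fun x => r.[x - c] / p.[x - c] ^+ 2).
  apply: smkM => //; first exact: smk_horner.
  apply: smkV => // [x Vx|]; first by rewrite expf_neq0 // lt0r_neq0 // pe.
  have -> : (fun x : R => p.[x - c] ^+ 2) = (fun x => p.[x - c] * p.[x - c]).
    by apply/funext => x; rewrite expr2.
  by apply: smkM => //; exact: smk_horner.
have X_s j : smk j V (fun x => (x - c) ^+ N).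
  have -> : (fun x : R => (x - c) ^+ N) = (fun x => ('X^N : {poly R}).[x - c]).
    by apply/funext => x; rewrite hornerXn.
  exact: smk_horner.
have Vc : V c by [].
rewrite (iter_derive_eq k oV schwE Vc).
rewrite (iter_deriveD k oV (fun j => smk_horner j V T c) (fun j => smkM oV (X_s j) (g_s j)) Vc).
have [h _ hE] := iter_derive_Xn c oV g_s (ltnW kN).
rewrite hE // iter_derive_horner subrr expr0n subn_eq0 leqNgt kN /= mul0r addr0.
by [].
Qed.
End LocalChart.

(** * Flattening charts and their transition maps *)

Section Charts.
Context {R : realType}.
Local Notation Dn n := (iter n (fun h : R -> R => 'D_1 h : R -> R)).
Implicit Types (w phi : R -> set R) (nu : R -> R).

(** A map carrying [nu] to the zero function: its equation is [S(v) = v'^2 nu_0(v) - nu] with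
    [nu_0 = 0]. Since [v'(c) = 1], the number [s] is [v''(c)]. *)
Record chart nu w (c s : R) : Prop := Chart {
  ch_diffeo : local_diffeo w;
  ch_orient : orientation_preserving w;
  ch_zero : w c 0;
  ch_der : 'D_1 (papp w) c = 1;
  ch_lj : lj (pinv w) c = s;
  ch_schw : forall x, pdom w x -> schw (pinv w) x = - nu x }.

Section OneChart.
Variables (w : R -> set R).
Hypotheses (wD : local_diffeo w) (wO : orientation_preserving w).
Let wiD := local_diffeo_inv wD.
Let wiO := orientation_inv wD wO.
Let comp := pcomp w (pinv w).
Let compD : local_diffeo comp := local_diffeo_comp wD wiD.

Let comp_ran y : pran w y -> pran comp y.
Proof. by move=> yr; apply/(pran_pcomp (pinv w) wD); split=> //; exact: pinvf_dom. Qed.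

Let pinvf_comp y : pran w y -> pinvf comp y = y.
Proof.
move=> yr; refine (etrans (pinvf_pcomp wD wiD compD (comp_ran yr)) _); exact: pinvfK.
Qed.

Let dpinvf_comp y : pran w y -> 'D_1 (pinvf comp) y = 1.
Proof.
move=> yr; refine (etrans _ (derive_id y 1)); apply: near_eq_derive.
by apply: filterS pinvf_comp (open_nbhs_nbhs (conj (ld_open_ran wD) yr)).
Qed.

Let lj_comp y : pran w y -> lj comp y = 0.
Proof.
move=> yr; have E : 'D_1 ('D_1 (pinvf comp)) y = 'D_1 (cst 1 : R -> R) y.
  by apply: near_eq_derive; apply: filterS dpinvf_comp (open_nbhs_nbhs (conj (ld_open_ran wD) yr)).
refine (etrans (congr1 (fun a => a / 'D_1 (pinvf comp) y) (etrans E (derive_cst _ _ _))) _).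
exact: mul0r.
Qed.

(** The cocycle law applied to [w] composed with its inverse, the identity on the range of [w],
    where [lj] vanishes; [schw_inverse] is the same argument for the Schwarzian. *)
Lemma lj_inverse y : pran w y ->
  lj w y = - (lj (pinv w) (pinvf w y) * 'D_1 (pinvf w) y).
Proof.
move=> yr; apply/eqP; rewrite -addr_eq0; apply/eqP.
rewrite -(lj_comp yr); apply/esym.
exact (lj_pcomp wD wiD compD wO wiO (comp_ran yr)).
Qed.

Lemma schw_inverse y : pran w y ->
  schw w y = - ('D_1 (pinvf w) y ^+ 2 * schw (pinv w) (pinvf w y)).
Proof.
move=> yr; apply/eqP; rewrite -addr_eq0; apply/eqP.
have E : schw comp y = 0.
  have E : 'D_1 (lj comp) y = 'D_1 (cst 0 : R -> R) y.
    by apply: near_eq_derive; apply: filterS lj_comp (open_nbhs_nbhs (conj (ld_open_ran wD) yr)).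
  refine (etrans (congr2 (fun a b => a - 2^-1 * b ^+ 2) (etrans E (derive_cst _ _ _)) (lj_comp yr)) _).
  by rewrite expr0n /= mulr0 subrr.
rewrite -E; apply/esym; exact (schw_pcomp wD wiD wO wiO (comp_ran yr)).
Qed.
End OneChart.

Section Transition.
Variables (nu : R -> R) (w1 w2 : R -> set R) (c1 c2 s1 s2 : R).
Hypotheses (C1 : chart nu w1 c1 s1) (C2 : chart nu w2 c2 s2).
Let D1 := ch_diffeo C1.
Let D2 := ch_diffeo C2.
Let Di1 := local_diffeo_inv D1.
Let Oi1 := orientation_inv D1 (ch_orient C1).

(** Two charts flattening the same [nu] differ by a symmetry of [nu]. Its inverse takes [c1] to
    [c2], the direction in which the evaluation points follow each other. *)
Definition transition := pcomp (pinv w1) w2.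

Let trD : local_diffeo transition := local_diffeo_comp Di1 D2.

Let tr_arith (k h n n' : R) : - n + k ^+ 2 * - (h ^+ 2 * - n') = (h * k) ^+ 2 * n' - n.
Proof. ring. Qed.

Lemma transition_schwarz : schwarz nu transition.
Proof.
move=> y yr; have [yr1 yr2] := (pran_pcomp w2 Di1 y).1 yr.
refine (etrans (schw_pcomp Di1 D2 Oi1 (ch_orient C2) yr) _).
rewrite (ch_schw C1 yr1) (schw_inverse D2 (ch_orient C2) yr2).
rewrite (dpinvf_pcomp Di1 D2 trD yr) (pinvf_pcomp Di1 D2 trD yr).
rewrite (ch_schw C2 (pinvf_dom D2 yr2)); exact: tr_arith.
Qed.

Let c1r : pran (pinv w1) c1. Proof. by exists 0; exact (ch_zero C1). Qed.
Let pc1 : pinvf (pinv w1) c1 = 0. Proof. exact (papp_graph D1 (ch_zero C1)). Qed.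
Let c2r : pran w2 0. Proof. by exists c2; exact (ch_zero C2). Qed.
Let pc2 : pinvf w2 0 = c2. Proof. exact (pinvf_graph D2 (ch_zero C2)). Qed.

Lemma transition_ran : pran transition c1.
Proof. by apply/(pran_pcomp w2 Di1); rewrite pc1; exact (conj c1r c2r). Qed.

Lemma transition_point : pinvf transition c1 = c2.
Proof. by rewrite (pinvf_pcomp Di1 D2 trD transition_ran) pc1. Qed.

Let d2 : 'D_1 (pinvf w2) 0 = 1.
Proof.
have := derive_papp_pinvf D2 c2r; rewrite pc2 (ch_der C2) mul1r; exact.
Qed.

Let d1 : 'D_1 (pinvf (pinv w1)) c1 = 1. Proof. exact (ch_der C1). Qed.

Lemma transition_der : 'D_1 (pinvf transition) c1 = 1.
Proof.
refine (etrans (dpinvf_pcomp Di1 D2 trD transition_ran) _).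
by rewrite pc1 d2 d1 mulr1.
Qed.

Lemma transition_lj : lj transition c1 = s1 - s2.
Proof.
refine (etrans (lj_pcomp Di1 D2 trD Oi1 (ch_orient C2) transition_ran) _).
by rewrite pc1 d1 (lj_inverse D2 (ch_orient C2) c2r) pc2 d2 !mulr1 (ch_lj C1) (ch_lj C2).
Qed.

Lemma transition_diffeo : local_diffeo transition. Proof. exact trD. Qed.
Lemma transition_orient : orientation_preserving transition.
Proof. exact (orientation_comp Di1 D2 Oi1 (ch_orient C2)). Qed.
End Transition.

Lemma transition_pg nu w1 w2 c1 c2 s1 s2 : chart nu w1 c1 s1 -> chart nu w2 c2 s2 ->
  schwarz_pg nu (transition w1 w2).
Proof.
move=> C1 C2; split; [exact (transition_diffeo C1 C2)|exact (transition_orient C1 C2)|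
  exact (transition_schwarz C1 C2)|].
rewrite /transition pinv_pcomp; exact (transition_schwarz C2 C1).
Qed.

Lemma nat_gap (i j : nat) : i != j -> 1 <= `|(i%:R : R) - j%:R|.
Proof.
rewrite neq_ltn => /orP[ij|ij].
  by rewrite distrC -natrB ?(ltnW ij) // normr_nat ler1n subn_gt0.
by rewrite -natrB ?(ltnW ij) // normr_nat ler1n subn_gt0.
Qed.

(** [nu] is glued by cutoffs from minus the Schwarzians of charts at the integers. Around each
    integer it equals the local function on a whole neighbourhood and not just to finite order,
    which is what [chart] demands. *)
Lemma jet_geometry (M N : nat) (s : nat -> R) (T : nat -> {poly R}) :
  exists (nu : R -> R) (w : nat -> R -> set R),
  [/\ smooth_on setT nu, forall i, (i <= M)%N -> chart nu (w i) i%:R (s i) &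
      forall i k, (i <= M)%N -> (k < N)%N -> Dn k nu i%:R = - (T i)^`(k).[0]].
Proof.
have [W WP] := choice (fun i : nat => local_chart (i%:R : R) (s i) (T i) N).
have [e eP] := choice WP; clear WP.
(* The cutoff vanishes from distance [2 r i] on, which is below [e i], hence inside the chart, and
   at most 1/2. Within [r i <= 1/4] of the integer [i] any other integer is more than 3/4 away, so
   only one summand of [nu] is alive there. *)
pose r i : R := Num.min (e i) 1 / 4.
have r0 i : 0 < r i by have [[e0 _ _ _] _] := eP i; rewrite divr_gt0 // lt_min e0 /=.
have re i : 2 * r i < e i.
  have [[e0 _ _ _] _] := eP i; have : Num.min (e i) 1 <= e i by rewrite ge_min lexx.
  by rewrite /r; lra.
have r1 i : 2 * r i <= 1 / 2.
  by have : Num.min (e i) 1 <= 1 by [rewrite ge_min lexx orbT]; rewrite /r; lra.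
have [B BP] := choice (fun i : nat => cutoff (i%:R : R) (r0 i)).
pose g i (x : R) : R := B i x * - schw (pinv (W i)) x.
pose nu (x : R) : R := \sum_(i <- index_iota 0 M.+1) g i x.
pose V i : set R := [set x | `|x - i%:R| < r i].
have oV i : open (V i) by exact: open_dist.
have nuE i x : (i <= M)%N -> V i x -> nu x = - schw (pinv (W i)) x.
  move=> iM Vx; rewrite /nu (bigD1_seq i) ?mem_index_iota ?iota_uniq //=.
  have [_ B1 _] := BP i; rewrite {1}/g B1 // mul1r big1_seq ?addr0 // => j /andP[ji _].
  have [_ _ B0] := BP j; rewrite /g B0 ?mul0r //.
  have gap := nat_gap ji; have ri := r1 i; have rj := r1 j; have rri := r0 i.
  have : `|j%:R - i%:R| <= `|x - j%:R| + `|x - i%:R|.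
    by rewrite -(distrC j%:R x); apply: le_trans (ler_normD _ _); rewrite addrA subrK.
  by move: Vx; rewrite /V /=; lra.
have nus : smooth_on setT nu.
  apply/smooth_onP => k; apply: smk_sum; first exact: openT.
  move=> i; have [[_ D O dom] _] := eP i; have [Bs _ B0] := BP i.
  have oD := ld_open_dom D.
  (* The summand is a product of smooth functions on the domain of the chart and zero on [Z]; these
     open sets cover the line because [2 r i < e i]. *)
  pose Z : set R := [set x | i%:R + 2 * r i < x] `|` [set x | x < i%:R - 2 * r i].
  have oZ : open Z by apply: openU; [exact: open_gt|exact: open_lt].
  apply: (@smk_sub _ _ _ k (pdom (W i) `|` Z)).
    move=> x _; have [xe|xe] := ltP `|x - i%:R| (e i); first by left; rewrite dom.
    right; have h := re i; have h' := lt_le_trans h xe; move: h'.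
    by rewrite ltNge ler_norml negb_and -!ltNge => /orP[h'|h']; [right|left]; rewrite /=; lra.
  apply: smkU.
    exact (smkM oD (Bs k _) (smkN oD (smk_schw k (local_diffeo_inv D) (orientation_inv D O)))).
  apply: smk_eq oZ _ (smk_cst k Z 0) => x xZ; rewrite /g B0 ?mul0r //.
  have h := r0 i; case: xZ => /= h'.
    by rewrite gtr0_norm; lra.
  by rewrite ltr0_norm; lra.
(* The charts are cut down to [V i], where the cutoff is 1 and [nu] is exactly minus their
   Schwarzian. *)
exists nu, (fun i => prestr (V i) (W i)); split=> // [i iM|i k iM kN].
- have [[e0 D O dom] [W0 W1 Wl _]] := eP i.
  have Dr := local_diffeo_restr (oV i) D; have s' := @prestr_psub _ (V i) (W i).
  have Di := local_diffeo_inv D; have Dri := local_diffeo_inv Dr; have si := pinv_psub s'.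
  have Vi : V i i%:R by rewrite /V /= subrr normr0.
  have cr : pran (pinv (prestr (V i) (W i))) i%:R by exists 0.
  split=> //.
  + exact (orientation_sub D s' (ld_open_dom Dr) O).
  + exact (etrans (esym (dpinvf_sub Di Dri si cr)) W1).
  + exact (etrans (esym (lj_sub Di Dri si cr)) Wl).
  + move=> x xd; rewrite (nuE i x iM) ?opprK; last by have [y []] := xd.
    by apply/esym; exact (schw_sub Di Dri si xd).
- have [_ [_ _ _ J]] := eP i; have Vi : V i i%:R by rewrite /V /= subrr normr0.
  have [[_ D O dom] _] := eP i.
  rewrite -(J k kN).
  have E := iter_derive_eq k (oV i) (fun x => @nuE i x iM) Vi.
  refine (etrans E _).
  have sN j : smk j (V i) (schw (pinv (W i))).
    apply: smk_sub (smk_schw j (local_diffeo_inv D) (orientation_inv D O)).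
    move=> x Vx; rewrite -[pran _]/(pdom (W i)) dom /=; apply: lt_trans Vx _.
    by have := re i; have := r0 i; lra.
  exact (iter_deriveN k (oV i) sN Vi).
Qed.
End Charts.

(** * Test functions and evaluation *)

Section TestFunction.
Context {R : realType} (Gamma : set (R -> set R)).
Local Notation C := R[i].
Hypothesis GammaP : pseudogroup Gamma.

(** [y^sg] is an eigenfunction of [y d/dy] with eigenvalue [sg], and the truncation [q] of the
    series of [exp (t x)] has [a]-th derivative [t^a] at 0 for [a < N]. Near [(c, 1)] the cutoffs
    are 1, and at [y = 1] the powers of [y] created by [y d/dx] disappear. *)
Lemma test_function phi (c t : R) (sg N : nat) : Gamma phi -> pran phi c ->
  exists2 f : R * R -> C, is_monomial Gamma (f, phi) &
    forall a b, (a < N)%N ->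
      iter a y_dx (iter b y_dy f) (c, 1) = (t ^+ a * sg%:R ^+ b)%:C%C.
Proof.
move=> G cr; have [D O] := pg_diffeo GammaP G.
have [e e0 er] : exists2 e, 0 < e & forall x, `|x - c| < e -> pran phi x.
  have := open_nbhs_nbhs (conj (ld_open_ran D) cr) => /nbhs_ballP[e e0 H].
  by exists e => // x xe; apply: H; rewrite /ball /= distrC.
(* Each cutoff vanishes from twice its radius on, so the support stays in [|x - c| <= e / 2] and
   [1/2 <= y <= 3/2], a compact part of the range of the lift. *)
pose r := e / 4; have r0 : 0 < r by rewrite divr_gt0.
have [B [Bs B1 B0]] := cutoff c r0.
have q0 : 0 < (1 / 4 : R) by [].
have [B' [Bs' B1' B0']] := cutoff (1 : R) q0.
pose q : {poly R} := \poly_(k < N) (t ^+ k / k`!%:R).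
pose f (z : R * R) : C := (B z.1 * q.[z.1 - c] * (B' z.2 * z.2 ^+ sg))%:C%C.
exists f.
  pose K : set (R * R) := `[c - 2 * r, c + 2 * r]%classic `*` `[1 / 2, 3 / 2]%classic.
  have cK : compact K by apply: compact_setX; exact: segment_compact.
  have Kr : K `<=` hran phi.
    move=> z [] /=; rewrite !in_itv /= => /andP[z1 z1'] /andP[z2 _]; split; last by lra.
    apply: er; rewrite ltr_norml; have : 4 * r = e by rewrite /r; lra.
    by move=> re; apply/andP; split; lra.
  apply: (mono_intro GammaP G cK Kr openT (@subsetT _ _)) => [k|z fz].
    apply: csm_real.
    have h1 (g : R -> R) : smk k setT g -> smk k setT (fun z : R * R => g z.1).
      by move=> gs; exact (smk_comp1 openT openT (fun _ _ => I) gs (smk_fst _ _)).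
    have h2 (g : R -> R) : smk k setT g -> smk k setT (fun z : R * R => g z.2).
      by move=> gs; exact (smk_comp1 openT openT (fun _ _ => I) gs (smk_snd _ _)).
    have sx : smk k setT (fun y : R => y ^+ sg).
      have -> : (fun y : R => y ^+ sg) = (fun y => ('X^sg : {poly R}).[y - 0]).
        by apply/funext => y; rewrite hornerXn subr0.
      exact: smk_horner.
    exact (smkM openT (smkM openT (h1 _ (Bs k setT)) (h1 _ (smk_horner k setT q c)))
      (smkM openT (h2 _ (Bs' k setT)) (h2 _ sx))).
  split; rewrite /= in_itv /=; apply: contraNT fz; rewrite negb_and -!ltNge => h.
    have -> : f z = 0; last by [].
    rewrite /f B0 ?mul0r //; case/orP: h => h.
      by rewrite ltr0_norm; lra.
    by rewrite gtr0_norm; lra.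
  have -> : f z = 0; last by [].
  rewrite /f B0' ?mul0r ?mulr0 //; case/orP: h => h.
    by rewrite ltr0_norm; lra.
  by rewrite gtr0_norm; lra.
pose U : set (R * R) := [set z | `|z.1 - c| < r /\ `|z.2 - 1| < 1 / 4].
have oU : open U.
  have oV (c' r' : R) : open [set x : R | `|x - c'| < r'] by exact: open_dist.
  have -> : U = fst @^-1` [set x : R | `|x - c| < r] `&` snd @^-1` [set x : R | `|x - 1| < 1 / 4].
    by rewrite eqEsubset; split.
  apply: openI.
    by apply: open_comp (oV c r) => z _; exact: cvg_fst.
  by apply: open_comp (oV 1 (1 / 4)) => z _; exact: cvg_snd.
have nU z : U z -> \near z, U z by move=> Uz; exact: open_nbhs_nbhs (conj oU Uz).
have fY b z : U z -> iter b y_dy f z = (z.2 ^+ sg * (sg%:R ^+ b *: q).[z.1 - c])%:C%C.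
  elim: b z => [|b IH] z Uz.
    rewrite /= /f; have [z1 z2] := Uz; rewrite B1 // B1' // expr0 scale1r !mul1r.
    by rewrite mulrC.
  refine (etrans (y_dy_eq (filterS IH (nU z Uz))) _).
  refine (etrans (@y_dy_homog R setT _ (fun k => smk_horner k setT _ c) sg z I) _).
  rewrite !hornerZ -(rmorph_nat (real_complex R)) -rmorphM exprS; congr (_%:C)%C; ring.
have fX a b z : U z -> iter a y_dx (iter b y_dy f) z =
    (z.2 ^+ (a + sg) * ((sg%:R ^+ b *: q)^`(a)).[z.1 - c])%:C%C.
  elim: a z => [|a IH] z Uz; first exact (fY b z Uz).
  refine (etrans (y_dx_eq (filterS IH (nU z Uz))) _).
  refine (etrans (@y_dx_homog R setT _ (fun k => smk_horner k setT _ c) (a + sg) z I) _).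
  rewrite derivnS; congr (_ * _)%:C%C.
  exact (congr1 (fun h : R -> R => h z.1) (derive_shift_horner _ c)).
move=> a b aN; rewrite (fX a b) /=; last by split; rewrite /= subrr normr0.
rewrite expr1n mul1r subrr derivnZ hornerZ derivn_horner0 coef_poly aN.
have -> : t ^+ a / a`!%:R *+ a`! = t ^+ a.
  by rewrite -[LHS]mulr_natr mulfVK // pnatr_eq0 -lt0n fact_gt0.
by rewrite mulrC.
Qed.
End TestFunction.

(** * Evaluation of products of standard elements *)

Section Evaluation.
Context {R : realType} (nu : R -> R) (Gamma : set (R -> set R)).
Local Notation C := R[i].
Local Notation A := (groupoid_alg Gamma).
Local Notation mono := (is_monomial Gamma).
Local Notation fn := (R * R -> C).
Hypotheses (nus : smooth_on setT nu) (GammaP : pseudogroup Gamma)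
  (GammaC : preserves_connection nu Gamma).
Implicit Types (f g : fn) (phi psi : R -> set R).

Section IteratedOperators.
Variables (L : (R -> set R) -> fn -> fn).
Hypothesis LP : local_op Gamma L.

Lemma lop_iter n f phi : mono (f, phi) -> mono (iter n (L phi) f, phi) /\
  iter n (lop L) (monoU Gamma f phi) = monoU Gamma (iter n (L phi) f) phi.
Proof.
move=> H; elim: n => [//|n [M E]]; split; first exact: (lop_mono LP M).
exact (etrans (congr1 (lop L) E) (local_opE LP M)).
Qed.
End IteratedOperators.

Lemma h1_act_iter (h : H1 C) n (a : A) :
  groupoid_act (h ^+ n) a = iter n (groupoid_act h) a.
Proof.
elim: n => [|n IH]; first exact (h1_act1 (groupoid_rep GammaP) a).
rewrite exprS; refine (etrans (h1_actM (groupoid_rep GammaP) h (h ^+ n) a) _).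
exact (congr1 (groupoid_act h) IH).
Qed.

Definition pbw_fun (e : nat * nat * nat) phi f : fn :=
  iter e.1.1 (fun g z => delta 0 phi z * g z) (iter e.1.2 y_dx (iter e.2 y_dy f)).

Lemma pbw_act (e : nat * nat * nat) f phi : mono (f, phi) ->
  mono (pbw_fun e phi f, phi) /\
  groupoid_act (h1_pbw C e) (monoU Gamma f phi) = monoU Gamma (pbw_fun e phi f) phi.
Proof.
case: e => [[c a] b] H; have rep := groupoid_rep GammaP.
have [M1 E1] := lop_iter (local_op_ydy GammaP) b H.
have [M2 E2] := lop_iter (local_op_ydx GammaP) a M1.
have [M3 E3] := lop_iter (local_op_delta GammaP 0) c M2.
split; first exact: M3.
have FX : groupoid_act (hX C) = lop (fun _ f => y_dx f) :> (A -> A).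
  by apply/funext => v; exact (h1_actX rep v).
have FY : groupoid_act (hY C) = lop (fun _ f => y_dy f) :> (A -> A).
  by apply/funext => v; exact (h1_actY rep v).
have Fd : groupoid_act (hdelta C 1) = lop (fun phi f z => delta 0 phi z * f z) :> (A -> A).
  by apply/funext => v; exact (h1_actd rep 0 v).
refine (etrans (h1_actM rep (hdelta C 1 ^+ c * hX C ^+ a) (hY C ^+ b) _) _).
refine (etrans (h1_actM rep (hdelta C 1 ^+ c) (hX C ^+ a) _) _).
refine (etrans (h1_act_iter _ c _) _).
refine (etrans (congr1 (iter c _) (h1_act_iter _ a _)) _).
refine (etrans (congr1 (fun v => iter c _ (iter a _ v)) (h1_act_iter _ b _)) _).
rewrite FX FY Fd.
refine (etrans (congr1 (fun v => iter c _ (iter a _ v)) E1) _).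
refine (etrans (congr1 (fun v => iter c _ v) E2) E3).
Qed.

Definition std_fun (m : {cmonom nat}) e (q : polyP C) phi f : fn :=
  fun z => rho nu (Zmono C m) z * pbw_fun e phi f z * transport phi (rho nu q) z.

Lemma chi_std m e q f phi : mono (f, phi) -> mono (std_fun m e q phi f, phi) /\
  chi nu (std (m, e) q) (monoU Gamma f phi) = monoU Gamma (std_fun m e q phi f) phi.
Proof.
move=> H; have [M E] := pbw_act e H.
have Ll := local_op_gmull GammaP (rho_smooth nus (Zmono C m)).
have Lr := local_op_gmulr GammaP (rho_smooth nus q).
have Ml := lop_mono Ll M; split; first exact (lop_mono Lr Ml).
refine (etrans (chi_pure nus GammaP GammaC _ _ _ _) _).
refine (etrans (congr1 (fun v => mulPr nu q (mulPl nu (Zmono C m) v)) E) _).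
refine (etrans (congr1 (mulPr nu q) (local_opE Ll M)) _).
exact (local_opE Lr Ml).
Qed.

Lemma pbw_fun_at e phi f z : pbw_fun e phi f z =
  delta 0 phi z ^+ e.1.1 * iter e.1.2 y_dx (iter e.2 y_dy f) z.
Proof.
by rewrite /pbw_fun; elim: e.1.1 => [|c IH]; rewrite ?mul1r // iterS IH exprS mulrA.
Qed.

Section Products.
Variables (F : nat -> fn) (Phi : nat -> R -> set R) (z : nat -> R * R).

(** The accumulated map [psi] has an inverse lift taking [z 0] to [z k]. Hence the next factor is
    evaluated at [z k], and since inverse lifts compose, the new accumulated map takes [z 0] to
    [z k.+1]. *)
Lemma gprod_chain m k g psi : mono (g, psi) -> hran psi (z 0%N) ->
  lift_inv psi (z 0%N) = z k ->
  (forall i, (k <= i < k + m)%N -> [/\ mono (F i, Phi i), hran (Phi i) (z i) &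
    lift_inv (Phi i) (z i) = z i.+1]) ->
  exists g' psi', mono (g', psi') /\
   (foldl (@gmul R Gamma) (monoU Gamma g psi) [seq monoU Gamma (F i) (Phi i) | i <- iota k m] =
     monoU Gamma g' psi' /\
    g' (z 0%N) = g (z 0%N) * \prod_(i <- iota k m) F i (z i)).
Proof.
elim: m k g psi => [|m IH] k g psi M zr zk H.
  by exists g, psi; rewrite big_nil mulr1.
have [|Mk zkr zk1] := H k; first by rewrite leqnn addnS ltnS leq_addr.
have [G _ _ _] := M; have [D O] := pg_diffeo GammaP G.
have [Gk _ _ _] := Mk; have [Dk Ok] := pg_diffeo GammaP Gk.
have [Dc Oc] := pg_diffeo GammaP (pg_comp GammaP G Gk).
have cr : hran (pcomp psi (Phi k)) (z 0%N).
  by apply/(hran_pcomp (Phi k) D O); split=> //; rewrite zk.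
have [|i ik|g' [psi' [M' [E' e']]]] := IH k.+1 _ _ (conv_mono GammaP M Mk) cr.
- by rewrite (lift_inv_pcomp D Dk Dc cr) zk.
- by apply: H; move: ik; rewrite addSnnS => /andP[/ltnW -> ->].
exists g', psi'; split=> //; split.
  refine (etrans (congr1 (fun v => foldl (@gmul R Gamma) v _) (gmulUU GammaP M Mk)) E').
by rewrite e' /conv (transportE D O _ zr) zk big_cons mulrA.
Qed.

Lemma gprod_ev n : (forall i, (i < n.+1)%N -> [/\ mono (F i, Phi i), hran (Phi i) (z i) &
    lift_inv (Phi i) (z i) = z i.+1]) ->
  ev (z 0%N) (gprod (fun i : 'I_n.+1 => monoU Gamma (F i) (Phi i))) =
    \prod_(i < n.+1) F i (z i).
Proof.
move=> H; have [M zr z1] := H 0%N isT.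
have Es : [seq monoU Gamma (F (val i)) (Phi (val i)) | i <- enum 'I_n.+1] =
    monoU Gamma (F 0%N) (Phi 0%N) :: [seq monoU Gamma (F i) (Phi i) | i <- iota 1 n].
  by rewrite -[RHS]/[seq monoU Gamma (F i) (Phi i) | i <- iota 0 n.+1] -val_enum_ord -map_comp.
have [|g [psi [Mg [E e]]]] := gprod_chain (m := n) M zr z1.
  by move=> i /andP[_ i2]; apply: H; move: i2; rewrite add1n.
rewrite /gprod Es; refine (etrans (congr1 (ev (z 0%N)) E) (etrans (evE (z 0%N) Mg) _)).
rewrite e -(big_mkord xpredT (fun i => F i (z i))) /index_iota subn0 /=.
by rewrite big_cons.
Qed.
End Products.
End Evaluation.

(** * Separating the basis tensors *)

Section PositionalDigits.

Lemma digits_inj (B : nat) (d d' : nat -> nat) L :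
  (forall v, d v < B)%N -> (forall v, d' v < B)%N ->
  (\sum_(v < L) d v * B ^ v = \sum_(v < L) d' v * B ^ v)%N ->
  forall v, (v < L)%N -> d v = d' v.
Proof.
elim: L d d' => [//|L IH] d d' dB dB'.
have B0 : (0 < B)%N by apply: leq_ltn_trans (dB 0%N).
have shift (f : nat -> nat) : (\sum_(v < L.+1) f v * B ^ v =
    f 0 + (\sum_(v < L) f v.+1 * B ^ v) * B)%N.
  rewrite big_ord_recl expn0 muln1; congr addn.
  by rewrite big_distrl /=; apply: eq_bigr => i _; rewrite /bump /= add1n expnSr mulnA.
rewrite !shift => E.
have E0 : d 0%N = d' 0%N.
  by have := congr1 (modn^~ B) E; rewrite /= (addnC (d 0)) (addnC (d' 0)) !modnMDl !modn_small.
move=> [_|v vL] //; apply: (IH (fun v => d v.+1) (fun v => d' v.+1)) => //.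
by move: E; rewrite E0 => /addnI /eqP; rewrite eqn_pmul2r // => /eqP.
Qed.

Lemma digits_inj2 (B m : nat) (d d' : nat -> nat -> nat) L :
  (forall i q, d i q < B)%N -> (forall i q, d' i q < B)%N ->
  (\sum_(i < L) \sum_(q < m) d i q * B ^ (i * m + q) =
    \sum_(i < L) \sum_(q < m) d' i q * B ^ (i * m + q))%N ->
  forall i q, (i < L)%N -> (q < m)%N -> d i q = d' i q.
Proof.
move=> dB dB' E i q iL qm; have m0 : (0 < m)%N by apply: leq_ltn_trans qm.
have flat (f : nat -> nat -> nat) : (\sum_(i < L) \sum_(q < m) f i q * B ^ (i * m + q) =
    \sum_(v < L * m) f (v %/ m) (v %% m) * B ^ v)%N.
  rewrite -(big_mkord xpredT (fun v => f (v %/ m) (v %% m) * B ^ v)%N).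
  elim: L {iL E} => [|L IH]; first by rewrite big_ord0 mul0n big_geq.
  rewrite big_ord_recr /= IH mulSn [(m + _)%N]addnC [RHS](@big_cat_nat _ _ _ (L * m)) ?leq_addr //=.
  congr addn; rewrite -[X in index_iota X _]add0n big_addn addKn big_mkord.
  apply: eq_bigr => k _.
  have e1 : ((k + L * m) %/ m = L)%N by rewrite addnC divnMDl // divn_small // addn0.
  have e2 : ((k + L * m) %% m = k)%N by rewrite addnC modnMDl modn_small.
  by rewrite e1 e2 addnC.
rewrite !flat in E.
have lt : (i * m + q < L * m)%N.
  by apply: leq_trans (_ : i.+1 * m <= _)%N; rewrite ?leq_mul2r ?iL ?orbT // mulSn addnC ltn_add2r.
have := @digits_inj B (fun v => d (v %/ m)%N (v %% m)%N) (fun v => d' (v %/ m)%N (v %% m)%N) (L * m)%N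
  (fun v => dB _ _) (fun v => dB' _ _) E _ lt.
by rewrite divnMDl // divn_small // addn0 modnMDl modn_small.
Qed.

Lemma ex_bound (T : eqType) (s : seq T) (P : T -> nat -> Prop) :
  (forall x m n, (m <= n)%N -> P x m -> P x n) -> (forall x, exists n, P x n) ->
  exists n, forall x, x \in s -> P x n.
Proof.
move=> mono ex; elim: s => [|x s [n IH]]; first by exists 0%N.
have [m Pm] := ex x; exists (maxn m n) => y; rewrite inE => /orP[/eqP ->|/IH].
  exact: mono (leq_maxl _ _) Pm.
exact: mono (leq_maxr _ _).
Qed.
End PositionalDigits.

Section VanishingPolynomial.
Variable (K : numDomainType).

Lemma poly_nat_roots (p : {poly K}) : (forall n : nat, p.[n%:R] = 0) -> p = 0.
Proof.
move=> H; apply/eqP; apply: contraT => p0.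
have u : uniq [seq (i%:R : K) | i <- iota 0 (size p)].
  by rewrite map_inj_uniq ?iota_uniq //; exact: mulrIn (oner_neq0 K).
have r : all (root p) [seq (i%:R : K) | i <- iota 0 (size p)].
  by apply/allP => _ /mapP[i _ ->]; apply/rootP.
by have := max_poly_roots p0 r u; rewrite size_map size_iota ltnn.
Qed.

(** The sum is the value at [n] of a polynomial whose coefficients at the distinct degrees [E j] are
    those of [x], and this polynomial has every natural number as a root. *)
Lemma monomial_independence (T : choiceType) (x : {malg K[T]}) (E : T -> nat) :
  {in msupp x &, injective E} ->
  (forall n : nat, \sum_(j <- msupp x) x@_j * n%:R ^+ E j = 0) -> x = 0.
Proof.
move=> inj H; pose p : {poly K} := \sum_(j <- msupp x) x@_j *: 'X^(E j).
have p0 : p = 0.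
  apply: poly_nat_roots => n; rewrite horner_sum -[RHS](H n); apply: eq_bigr => j _.
  by rewrite hornerZ hornerXn.
apply/malgP => j; rewrite mcoeff0.
have [js|/mcoeff_outdom //] := boolP (j \in msupp x).
have := congr1 (fun q : {poly K} => q`_(E j)) p0; rewrite coef0 coef_sum => <-.
rewrite (big_rem j) //= coefZ coefXn eqxx mulr1 big1_seq ?addr0 // => i /andP[_ im].
rewrite coefZ coefXn; case: eqP => [e|]; last by rewrite mulr0.
have ij : i = j by apply: inj => //; exact: mem_rem im.
by move: im; rewrite ij mem_rem_uniqF ?fset_uniq.
Qed.
End VanishingPolynomial.

Section Coordinates.
Context {K : fieldType}.

Lemma lin_span_malg (V : lmodType K) (T : choiceType) (F : T -> V) (v : V) :
  lin_span (fun v => exists j, v = F j) v -> exists x : {malg K[T]}, v = lext F x.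
Proof.
elim=> [|k _ w [j ->] _ [x ->]]; first by exists 0; rewrite linear0.
by exists (k *: << j >> + x); rewrite linearP /= lextU.
Qed.

Lemma cmonom_bound (m : {cmonom nat}) : exists N,
  (forall q, (N <= q)%N -> m q = 0%N) /\ (forall q, (m q < N)%N).
Proof.
exists (maxn (\max_(q <- finsupp m) q).+1 (\max_(q <- finsupp m) m q).+1); split=> q.
  rewrite geq_max => /andP[h _]; apply/eqP; rewrite cmE_eq0; apply/negP => qm.
  by have := leq_trans h (leq_bigmax_seq q qm isT); rewrite ltnn.
rewrite leq_max !ltnS; apply/orP; right.
have [qm|] := boolP (q \in finsupp m); first exact: (leq_bigmax_seq q qm isT).
by rewrite -cmE_eq0 => /eqP ->.
Qed.

Lemma mval_bounded (R : comNzRingType) (o : nat -> R) (m : {cmonom nat}) N :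
  (forall q, (N <= q)%N -> m q = 0%N) -> mval o m = \prod_(q < N) o q ^+ m q.
Proof.
move=> H; rewrite /mval -(big_mkord xpredT (fun q => o q ^+ m q)) /index_iota subn0.
rewrite [RHS](bigID (fun q => q \in finsupp m)) /= [X in _ * X]big1 ?mulr1; last first.
  by move=> q; rewrite -cmE_eq0 => /eqP ->.
rewrite -[RHS]big_filter; apply: perm_big; apply: uniq_perm.
- exact: fset_uniq.
- by rewrite filter_uniq ?iota_uniq.
- move=> q; rewrite mem_filter mem_iota add0n /=.
  case: (boolP (q \in finsupp m)) => //= qm; apply/esym.
  by rewrite ltnNge; apply/negP => /H; apply/eqP; rewrite cmE_neq0.
Qed.
End Coordinates.

Section Exponents.
Variable n : nat.
Implicit Types j : tens_index n.

(* the exponent in the basis tensor [j] of the [q]-th variable at the [i]-th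
   point: the jets [Z_q] for [q < N], then [delta_1], [X] and [Y] *)
Definition expo (N : nat) j (i q : nat) : nat :=
  if (i < n.+1)%N then
    let e := j.1 (inord i) in
    if (q < N)%N then e.1 q else if q == N then e.2.1.1
    else if q == N.+1 then e.2.1.2 else if q == N.+2 then e.2.2 else 0
  else if (q < N)%N then j.2 q else 0.

(** One [N] bounds the indices of the variables that occur and all the exponents, since it is both
    the number of jets prescribed at each point and the base of the digits in [code]. *)
Definition bounded j (N : nat) : Prop :=
  [/\ forall i q, (N <= q)%N -> (j.1 i).1 q = 0%N,
      forall q, (N <= q)%N -> j.2 q = 0%N,
      forall i q, ((j.1 i).1 q < N)%N,
      forall q, (j.2 q < N)%N &
      forall i, [/\ (j.1 i).2.1.1 < N, (j.1 i).2.1.2 < N & (j.1 i).2.2 < N]%N].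

Lemma bounded_leq j m N : (m <= N)%N -> bounded j m -> bounded j N.
Proof.
move=> mN [a b c d e]; split=> [i q Nq|q Nq|i q|q|i].
- exact: a (leq_trans mN Nq).
- exact: b (leq_trans mN Nq).
- exact: leq_trans (c i q) mN.
- exact: leq_trans (d q) mN.
- by have [e1 e2 e3] := e i; split; [exact: leq_trans e1 mN|exact: leq_trans e2 mN|exact: leq_trans e3 mN].
Qed.

Lemma ex_bounded j : exists N, bounded j N.
Proof.
pose P (i : 'I_n.+1) N := [/\ forall q, (N <= q)%N -> (j.1 i).1 q = 0%N,
  forall q, ((j.1 i).1 q < N)%N &
  [/\ (j.1 i).2.1.1 < N, (j.1 i).2.1.2 < N & (j.1 i).2.2 < N]%N].
have [|i|N NP] := @ex_bound _ (enum 'I_n.+1) P.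
- move=> i m N mN [a b [e1 e2 e3]]; split=> [q Nq|q|].
  + exact: a (leq_trans mN Nq).
  + exact: leq_trans (b q) mN.
  + by split; [exact: leq_trans e1 mN|exact: leq_trans e2 mN|exact: leq_trans e3 mN].
- have [N [a b]] := cmonom_bound (j.1 i).1.
  pose M := (N + ((j.1 i).2.1.1 + (j.1 i).2.1.2 + (j.1 i).2.2).+1)%N.
  exists M; split=> [q Mq|q|]; first by apply: a; apply: leq_trans Mq; rewrite leq_addr.
    by apply: leq_trans (b q) _; rewrite leq_addr.
  by rewrite /M; split; lia.
have [N' [a b]] := cmonom_bound j.2.
exists (maxn N N'); split=> [i q Nq|q Nq|i q|q|i].
- have [p _ _] := NP i (mem_enum _ _); apply: p; exact: leq_trans (leq_maxl _ _) Nq.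
- by apply: a; exact: leq_trans (leq_maxr _ _) Nq.
- have [_ p _] := NP i (mem_enum _ _); exact: leq_trans (p q) (leq_maxl _ _).
- exact: leq_trans (b q) (leq_maxr _ _).
- have [_ _ [e1 e2 e3]] := NP i (mem_enum _ _).
  by split; [exact: leq_trans e1 (leq_maxl _ _)|exact: leq_trans e2 (leq_maxl _ _)|
    exact: leq_trans e3 (leq_maxl _ _)].
Qed.

Lemma expo_lt j N i q : bounded j N -> (0 < N)%N -> (expo N j i q < N)%N.
Proof.
move=> [a b c d e] N0; rewrite /expo; case: ifP => _; last by case: ifP.
have [e1 e2 e3] := e (inord i).
by case: ifP => // _; case: ifP => // _; case: ifP => // _; case: ifP.
Qed.

Lemma expo_inj j j' N : bounded j N -> bounded j' N ->
  (forall i q, (i < n.+2)%N -> (q < N.+3)%N -> expo N j i q = expo N j' i q) -> j = j'.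
Proof.
move=> [a b _ _ _] [a' b' _ _ _] E.
have E1 i : j.1 i = j'.1 i.
  have Ei q : (q < N.+3)%N -> expo N j i q = expo N j' i q.
    by move=> qN; apply: E => //; exact: leq_trans (ltn_ord i) (leqnSn _).
  move: Ei; rewrite /expo ltn_ord inord_val.
  move: (a i) (a' i); case: (j.1 i) => m [[c x] y]; case: (j'.1 i) => m' [[c' x'] y'] /= ai ai' Ei.
  have -> : m = m'.
    apply: cmonomP => q; have [qN|Nq] := ltnP q N; last by rewrite ai // ai'.
    by have := Ei q; rewrite qN; apply; lia.
  have h0 : (N < N.+3)%N by lia.
  have h1 : (N.+1 < N.+3)%N by lia.
  have h2 : (N.+2 < N.+3)%N by lia.
  have := Ei N h0; rewrite ltnn eqxx => ->.
  have c1 : (N.+1 < N)%N = false by lia.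
  have c2 : (N.+1 == N)%N = false by lia.
  have d1 : (N.+2 < N)%N = false by lia.
  have d2 : (N.+2 == N)%N = false by lia.
  have d3 : (N.+2 == N.+1)%N = false by lia.
  have := Ei N.+1 h1; rewrite c1 c2 eqxx => ->.
  by have := Ei N.+2 h2; rewrite d1 d2 d3 eqxx => ->.
have E2 : j.2 = j'.2.
  apply: cmonomP => q; have [qN|Nq] := ltnP q N; last by rewrite b // b'.
  by have := E n.+1 q; rewrite /expo ltnn qN; apply; lia.
rewrite [j]surjective_pairing [j']surjective_pairing E2; congr (_, _).
by apply/ffunP.
Qed.
End Exponents.

Lemma lext_linear_image (K : comNzRingType) (V W : lmodType K) (T : choiceType)
  (F : T -> V) (L : V -> W) (x : {malg K[T]}) : linear L ->
  L (lext F x) = \sum_(j <- msupp x) x@_j *: L (F j).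
Proof.
move=> LL; rewrite /lext; elim: (enum_fset (msupp x)) => [|j s IH].
  by rewrite !big_nil (lin0 LL).
by rewrite !big_cons LL IH.
Qed.

Lemma expo_prod (K : comNzRingType) n (j : tens_index n) N (Y : nat -> nat -> K) :
  \prod_(i < n.+2) \prod_(q < N.+3) Y i q ^+ expo N j i q =
  \prod_(i < n.+1) ((\prod_(q < N) Y i q ^+ (j.1 i).1 q) *
    (Y i N ^+ (j.1 i).2.1.1 * (Y i N.+1 ^+ (j.1 i).2.1.2 * Y i N.+2 ^+ (j.1 i).2.2))) *
  \prod_(q < N) Y n.+1 q ^+ j.2 q.
Proof.
have c1 : (N.+1 < N)%N = false by lia.
have c2 : (N.+1 == N)%N = false by lia.
have d1 : (N.+2 < N)%N = false by lia.
have d2 : (N.+2 == N)%N = false by lia.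
have d3 : (N.+2 == N.+1)%N = false by lia.
rewrite big_ord_recr /=; congr (_ * _).
  apply: eq_bigr => i _; rewrite !big_ord_recr /= /expo ltn_ord inord_val.
  rewrite ltnn eqxx c1 c2 eqxx d1 d2 d3 eqxx -!mulrA; congr (_ * _).
  by apply: eq_bigr => q _; rewrite ltn_ord.
rewrite !big_ord_recr /= /expo ltnn ltnn c1 d1 !expr0 !mulr1.
by apply: eq_bigr => q _; rewrite ltn_ord.
Qed.

(** * The value of a standard tensor at a prescribed geometry *)

Section BasisValue.
Context {R : realType} (n N tau : nat).
Local Notation C := R[i].
Local Notation M := (R * R)%type.
Local Notation Dn n := (iter n (fun h : R -> R => 'D_1 h : R -> R)).
Implicit Types j : tens_index n.

(* The values of the variables: powers of [tau] whose exponents are the successive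
   powers of [N], so that an exponent vector bounded by [N] is read off the
   base [N] digits of [code]. *)
Definition var_exp (i q : nat) : nat := (N ^ (i * N.+3 + q))%N.
Definition var (i q : nat) : R := (tau ^ var_exp i q)%:R.
Definition code j : nat := (\sum_(i < n.+2) \sum_(q < N.+3) expo N j i q * var_exp i q)%N.

Lemma code_prod j : tau%:R ^+ code j =
  \prod_(i < n.+2) \prod_(q < N.+3) (var i q)%:C%C ^+ expo N j i q :> C.
Proof.
rewrite /code -GRing.prodrXr; apply: eq_bigr => i _; rewrite -GRing.prodrXr.
apply: eq_bigr => q _; rewrite mulnC exprM; congr (_ ^+ _).
by rewrite /var natrX rmorphXn rmorph_nat.
Qed.

Lemma code_inj j j' : (0 < N)%N -> bounded j N -> bounded j' N -> code j = code j' -> j = j'.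
Proof.
move=> N0 b b' E; apply: (expo_inj b b') => i q iL qN.
exact: (digits_inj2 (fun i q => expo_lt i q b N0) (fun i q => expo_lt i q b' N0) E iL qN).
Qed.

Definition point (i : nat) : M := (i%:R, 1).

Section Realization.
Variables (nu : R -> R) (phi : nat -> R -> set R) (f : nat -> M -> C).
Let Gamma := schwarz_pg nu.
Let GammaP : pseudogroup Gamma := schwarz_pg_pseudogroup nu.
Let GammaC : preserves_connection nu Gamma := @schwarz_pg_preserves R nu.
Hypotheses (nus : smooth_on setT nu)
  (jets : forall i k, (i <= n.+1)%N -> (k < N)%N -> Dn k nu i%:R = - var i k)
  (phi_ran : forall i, (i < n.+1)%N -> pran (phi i) i%:R)
  (phi_point : forall i, (i < n.+1)%N -> pinvf (phi i) i%:R = i.+1%:R)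
  (phi_der : forall i, (i < n.+1)%N -> 'D_1 (pinvf (phi i)) i%:R = 1)
  (phi_lj : forall i, (i < n.+1)%N -> lj (phi i) i%:R = var i N)
  (fM : forall i, (i < n.+1)%N -> is_monomial Gamma (f i, phi i))
  (fE : forall i a b, (i < n.+1)%N -> (a < N)%N ->
    iter a y_dx (iter b y_dy (f i)) (point i) = (var i N.+1 ^+ a * var i N.+2 ^+ b)%:C%C).

Let om_point i k : (i <= n.+1)%N -> (k < N)%N ->
  iter k y_dx (Omega nu) (point i) = (var i k)%:C%C.
Proof.
move=> iM kN; refine (etrans (omE nus k (point i)) _).
rewrite /= expr1n mul1r; congr (_%:C)%C.
refine (etrans (iter_deriveN k openT (fun k => smooth_smk k nus) I) _).
by rewrite jets // opprK.
Qed.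

Let rho_point i (m : {cmonom nat}) : (i <= n.+1)%N -> (forall q, (N <= q)%N -> m q = 0%N) ->
  rho nu (Zmono C m) (point i) = \prod_(q < N) (var i q)%:C%C ^+ m q.
Proof.
move=> iM mN; refine (etrans (rhoU nu m (point i)) _).
rewrite (mval_bounded _ mN); apply: eq_bigr => q _; congr (_ ^+ _).
exact: om_point.
Qed.

Let hran_point i : (i < n.+1)%N -> hran (phi i) (point i).
Proof. by move=> iL; split; [exact: phi_ran|exact: ltr01]. Qed.

Let lift_point i : (i < n.+1)%N -> lift_inv (phi i) (point i) = point i.+1.
Proof. by move=> iL; rewrite /lift_inv /= phi_point // phi_der // mulr1. Qed.

Let delta_point i : (i < n.+1)%N -> delta 0 (phi i) (point i) = (var i N)%:C%C.
Proof. by move=> iL; rewrite /delta /= log_jacE /= expr1 mul1r phi_lj. Qed.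

Lemma basis_value j : bounded j N ->
  ev (point 0) (chi_n nu (tclass (tens_basis C j))
    (fun i : 'I_n.+1 => monoU Gamma (f i) (phi i))) = tau%:R ^+ code j.
Proof.
move=> [bm bl _ _ be].
pose q (i : nat) : polyP C := if i == n then Zmono C j.2 else 1.
pose G (i : nat) := std_fun nu (j.1 (inord i)).1 (j.1 (inord i)).2 (q i) (phi i) (f i).
have chiE i : (i < n.+1)%N -> is_monomial Gamma (G i, phi i) /\
    chi nu (std (j.1 (inord i)) (q i)) (monoU Gamma (f i) (phi i)) = monoU Gamma (G i) (phi i).
  move=> iL; have := chi_std nus GammaP GammaC (j.1 (inord i)).1 (j.1 (inord i)).2 (q i) (fM iL).
  by rewrite -surjective_pairing.
have Ec : chi_n nu (tclass (tens_basis C j)) (fun i : 'I_n.+1 => monoU Gamma (f i) (phi i)) =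
    gprod (fun i : 'I_n.+1 => monoU Gamma (G i) (phi i)).
  refine (etrans (chi_n_pure nus GammaP GammaC (tens_basis C j) _) _).
  refine (congr1 (@gprod R Gamma n.+1) _); apply/funext => i.
  have [_ <-] := chiE i (ltn_ord i); rewrite inord_val.
  by rewrite /tens_basis /q.
refine (etrans (congr1 (ev (point 0)) Ec) _).
refine (etrans (gprod_ev GammaP (F := G) (Phi := phi) (z := point) (n := n) _) _).
  by move=> i iL; have [Mi _] := chiE i iL; split; [|exact: hran_point|exact: lift_point].
refine (etrans _ (esym (etrans (code_prod j) (expo_prod j N (fun i q => (var i q)%:C%C : C))))).
(* Right multiplication by [q i] is evaluated at [point i.+1]. All [q i] but the last are 1, so this
   accounts for the jets at the extra point [n.+1], which no other part of the product reaches. *)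
have last_q : \prod_(i < n.+1) rho nu (q i) (point i.+1) =
    \prod_(k < N) (var n.+1 k)%:C%C ^+ j.2 k.
  rewrite big_ord_recr /= big1 ?mul1r; last first.
    by move=> i _; rewrite /q ltn_eqF // rho1.
  by rewrite /q eqxx rho_point.
rewrite -last_q -big_split /=; apply: eq_bigr => i _.
have iL := ltn_ord i; have [D O] := pg_diffeo GammaP (phi := phi i) (let: And4 a _ _ _ := fM iL in a).
rewrite /G /std_fun inord_val (transportE D O _ (hran_point iL)) lift_point //; congr (_ * _).
rewrite (rho_point (ltnW iL) (bm i)) pbw_fun_at delta_point //; congr (_ * (_ * _)).
have [_ aN _] := be i.
by rewrite fE // rmorphM !rmorphXn.
Qed.
End Realization.
End BasisValue.

Section Separation.
Context {R : realType} (n : nat).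
Local Notation C := R[i].
Variable t : tensP C n.+1.
Hypothesis tK : forall (nu : R -> R) (Gamma : set (R -> set R)),
  smooth_on setT nu -> pseudogroup Gamma -> preserves_connection nu Gamma ->
  forall a : 'I_n.+1 -> groupoid_alg Gamma, chi_n nu t a = 0.

(** One geometry is built for each [tau]; evaluating [chi_n nu t a = 0] at [point 0] turns every
    standard tensor into its power of [tau]. *)
Lemma kernel_relation N tau (x : {malg C[tens_index n]}) :
  t = lext (fun j => tclass (tens_basis C j)) x ->
  (forall j, j \in msupp x -> bounded j N) ->
  \sum_(j <- msupp x) x@_j * tau%:R ^+ code N j = 0 :> C.
Proof.
move=> xE xN.
(* Transitions see the differences [s i - s i.+1] only ([transition_lj]), so partial sums are needed
   to obtain [var i N] at each point. *)
pose s (i : nat) : R := - \sum_(l < i) var N tau l N.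
(* Division by the factorial makes [var i k] the [k]-th derivative at 0. [nu] receives the opposite
   jets, and the sign in [Omega] undoes this. *)
pose T (i : nat) : {poly R} := \poly_(k < N) (var N tau i k / k`!%:R).
have [nu [w [nus CH J]]] := jet_geometry n.+1 N s T.
pose phi i := transition (w i) (w i.+1).
have C1 i : (i < n.+1)%N -> chart nu (w i) i%:R (s i) by move=> iL; exact (CH i (ltnW iL)).
have C2 i : (i < n.+1)%N -> chart nu (w i.+1) i.+1%:R (s i.+1) by move=> iL; exact (CH i.+1 iL).
have GP := schwarz_pg_pseudogroup nu; have GC := @schwarz_pg_preserves R nu.
have Gphi i : (i < n.+1)%N -> schwarz_pg nu (phi i).
  by move=> iL; exact (transition_pg (C1 i iL) (C2 i iL)).
have phi_ran i : (i < n.+1)%N -> pran (phi i) i%:R.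
  by move=> iL; exact (transition_ran (C1 i iL) (C2 i iL)).
pose P (i : nat) (fi : R * R -> C) := (i < n.+1)%N ->
  is_monomial (schwarz_pg nu) (fi, phi i) /\
    forall a b, (a < N)%N -> iter a y_dx (iter b y_dy fi) (point i) =
      (var N tau i N.+1 ^+ a * var N tau i N.+2 ^+ b)%:C%C.
have ex i : exists fi, P i fi.
  have [iL|iL] := boolP (i < n.+1)%N; last by exists (fun=> 0) => iL'; rewrite iL' in iL.
  (* The eigenvalue of [y d/dy] has to be a natural number, which the value of [var] is, being a
     power of [tau]. *)
  have [g gM gE] := test_function GP (var N tau i N.+1) (tau ^ var_exp N i N.+2)%N N
    (Gphi i iL) (phi_ran i iL).
  by exists g.
have [f fP] := choice ex.
pose a (i : 'I_n.+1) := monoU (schwarz_pg nu) (f i) (phi i).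
have L := linear_comp (ev_linear (Gamma := schwarz_pg nu) (point 0)) (chi_n_linear nus GP GC a).
have E : ev (point 0) (chi_n nu t a) = 0.
  exact (etrans (congr1 (ev (point 0)) (tK nus GP GC a)) (lin0 (ev_linear (point 0)))).
rewrite xE in E; refine (etrans _ (etrans (esym (lext_linear_image _ x L)) E)).
apply: eq_big_seq => j jx; congr (_ * _); apply/esym.
apply: (basis_value (nu := nu) (phi := phi) (f := f)) => //.
- move=> i k iM kN; rewrite J // derivn_horner0 coef_poly kN; congr (- _).
  by rewrite -[LHS]mulr_natr mulfVK // pnatr_eq0 -lt0n fact_gt0.
- by move=> i iL; exact (transition_point (C1 i iL) (C2 i iL)).
- by move=> i iL; exact (transition_der (C1 i iL) (C2 i iL)).
- move=> i iL; refine (etrans (transition_lj (C1 i iL) (C2 i iL)) _).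
  by rewrite /s big_ord_recr /= opprK addKr.
- by move=> i iL; have [] := fP i iL.
- by move=> i c b iL cN; have [_] := fP i iL; apply.
- exact: xN.
Qed.

Lemma kernels_trivial : t = 0.
Proof.
have [x xE] := lin_span_malg (tensP_span t).
have [N NP] := @ex_bound _ (enum_fset (msupp x)) (@bounded n) (@bounded_leq n) (@ex_bounded n).
(* [N.+1] in place of [N] guarantees the positive base that [code_inj] asks for. *)
have bN j : j \in msupp x -> bounded j N.+1.
  by move=> jx; exact (bounded_leq (leqnSn N) (NP j jx)).
suff x0 : x = 0 by rewrite xE x0 linear0.
apply: (@monomial_independence _ _ x (@code n N.+1)) => [j j' jx jx'|tau].
  exact: code_inj (bN _ jx) (bN _ jx').
exact: kernel_relation.
Qed.
End Separation.

Theorem proposition5p4 (R : realType) (n : nat) (hn : (1 <= n)%N) :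
  \bigcap_(p in [set p : (R -> R) * set (R -> set R) |
                 [/\ smooth_on setT p.1, pseudogroup p.2 &
                     preserves_connection p.1 p.2]])
    Ker_chi p.1 p.2 (n := n)
  = [set 0 : tensP R[i] n].
Proof.
rewrite eqEsubset; split=> [t tK|_ -> p [nus GP GC] a].
  case: n hn t tK => [//|n] _ t tK; apply: kernels_trivial => nu Gamma nus GP GC a.
  exact (tK (nu, Gamma) (And3 nus GP GC) a).
exact (lin0 (chi_n_linear nus GP GC a)).
Qed.
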